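(* Let $H=\lambda V+W$ be the model described in the context (for all $\lambda\in\mathcal D_{\lambda_0}$). Then there are constants $C,\nu>0$, depending on $\theta$, $C_0$, $\lambda_0$, $E_0$, $A_0$ and the measure $\mu$, such that for $a_0\le\xi\le A_0\log\log N$ and $L\ge12\xi$ each of the following events has $(\xi,\nu)$-high probability (with $z=E+\mathrm i\eta$): $$\bigcap_{z\in\mathcal D_L,\ \lambda\in\mathcal D_{\lambda_0}}\left\{\max_{i\neq j}|G_{ij}(z)|\le C\frac{(\varphi_N)^\xi}{\sqrt{N\eta}}\right\},$$ $$\bigcap_{z\in\mathcal D_L,\ \lambda\in\mathcal D_{\lambda_0}}\left\{\max_{1\le i\le N}|\mathbb E^{v_i}G_{ii}(z)-m(z)|\le C(\varphi_N)^\xi\left(\frac{\lambda}{\sqrt N}+\frac1{(N\eta)^{1/3}}\right)\right\},$$ $$\bigcap_{z\in\mathcal D_L,\ \lambda\in\mathcal D_{\lambda_0}}\left\{|m(z)-m_{fc}(z)|\le C\frac{(\varphi_N)^\xi}{(N\eta)^{1/3}}\right\}.$$ Here $\mathbb E^{v_i}$ denotes the expectation with respect to the random variable $v_i$.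
   Context: Model. For each $N$, $W=(w_{ij})$ is an $N\times N$ random matrix whose entries are independent up to the symmetry constraint $w_{ij}=\overline{w_{ji}}$, centered, complex, with $\mathbb E w_{ii}^2=\frac1N$, $\mathbb E|w_{ij}|^2=\frac1N$, $\mathbb E w_{ij}^2=0$ ($i\neq j$), and $\mathbb P(\sqrt N|w_{ij}|>x)\le C_0e^{-x^{1/\theta}}$ for fixed constants $C_0>0$, $\theta>1$. $V=\operatorname{diag}(v_1,\dots,v_N)$ has real, centered, i.i.d. entries with law $\mu$, $\operatorname{supp}\mu=[-1,1]$, and is independent of $W$. $H=\lambda V+W$, with $G(z)=(G_{ij}(z))=(H-z)^{-1}$, $m(z)=\frac1N\operatorname{Tr}G(z)$ for $z\in\mathbb C^+$ (upper half-plane). Fix $\lambda_0>0$ and $\mathcal D_{\lambda_0}=\{\lambda\in\mathbb R^+:\lambda\le\lambda_0\}$. Assumption on $\lambda,\mu$ (for every $\lambda\in\mathcal D_{\lambda_0}$): if $\lambda\le1$, $\mu$ has a continuous density $\mu(v)$ with $\mu(v)>0$ for $v\in(-1,1)$ and $\mu(v)=0$ for $v\notin[-1,1]$; if $\lambda>1$, $\mu$ is a centered Jacobi measure, i.e. has density $Z^{-1}(1+v)^{a}(1-v)^{b}d(v)\mathbf 1_{[-1,1]}(v)$ with $d\in C^1([-1,1])$, $d>0$ on $[-1,1]$, $Z$ a normalization, and either $-1<a,b\le1$, or $1<a,b<\infty$ and $\lambda<\lambda_1$, $\lambda<\lambda_2$, where $\lambda_1=(\int(1+v)^{-2}d\mu(v))^{1/2}$,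 $\lambda_2=(\int(1-v)^{-2}d\mu(v))^{1/2}$. Deformed semicircle law. $m_{fc}=m_{fc}^\lambda$ is the unique solution, with $\operatorname{Im}m_{fc}(z)\ge0$, of $m_{fc}(z)=\int\frac{d\mu(v)}{\lambda v-z-m_{fc}(z)}$, $z\in\mathbb C^+$. Parameters. $\varphi_N=(\log N)^{C_\varphi}$, and $a_0>2$, $A_0\ge10$, $C_\varphi\ge1$ are fixed constants, depending only on $\theta,C_0$, chosen such that the following large deviation estimates hold for $N$ sufficiently large and all $a_0\le\xi\le A_0\log\log N$ ($\xi=\xi_N$): for independent centered complex random variables $(a_i),(b_i)$ with variance $\sigma^2$ and $\mathbb P(|a_i|\ge x\sigma)\le C_0e^{-x^{1/\theta}}$, $\mathbb P(|b_i|\ge x\sigma)\le C_0e^{-x^{1/\theta}}$, and $A_i,B_{ij}\in\mathbb C$, each of the events $|\sum_iA_ia_i|\ge\varphi_N^\xi\sigma(\sum_i|A_i|^2)^{1/2}$; $|\sum_i\bar a_iB_{ii}a_i-\sum_i\sigma^2B_{ii}|\ge\varphi_N^\xi\sigma^2(\sum_i|B_{ii}|^2)^{1/2}$; $|\sum_{i\ne j}\bar a_iB_{ij}a_j|\ge\varphi_N^\xi\sigma^2(\sum_{i\neq j}|B_{ij}|^2)^{1/2}$; $|\sum_{i,j}\bar a_iB_{ij}b_j|\ge\varphi_N^\xi\sigma^2(\sum_{i,j}|B_{ij}|^2)^{1/2}$ has probability at most $e^{-(\log N)^\xi}$. An event $\Omega$ has $(\xi,\nu)$-high probability if $\mathbb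 P(\Omega^c)\le e^{-\nu(\log N)^\xi}$ for $N$ sufficiently large. Fix $E_0\ge3+\lambda_0$; for $L=L(N)$, $\mathcal D_L=\{z=E+\mathrm i\eta\in\mathbb C:|E|\le E_0,\ (\varphi_N)^L\le N\eta\le3N\}$. *)

(* Defs.v *)
From HB Require Import structures.
From mathcomp Require Import all_boot all_order all_algebra.
From mathcomp Require Import all_classical all_reals all_analysis.
From mathcomp Require Import complex.

Set Implicit Arguments.
Unset Strict Implicit.
Unset Printing Implicit Defensive.

Import Order.TTheory GRing.Theory Num.Theory.
Import numFieldNormedType.Exports.

Local Open Scope classical_set_scope.
Local Open Scope ring_scope.
Local Open Scope complex_scope.

(* The real-valued modulus of a complex number; [`|z|] is [(modulus z)%:C]. *)
Notation modulus := ComplexField.Normc.normc.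

(** * Complex random variables and independence *)

Section Probability.
Context {R : realType} d (T : measurableType d) (P : probability T R).

Definition cmeasurable (X : T -> R[i]) : Prop :=
  measurable_fun setT (fun t => complex.Re (X t)) /\
  measurable_fun setT (fun t => complex.Im (X t)).

(* [Rintegral] is 0 on non-integrable functions; every function integrated
   below is integrable, either bounded or by the tail bounds. *)
Definition cintegral (X : T -> R[i]) : R[i] :=
  (\int[P]_t complex.Re (X t)) +i* (\int[P]_t complex.Im (X t)).

Definition sigma_of (F : set (T -> R)) : set (set T) :=
  <<s \bigcup_(f in F) preimage_set_system setT f measurable >>.

Definition coords (X : T -> R[i]) : set (T -> R) :=
  [set (fun t => complex.Re (X t)); (fun t => complex.Im (X t))].

Definition mutually_independent (I : finType) (D : {set I})
    (S : I -> set (set T)) : Prop :=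
  forall (J : {set I}) (A : I -> set T), J \subset D ->
    (forall i, i \in J -> S i (A i)) ->
    P (\bigcap_(i in [set` J]) A i) = (\prod_(i in J) P (A i))%E.

Definition independent (S1 S2 : set (set T)) : Prop :=
  forall A B, S1 A -> S2 B -> P (A `&` B) = (P A * P B)%E.

End Probability.

(** * Control parameters *)

Definition phi {R : realType} (Cphi : R) (N : nat) : R := ln N%:R `^ Cphi.

Definition xi_range {R : realType} (a0 A0 : R) (N : nat) (xi : R) : Prop :=
  a0 <= xi <= A0 * ln (ln N%:R).

Section LargeDeviation.
Context {R : realType} d (T : measurableType d) (P : probability T R).

(* When the threshold [t] vanishes (all coefficients are zero) the event
   [t <= |X|] is trivially certain, so the estimate is meant for [0 < t]. *)
Definition deviation_le (X : T -> R[i]) (t p : R) : Prop :=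
  0 < t -> (P [set w | (t <= modulus (X w))%R] <= p%:E)%E.

Definition ld_variable (theta C0 sigma : R) (a : T -> R[i]) : Prop :=
  [/\ cmeasurable a,
      cintegral P a = 0,
      cintegral P (fun w => `|a w| ^+ 2) = (sigma ^+ 2)%:C &
      forall x : R, 0 < x ->
        (P [set w | (x * sigma <= modulus (a w))%R]
           <= (C0 * expR (- (x `^ theta^-1)))%:E)%E].

Definition ld_family (theta C0 sigma : R) (N : nat) (a b : 'I_N -> T -> R[i]) :
    Prop :=
  [/\ forall i, ld_variable theta C0 sigma (a i),
      forall i, ld_variable theta C0 sigma (b i) &
      mutually_independent P [set: 'I_N + 'I_N]
        (fun k => sigma_of (coords
           (match k with inl i => a i | inr i => b i end)))].

Definition ld_bounds (sigma f p : R) (N : nat) (a b : 'I_N -> T -> R[i])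
    (A : 'I_N -> R[i]) (B : 'M[R[i]]_N) : Prop :=
  [/\ deviation_le (fun w => \sum_i A i * a i w)
        (f * sigma * Num.sqrt (\sum_i modulus (A i) ^+ 2)) p,
      deviation_le (fun w => \sum_i conjc (a i w) * B i i * a i w
                             - \sum_i (sigma ^+ 2)%:C * B i i)
        (f * sigma ^+ 2 * Num.sqrt (\sum_i modulus (B i i) ^+ 2)) p,
      deviation_le (fun w => \sum_i \sum_(j | i != j) conjc (a i w) * B i j * a j w)
        (f * sigma ^+ 2 *
           Num.sqrt (\sum_i \sum_(j | i != j) modulus (B i j) ^+ 2)) p &
      deviation_le (fun w => \sum_i \sum_j conjc (a i w) * B i j * b j w)
        (f * sigma ^+ 2 * Num.sqrt (\sum_i \sum_j modulus (B i j) ^+ 2)) p].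

End LargeDeviation.

Definition large_deviation_estimates {R : realType}
    (theta C0 a0 A0 Cphi : R) : Prop :=
  \forall N \near \oo, forall xi : R, xi_range a0 A0 N xi ->
    forall (d : measure_display) (T : measurableType d) (P : probability T R)
      (sigma : R) (a b : 'I_N -> T -> R[i]) (A : 'I_N -> R[i]) (B : 'M[R[i]]_N),
    0 < sigma -> ld_family P theta C0 sigma a b ->
    ld_bounds P sigma (phi Cphi N `^ xi) (expR (- (ln N%:R `^ xi))) a b A B.

Definition high_probability {R : realType} (d : nat -> measure_display)
    (T : forall N, measurableType (d N)) (P : forall N, probability (T N) R)
    (xi : nat -> R) (nu : R) (Omega : forall N, set (T N)) : Prop :=
  \forall N \near \oo, measurable (Omega N) /\
    (P N (~` Omega N) <= (expR (- (nu * (ln N%:R `^ xi N))))%:E)%E.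

(** * The law of the diagonal entries *)

Section Law.
Context {R : realType} (mu : probability (measurableTypeR R) R).

Definition support_of : set R :=
  [set x | forall U : set R, open U -> U x -> (0 < mu U)%E].

Definition has_density (f : R -> R) : Prop :=
  forall A : set R, measurable A ->
    mu A = (\int[lebesgue_measure]_(x in A) (f x)%:E)%E.

Definition positive_continuous_density : Prop :=
  exists f : R -> R,
    [/\ has_density f,
        forall v, -1 < v < 1 -> {for v, continuous f},
        forall v, -1 < v < 1 -> 0 < f v &
        forall v, ~~ (-1 <= v <= 1) -> f v = 0].

Definition C1_on (a b : R) (g : R -> R) : Prop :=
  {within `[a, b], continuous g} /\
  exists g' : R -> R, {within `[a, b], continuous g'} /\
    (forall x, a < x < b -> is_derive x 1 g (g' x)).

Definition jacobi_measure (a b : R) : Prop :=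
  [/\ -1 < a, -1 < b & exists (Z : R) (g : R -> R),
    [/\ 0 < Z, C1_on (-1) 1 g, forall v, -1 <= v <= 1 -> 0 < g v &
        has_density (fun v => if -1 <= v <= 1
          then Z^-1 * (1 + v) `^ a * (1 - v) `^ b * g v else 0)]].

Definition lambda1 : R := Num.sqrt (\int[mu]_v (1 + v) ^- 2).
Definition lambda2 : R := Num.sqrt (\int[mu]_v (1 - v) ^- 2).

Definition admissible (lambda : R) : Prop :=
  (lambda <= 1 -> positive_continuous_density) /\
  (1 < lambda -> exists a b : R, jacobi_measure a b /\
     ((a <= 1 /\ b <= 1) \/
      [/\ 1 < a, 1 < b, lambda < lambda1 & lambda < lambda2])).

(* Stieltjes transform of the deformed semicircle law: the unique [m] with
   nonnegative imaginary part solving the self-consistent equation. *)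
Definition mfc (lambda : R) (z : R[i]) : R[i] :=
  xget 0 [set m : R[i] | 0 <= complex.Im m /\
    m = cintegral mu (fun v : measurableTypeR R => ((lambda * v)%:C - z - m)^-1)].

End Law.

(** * The deformed Wigner matrix *)

Definition wigner {R : realType} d (T : measurableType d) (P : probability T R)
    (theta C0 : R) (N : nat) (W : T -> 'M[R[i]]_N) : Prop :=
  [/\ forall i j, cmeasurable (fun w => W w i j),
      forall w i j, W w i j = conjc (W w j i),
      mutually_independent P [set p : 'I_N * 'I_N | (p.1 <= p.2)%N]
        (fun p => sigma_of (coords (fun w => W w p.1 p.2))),
      [/\ forall i j, cintegral P (fun w => W w i j) = 0,
          forall i, cintegral P (fun w => W w i i ^+ 2) = N%:R^-1,
          forall i j, cintegral P (fun w => `|W w i j| ^+ 2) = N%:R^-1 &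
          forall i j, i != j -> cintegral P (fun w => W w i j ^+ 2) = 0] &
      forall i j (x : R), 0 < x ->
        (P [set w | (x < Num.sqrt N%:R * modulus (W w i j))%R]
           <= (C0 * expR (- (x `^ theta^-1)))%:E)%E].

Definition iid_with_law {R : realType} d (T : measurableType d)
    (P : probability T R) (mu : probability (measurableTypeR R) R)
    (N : nat) (v : T -> 'rV[R]_N) : Prop :=
  [/\ forall i, measurable_fun setT (fun w => v w 0 i),
      forall i (A : set R), measurable A -> P [set w | A (v w 0 i)] = mu A &
      mutually_independent P [set: 'I_N]
        (fun i => sigma_of [set (fun w => v w 0 i)])].

Definition deformed_model {R : realType} d (T : measurableType d)
    (P : probability T R) (theta C0 : R)
    (mu : probability (measurableTypeR R) R) (N : nat)
    (W : T -> 'M[R[i]]_N) (v : T -> 'rV[R]_N) : Prop :=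
  [/\ wigner P theta C0 W, iid_with_law P mu v &
      independent P
        (sigma_of [set (fun w => v w 0 i) | i in [set: 'I_N]])
        (sigma_of (\bigcup_(p in [set: 'I_N * 'I_N])
                     coords (fun w => W w p.1 p.2)))].

Section Resolvent.
Context {R : realType} (N : nat).

Definition hamiltonian (lambda : R) (v : 'rV[R]_N) (W : 'M[R[i]]_N) : 'M[R[i]]_N :=
  lambda%:C *: diag_mx (map_mx (fun x : R => x%:C) v) + W.

Definition resolvent (lambda : R) (v : 'rV[R]_N) (W : 'M[R[i]]_N) (z : R[i]) :
    'M[R[i]]_N :=
  invmx (hamiltonian lambda v W - z%:M).

Definition mN (lambda : R) (v : 'rV[R]_N) (W : 'M[R[i]]_N) (z : R[i]) : R[i] :=
  N%:R^-1 * \tr (resolvent lambda v W z).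

Definition set_entry (v : 'rV[R]_N) (i : 'I_N) (x : R) : 'rV[R]_N :=
  \row_j (if j == i then x else v 0 j).

(* E^{v_i} G_ii: integrate out v_i over its law, all other entries of V and
   all of W being kept fixed. *)
Definition partial_expectation_G (mu : probability (measurableTypeR R) R)
    (lambda : R) (v : 'rV[R]_N) (W : 'M[R[i]]_N) (z : R[i]) (i : 'I_N) : R[i] :=
  cintegral mu (fun x : measurableTypeR R =>
    resolvent lambda (set_entry v i x) W z i i).

End Resolvent.

Definition lambda_domain {R : realType} (lambda0 : R) : set R :=
  [set lambda | 0 < lambda <= lambda0].

Definition spectral_domain {R : realType} (Cphi E0 : R) (N : nat) (L : R) :
    set R[i] :=
  [set z | `|complex.Re z| <= E0 /\
           phi Cphi N `^ L <= N%:R * complex.Im z <= 3 * N%:R].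

Section Events.
Context {R : realType} d (T : measurableType d) (N : nat).
Variables (W : T -> 'M[R[i]]_N) (v : T -> 'rV[R]_N).
Variables (mu : probability (measurableTypeR R) R).
Variables (Cphi E0 lambda0 C xi L : R).

Definition offdiagonal_event : set T :=
  \bigcap_(z in spectral_domain Cphi E0 N L)
  \bigcap_(lambda in lambda_domain lambda0)
    [set w | forall i j : 'I_N, i != j ->
       modulus (resolvent lambda (v w) (W w) z i j)
       <= C * (phi Cphi N `^ xi / Num.sqrt (N%:R * complex.Im z))].

Definition diagonal_event : set T :=
  \bigcap_(z in spectral_domain Cphi E0 N L)
  \bigcap_(lambda in lambda_domain lambda0)
    [set w | forall i : 'I_N,
       modulus (partial_expectation_G mu lambda (v w) (W w) z i
                - mN lambda (v w) (W w) z)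
       <= C * phi Cphi N `^ xi *
          (lambda / Num.sqrt N%:R + ((N%:R * complex.Im z) `^ (3^-1))^-1)].

Definition weak_local_law_event : set T :=
  \bigcap_(z in spectral_domain Cphi E0 N L)
  \bigcap_(lambda in lambda_domain lambda0)
    [set w |
       modulus (mN lambda (v w) (W w) z - mfc mu lambda z)
       <= C * (phi Cphi N `^ xi / (N%:R * complex.Im z) `^ (3^-1))].

End Events.

(* Main.v *)
(* Put Phi = phi^xi, omega^3 = Phi^2 / (N eta), g(zeta) = int dmu(v) / (lambda v - zeta) and
   F(zeta) = zeta - g(zeta), so that F(z + m_fc(z)) = z.

   Schur's complement formula gives 1 / G_ii = lambda v_i - (z + m) - eps_i, where eps_i does
   not involve v_i and, by the large deviation estimates and Ward's identity, satisfies
   |eps_i|^2 <= C omega^3 (Im (z + m) + omega).  Averaging over i and applying Hoeffding's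
   inequality to the v_i, uniformly over the parameters, yields the same bound for
   |F(z + m) - z|^2.

   Stability: the hypotheses on mu provide c > 0 with int |lambda v - zeta|^-2 dmu > 1 whenever
   0 < Im zeta <= c and |Re zeta| <= lambda + c; near the end points of the support this
   rests on int (1 -+ v)^-2 dmu > lambda^2 and monotone convergence.  Since the integral is
   below 1 at z + m_fc, that point stays away from the support, and there
   u = (z + m) - (z + m_fc) satisfies a quadratic equation whose linear coefficient is
   comparable to an explicit beta and whose quadratic coefficient is bounded below when beta
   is small.  As beta increases along the path t |-> F(z + m_fc + i t), a continuity argument
   started at large t gives |u| <= C omega, the third estimate.  The first two follow from
   G_ij = -G_jj sum_k G^(j)_ik h_kj and from
   E^{v_i} G_ii = int dmu(x) / (lambda x - (z + m) - eps_i).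

   The exceptional set is a union over a polynomial net in (lambda, z), and by continuity in
   (lambda, z) the events reduce to rational parameters, hence are measurable. *)
Require Import Defs.
From HB Require Import structures.
From mathcomp Require Import all_boot all_order all_algebra.
From mathcomp Require Import all_classical all_reals all_analysis.
From mathcomp Require Import measurable_realfun complex ring lra.

Set Implicit Arguments.
Unset Strict Implicit.
Unset Printing Implicit Defensive.

Import Order.TTheory GRing.Theory Num.Theory.
Import numFieldNormedType.Exports.

Local Open Scope classical_set_scope.
Local Open Scope ring_scope.
Local Open Scope complex_scope.


(** * Complex-valued random variables *)

(** The exponent 1/3 is dictated by the edges. With beta the size of the linear coefficient, the
    approximate equation reads roughly |beta u + u^2|^2 <= omega^3 (Im + omega), where Im is at most
    a multiple of beta. If beta dominates omega, division gives |u|^2 <= C omega^3 / beta <= C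
    omega^2. If beta is of order at most omega, then either |u| is too, or u^2 dominates and |u|^4
    <= C omega^3 |u|. Both end in |u| <= C omega.

    Two circularities shape the argument. The equation for m is available only while z + m stays
    away from lambda times the support, which is part of what has to be shown; so closeness is
    propagated by continuity. And z + m is random, while concentration of averages over the v_i is
    proved at fixed points; so it is required at every zeta of a deterministic region and only then
    evaluated at z + m. All probabilistic input is therefore gathered in one predicate,
    [good_sample], whose consequences are deterministic.

    The condition L >= 12 xi gives N eta >= Phi^12, hence omega <= Phi^-3, which falls below any
    fixed threshold. *)

Section ComplexModulus.
Context {R : rcfType}.
Implicit Types x y z : R[i].

Lemma modulus_ge0 x : 0 <= modulus x.
Proof. by case: x => a b /=; exact: sqrtr_ge0. Qed.

Lemma modulusM x y : modulus (x * y) = modulus x * modulus y.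
Proof. exact: ComplexField.Normc.normcM. Qed.

Lemma modulusV x : modulus x^-1 = (modulus x)^-1.
Proof. exact: ComplexField.Normc.normcV. Qed.

Lemma modulusD x y : modulus (x + y) <= modulus x + modulus y.
Proof. exact: (@le_normcD R). Qed.

Lemma modulusN x : modulus (- x) = modulus x.
Proof. exact: (@normcN R). Qed.

Lemma modulusB x y : modulus (x - y) <= modulus x + modulus y.
Proof. by rewrite -(modulusN y) modulusD. Qed.

Lemma modulusC x y : modulus (x - y) = modulus (y - x).
Proof. by rewrite -modulusN opprB. Qed.

Lemma modulus0 : modulus (0 : R[i]) = 0.
Proof. exact: ComplexField.Normc.normc0. Qed.

Lemma modulus1 : modulus (1 : R[i]) = 1.
Proof. exact: ComplexField.Normc.normc1. Qed.

Lemma modulus_eq0 x : (modulus x == 0) = (x == 0).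
Proof.
apply/eqP/eqP => [/ComplexField.Normc.eq0_normc//|->]; exact: modulus0.
Qed.

Lemma modulus_gt0 x : (0 < modulus x) = (x != 0).
Proof. by rewrite lt_def modulus_eq0 modulus_ge0 andbT. Qed.

Lemma modulus_conjc x : modulus (conjc x) = modulus x.
Proof. by case: x => a b /=; rewrite sqrrN. Qed.

Lemma sqr_modulus x : modulus x ^+ 2 = complex.Re x ^+ 2 + complex.Im x ^+ 2.
Proof. by case: x => a b /=; rewrite sqr_sqrtr// addr_ge0 ?sqr_ge0. Qed.

Lemma modulus_real (a : R) : modulus a%:C = `|a|.
Proof. by rewrite /= expr0n/= addr0 sqrtr_sqr. Qed.

Lemma Re_le_modulus x : `|complex.Re x| <= modulus x.
Proof.
by rewrite -ler_sqr ?nnegrE ?modulus_ge0// sqr_modulus real_normK ?num_real// lerDl sqr_ge0.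
Qed.

Lemma Im_le_modulus x : `|complex.Im x| <= modulus x.
Proof.
by rewrite -ler_sqr ?nnegrE ?modulus_ge0// sqr_modulus real_normK ?num_real// lerDr sqr_ge0.
Qed.

Lemma modulus_le_ReIm x : modulus x <= `|complex.Re x| + `|complex.Im x|.
Proof.
rewrite -ler_sqr ?nnegrE ?modulus_ge0 ?addr_ge0// sqr_modulus sqrrD.
rewrite !real_normK ?num_real// -subr_ge0.
by rewrite [X in 0 <= X](_ : _ = `|complex.Re x| * `|complex.Im x| *+ 2) ?mulrn_wge0 ?mulr_ge0//; ring.
Qed.

Lemma modulus_lerB x y : modulus x - modulus y <= modulus (x - y).
Proof. by rewrite lerBlDr (le_trans _ (modulusD _ _))// subrK. Qed.

Lemma modulus_dist_trans y x z : modulus (x - z) <= modulus (x - y) + modulus (y - z).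
Proof. by rewrite (le_trans _ (modulusD _ _))// addrA subrK. Qed.

Lemma modulus_sum (I : Type) (s : seq I) (P : pred I) (f : I -> R[i]) :
  modulus (\sum_(i <- s | P i) f i) <= \sum_(i <- s | P i) modulus (f i).
Proof.
elim/big_rec2: _ => [|i x y _ h]; first by rewrite modulus0.
by rewrite (le_trans (modulusD _ _))// lerD2l.
Qed.

Lemma ReD x y : complex.Re (x + y) = complex.Re x + complex.Re y.
Proof. by case: x; case: y. Qed.
Lemma ImD x y : complex.Im (x + y) = complex.Im x + complex.Im y.
Proof. by case: x; case: y. Qed.
Lemma ReN x : complex.Re (- x) = - complex.Re x. Proof. by case: x. Qed.
Lemma ImN x : complex.Im (- x) = - complex.Im x. Proof. by case: x. Qed.
Lemma ReM x y : complex.Re (x * y) = complex.Re x * complex.Re y - complex.Im x * complex.Im y.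
Proof. by case: x; case: y. Qed.
Lemma ImM x y : complex.Im (x * y) = complex.Re x * complex.Im y + complex.Im x * complex.Re y.
Proof. by case: x => a b; case: y => c d. Qed.
Lemma Re_conjc x : complex.Re (conjc x) = complex.Re x. Proof. by case: x. Qed.
Lemma Im_conjc x : complex.Im (conjc x) = - complex.Im x. Proof. by case: x. Qed.
Lemma ReV x : complex.Re x^-1 = complex.Re x / modulus x ^+ 2.
Proof. by rewrite sqr_modulus; case: x. Qed.
Lemma ImV x : complex.Im x^-1 = - complex.Im x / modulus x ^+ 2.
Proof. by rewrite sqr_modulus; case: x => a b /=; rewrite mulNr. Qed.
Lemma Re_sum (I : Type) (s : seq I) (P : pred I) (f : I -> R[i]) :
  complex.Re (\sum_(i <- s | P i) f i) = \sum_(i <- s | P i) complex.Re (f i).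
Proof. by elim/big_rec2: _ => // i x y _ <-; rewrite ReD. Qed.
Lemma Im_sum (I : Type) (s : seq I) (P : pred I) (f : I -> R[i]) :
  complex.Im (\sum_(i <- s | P i) f i) = \sum_(i <- s | P i) complex.Im (f i).
Proof. by elim/big_rec2: _ => // i x y _ <-; rewrite ImD. Qed.

Lemma mul_conjc_modulus x : x * conjc x = (modulus x ^+ 2)%:C.
Proof.
apply/eqP; rewrite eq_complex ReM ImM Re_conjc Im_conjc /= sqr_modulus.
by apply/andP; split; apply/eqP; ring.
Qed.

End ComplexModulus.

Section ComplexMeasurable.
Context {R : realType} d (T : measurableType d).
Implicit Types f g : T -> R[i].

Lemma measurable_inv_fun (f : T -> R) :
  measurable_fun setT f -> measurable_fun setT (fun x => (f x)^-1).
Proof.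
move=> mf; apply: (measurableT_comp (f := fun x : R => x^-1)) => //.
(* Inversion is discontinuous only at 0, where its value is 0 by convention; that point is treated
   apart. *)
rewrite -(setUv [set 0 : R]); apply/measurable_funU => //.
  exact: measurableC.
split.
  have h : {in [set 0 : R], (fun=> 0 : R) =1 GRing.inv}.
    by move=> x; rewrite inE => -> ; rewrite invr0.
  by apply: (eq_measurable_fun _ h); exact: measurable_cst.
apply: open_continuous_measurable_fun.
  by rewrite openC; exact: closed_eq.
by move=> x; rewrite inE/= => /eqP x0; exact: inv_continuous.
Qed.

Lemma cmeasurable_cst (c : R[i]) : cmeasurable (fun _ : T => c).
Proof. by split; exact: measurable_cst. Qed.

Lemma cmeasurableD f g : cmeasurable f -> cmeasurable g -> cmeasurable (fun t => f t + g t).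
Proof.
move=> [f1 f2] [g1 g2]; split.
  by under eq_fun do rewrite ReD; exact: measurable_funD.
by under eq_fun do rewrite ImD; exact: measurable_funD.
Qed.

Lemma cmeasurableN f : cmeasurable f -> cmeasurable (fun t => - f t).
Proof.
move=> [f1 f2]; split.
  by under eq_fun do rewrite ReN; exact: measurable_funN.
by under eq_fun do rewrite ImN; exact: measurable_funN.
Qed.

Lemma cmeasurableB f g : cmeasurable f -> cmeasurable g -> cmeasurable (fun t => f t - g t).
Proof. by move=> mf mg; apply: cmeasurableD => //; exact: cmeasurableN. Qed.

Lemma cmeasurableM f g : cmeasurable f -> cmeasurable g -> cmeasurable (fun t => f t * g t).
Proof.
move=> [f1 f2] [g1 g2]; split.
  by under eq_fun do rewrite ReM; apply: measurable_funB; exact: measurable_funM.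
by under eq_fun do rewrite ImM; apply: measurable_funD; exact: measurable_funM.
Qed.

Lemma measurable_modulus_sqr f : cmeasurable f -> measurable_fun setT (fun t => modulus (f t) ^+ 2).
Proof.
move=> [f1 f2]; under eq_fun do rewrite sqr_modulus.
by apply: measurable_funD; exact: measurable_funX.
Qed.

Lemma measurable_modulus f : cmeasurable f -> measurable_fun setT (fun t => modulus (f t)).
Proof.
move=> mf; have -> : (fun t => modulus (f t)) = Num.sqrt \o (fun t => modulus (f t) ^+ 2).
  by apply/funext => t /=; rewrite sqrtr_sqr ger0_norm// modulus_ge0.
apply: measurableT_comp; last exact: measurable_modulus_sqr.
by apply: continuous_measurable_fun; exact: sqrt_continuous.
Qed.

Lemma cmeasurableV f : cmeasurable f -> cmeasurable (fun t => (f t)^-1).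
Proof.
move=> mf; have [f1 f2] := mf; split.
  under eq_fun do rewrite ReV; apply: measurable_funM => //.
  exact/measurable_inv_fun/measurable_modulus_sqr.
under eq_fun do rewrite ImV; apply: measurable_funM; first exact: measurable_funN.
exact/measurable_inv_fun/measurable_modulus_sqr.
Qed.

Lemma cmeasurable_conjc f : cmeasurable f -> cmeasurable (fun t => conjc (f t)).
Proof.
move=> [f1 f2]; split.
  by under eq_fun do rewrite Re_conjc.
by under eq_fun do rewrite Im_conjc; exact: measurable_funN.
Qed.

Lemma cmeasurable_sum (I : Type) (s : seq I) (P : pred I) (f : I -> T -> R[i]) :
  (forall i, P i -> cmeasurable (f i)) -> cmeasurable (fun t => \sum_(i <- s | P i) f i t).
Proof.
move=> mf; elim: s => [|i s ih].
  under eq_fun do rewrite big_nil; exact: cmeasurable_cst.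
under eq_fun do rewrite big_cons.
by have [Pi|//] := boolP (P i); apply: cmeasurableD => //; exact: mf.
Qed.

Lemma cmeasurable_prod (I : Type) (s : seq I) (P : pred I) (f : I -> T -> R[i]) :
  (forall i, P i -> cmeasurable (f i)) -> cmeasurable (fun t => \prod_(i <- s | P i) f i t).
Proof.
move=> mf; elim: s => [|i s ih].
  under eq_fun do rewrite big_nil; exact: cmeasurable_cst.
under eq_fun do rewrite big_cons.
by have [Pi|//] := boolP (P i); apply: cmeasurableM => //; exact: mf.
Qed.

Lemma cmeasurable_real (f : T -> R) : measurable_fun setT f -> cmeasurable (fun t => (f t)%:C).
Proof. by move=> mf; split => //=; exact: measurable_cst. Qed.

Lemma cmeasurable_det n (A : T -> 'M[R[i]]_n) :
  (forall i j, cmeasurable (fun t => A t i j)) -> cmeasurable (fun t => \det (A t)).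
Proof.
move=> mA; apply: cmeasurable_sum => s _; apply: cmeasurableM; first exact: cmeasurable_cst.
by apply: cmeasurable_prod => i _; exact: mA.
Qed.

(** On invertible matrices [invmx] is the adjugate over the determinant, a rational expression in
    the entries; the unit hypothesis excludes the default branch of [invmx]. *)
Lemma cmeasurable_invmx n (A : T -> 'M[R[i]]_n) :
  (forall i j, cmeasurable (fun t => A t i j)) -> (forall t, A t \in unitmx) ->
  forall i j, cmeasurable (fun t => invmx (A t) i j).
Proof.
move=> mA uA i j.
under eq_fun do rewrite /invmx uA !mxE.
apply: cmeasurableM; first exact/cmeasurableV/cmeasurable_det.
apply: cmeasurableM; first exact: cmeasurable_cst.
apply: cmeasurable_det => k l.
by under eq_fun do rewrite !mxE; exact: mA.
Qed.

End ComplexMeasurable.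

Lemma cmeasurable_comp {R : realType} d1 d2 (T1 : measurableType d1) (T2 : measurableType d2)
    (h : T1 -> T2) (f : T2 -> R[i]) :
  measurable_fun setT h -> cmeasurable f -> cmeasurable (fun t => f (h t)).
Proof.
by move=> mh [f1 f2]; split; [exact: (measurableT_comp f1)|exact: (measurableT_comp f2)].
Qed.


Section ComplexIntegral.
Context {R : realType} d (T : measurableType d) (P : probability T R).
Implicit Types (f g : T -> R[i]) (h k : T -> R).

(** Boundedness stands in for integrability: Cauchy kernels at points of the open half-plane are
    bounded, and bounded functions, unlike integrable ones, are closed under products. *)
Definition rbounded h := measurable_fun setT h /\ exists K, forall t, `|h t| <= K.
Definition cbounded f := cmeasurable f /\ exists K, forall t, modulus (f t) <= K.

Lemma rbounded_integrable h : rbounded h -> P.-integrable setT (EFin \o h).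
Proof.
move=> [mh [K hK]]; apply: measurable_bounded_integrable => //.
  by rewrite (le_lt_trans (probability_le1 _ _)) ?ltry.
exists K; split; first exact: num_real.
by move=> x Kx t _ /=; rewrite (le_trans (hK t))// ltW.
Qed.

Lemma cbounded_Re f : cbounded f -> rbounded (fun t => complex.Re (f t)).
Proof.
by move=> [[m1 m2] [K hK]]; split => //; exists K => t; rewrite (le_trans (Re_le_modulus _)).
Qed.
Lemma cbounded_Im f : cbounded f -> rbounded (fun t => complex.Im (f t)).
Proof.
by move=> [[m1 m2] [K hK]]; split => //; exists K => t; rewrite (le_trans (Im_le_modulus _)).
Qed.
Lemma cbounded_modulus f : cbounded f -> rbounded (fun t => modulus (f t)).
Proof.
move=> [mf [K hK]]; split; first exact: measurable_modulus.
by exists K => t; rewrite ger0_norm ?modulus_ge0.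
Qed.

Lemma rbounded_cst (c : R) : rbounded (fun=> c).
Proof. by split; [exact: measurable_cst|exists `|c|]. Qed.
Lemma rboundedD h k : rbounded h -> rbounded k -> rbounded (fun t => h t + k t).
Proof.
move=> [mh [K hK]] [mk [L hL]]; split; first exact: measurable_funD.
by exists (K + L) => t; rewrite (le_trans (ler_normD _ _))// lerD.
Qed.
Lemma rboundedN h : rbounded h -> rbounded (fun t => - h t).
Proof.
move=> [mh [K hK]]; split; first exact: measurable_funN.
by exists K => t; rewrite normrN.
Qed.
Lemma rboundedB h k : rbounded h -> rbounded k -> rbounded (fun t => h t - k t).
Proof. by move=> hh hk; apply: rboundedD => //; exact: rboundedN. Qed.
Lemma rboundedM h k : rbounded h -> rbounded k -> rbounded (fun t => h t * k t).
Proof.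
move=> [mh [K hK]] [mk [L hL]]; split; first exact: measurable_funM.
by exists (K * L) => t; rewrite normrM ler_pM.
Qed.

Lemma cbounded_cst (c : R[i]) : cbounded (fun=> c).
Proof. by split; [exact: cmeasurable_cst|exists (modulus c)]. Qed.
Lemma cboundedD f g : cbounded f -> cbounded g -> cbounded (fun t => f t + g t).
Proof.
move=> [mh [K hK]] [mk [L hL]]; split; first exact: cmeasurableD.
by exists (K + L) => t; rewrite (le_trans (modulusD _ _))// lerD.
Qed.
Lemma cboundedN f : cbounded f -> cbounded (fun t => - f t).
Proof.
move=> [mh [K hK]]; split; first exact: cmeasurableN.
by exists K => t; rewrite modulusN.
Qed.
Lemma cboundedB f g : cbounded f -> cbounded g -> cbounded (fun t => f t - g t).
Proof. by move=> hh hk; apply: cboundedD => //; exact: cboundedN. Qed.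
Lemma cboundedM f g : cbounded f -> cbounded g -> cbounded (fun t => f t * g t).
Proof.
move=> [mh [K hK]] [mk [L hL]]; split; first exact: cmeasurableM.
by exists (K * L) => t; rewrite modulusM ler_pM// modulus_ge0.
Qed.
Lemma cbounded_sqr f : cbounded f -> rbounded (fun t => modulus (f t) ^+ 2).
Proof.
move=> hf; have := cboundedM hf hf => /cbounded_modulus.
by under eq_fun do rewrite modulusM -expr2.
Qed.
Lemma cbounded_real h : rbounded h -> cbounded (fun t => (h t)%:C).
Proof.
move=> [mh [K hK]]; split; first exact: cmeasurable_real.
by exists K => t; rewrite modulus_real.
Qed.

Lemma RintD h k : rbounded h -> rbounded k ->
  \int[P]_t (h t + k t) = \int[P]_t h t + \int[P]_t k t.
Proof. by move=> hh hk; apply: RintegralD => //; exact: rbounded_integrable. Qed.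
Lemma RintB h k : rbounded h -> rbounded k ->
  \int[P]_t (h t - k t) = \int[P]_t h t - \int[P]_t k t.
Proof. by move=> hh hk; apply: RintegralB => //; exact: rbounded_integrable. Qed.
Lemma RintZ (c : R) h : rbounded h -> \int[P]_t (c * h t) = c * \int[P]_t h t.
Proof. by move=> hh; apply: RintegralZl => //; exact: rbounded_integrable. Qed.
Lemma Rint_cst (c : R) : \int[P]_t c = c.
Proof.
rewrite (_ : \int[P]_t c = c * fine (P setT)); last exact: Rintegral_cst.
by rewrite probability_setT mulr1.
Qed.
Lemma RintN h : rbounded h -> \int[P]_t (- h t) = - \int[P]_t h t.
Proof.
move=> hh; rewrite -mulN1r -RintZ//; congr Rintegral.
by apply/funext => t; rewrite mulN1r.
Qed.

Lemma RintZr (c : R) h : rbounded h -> \int[P]_t (h t * c) = \int[P]_t h t * c.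
Proof. by move=> hh; rewrite mulrC -RintZ//; congr Rintegral; apply/funext => t; rewrite mulrC. Qed.

Lemma le_Rint_on (D : set T) h k : measurable D -> P (~` D) = 0%E ->
  rbounded h -> rbounded k -> (forall t, D t -> h t <= k t) ->
  \int[P]_t h t <= \int[P]_t k t.
Proof.
move=> mD D0 hh hk hle.
have E l : rbounded l -> \int[P]_t l t = \int[P]_(t in D) l t.
  move=> hl; rewrite /Rintegral (negligible_integral (measurableC mD))//.
    by rewrite setTD setCK.
  exact: rbounded_integrable.
rewrite (E _ hh) (E _ hk); apply: le_Rintegral => //;
  by apply: (integrableS measurableT) => //; exact: rbounded_integrable.
Qed.

Lemma le_Rint h k : rbounded h -> rbounded k -> (forall t, h t <= k t) ->
  \int[P]_t h t <= \int[P]_t k t.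
Proof.
move=> hh hk hle; apply: (@le_Rint_on setT) => //.
by rewrite setCT measure0.
Qed.

Lemma Re_cintegral f : complex.Re (cintegral P f) = \int[P]_t complex.Re (f t).
Proof. by []. Qed.
Lemma Im_cintegral f : complex.Im (cintegral P f) = \int[P]_t complex.Im (f t).
Proof. by []. Qed.

Lemma cintegral_ext f g : (forall t, f t = g t) -> cintegral P f = cintegral P g.
Proof. by move=> /funext ->. Qed.

Lemma cintegralD f g : cbounded f -> cbounded g ->
  cintegral P (fun t => f t + g t) = cintegral P f + cintegral P g.
Proof.
move=> hf hg; apply/eqP; rewrite eq_complex ReD ImD /=.
under eq_Rintegral do rewrite ReD.
under [X in _ && (X == _)]eq_Rintegral do rewrite ImD.
rewrite !RintD ?eqxx//; by [exact: cbounded_Re|exact: cbounded_Im].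
Qed.

Lemma cintegralZ (c : R[i]) f : cbounded f ->
  cintegral P (fun t => c * f t) = c * cintegral P f.
Proof.
move=> hf; apply/eqP; rewrite eq_complex ReM ImM /=.
have hR := cbounded_Re hf; have hI := cbounded_Im hf.
have bZ (a : R) h : rbounded h -> rbounded (fun t => a * h t).
  by move=> hh; apply: rboundedM => //; exact: rbounded_cst.
under eq_Rintegral do rewrite ReM.
under [X in _ && (X == _)]eq_Rintegral do rewrite ImM.
by rewrite RintB ?RintD ?RintZ ?eqxx//; exact: bZ.
Qed.

Lemma cintegralB f g : cbounded f -> cbounded g ->
  cintegral P (fun t => f t - g t) = cintegral P f - cintegral P g.
Proof.
move=> hf hg; rewrite cintegralD//; last exact: cboundedN.
congr (_ + _); rewrite -mulN1r -cintegralZ//.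
by apply: cintegral_ext => t; rewrite mulN1r.
Qed.

Lemma cintegral_real h : cintegral P (fun t => (h t)%:C) = (\int[P]_t h t)%:C.
Proof. by rewrite /cintegral /= Rint_cst. Qed.

(** Multiplying by the conjugate of the integral [I] makes the integral real and nonnegative, so
    only a real part has to be compared with the modulus of the integrand. *)
Lemma modulus_cintegral f : cbounded f ->
  modulus (cintegral P f) <= \int[P]_t modulus (f t).
Proof.
move=> hf; set I := cintegral P f.
have hI0 : 0 <= \int[P]_t modulus (f t).
  by apply: Rintegral_ge0 => t _; exact: modulus_ge0.
have [->|I0] := eqVneq I 0; first by rewrite modulus0.
have mI : 0 < modulus I by rewrite modulus_gt0.
rewrite -(ler_pM2l mI) -RintZ; last exact: cbounded_modulus.
have -> : modulus I * modulus I = complex.Re (conjc I * I).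
  by rewrite [conjc I * I]mulrC mul_conjc_modulus /= expr2.
rewrite -cintegralZ// Re_cintegral; apply: le_Rint.
- by apply: cbounded_Re; apply: cboundedM => //; exact: cbounded_cst.
- apply: rboundedM; [exact: rbounded_cst|exact: cbounded_modulus].
move=> t; rewrite (le_trans (ler_norm _))// (le_trans (Re_le_modulus _))//.
by rewrite modulusM modulus_conjc.
Qed.

End ComplexIntegral.


(** * Stieltjes transforms and the self-consistent equation *)

(** The intervals around [x n] of radius r n = D k^n / (1 - k) are nested because r n = r (n+1) + D
    k^n. The limit is the supremum of their left end points, which yields the explicit rate at
    once. *)
Lemma geometric_seq_limit {R : realType} (x : nat -> R) (D k : R) : 0 <= D -> 0 < k < 1 ->
  (forall n, `|x n.+1 - x n| <= D * k ^+ n) ->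
  exists l, forall n, `|x n - l| <= D / (1 - k) * k ^+ n.
Proof.
move=> D0 /andP[k0 k1] hx.
have k1' : 0 < 1 - k by rewrite subr_gt0.
pose r n := D / (1 - k) * k ^+ n.
have rS n : r n = r n.+1 + D * k ^+ n.
  by rewrite /r exprS; field; rewrite gt_eqF.
have r0 n : 0 <= r n by rewrite /r !mulr_ge0// ?invr_ge0 ltW// exprn_gt0.
have ud n m : x n - r n <= x (n + m)%N - r (n + m)%N.
  elim: m => [|m ih]; first by rewrite addn0.
  rewrite addnS (le_trans ih)//.
  have := hx (n + m)%N; rewrite ler_norml => /andP[h1 _].
  by rewrite (rS (n + m)%N); lra.
have wd n m : x (n + m)%N + r (n + m)%N <= x n + r n.
  elim: m => [|m ih]; first by rewrite addn0.
  rewrite addnS (le_trans _ ih)//.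
  have := hx (n + m)%N; rewrite ler_norml => /andP[_ h1].
  by rewrite (rS (n + m)%N); lra.
have uw n m : x n - r n <= x m + r m.
  apply: (le_trans (ud n m)); apply: (le_trans _ (wd m n)); rewrite addnC.
  by have := r0 (m + n)%N; lra.
pose S := range (fun n => x n - r n).
have Sne : S !=set0 by exists (x 0%N - r 0%N); exists 0%N.
exists (sup S) => n; rewrite -/(r n) ler_norml.
have h1 : x n - r n <= sup S.
  apply: ub_le_sup; last by exists n.
  by exists (x n + r n) => _ [m _ <-]; exact: uw.
have h2 : sup S <= x n + r n.
  by apply: ge_sup => // _ [m _ <-]; exact: uw.
by apply/andP; split; lra.
Qed.

Lemma le0_of_geometric {R : realType} (x B k : R) : 0 < k < 1 ->
  (forall n, x <= B * k ^+ n) -> x <= 0.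
Proof.
move=> /andP[k0 k1] hx; rewrite leNgt; apply/negP => x0.
have : (fun n => B * k ^+ n) @ \oo --> B * (0 : R).
  apply: cvgMr; apply: cvg_expr; by rewrite ger0_norm// ltW.
rewrite mulr0 => /cvgrPdist_lt /(_ _ x0)[N _ /(_ N (leqnn N))] /=.
rewrite sub0r normrN => h.
by have := lt_le_trans h (hx N); rewrite ltNge ler_norm.
Qed.

Section Stieltjes.
Context {R : realType} (mu : probability (measurableTypeR R) R).
Implicit Types (lam v : R) (z u w : R[i]).

Definition cauchy_kernel lam z : measurableTypeR R -> R[i] := fun v => ((lam * v)%:C - z)^-1.
Local Notation q := cauchy_kernel.
Definition stieltjes lam z : R[i] := cintegral mu (q lam z).
Definition kernel_sqr lam z : R := \int[mu]_v modulus (q lam z v) ^+ 2.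
Definition kernel_prod lam z lam' u : R[i] := cintegral mu (fun v => q lam z v * q lam' u v).
Local Notation g := stieltjes.
Local Notation S2 := kernel_sqr.
Local Notation T := kernel_prod.

Lemma Im_kernel_den lam z v : complex.Im ((lam * v)%:C - z) = - complex.Im z.
Proof. by rewrite ImD ImN /= add0r. Qed.
Lemma Re_kernel_den lam z v : complex.Re ((lam * v)%:C - z) = lam * v - complex.Re z.
Proof. by rewrite ReD ReN. Qed.

Lemma kernel_den_neq0 lam z v : complex.Im z != 0 -> (lam * v)%:C - z != 0.
Proof.
by apply: contra => /eqP h; have := Im_kernel_den lam z v; rewrite h /= => /eqP; rewrite eq_sym oppr_eq0.
Qed.

Lemma kernel_den_ge lam z v : 0 < complex.Im z -> complex.Im z <= modulus ((lam * v)%:C - z).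
Proof.
move=> z0; have := Im_le_modulus ((lam * v)%:C - z).
by rewrite Im_kernel_den normrN gtr0_norm.
Qed.

Lemma modulus_kernel lam z v : 0 < complex.Im z -> modulus (q lam z v) <= (complex.Im z)^-1.
Proof.
move=> z0; rewrite /q modulusV lef_pV2 ?posrE ?kernel_den_ge//.
exact: (lt_le_trans z0 (kernel_den_ge _ _ z0)).
Qed.

Lemma Im_kernel lam z v : complex.Im (q lam z v) = complex.Im z * modulus (q lam z v) ^+ 2.
Proof. by rewrite /q ImV Im_kernel_den opprK modulusV exprVn. Qed.
Lemma Re_kernel lam z v :
  complex.Re (q lam z v) = (lam * v - complex.Re z) * modulus (q lam z v) ^+ 2.
Proof. by rewrite /q ReV Re_kernel_den modulusV exprVn. Qed.

Lemma cbounded_kernel lam z : 0 < complex.Im z -> cbounded (q lam z).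
Proof.
move=> z0; split; last by exists (complex.Im z)^-1 => v; exact: modulus_kernel.
apply: cmeasurableV; apply: cmeasurableB; last exact: cmeasurable_cst.
apply: cmeasurable_real; apply: measurable_funM => //.
Qed.
Local Hint Resolve cbounded_kernel : core.

Lemma cbounded_kernelM lam z lam' u : 0 < complex.Im z -> 0 < complex.Im u ->
  cbounded (fun v => q lam z v * q lam' u v).
Proof. by move=> z0 u0; apply: cboundedM; exact: cbounded_kernel. Qed.
Local Hint Resolve cbounded_kernelM : core.

Lemma rbounded_kernel_sqr lam z : 0 < complex.Im z -> rbounded (fun v => modulus (q lam z v) ^+ 2).
Proof. by move=> z0; exact/cbounded_sqr/cbounded_kernel. Qed.
Local Hint Resolve rbounded_kernel_sqr : core.

Lemma kernel_sqr_ge0 lam z : 0 <= S2 lam z.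
Proof. by apply: Rintegral_ge0 => v _; exact: sqr_ge0. Qed.

Lemma Im_stieltjes lam z : 0 < complex.Im z -> complex.Im (g lam z) = complex.Im z * S2 lam z.
Proof.
move=> z0; rewrite /= -RintZ; last exact: rbounded_kernel_sqr.
by congr Rintegral; apply/funext => v; exact: Im_kernel.
Qed.

Lemma kernelB lam z lam' u v : complex.Im z != 0 -> complex.Im u != 0 ->
  q lam z v - q lam' u v = ((z - u) + ((lam' - lam) * v)%:C) * (q lam z v * q lam' u v).
Proof.
move=> z0 u0; rewrite /q.
have dz := kernel_den_neq0 lam v z0; have du := kernel_den_neq0 lam' v u0.
have -> : z - u + ((lam' - lam) * v)%:C = ((lam' * v)%:C - u) - ((lam * v)%:C - z).
  by rewrite mulrBl rmorphB /=; ring.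
by move: dz du; set a := (lam * v)%:C - z; set b := (lam' * v)%:C - u => a0 b0; field; rewrite a0 b0.
Qed.

Lemma stieltjesB lam z u : 0 < complex.Im z -> 0 < complex.Im u ->
  g lam z - g lam u = (z - u) * T lam z lam u.
Proof.
move=> z0 u0; rewrite -cintegralB; [|exact: cbounded_kernel..].
rewrite -cintegralZ; last exact: cbounded_kernelM.
apply: cintegral_ext => v; rewrite kernelB ?gt_eqF//.
by rewrite subrr mul0r addr0.
Qed.

(** The arithmetic-geometric inequality under the integral; the free weight [s] is optimised
    afterwards to obtain Cauchy-Schwarz. *)
Lemma modulus_kernel_prod_avg lam z lam' u s : 0 < s -> 0 < complex.Im z -> 0 < complex.Im u ->
  modulus (T lam z lam' u) <= (s * S2 lam z + s^-1 * S2 lam' u) / 2.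
Proof.
move=> s0 z0 u0; apply: (le_trans (modulus_cintegral _ _)); first exact: cbounded_kernelM.
have b1 := rbounded_kernel_sqr lam z0; have b2 := rbounded_kernel_sqr lam' u0.
have bZ (a : R) h : rbounded h -> rbounded (fun t : measurableTypeR R => a * h t).
  by move=> hh; apply: rboundedM => //; exact: rbounded_cst.
rewrite -!RintZ// -RintD; [|exact: bZ..].
rewrite mulrC -RintZ; last by apply: rboundedD; exact: bZ.
apply: le_Rint; [by apply: cbounded_modulus; exact: cbounded_kernelM| |].
  by apply: (bZ 2^-1); apply: rboundedD; exact: bZ.
move=> v; rewrite modulusM; set a := modulus _; set b := modulus _.
rewrite -subr_ge0.
have -> : 2^-1 * (s * a ^+ 2 + s^-1 * b ^+ 2) - a * b = (2 * s)^-1 * (s * a - b) ^+ 2.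
  by field; rewrite gt_eqF.
by rewrite mulr_ge0 ?sqr_ge0// invr_ge0 mulr_ge0// ltW.
Qed.

Lemma modulus_kernel_prod_CS lam z lam' u : 0 < complex.Im z -> 0 < complex.Im u ->
  0 < S2 lam z -> 0 < S2 lam' u ->
  modulus (T lam z lam' u) ^+ 2 <= S2 lam z * S2 lam' u.
Proof.
move=> z0 u0 A0 B0; set A := S2 lam z; set B := S2 lam' u.
have hA : 0 < Num.sqrt A by rewrite sqrtr_gt0.
have hB : 0 < Num.sqrt B by rewrite sqrtr_gt0.
(* This weight makes the two terms of the average equal, both being sqrt(A B). *)
have := @modulus_kernel_prod_avg lam z lam' u (Num.sqrt B / Num.sqrt A) (divr_gt0 hB hA) z0 u0.
have -> : (Num.sqrt B / Num.sqrt A * A + (Num.sqrt B / Num.sqrt A)^-1 * B) / 2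
        = Num.sqrt A * Num.sqrt B.
  have : Num.sqrt A ^+ 2 = A by exact: sqr_sqrtr (ltW A0).
  have : Num.sqrt B ^+ 2 = B by exact: sqr_sqrtr (ltW B0).
  move: hA hB; set a := Num.sqrt A; set b := Num.sqrt B => a0 b0 <- <-.
  by field; rewrite !gt_eqF.
move=> h; rewrite -[A](sqr_sqrtr (ltW A0)) -[B](sqr_sqrtr (ltW B0)) -exprMn.
by rewrite ler_sqr ?nnegrE ?modulus_ge0// mulr_ge0// ltW.
Qed.

Lemma modulus_stieltjes lam z : 0 < complex.Im z -> modulus (g lam z) <= (complex.Im z)^-1.
Proof.
move=> z0; apply: (le_trans (modulus_cintegral _ _)); first exact: cbounded_kernel.
rewrite -[leRHS](Rint_cst mu); apply: le_Rint; [exact/cbounded_modulus/cbounded_kernel| |].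
  exact: rbounded_cst.
by move=> v; exact: modulus_kernel.
Qed.

Lemma modulus_kernel_prod_inv lam z lam' u : 0 < complex.Im z -> 0 < complex.Im u ->
  modulus (T lam z lam' u) <= (complex.Im z)^-1 * (complex.Im u)^-1.
Proof.
move=> z0 u0; apply: (le_trans (modulus_cintegral _ _)); first exact: cbounded_kernelM.
rewrite -[leRHS](Rint_cst mu); apply: le_Rint.
- by apply: cbounded_modulus; exact: cbounded_kernelM.
- exact: rbounded_cst.
by move=> v; rewrite modulusM; apply: ler_pM; rewrite ?modulus_ge0// modulus_kernel.
Qed.

Lemma modulus_stieltjes_sqr lam z : 0 < complex.Im z -> modulus (g lam z) <= (1 + S2 lam z) / 2.
Proof.
move=> z0; apply: (le_trans (modulus_cintegral _ _)); first exact: cbounded_kernel.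
have b1 := rbounded_kernel_sqr lam z0.
have b2 : rbounded (fun v => 1 + modulus (q lam z v) ^+ 2).
  by apply: rboundedD => //; exact: rbounded_cst.
rewrite -[X in X + _](Rint_cst mu 1) -RintD//; last exact: rbounded_cst.
rewrite -RintZr//; apply: le_Rint; [exact/cbounded_modulus/cbounded_kernel| |].
  by apply: rboundedM => //; exact: rbounded_cst.
by move=> v; have := sqr_ge0 (1 - modulus (q lam z v)); nra.
Qed.


Hypothesis hsupp : mu (~` [set v : R | -1 <= v <= 1]) = 0%E.

Lemma measurable_support : measurable [set v : measurableTypeR R | -1 <= v <= 1].
Proof.
have -> : [set v : measurableTypeR R | -1 <= v <= 1] = `[-1, 1]%classic.
  by apply/seteqP; split => v /=; rewrite in_itv.
exact: measurable_itv.
Qed.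

Lemma le_Rint_supp (h k : R -> R) : rbounded (h : measurableTypeR R -> R) ->
  rbounded (k : measurableTypeR R -> R) -> (forall v, -1 <= v <= 1 -> h v <= k v) ->
  \int[mu]_v h v <= \int[mu]_v k v.
Proof. by move=> hh hk hle; apply: (le_Rint_on measurable_support hsupp). Qed.

Lemma kernel_den_le lam z v : -1 <= v <= 1 ->
  modulus ((lam * v)%:C - z) <= `|lam| + modulus z.
Proof.
move=> hv; rewrite (le_trans (modulusB _ _))// lerD2r modulus_real normrM.
by rewrite ler_piMr// ler_norml.
Qed.

Lemma modulus_kernel_ge lam z v : 0 < complex.Im z -> -1 <= v <= 1 ->
  (`|lam| + modulus z)^-1 <= modulus (q lam z v).
Proof.
move=> z0 hv; have h := kernel_den_le lam z hv.
have h0 := lt_le_trans z0 (kernel_den_ge lam v z0).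
by rewrite /q modulusV lef_pV2 ?posrE// (lt_le_trans h0).
Qed.

Lemma kernel_sqr_ge lam z : 0 < complex.Im z -> (`|lam| + modulus z) ^- 2 <= S2 lam z.
Proof.
move=> z0; rewrite -[leLHS](Rint_cst mu); apply: le_Rint_supp.
- exact: rbounded_cst.
- exact: rbounded_kernel_sqr.
move=> v hv; rewrite -exprVn lerXn2r ?nnegrE ?modulus_ge0 ?modulus_kernel_ge//.
by rewrite invr_ge0 addr_ge0 ?modulus_ge0.
Qed.

Lemma kernel_sqr_gt0 lam z : 0 < complex.Im z -> 0 < S2 lam z.
Proof.
move=> z0; apply: lt_le_trans (kernel_sqr_ge lam z0).
rewrite invr_gt0 exprn_gt0// ltr_wpDl// modulus_gt0; apply/eqP => h.
by move: z0; rewrite h /= ltxx.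
Qed.

Lemma Im_stieltjes_gt0 lam z : 0 < complex.Im z -> 0 < complex.Im (g lam z).
Proof. by move=> z0; rewrite Im_stieltjes// mulr_gt0// kernel_sqr_gt0. Qed.

(** This is 2 (cosh d - 1) for the hyperbolic distance d of the upper half-plane. *)
Definition hdist (m n : R[i]) : R := modulus (m - n) ^+ 2 / (complex.Im m * complex.Im n).

Lemma hdist_ge0 m n : 0 < complex.Im m -> 0 < complex.Im n -> 0 <= hdist m n.
Proof. by move=> m0 n0; rewrite /hdist divr_ge0 ?sqr_ge0// mulr_ge0// ltW. Qed.

(* In the metric [hdist] of the upper half-plane the self-consistent map
   contracts by [(1 + eta^2)^-2] on [Im m <= 1 / eta]. *)
Lemma hdist_contraction lam z m n : 0 < complex.Im z -> 0 < complex.Im m -> 0 < complex.Im n ->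
  complex.Im m <= (complex.Im z)^-1 -> complex.Im n <= (complex.Im z)^-1 ->
  hdist (g lam (z + m)) (g lam (z + n)) <= (1 + complex.Im z ^+ 2) ^- 2 * hdist m n.
Proof.
move=> z0 m0 n0 hm hn.
have zm : 0 < complex.Im (z + m) by rewrite ImD addr_gt0.
have zn : 0 < complex.Im (z + n) by rewrite ImD addr_gt0.
have Sm := kernel_sqr_gt0 lam zm; have Sn := kernel_sqr_gt0 lam zn.
rewrite /hdist stieltjesB// !Im_stieltjes//.
have -> : z + m - (z + n) = m - n by ring.
rewrite modulusM exprMn.
(* Cauchy-Schwarz makes both factors [S2] cancel against the imaginary parts of the images. The gain
   comes from the translation by [z] alone, which raises both imaginary parts. *)
have hT := modulus_kernel_prod_CS zm zn Sm Sn.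
have zmn : 0 < complex.Im (z + m) * complex.Im (z + n) by rewrite mulr_gt0.
apply: (@le_trans _ _ (modulus (m - n) ^+ 2 / (complex.Im (z + m) * complex.Im (z + n)))).
  rewrite ler_pdivrMr ?mulr_gt0//.
  rewrite [leRHS](_ : _ = modulus (m - n) ^+ 2 * (S2 lam (z + m) * S2 lam (z + n))).
    by rewrite ler_wpM2l ?sqr_ge0.
  move: zm zn; set a := complex.Im (z + m); set b := complex.Im (z + n); clearbody a b => a0 b0.
  by field; rewrite (gt_eqF a0) (gt_eqF b0).
have e0 : 0 < 1 + complex.Im z ^+ 2 by rewrite ltr_wpDr// ?sqr_ge0.
rewrite mulrCA ler_wpM2l ?sqr_ge0// -invfM lef_pV2 ?posrE ?mulr_gt0//.
have key a : 0 < a -> a <= (complex.Im z)^-1 -> (1 + complex.Im z ^+ 2) * a <= complex.Im z + a.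
  move=> a0 ha; rewrite mulrDl mul1r addrC lerD2r expr2 -mulrA ger_pMr//.
  by rewrite mulrC -ler_pdivlMr// mul1r.
rewrite expr2 mulrACA !ImD ler_pM ?key//; apply: mulr_ge0; exact: ltW.
Qed.

(** Fixed-point iteration measured by [hdist]. All iterates, the starting one included, have
    imaginary part at most 1 / Im z, so a decay of [hdist] by k^2 per step turns into increments of
    modulus at most D k^n. The limit is first known to lie in the closed half-plane only, and the
    equation then moves it inside. *)
Lemma fixpoint_exists lam z : 0 < complex.Im z ->
  exists m, 0 < complex.Im m /\ m = g lam (z + m).
Proof.
move=> z0.
pose k := (1 + complex.Im z ^+ 2)^-1.
have e1 : 1 < 1 + complex.Im z ^+ 2 by rewrite ltrDl exprn_gt0.
have k01 : 0 < k < 1 by rewrite invr_gt0 (lt_trans _ e1)// invf_lt1// (lt_trans _ e1).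
have k0 : 0 < k by case/andP: k01.
pose x n := iter n (fun m => g lam (z + m)) (g lam (z + 'i%C)).
have zP m : 0 < complex.Im m -> 0 < complex.Im (z + m) by move=> ?; rewrite ImD addr_gt0.
have i0 : 0 < complex.Im ('i%C : R[i]) by rewrite /= ltr01.
have le_inv m : 0 < complex.Im m -> modulus (g lam (z + m)) <= (complex.Im z)^-1.
  move=> m0; apply: (le_trans (modulus_stieltjes lam (zP _ m0))).
  by rewrite lef_pV2 ?posrE ?zP// ImD lerDl ltW.
have xI n : 0 < complex.Im (x n).
  by elim: n => [|n ih] /=; apply: Im_stieltjes_gt0; exact: zP.
have xle n : modulus (x n) <= (complex.Im z)^-1.
  by case: n => [|n] /=; apply: le_inv.
have xIle n : complex.Im (x n) <= (complex.Im z)^-1.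
  by rewrite (le_trans (ler_norm _))// (le_trans (Im_le_modulus _)).
have hx n : hdist (x n) (x n.+1) <= (k ^+ n) ^+ 2 * hdist (x 0%N) (x 1%N).
  elim: n => [|n ih]; first by rewrite expr0 expr1n mul1r.
  apply: (le_trans (hdist_contraction lam z0 (xI n) (xI n.+1) (xIle n) (xIle n.+1))).
  rewrite [k ^+ n.+1]exprS exprMn -mulrA [k ^+ 2]exprVn ler_wpM2l// invr_ge0 exprn_ge0//.
  by rewrite ltW// (lt_trans _ e1).
pose D := Num.sqrt (hdist (x 0%N) (x 1%N)) * (complex.Im z)^-1.
have h01 := hdist_ge0 (xI 0%N) (xI 1%N).
have D0 : 0 <= D by rewrite mulr_ge0 ?sqrtr_ge0// invr_ge0 ltW.
have dx n : modulus (x n.+1 - x n) <= D * k ^+ n.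
  rewrite modulusC -ler_sqr ?nnegrE ?modulus_ge0//; last by rewrite mulr_ge0// exprn_ge0// ltW.
  rewrite /D !exprMn sqr_sqrtr//.
  have := hx n; rewrite {1}/hdist ler_pdivrMr ?mulr_gt0// => /le_trans; apply.
  rewrite [leRHS](_ : _ = (k ^+ n) ^+ 2 * hdist (x 0%N) (x 1%N) * ((complex.Im z)^-1 * (complex.Im z)^-1)).
    apply: ler_wpM2l; first by rewrite mulr_ge0 ?sqr_ge0.
    by apply: ler_pM => //; exact: ltW.
  by rewrite [in RHS]mulrC expr2; ring.
have [a ha] : exists a, forall n, `|complex.Re (x n) - a| <= D / (1 - k) * k ^+ n.
  apply: geometric_seq_limit => // n.
  by rewrite -ReN -ReD (le_trans (Re_le_modulus _)).
have [b hb] : exists a, forall n, `|complex.Im (x n) - a| <= D / (1 - k) * k ^+ n.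
  apply: geometric_seq_limit => // n.
  by rewrite -ImN -ImD (le_trans (Im_le_modulus _)).
pose m : R[i] := a +i* b.
pose B := D / (1 - k).
have hm n : modulus (x n - m) <= (B + B) * k ^+ n.
  rewrite (le_trans (modulus_le_ReIm _))// ReD ReN ImD ImN /= mulrDl.
  by rewrite lerD.
have b0 : 0 <= b.
  rewrite -oppr_le0; apply: (@le0_of_geometric _ _ B k) => // n.
  have := hb n; rewrite ler_norml => /andP[_ h]; have := xI n; rewrite /B; lra.
have zm : 0 < complex.Im (z + m) by rewrite ImD /= ltr_wpDr.
have hg n : modulus (g lam (z + x n) - g lam (z + m)) <= (complex.Im z) ^- 2 * modulus (x n - m).
  rewrite (stieltjesB _ (zP _ (xI n)) zm) modulusM mulrC.
  have -> : z + x n - (z + m) = x n - m by ring.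
  rewrite ler_wpM2r ?modulus_ge0//.
  apply: (le_trans (modulus_kernel_prod_inv _ _ (zP _ (xI n)) zm)).
  have h w : complex.Im w >= 0 -> 0 <= (complex.Im (z + w))^-1 <= (complex.Im z)^-1.
    move=> w0; have p : 0 < complex.Im (z + w) by rewrite ImD ltr_wpDr.
    by rewrite invr_ge0 ltW//= lef_pV2// ImD lerDl.
  have /andP[p1 p2] := h _ (ltW (xI n)); have /andP[p3 p4] := h m b0.
  by rewrite expr2 invfM; exact: ler_pM.
have fix_m : m = g lam (z + m).
  apply/eqP; rewrite -subr_eq0 -modulus_eq0 eq_le modulus_ge0 andbT.
  apply: (@le0_of_geometric _ _ ((B + B) * k + (complex.Im z) ^- 2 * (B + B)) k) => // n.
  apply: (le_trans (modulus_dist_trans (x n.+1) _ _)).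
  rewrite modulusC mulrDl lerD//.
    by rewrite -mulrA -exprS.
  rewrite [x n.+1]/= (le_trans (hg n))// -mulrA ler_wpM2l//.
  by rewrite invr_ge0 exprn_ge0// ltW.
exists m; split => //.
by rewrite fix_m Im_stieltjes_gt0.
Qed.

Lemma fixpoint_Im_gt0 lam z m : 0 < complex.Im z -> 0 <= complex.Im m ->
  m = g lam (z + m) -> 0 < complex.Im m.
Proof. by move=> z0 m0 ->; apply: Im_stieltjes_gt0; rewrite ImD ltr_wpDr. Qed.

(** A solution exists, so [xget] returns one and not its default 0; the sign Im >= 0 in the
    definition is improved to > 0 by the equation. *)
Lemma mfcP lam z : 0 < complex.Im z ->
  0 < complex.Im (mfc mu lam z) /\ mfc mu lam z = g lam (z + mfc mu lam z).
Proof.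
move=> z0; rewrite /mfc; set A := [set m | _].
have AE m : A m <-> 0 <= complex.Im m /\ m = g lam (z + m).
  rewrite /A /= /g /q; split => -[h1 h2]; split => //; rewrite {1}h2; apply: cintegral_ext => v;
    by rewrite opprD addrA.
have [m [m0 hm]] := fixpoint_exists lam z0.
have Am : A m by apply/AE; split => //; exact: ltW.
have [h1 h2] := proj1 (AE _) (xgetI 0 Am).
by split => //; exact: (fixpoint_Im_gt0 z0 h1 h2).
Qed.

(** The imaginary part of the fixed-point equation. It forces [S2] below 1 at z + mfc, which is what
    [key_bound] contradicts near the support. *)
Lemma kernel_sqr_mfc lam z : 0 < complex.Im z ->
  complex.Im (z + mfc mu lam z) * (1 - S2 lam (z + mfc mu lam z)) = complex.Im z.
Proof.
move=> z0; have [m0 hm] := mfcP lam z0.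
have zm : 0 < complex.Im (z + mfc mu lam z) by rewrite ImD addr_gt0.
rewrite mulrBr mulr1 -Im_stieltjes// -hm ImD; ring.
Qed.

Lemma modulus_mfc_le1 lam z : 0 < complex.Im z -> modulus (mfc mu lam z) <= 1.
Proof.
move=> z0; have [m0 hm] := mfcP lam z0.
have zm : 0 < complex.Im (z + mfc mu lam z) by rewrite ImD addr_gt0.
have h := kernel_sqr_mfc lam z0.
have S1 : S2 lam (z + mfc mu lam z) <= 1.
  by rewrite -subr_ge0 -(pmulr_rge0 _ zm) h ltW.
by rewrite hm (le_trans (modulus_stieltjes_sqr lam zm))//; lra.
Qed.

End Stieltjes.

(** * Stability of the self-consistent equation *)

Section Stability.
Context {R : realType} (mu : probability (measurableTypeR R) R).
Hypothesis hsupp : mu (~` [set v : R | -1 <= v <= 1]) = 0%E.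
Implicit Types (lam v : R) (z u w : R[i]).
Local Notation q := cauchy_kernel.
Local Notation g := (stieltjes mu).
Local Notation S2 := (kernel_sqr mu).
Local Notation T := (kernel_prod mu).

(* The inverse of the subordination map [z |-> z + mfc z]. *)
Definition subord_inv lam z : R[i] := z - g lam z.
Local Notation F := subord_inv.

Lemma modulus_cintegral_supp (f : R -> R[i]) (h : R -> R) :
  cbounded (f : measurableTypeR R -> R[i]) -> rbounded (h : measurableTypeR R -> R) ->
  (forall v, -1 <= v <= 1 -> modulus (f v) <= h v) ->
  modulus (cintegral mu f) <= \int[mu]_v h v.
Proof.
move=> hf hh hle; apply: (le_trans (modulus_cintegral mu hf)).
by apply: (le_Rint_supp hsupp) => //; exact: cbounded_modulus.
Qed.

(* Wherever [kernel_sqr <= 1], which is the case at [z + mfc z], this bound keeps [z] at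
   distance of order [c] from [lam] times the support. *)
Definition key_bound (lam0 c : R) := forall lam z, 0 < lam <= lam0 ->
  0 < complex.Im z <= c -> `|complex.Re z| <= lam + c -> 1 < S2 lam z.

Definition off_support c lam z := forall v, -1 <= v <= 1 -> c <= modulus ((lam * v)%:C - z).

Variables (lam0 c B : R).
Hypotheses (lam0_gt0 : 0 < lam0) (c_gt0 : 0 < c) (c_le1 : c <= 1) (B_ge0 : 0 <= B).
Hypothesis hkey : key_bound lam0 c.

(** An upper bound for |lam v - z| when |v| <= 1, |Re z| <= B and Im z <= 2, so that 1 / D bounds
    the kernel from below. *)
Let D := lam0 + B + 2.
Let D_ge2 : 2 <= D. Proof. by rewrite /D; have := lam0_gt0; have := B_ge0; lra. Qed.
Let D_gt0 : 0 < D. Proof. exact: lt_le_trans D_ge2. Qed.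

Section Point.
Variables (lam : R) (z : R[i]).
Hypotheses (hlam : 0 < lam <= lam0) (z_gt0 : 0 < complex.Im z).
Hypotheses (hS : S2 lam z <= 1) (hRe : `|complex.Re z| <= B).
Local Notation y := (complex.Im z).
Local Notation p := (q lam z).

Lemma far_from_support : y <= c -> lam + c < `|complex.Re z|.
Proof.
move=> yc; rewrite ltNge; apply/negP => h.
by have := hkey hlam _ h; rewrite z_gt0 yc => /(_ isT); rewrite ltNge hS.
Qed.

Let lamv v : -1 <= v <= 1 -> `|lam * v| <= lam.
Proof.
move=> hv; rewrite normrM gtr0_norm; last by case/andP: hlam.
by rewrite ler_piMr ?ler_norml// ltW//; case/andP: hlam.
Qed.

Lemma off_support_key : off_support c lam z.
Proof.
move=> v hv; have [yc|cy] := leP y c; last first.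
  by rewrite (le_trans (ltW cy))// kernel_den_ge.
rewrite (le_trans _ (Re_le_modulus _))// Re_kernel_den distrC (le_trans _ (lerB_dist _ _))//.
by have := far_from_support yc; have := lamv hv; lra.
Qed.

Lemma kernel_le_key v : -1 <= v <= 1 -> modulus (p v) <= c^-1.
Proof.
move=> hv; have h := off_support_key hv.
by rewrite /q modulusV lef_pV2 ?posrE// (lt_le_trans c_gt0).
Qed.

Lemma kernel_ge_key v : y <= 2 -> -1 <= v <= 1 -> D^-1 <= modulus (p v).
Proof.
move=> y2 hv; rewrite (le_trans _ (modulus_kernel_ge lam z_gt0 hv))//.
rewrite lef_pV2 ?posrE//; last first.
  by rewrite ltr_wpDl// modulus_gt0; apply: contraTneq z_gt0 => ->; rewrite ltxx.
have := modulus_le_ReIm z; rewrite (gtr0_norm z_gt0) /D.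
by case/andP: hlam => l0 l1; rewrite (gtr0_norm l0); have := hRe; lra.
Qed.

Lemma kernel_pow_ge n v : y <= 2 -> -1 <= v <= 1 -> D ^- n <= modulus (p v) ^+ n.
Proof.
move=> y2 hv; rewrite -exprVn; apply: lerXn2r; rewrite ?nnegrE ?modulus_ge0//.
  by rewrite invr_ge0 ltW.
exact: kernel_ge_key.
Qed.

Let rb_pow n : rbounded (fun v => modulus (p v) ^+ n : R).
Proof.
elim: n => [|n ih].
  by under eq_fun do rewrite expr0; exact: rbounded_cst.
under eq_fun do rewrite exprS.
by apply: rboundedM => //; apply: cbounded_modulus; exact: cbounded_kernel.
Qed.

(** Pointwise |p|^2 - Re p^2 = 2 (Im p)^2, and Im p = y |p|^2. *)
Lemma Re_one_sub_prod :
  complex.Re (1 - T lam z lam z) = 1 - S2 lam z + 2 * y ^+ 2 * \int[mu]_v modulus (p v) ^+ 4.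
Proof.
rewrite ReD ReN /= -RintZ//; last exact: rb_pow.
have -> : \int[mu]_t complex.Re (p t * p t)
  = S2 lam z - \int[mu]_v (2 * y ^+ 2 * modulus (p v) ^+ 4).
  rewrite -RintB; [|exact: rb_pow|by apply: rboundedM; [exact: rbounded_cst|exact: rb_pow]].
  congr Rintegral; apply/funext => v.
  have := Im_kernel lam z v; have := sqr_modulus (p v); rewrite ReM.
  set A := complex.Re _; set C := complex.Im _; set P := modulus _ => h1 h2.
  have -> : P ^+ 4 = P ^+ 2 * P ^+ 2 by ring.
  have -> : 2 * y ^+ 2 * (P ^+ 2 * P ^+ 2) = 2 * C ^+ 2 by rewrite h2; ring.
  by rewrite h1; ring.
ring.
Qed.

Lemma Re_one_sub_prod_ge : 1 - S2 lam z <= complex.Re (1 - T lam z lam z).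
Proof.
rewrite Re_one_sub_prod lerDl mulr_ge0//; first by rewrite mulr_ge0// sqr_ge0.
by apply: Rintegral_ge0 => v _; rewrite exprn_ge0 ?modulus_ge0.
Qed.

Lemma Im_prod : complex.Im (T lam z lam z) =
  2 * y * \int[mu]_v ((lam * v - complex.Re z) * modulus (p v) ^+ 4).
Proof.
rewrite /= -RintZ; last first.
  have -> : (fun v => (lam * v - complex.Re z) * modulus (p v) ^+ 4) =
            (fun v => complex.Re (p v) * modulus (p v) ^+ 2).
    by apply/funext => v; rewrite Re_kernel; ring.
  by apply: rboundedM; [apply: cbounded_Re; exact: cbounded_kernel|exact: (rb_pow 2)].
congr Rintegral; apply/funext => v; rewrite ImM.
by rewrite Im_kernel Re_kernel; ring.
Qed.

Definition stab_const := c * D ^- 4.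

Lemma stab_const_gt0 : 0 < stab_const.
Proof. by rewrite mulr_gt0// invr_gt0 exprn_gt0. Qed.

Lemma invD4 : D ^- 4 <= 16^-1.
Proof.
rewrite lef_pV2 ?posrE ?exprn_gt0//; have := D_ge2.
have -> : D ^+ 4 = (D ^+ 2) ^+ 2 by ring.
have := sqr_ge0 (D - 2); nra.
Qed.

Lemma stab_const_le : stab_const <= 16^-1.
Proof.
rewrite /stab_const; have := invD4; have i0 : 0 <= D ^- 4 by rewrite invr_ge0 exprn_ge0// ltW.
by have := c_le1; have := c_gt0; nra.
Qed.

(** At such heights Re z lies outside lam times the support by at least [c], so lam v - Re z keeps
    one sign and nothing cancels in [Im_prod]. The two factors of [stab_const] bound |lam v - Re z|
    and |p|^4. *)
Lemma Im_prod_ge : y <= c -> 2 * y * stab_const <= `|complex.Im (T lam z lam z)|.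
Proof.
move=> yc; have hfar := far_from_support yc.
have y2 : y <= 2 by have := c_le1; lra.
pose h v := (lam * v - complex.Re z) * modulus (p v) ^+ 4.
have hh : rbounded (h : measurableTypeR R -> R).
  have -> : h = (fun v => complex.Re (p v) * modulus (p v) ^+ 2).
    by apply/funext => v; rewrite Re_kernel /h; ring.
  by apply: rboundedM; [apply: cbounded_Re; exact: cbounded_kernel|exact: (rb_pow 2)].
rewrite Im_prod normrM (ger0_norm (x := 2 * y)); last by rewrite mulr_ge0// ltW.
rewrite ler_wpM2l//; first by rewrite mulr_ge0// ltW.
have hp v : -1 <= v <= 1 -> D ^- 4 <= modulus (p v) ^+ 4 by exact: kernel_pow_ge.
have D4 : 0 < D ^- 4 by rewrite invr_gt0 exprn_gt0.
have [x0|x0] := leP 0 (complex.Re z).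
  rewrite -normrN (le_trans _ (ler_norm _))// -RintN//.
  rewrite -[leLHS](Rint_cst mu); apply: (le_Rint_supp hsupp).
  - exact: rbounded_cst.
  - exact: rboundedN.
  move=> v hv; rewrite /h /stab_const -mulNr; apply: ler_pM; [exact: ltW|exact: ltW| |exact: hp].
  by have := lamv hv; move: hfar; rewrite (ger0_norm x0) ler_norml => h1 /andP[h2 h3]; lra.
rewrite (le_trans _ (ler_norm _))//.
rewrite -[leLHS](Rint_cst mu); apply: (le_Rint_supp hsupp) => //.
- exact: rbounded_cst.
move=> v hv; rewrite /h /stab_const; apply: ler_pM; [exact: ltW|exact: ltW| |exact: hp].
by have := lamv hv; move: hfar; rewrite (ltr0_norm x0) ler_norml => h1 /andP[h2 h3]; lra.
Qed.

(* Up to constants the distance of [kernel_prod lam z lam z] from 1; it degenerates at the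
   edges of the spectrum. *)
Definition stab_beta := 1 - S2 lam z + Num.min 1 y.

Lemma stab_beta_gt0 : 0 < stab_beta.
Proof. by rewrite /stab_beta ltr_wpDl ?subr_ge0// lt_min z_gt0 ltr01. Qed.

Lemma stab_beta_le2 : stab_beta <= 2.
Proof.
rewrite /stab_beta; have := kernel_sqr_ge0 mu lam z.
have : Num.min 1 y <= 1 by rewrite ge_min lexx.
lra.
Qed.

(** Three ranges of height. Above 2 the kernel is small and the real part is at least 3/4. For y <=
    c the real part supplies 1 - S2 and the imaginary part supplies y. In between, the quartic term
    of [Re_one_sub_prod] is bounded below. *)
Lemma one_sub_prod_ge : stab_const * stab_beta <= modulus (1 - T lam z lam z).
Proof.
have S1 : 0 <= 1 - S2 lam z by rewrite subr_ge0.
have hRe1 := Re_one_sub_prod_ge.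
have hm := le_trans (ler_norm _) (Re_le_modulus (1 - T lam z lam z)).
have a16 := stab_const_le; have a0 := stab_const_gt0.
have m1 : Num.min 1 y <= 1 by rewrite ge_min lexx.
have m2 : Num.min 1 y <= y by rewrite ge_min lexx orbT.
have m0 : 0 < Num.min 1 y by rewrite lt_min z_gt0 ltr01.
rewrite /stab_beta.
have [y2|y2] := leP y 2; last first.
  have : S2 lam z <= 4^-1.
    rewrite -[leRHS](Rint_cst mu); apply: le_Rint; [exact: rb_pow|exact: rbounded_cst|].
    move=> v; have := modulus_kernel lam v z_gt0.
    have : y^-1 <= 2^-1 by rewrite lef_pV2 ?posrE// ltW.
    have := modulus_ge0 (p v); nra.
  nra.
have [yc|cy] := leP y c.
  have := Im_prod_ge yc; have := Im_le_modulus (1 - T lam z lam z).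
  rewrite ImD ImN [complex.Im 1]/= sub0r normrN => h1 h2.
  have : 2 * y * stab_const <= modulus (1 - T lam z lam z) by exact: le_trans h2 h1.
  nra.
have h4 : D ^- 4 <= \int[mu]_v modulus (p v) ^+ 4.
  rewrite -[leLHS](Rint_cst mu); apply: (le_Rint_supp hsupp).
  - exact: rbounded_cst.
  - exact: rb_pow.
  by move=> v; exact: kernel_pow_ge.
have h5 := Re_one_sub_prod.
have D4 : 0 < D ^- 4 by rewrite invr_gt0 exprn_gt0.
have h6 : 2 * y ^+ 2 * D ^- 4 <= 2 * y ^+ 2 * \int[mu]_v modulus (p v) ^+ 4.
  by rewrite ler_wpM2l// mulr_ge0// sqr_ge0.
have h7 : y * stab_const <= y ^+ 2 * D ^- 4.
  rewrite /stab_const mulrA; apply: ler_wpM2r; first exact: ltW.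
  by rewrite expr2; apply: ler_wpM2l; exact: ltW.
nra.
Qed.

(** Write 1 - T as (1 - S2) plus the integral of p (conj p - p), and use |conj p - p| = 2 y |p|^2
    with |p| <= 1 / c on the support. *)
Lemma one_sub_prod_le : modulus (1 - T lam z lam z) <= 1 - S2 lam z + 2 / c * y.
Proof.
have hb : cbounded p by exact: cbounded_kernel.
have -> : 1 - T lam z lam z =
   (1 - S2 lam z)%:C + cintegral mu (fun v => p v * (conjc (p v) - p v)).
  have hc : cbounded (fun v : measurableTypeR R => (conjc (p v))).
    split; first by apply: cmeasurable_conjc; case: hb.
    by case: hb => _ [K hK]; exists K => v; rewrite modulus_conjc.
  have -> : cintegral mu (fun v => p v * (conjc (p v) - p v)) =
            (S2 lam z)%:C - T lam z lam z.
    rewrite -cintegral_real -cintegralB; last exact: cboundedM.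
      by apply: cintegral_ext => v; rewrite mulrBr mul_conjc_modulus.
    exact/cbounded_real/cbounded_sqr.
  by rewrite rmorphB /= ; ring.
rewrite (le_trans (modulusD _ _))// modulus_real ger0_norm ?subr_ge0// lerD2l.
have hf : cbounded (fun v : measurableTypeR R => p v * (conjc (p v) - p v)).
  apply: cboundedM => //; apply: cboundedB => //; split; first by apply: cmeasurable_conjc; case: hb.
  by case: hb => _ [K hK]; exists K => v; rewrite modulus_conjc.
have e v : modulus (p v * (conjc (p v) - p v)) = modulus (p v) * (2 * (y * modulus (p v) ^+ 2)).
  rewrite modulusM -Im_kernel; congr (_ * _).
  have I0 : 0 <= complex.Im (p v) by rewrite Im_kernel mulr_ge0 ?sqr_ge0// ltW.
  apply/eqP; rewrite -(@eqrXn2 _ 2) ?modulus_ge0 ?mulr_ge0// sqr_modulus.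
  by rewrite ReD ReN ImD ImN Re_conjc Im_conjc; apply/eqP; ring.
apply: (le_trans (modulus_cintegral_supp hf (h := fun v => 2 / c * y * modulus (p v) ^+ 2) _ _)).
- by apply: rboundedM; [exact: rbounded_cst|exact: rb_pow].
- move=> v hv; rewrite e; have := kernel_le_key hv.
  have : 0 <= 2 * (y * modulus (p v) ^+ 2) by rewrite mulr_ge0// mulr_ge0 ?sqr_ge0// ltW.
  set A := 2 * _ => A0 h.
  rewrite (_ : 2 / c * y * modulus (p v) ^+ 2 = c^-1 * A); first by rewrite ler_wpM2r.
  by rewrite /A; ring.
rewrite RintZ; last exact: rb_pow.
rewrite -[leRHS]mulr1 ler_wpM2l// mulr_ge0 ?divr_ge0// ltW//.
Qed.

Definition cubic_const := c ^+ 3 / 4 * D ^- 6.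

Lemma cubic_const_gt0 : 0 < cubic_const.
Proof. by rewrite /cubic_const !mulr_gt0 ?invr_gt0 ?exprn_gt0. Qed.

(* Coefficient of the quadratic term in the expansion of [subord_inv] at an edge, where the
   linear coefficient [1 - kernel_prod] vanishes. *)
Definition kernel_cube := cintegral mu (fun v => p v * (p v * p v)).

(** With d = lam v - Re z one has Re p^3 = d (d^2 - 3 y^2) |p|^6. Since |d| >= c and y <= c / 2, the
    middle factor is at least c^2 / 4, and d keeps one sign on the support. *)
Lemma kernel_cube_ge : y <= c / 2 -> cubic_const <= modulus kernel_cube.
Proof.
move=> yc2; have yc : y <= c by have := c_gt0; lra.
have hfar := far_from_support yc.
have y2 : y <= 2 by have := c_le1; lra.
have hb : cbounded (fun v => p v * (p v * p v)).
  by do 2?apply: cboundedM; exact: cbounded_kernel.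
rewrite (le_trans _ (Re_le_modulus _))//.
have e v : complex.Re (p v * (p v * p v)) =
   (lam * v - complex.Re z) * ((lam * v - complex.Re z) ^+ 2 - 3 * y ^+ 2) * modulus (p v) ^+ 6.
  by rewrite !ReM ImM Re_kernel Im_kernel; ring.
have hp v : -1 <= v <= 1 -> D ^- 6 <= modulus (p v) ^+ 6 by exact: kernel_pow_ge.
have D6 : 0 < D ^- 6 by rewrite invr_gt0 exprn_gt0.
have key (d : R) : c <= d -> c ^+ 3 / 4 <= d * (d ^+ 2 - 3 * y ^+ 2).
  move=> cd; have cd2 : c ^+ 2 <= d ^+ 2 by have := c_gt0; nra.
  have yc4 : y ^+ 2 <= c ^+ 2 / 4 by have := z_gt0; have := c_gt0; nra.
  have : c ^+ 2 / 4 <= d ^+ 2 - 3 * y ^+ 2 by lra.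
  have -> : c ^+ 3 / 4 = c * (c ^+ 2 / 4) by ring.
  by move=> h; apply: ler_pM => //; rewrite ?divr_ge0 ?sqr_ge0// ltW.
have [x0|x0] := leP 0 (complex.Re z).
  rewrite -normrN (le_trans _ (ler_norm _))// Re_cintegral -RintN; last exact: cbounded_Re.
  rewrite -[leLHS](Rint_cst mu); apply: (le_Rint_supp hsupp).
  - exact: rbounded_cst.
  - by apply: rboundedN; exact: cbounded_Re.
  move=> v hv; rewrite e /cubic_const -mulNr; apply: ler_pM; [|exact: ltW| |exact: hp].
    by rewrite divr_ge0// exprn_ge0// ltW.
  rewrite (_ : - (_ * _) = (complex.Re z - lam * v) * ((complex.Re z - lam * v) ^+ 2 - 3 * y ^+ 2)); last ring.
  apply: key.
  by have := lamv hv; move: hfar; rewrite (ger0_norm x0) ler_norml => h1 /andP[h2 h3]; lra.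
rewrite (le_trans _ (ler_norm _))// Re_cintegral.
rewrite -[leLHS](Rint_cst mu); apply: (le_Rint_supp hsupp).
- exact: rbounded_cst.
- exact: cbounded_Re.
move=> v hv; rewrite e /cubic_const; apply: ler_pM; [|exact: ltW| |exact: hp].
  by rewrite divr_ge0// exprn_ge0// ltW.
apply: key.
by have := lamv hv; move: hfar; rewrite (ltr0_norm x0) ler_norml => h1 /andP[h2 h3]; lra.
Qed.

Section Neighbour.
Variable w : R[i].
Hypotheses (w_gt0 : 0 < complex.Im w) (hw : modulus (w - z) <= c / 2).

Lemma off_support_near : off_support (c / 2) lam w.
Proof.
move=> v hv; have := off_support_key hv.
have := modulus_dist_trans w (lam * v)%:C z; have := hw; lra.
Qed.

Lemma kernel_le_near v : -1 <= v <= 1 -> modulus (q lam w v) <= 2 / c.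
Proof.
move=> hv; have h := off_support_near hv; have c2 : 0 < c / 2 by rewrite divr_gt0.
by rewrite -invf_div /q modulusV lef_pV2 ?posrE// (lt_le_trans c2).
Qed.

Lemma subord_invB : F lam w - F lam z = (w - z) * (1 - T lam w lam z).
Proof. by rewrite /F mulrBr mulr1 -stieltjesB//; ring. Qed.

(** Together with [subord_invB] and [kernel_cubeB] this is an exact expansion in u = w - z: divided
    differences of the kernel replace Taylor's formula, so the remainder is itself an integral of
    kernels. *)
Lemma kernel_prodB : T lam w lam z - T lam z lam z =
  (w - z) * cintegral mu (fun v => q lam w v * (p v * p v)).
Proof.
have bp := cbounded_kernel lam z_gt0; have bw := cbounded_kernel lam w_gt0.
rewrite -cintegralB; [|exact: cboundedM..].
rewrite -cintegralZ; last by do 2?apply: cboundedM.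
apply: cintegral_ext => v; rewrite -mulrBl kernelB ?gt_eqF// subrr mul0r addr0; ring.
Qed.

Lemma kernel_cubeB : cintegral mu (fun v => q lam w v * (p v * p v)) - kernel_cube =
  (w - z) * cintegral mu (fun v => q lam w v * p v * (p v * p v)).
Proof.
have bp := cbounded_kernel lam z_gt0; have bw := cbounded_kernel lam w_gt0.
rewrite -cintegralB; [|by do 2?apply: cboundedM..].
rewrite -cintegralZ; last by do 3?apply: cboundedM.
apply: cintegral_ext => v; rewrite -mulrBl kernelB ?gt_eqF// subrr mul0r addr0; ring.
Qed.

Lemma kernel_near_sqr_le : modulus (cintegral mu (fun v => q lam w v * (p v * p v))) <= 2 / c.
Proof.
have bp := cbounded_kernel lam z_gt0; have bw := cbounded_kernel lam w_gt0.
apply: (le_trans (modulus_cintegral_supp (h := fun v => 2 / c * modulus (p v) ^+ 2) _ _ _)).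
- by do 2?apply: cboundedM.
- by apply: rboundedM; [exact: rbounded_cst|exact: rb_pow].
- move=> v hv; rewrite !modulusM -expr2 ler_wpM2r ?sqr_ge0//; exact: kernel_le_near.
rewrite RintZ; last exact: rb_pow.
by rewrite ler_piMr// divr_ge0// ltW.
Qed.

Lemma kernel_near_cube_le :
  modulus (cintegral mu (fun v => q lam w v * p v * (p v * p v))) <= 2 / c ^+ 2.
Proof.
have bp := cbounded_kernel lam z_gt0; have bw := cbounded_kernel lam w_gt0.
have h0 : 0 <= 2 / c * c^-1 by rewrite mulr_ge0 ?divr_ge0 ?invr_ge0 ?ltW.
apply: (le_trans (modulus_cintegral_supp (h := fun v => 2 / c * c^-1 * modulus (p v) ^+ 2) _ _ _)).
- by do 3?apply: cboundedM.
- by apply: rboundedM; [exact: rbounded_cst|exact: rb_pow].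
- move=> v hv; rewrite !modulusM -expr2 ler_wpM2r ?sqr_ge0//.
  by apply: ler_pM; rewrite ?modulus_ge0 ?kernel_le_near ?kernel_le_key.
rewrite RintZ; last exact: rb_pow.
by rewrite (_ : 2 / c ^+ 2 = 2 / c * c^-1) ?ler_piMr// expr2 invfM mulrA.
Qed.

(** In this radius the second-order contribution, at most |u| (2 / c), eats no more than half of the
    linear coefficient. *)
Lemma stable_regime : modulus (w - z) <= stab_const * c / 4 * stab_beta ->
  modulus (w - z) * (stab_const * stab_beta / 2) <= modulus (F lam w - F lam z).
Proof.
move=> hu; rewrite subord_invB modulusM ler_wpM2l ?modulus_ge0//.
have h1 := one_sub_prod_ge.
have h2 : modulus (T lam w lam z - T lam z lam z) <= stab_const * stab_beta / 2.
  rewrite kernel_prodB modulusM.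
  have := ler_pM (modulus_ge0 _) (modulus_ge0 _) hu kernel_near_sqr_le.
  move=> /le_trans; apply.
  rewrite (_ : stab_const * c / 4 * stab_beta * (2 / c) = stab_const * stab_beta / 2)//.
  by field; rewrite gt_eqF.
have := modulus_lerB (1 - T lam z lam z) (T lam w lam z - T lam z lam z).
rewrite (_ : 1 - T lam z lam z - (T lam w lam z - T lam z lam z) = 1 - T lam w lam z); last ring.
by lra.
Qed.

(** The opposite regime: the quadratic coefficient stays within half of [kernel_cube], and the
    linear one is a perturbation of order beta. The bound is useful once |u| exceeds a multiple of
    beta. *)
Lemma edge_regime : y <= c / 2 -> modulus (w - z) <= cubic_const * c ^+ 2 / 4 ->
  modulus (w - z) * (modulus (w - z) * (cubic_const / 2) - 2 / c * stab_beta)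
    <= modulus (F lam w - F lam z).
Proof.
move=> yc hu; rewrite subord_invB modulusM ler_wpM2l ?modulus_ge0//.
set P3 := cintegral mu (fun v => q lam w v * (p v * p v)).
have h3 : cubic_const / 2 <= modulus P3.
  have h := modulus_lerB kernel_cube (kernel_cube - P3).
  rewrite (_ : kernel_cube - (kernel_cube - P3) = P3) in h; last ring.
  have h4 : modulus (kernel_cube - P3) <= cubic_const / 2.
    rewrite modulusC kernel_cubeB modulusM.
    have := ler_pM (modulus_ge0 _) (modulus_ge0 _) hu kernel_near_cube_le.
    move=> /le_trans; apply.
    rewrite (_ : cubic_const * c ^+ 2 / 4 * (2 / c ^+ 2) = cubic_const / 2)//.
    by field; rewrite gt_eqF.
  have := kernel_cube_ge yc; lra.
have h5 : modulus (1 - T lam z lam z) <= 2 / c * stab_beta.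
  apply: (le_trans one_sub_prod_le); rewrite /stab_beta.
  have -> : Num.min 1 y = y by apply/min_idPr; have := c_le1; lra.
  rewrite mulrDr lerD2r ler_peMl ?subr_ge0//.
  by rewrite ler_pdivlMr// mul1r; have := c_le1; lra.
have := modulus_lerB (T lam w lam z - T lam z lam z) (1 - T lam z lam z).
rewrite modulusC (_ : 1 - T lam z lam z - (T lam w lam z - T lam z lam z) = 1 - T lam w lam z); last ring.
rewrite kernel_prodB modulusM -/P3.
have : modulus (w - z) * (cubic_const / 2) <= modulus (w - z) * modulus P3.
  by rewrite ler_wpM2l ?modulus_ge0.
lra.
Qed.

End Neighbour.
End Point.
End Stability.

(** Descend from [T0] in steps of length k / K: the variation of [f] over one step is at most [k],
    exactly the margin that the self-improvement provides. *)
Lemma continuity_induction {R : realType} (f : R -> R) (T0 K k : R) : 0 < K -> 0 < k ->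
  f T0 <= 0 -> (forall t : R, 0 <= t <= T0 -> f t <= 0 -> f t <= - k) ->
  (forall s t : R, 0 <= s <= T0 -> 0 <= t <= T0 -> `|f s - f t| <= K * `|s - t|) ->
  forall t : R, 0 <= t <= T0 -> f t <= 0.
Proof.
move=> K0 k0 f0 step lip.
have key n (t : R) : 0 <= t <= T0 -> T0 - t <= n%:R * (k / K) -> f t <= 0.
  elim: n t => [|n ih] t /andP[t0 tT].
    rewrite mul0r subr_le0 => Tt; suff -> : t = T0 by [].
    by apply/eqP; rewrite eq_le tT Tt.
  move=> h; have kK : 0 < k / K by rewrite divr_gt0.
  pose s := Num.min T0 (t + k / K).
  have st : 0 <= s - t <= k / K.
    rewrite /s; case: (leP T0 (t + k / K)) => h1; apply/andP; split; lra.
  have hs : 0 <= s <= T0.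
    apply/andP; split; first by case/andP: st; lra.
    by rewrite /s ge_min lexx.
  have sn : T0 - s <= n%:R * (k / K).
    rewrite /s; case: (leP T0 (t + k / K)) => h1; first by rewrite subrr mulr_ge0// ltW.
    by move: h; rewrite -natr1 mulrDl mul1r; lra.
  have fs := step s hs (ih s hs sn).
  have := lip s t hs; rewrite t0 tT => /(_ isT).
  have [st0 stk] := andP st; rewrite (ger0_norm st0) ler_norml => /andP[h1 h2].
  have : K * (s - t) <= k by rewrite mulrC -ler_pdivlMr.
  lra.
move=> t ht; pose n := (Num.truncn ((T0 - t) / (k / K))).+1.
apply: (key n) => //; rewrite -ler_pdivrMr ?divr_gt0//.
by apply/ltW; rewrite /n; apply: truncnS_gt.
Qed.

Lemma min_lip {R : realType} (a b c : R) : `|Num.min a b - Num.min a c| <= `|b - c|.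
Proof.
by case: (leP a b) => h1; case: (leP a c) => h2; rewrite ?subrr ?normr0//;
  rewrite !ler_norml; have := ler_norm (b - c); have := ler_norm (- (b - c)); rewrite normrN;
  move=> ? ?; apply/andP; split; lra.
Qed.

(** * The continuity argument along a vertical path *)

Section Path.
Context {R : realType} (mu : probability (measurableTypeR R) R).
Hypothesis hsupp : mu (~` [set v : R | -1 <= v <= 1]) = 0%E.
Implicit Types (lam v t s r y : R) (z u w : R[i]).
Local Notation q := cauchy_kernel.
Local Notation g := (stieltjes mu).
Local Notation S2 := (kernel_sqr mu).
Local Notation F := (subord_inv mu).
Local Notation beta := (stab_beta mu).

Lemma stieltjes_lip lam z u y : 0 < y -> y <= complex.Im z -> y <= complex.Im u ->
  modulus (g lam z - g lam u) <= y ^- 2 * modulus (z - u).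
Proof.
move=> y0 yz yu; have z0 := lt_le_trans y0 yz; have u0 := lt_le_trans y0 yu.
rewrite stieltjesB// modulusM mulrC ler_wpM2r ?modulus_ge0//.
apply: (le_trans (modulus_kernel_prod_inv mu _ _ z0 u0)).
rewrite expr2 invfM; apply: ler_pM; [by rewrite invr_ge0 ltW|by rewrite invr_ge0 ltW|by rewrite lef_pV2|by rewrite lef_pV2].
Qed.

Lemma kernel_sqr_lip lam z u y : 0 < y -> y <= complex.Im z -> y <= complex.Im u ->
  `|S2 lam z - S2 lam u| <= 2 * y ^- 3 * modulus (z - u).
Proof.
move=> y0 yz yu; have z0 := lt_le_trans y0 yz; have u0 := lt_le_trans y0 yu.
have y3 : 0 <= 2 * y ^- 3 * modulus (z - u).
  by rewrite !mulr_ge0 ?modulus_ge0// invr_ge0 exprn_ge0// ltW.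
have pt v : `|modulus (q lam z v) ^+ 2 - modulus (q lam u v) ^+ 2| <= 2 * y ^- 3 * modulus (z - u).
  set a := modulus (q lam z v); set b := modulus (q lam u v).
  have a0 : 0 <= a by exact: modulus_ge0.
  have b0 : 0 <= b by exact: modulus_ge0.
  have ay : a <= y^-1 by rewrite (le_trans (modulus_kernel _ _ z0))// lef_pV2.
  have bY : b <= y^-1 by rewrite (le_trans (modulus_kernel _ _ u0))// lef_pV2.
  have iy : 0 < y^-1 by rewrite invr_gt0.
  have ab : `|a - b| <= y^-1 * y^-1 * modulus (z - u).
    have h : `|a - b| <= modulus (q lam z v - q lam u v).
      rewrite ler_norml; have := modulus_lerB (q lam z v) (q lam u v).
      have := modulus_lerB (q lam u v) (q lam z v); rewrite modulusC -/a -/b => h1 h2.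
      by apply/andP; split; lra.
    apply: (le_trans h); rewrite kernelB ?gt_eqF// subrr mul0r addr0 modulusM mulrC.
    by rewrite ler_wpM2r ?modulus_ge0// modulusM; apply: ler_pM.
  rewrite subr_sqr normrM (ger0_norm (addr_ge0 a0 b0)).
  have -> : 2 * y ^- 3 * modulus (z - u) = y^-1 * y^-1 * modulus (z - u) * (y^-1 + y^-1).
    by field; rewrite gt_eqF.
  by apply: ler_pM => //; [exact: addr_ge0|exact: lerD].
have bz := rbounded_kernel_sqr lam z0; have bu := rbounded_kernel_sqr lam u0.
rewrite -RintB// ler_norml; apply/andP; split.
  rewrite -[leLHS](Rint_cst mu); apply: le_Rint; [exact: rbounded_cst|exact: rboundedB|].
  by move=> v; have := pt v; rewrite ler_norml => /andP[].
rewrite -[leRHS](Rint_cst mu); apply: le_Rint; [exact: rboundedB|exact: rbounded_cst|].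
by move=> v; have := pt v; rewrite ler_norml => /andP[].
Qed.

Variables (lam0 c B Y : R).
Hypotheses (lam0_gt0 : 0 < lam0) (c_gt0 : 0 < c) (c_le1 : c <= 1) (B_ge0 : 0 <= B) (Y_ge0 : 0 <= Y).
Hypothesis hkey : key_bound mu lam0 c.

Let a := stab_const lam0 c B.
Let b := cubic_const lam0 c B.
Let c2 := a * c / 4.
Let c0 := Num.min (c / 2) (b * c ^+ 2 / 4).
Let T0 := Num.max 2 (Num.max (3 / c2) (3 / c0)).

Let a_gt0 : 0 < a. Proof. exact: stab_const_gt0. Qed.
Let b_gt0 : 0 < b. Proof. exact: cubic_const_gt0. Qed.
Let c2_gt0 : 0 < c2. Proof. by rewrite /c2 divr_gt0// mulr_gt0. Qed.
Let c0_gt0 : 0 < c0. Proof. by rewrite lt_min !divr_gt0// mulr_gt0// exprn_gt0. Qed.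
Let T0_ge2 : 2 <= T0. Proof. by rewrite le_max lexx. Qed.

Definition path_length : R := T0.

Section OnePath.
Variables (lam : R) (z : R[i]) (m : R[i] -> R[i]) (om : R[i] -> R) (M Cr : R).
Hypotheses (hlam : 0 < lam <= lam0) (z_gt0 : 0 < complex.Im z) (z_leY : complex.Im z <= Y).
Let zs := z + mfc mu lam z.
Hypothesis hRe : `|complex.Re zs| <= B.
Let eta := complex.Im z.
Hypothesis m_lip : forall w w', eta <= complex.Im w -> eta <= complex.Im w' ->
  modulus (m w - m w') <= M * modulus (w - w').
Hypothesis m_im : forall w, eta <= complex.Im w -> 0 <= complex.Im (m w).
Hypothesis m_le : forall w, eta <= complex.Im w -> modulus (m w) <= (complex.Im w)^-1.
Hypothesis om_gt0 : forall w, eta <= complex.Im w -> 0 < om w.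
Hypothesis om_mono : forall w w', eta <= complex.Im w -> complex.Im w <= complex.Im w' -> om w' <= om w.
Hypothesis Cr_gt0 : 0 < Cr.
Hypothesis M_ge0 : 0 <= M.
(** The approximate equation is granted only where w + m w is off the support. This premise is
    recovered at each point of the path from the smallness of the gap. *)
Hypothesis approx : forall w, eta <= complex.Im w -> `|complex.Re w| <= B + 1 ->
  complex.Im w <= Y + 1 + T0 -> off_support (c / 2) lam (w + m w) ->
  modulus (F lam (w + m w) - w) ^+ 2 <= Cr * om w ^+ 3 * (complex.Im (w + m w) + om w).

(** [D1] bounds the heights on the path, and [A1] is the constant in |u|^2 beta <= A1 omega^3. [K]
    separates the regimes: beta >= K omega is called stable, and K is large enough for A1 omega^3 to
    be at most (c2 beta / 2)^2 beta there. *)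
Let D1 := Y + 1 + T0.
Let A1 := 4 * Cr * (D1 + 3) / a ^+ 2.
Definition path_K := 4 * A1 / c2 ^+ 2 + 1.
Let K := path_K.
Let A2 := 16 * Cr * (K + 2) / b ^+ 2.
(** A sum of the constants of all cases: stable regime, gap dominated by beta, and dominating
    quadratic term. The threshold [path_om0] then keeps K omega below c / 4, so that the edge regime
    occurs at small heights only, and path_C omega below c0 / 2. *)
Definition path_C := A1 + 1 + (8 * K / (b * c) + (A2 + 2)).
Definition path_om0 := Num.min (c / 2 / K / 2) (c0 / 2 / path_C).
Hypothesis om_small : om z <= path_om0.

Let D1_gt0 : 0 < D1. Proof. by rewrite /D1; have := T0_ge2; have := Y_ge0; lra. Qed.
Let A1_gt0 : 0 < A1. Proof. by rewrite /A1 divr_gt0 ?exprn_gt0// !mulr_gt0//; have := D1_gt0; lra. Qed.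
Let K_ge1 : 1 <= K.
Proof. by rewrite /K /path_K lerDr divr_ge0 ?sqr_ge0// mulr_ge0// ltW. Qed.
Let A2_gt0 : 0 < A2. Proof. by rewrite /A2 divr_gt0 ?exprn_gt0// !mulr_gt0//; have := K_ge1; lra. Qed.
Let bc_gt0 : 0 < 8 * K / (b * c).
Proof. by apply: divr_gt0; apply: mulr_gt0 => //; exact: lt_le_trans K_ge1. Qed.

Let zs_gt0 : 0 < complex.Im zs.
Proof. by rewrite /zs ImD addr_gt0//; have [] := mfcP hsupp lam z_gt0. Qed.

(* Moving the exact solution vertically makes the spectral parameter [ws t] explicit, and the
   stability parameter is increasing along the path; at [t = T0] the claim is trivial. *)
Let ps (t : R) : R[i] := zs + t *i.
Let ws (t : R) : R[i] := F lam (ps t).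
Let us (t : R) : R[i] := ws t + m (ws t).

Let ps_Im t : complex.Im (ps t) = complex.Im zs + t. Proof. by rewrite ImD. Qed.
Let ps_Re t : complex.Re (ps t) = complex.Re zs. Proof. by rewrite ReD /= addr0. Qed.
Let ps_gt0 t : 0 <= t -> 0 < complex.Im (ps t).
Proof. by move=> t0; rewrite ps_Im ltr_wpDr. Qed.

Let modulus_im (t : R) : modulus (t *i) = `|t|.
Proof. by rewrite /= expr0n/= add0r sqrtr_sqr. Qed.

Let psB s t : ps s - ps t = (s - t) *i.
Proof. by apply/eqP; rewrite eq_complex /ps !ReD !ImD !ReN !ImN /=; apply/andP; split; apply/eqP; rewrite ?ReD ?ImD /=; ring. Qed.

Let zs_Im_le : complex.Im zs <= Y + 1.
Proof.
rewrite /zs ImD lerD// (le_trans (ler_norm _))// (le_trans (Im_le_modulus _))//.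
exact: modulus_mfc_le1.
Qed.

Let S2_zs : S2 lam zs <= 1.
Proof.
have h := kernel_sqr_mfc hsupp lam z_gt0; rewrite -subr_ge0 -(pmulr_rge0 _ zs_gt0) h.
exact: ltW.
Qed.

Let S2_decr s t : 0 <= s <= t -> S2 lam (ps t) <= S2 lam (ps s).
Proof.
move=> /andP[s0 st]; have t0 := le_trans s0 st.
apply: le_Rint; [exact/rbounded_kernel_sqr/ps_gt0..|].
move=> v; rewrite lerXn2r ?nnegrE ?modulus_ge0// /q !modulusV.
have h r : 0 <= r -> 0 < modulus ((lam * v)%:C - ps r).
  by move=> r0; apply: lt_le_trans (kernel_den_ge lam v (ps_gt0 r0)); exact: ps_gt0.
rewrite lef_pV2 ?posrE ?h// -ler_sqr ?nnegrE ?modulus_ge0// !sqr_modulus.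
rewrite !Re_kernel_den !Im_kernel_den !ps_Re !ps_Im lerD2l !sqrrN.
by rewrite lerXn2r ?nnegrE; have := zs_gt0; lra.
Qed.

Let S2_le1 t : 0 <= t -> S2 lam (ps t) <= 1.
Proof.
move=> t0; apply: (le_trans (S2_decr (s := 0) _)); first by rewrite lexx.
by rewrite /ps (_ : 0 *i = 0) ?addr0.
Qed.

Let ws_Im t : 0 <= t -> complex.Im (ws t) = complex.Im (ps t) * (1 - S2 lam (ps t)).
Proof. by move=> t0; rewrite /ws /F ImD ImN Im_stieltjes ?ps_gt0//; ring. Qed.

Let ws0 : ws 0 = z.
Proof.
rewrite /ws /F /ps (_ : 0 *i = 0) ?addr0//.
by have [_ h] := mfcP hsupp lam z_gt0; rewrite /zs -h addrK.
Qed.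

Let ws_mono s t : 0 <= s <= t -> complex.Im (ws s) <= complex.Im (ws t).
Proof.
move=> /andP[s0 st]; have t0 := le_trans s0 st; rewrite !ws_Im//.
apply: ler_pM; [exact/ltW/ps_gt0|by rewrite subr_ge0 S2_le1|by rewrite !ps_Im lerD2l|].
by rewrite lerD2l lerN2 S2_decr// s0.
Qed.

Let ws_ge t : 0 <= t -> eta <= complex.Im (ws t).
Proof. by move=> t0; rewrite /eta -ws0 ws_mono// lexx. Qed.

Let ws_le t : 0 <= t <= T0 -> complex.Im (ws t) <= D1.
Proof.
move=> /andP[t0 tT]; rewrite ws_Im//.
apply: (@le_trans _ _ (complex.Im (ps t))).
  by apply: ler_piMr; [exact/ltW/ps_gt0|rewrite gerBl kernel_sqr_ge0].
by rewrite ps_Im /D1 lerD.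
Qed.

Let ws_Re t : 0 <= t -> `|complex.Re (ws t)| <= B + 1.
Proof.
move=> t0; rewrite /ws /F ReD ReN ps_Re (le_trans (ler_normB _ _))// lerD//.
rewrite (le_trans (Re_le_modulus _))// (le_trans (modulus_stieltjes_sqr _ _ (ps_gt0 t0)))//.
by have := S2_le1 t0; lra.
Qed.

Let y0 := complex.Im zs.

Let ws_lip s t : 0 <= s -> 0 <= t -> modulus (ws s - ws t) <= (1 + y0 ^- 2) * `|s - t|.
Proof.
move=> s0 t0; rewrite /ws /F.
rewrite (_ : _ - _ - (_ - _) = (ps s - ps t) - (g lam (ps s) - g lam (ps t))); last ring.
rewrite (le_trans (modulusB _ _))// mulrDl mul1r psB modulus_im lerD2l.
rewrite -(modulus_im (s - t)) -psB; apply: stieltjes_lip => //;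
  by rewrite ps_Im lerDl.
Qed.

Let gap t := us t - ps t.

(** The constant degenerates with [y0] and with [M], but [continuity_induction] asks only that it be
    finite. *)
Let gap_lip s t : 0 <= s -> 0 <= t ->
  `|modulus (gap s) - modulus (gap t)| <= ((1 + M) * (1 + y0 ^- 2) + 1) * `|s - t|.
Proof.
move=> s0 t0.
have h : modulus (gap s - gap t) <= ((1 + M) * (1 + y0 ^- 2) + 1) * `|s - t|.
  rewrite /gap /us.
  rewrite (_ : _ - _ - (_ - _) = (ws s - ws t) + (m (ws s) - m (ws t)) - (ps s - ps t)); last ring.
  rewrite (le_trans (modulusB _ _))// [leRHS]mulrDl mul1r psB modulus_im lerD2r.
  rewrite (le_trans (modulusD _ _))// mulrDl mul1r mulrDl.
  have h1 := ws_lip s0 t0; apply: lerD => //.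
  apply: (le_trans (m_lip (ws_ge s0) (ws_ge t0))).
  by rewrite -mulrA ler_wpM2l.
apply: le_trans h; rewrite ler_norml.
have := modulus_lerB (gap s) (gap t); have := modulus_lerB (gap t) (gap s).
by rewrite [modulus (gap t - _)]modulusC => h1 h2; apply/andP; split; lra.
Qed.

Let be t := beta lam (ps t).

Let be_lip s t : 0 <= s -> 0 <= t -> `|be s - be t| <= (2 * y0 ^- 3 + 1) * `|s - t|.
Proof.
move=> s0 t0; rewrite /be /stab_beta.
rewrite (_ : _ + _ - _ = (S2 lam (ps t) - S2 lam (ps s)) +
  (Num.min 1 (complex.Im (ps s)) - Num.min 1 (complex.Im (ps t)))); last ring.
rewrite (le_trans (ler_normD _ _))// mulrDl mul1r lerD//.
  rewrite distrC -(modulus_im (s - t)) -psB; apply: kernel_sqr_lip => //;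
    by rewrite ps_Im lerDl.
by rewrite (le_trans (min_lip _ _ _))// !ps_Im opprD addrACA subrr add0r.
Qed.

Let be_mono s t : 0 <= s <= t -> be s <= be t.
Proof.
move=> st; have /andP[s0 st'] := st; rewrite /be /stab_beta; apply: lerD.
  by rewrite lerD2l lerN2 S2_decr.
by rewrite !ps_Im le_min ge_min lexx/= ge_min lerD2l st' orbT.
Qed.

Let be_gt0 t : 0 <= t -> 0 < be t.
Proof. by move=> t0; apply: stab_beta_gt0; [exact: ps_gt0|exact: S2_le1]. Qed.

Let us_gt0 t : 0 <= t -> 0 < complex.Im (us t).
Proof.
move=> t0; rewrite /us ImD ltr_wpDr ?m_im ?ws_ge//.
by rewrite (lt_le_trans z_gt0)// ws_ge.
Qed.

(** [ws t] is the image of [ps t] under [F], so this is [approx] at [ws t]; a gap of at most c / 2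
    costs only half of the distance from the support. *)
Let F_gap t : 0 <= t <= T0 -> modulus (gap t) <= c / 2 ->
  modulus (F lam (us t) - F lam (ps t)) ^+ 2 <=
    Cr * om (ws t) ^+ 3 * (complex.Im (ps t) + modulus (gap t) + om (ws t)).
Proof.
move=> ht hg; have /andP[t0 tT] := ht.
have good : off_support (c / 2) lam (us t).
  apply: (off_support_near hkey hlam (ps_gt0 t0) (S2_le1 t0)).
  exact: hg.
have o0 := om_gt0 (ws_ge t0).
apply: (le_trans (approx (ws_ge t0) (ws_Re t0) (ws_le ht) good)).
rewrite ler_wpM2l//; first by rewrite mulr_ge0 ?exprn_ge0 ?ltW.
rewrite lerD2r -/(us t) -lerBlDl (_ : complex.Im (us t) - _ = complex.Im (gap t)); last first.
  by rewrite /gap [in RHS]ImD [complex.Im (- _)]ImN.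
by rewrite (le_trans (ler_norm _))// Im_le_modulus.
Qed.

Let gap_T0 : modulus (gap T0) <= 3 / T0.
Proof.
have T00 : 0 <= T0 by have := T0_ge2; lra.
have T01 : 0 < T0 by have := T0_ge2; lra.
have yT : T0 <= complex.Im (ps T0) by rewrite ps_Im lerDr ltW.
have S4 : S2 lam (ps T0) <= 4^-1.
  rewrite -[leRHS](Rint_cst mu); apply: le_Rint; [exact/rbounded_kernel_sqr/ps_gt0|exact: rbounded_cst|].
  move=> v; have := modulus_kernel lam v (ps_gt0 T00).
  have : (complex.Im (ps T0))^-1 <= 2^-1.
    by rewrite lef_pV2 ?posrE ?ps_gt0// (le_trans T0_ge2).
  have := modulus_ge0 (q lam (ps T0) v); nra.
have wT : 3 / 4 * T0 <= complex.Im (ws T0).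
  rewrite ws_Im// mulrC; apply: ler_pM => //; lra.
rewrite (_ : gap T0 = m (ws T0) - g lam (ps T0)); last first.
  by rewrite /gap /us /ws /F; ring.
rewrite (le_trans (modulusB _ _))//.
have h1 : modulus (m (ws T0)) <= (3 / 4 * T0)^-1.
  apply: (le_trans (m_le (ws_ge T00))).
  by rewrite lef_pV2 ?posrE// ?(lt_le_trans _ wT)// mulr_gt0.
have h2 : modulus (g lam (ps T0)) <= T0^-1.
  apply: (le_trans (modulus_stieltjes mu lam (ps_gt0 T00))).
  by rewrite lef_pV2 ?posrE// ps_gt0.
apply: (le_trans (lerD h1 h2)); rewrite -subr_ge0.
rewrite (_ : _ - _ = 2 / 3 * T0^-1); last by field; rewrite gt_eqF.
by rewrite mulr_ge0// invr_ge0.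
Qed.

Let be_T0 : 1 <= be T0.
Proof.
have T00 : 0 <= T0 by have := T0_ge2; lra.
rewrite /be /stab_beta; have := S2_le1 T00.
have -> : Num.min 1 (complex.Im (ps T0)) = 1; last by lra.
by apply/min_idPl; rewrite ps_Im; have := zs_gt0; have := T0_ge2; lra.
Qed.

(** Turns the factor Im in [approx] into a factor beta, which cancels one of the two powers of beta
    coming from the squared stability bound. *)
Let Im_ps_le t : 0 <= t <= T0 -> complex.Im (ps t) <= D1 * be t.
Proof.
move=> ht; have /andP[t0 tT] := ht.
have D11 : 1 <= D1 by rewrite /D1; have := T0_ge2; have := Y_ge0; lra.
have S1 : 0 <= 1 - S2 lam (ps t) by rewrite subr_ge0 S2_le1.
have yD : complex.Im (ps t) <= D1 by rewrite ps_Im /D1 lerD.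
have y1 := ps_gt0 t0.
rewrite /be /stab_beta; case: (leP 1 (complex.Im (ps t))) => h; nra.
Qed.

Let stable_step t : 0 <= t <= T0 -> K * om (ws t) <= be t -> modulus (gap t) <= c2 * be t ->
  modulus (gap t) ^+ 2 * be t <= A1 * om (ws t) ^+ 3.
Proof.
move=> ht hK hg; have /andP[t0 tT] := ht.
have o0 := om_gt0 (ws_ge t0); have b0 := be_gt0 t0.
have b2 : be t <= 2 by apply: stab_beta_le2.
have a16 : a <= 16^-1 by exact: stab_const_le.
have hg2 : modulus (gap t) <= c / 2.
  apply: (le_trans hg); rewrite /c2.
  have ab : a * be t <= 8^-1 by have := a_gt0; nra.
  rewrite (_ : a * c / 4 * be t = c * (a * be t) / 4); last by field.
  by have := c_gt0; nra.
have h1 := stable_regime hsupp lam0_gt0 c_gt0 c_le1 B_ge0 hkey hlam (ps_gt0 t0) (S2_le1 t0) _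
  (us_gt0 t0) hg2 hg.
rewrite ps_Re in h1; have {}h1 := h1 hRe.
have h2 := F_gap ht hg2.
have g0 : 0 <= modulus (gap t) by exact: modulus_ge0.
have gb : modulus (gap t) <= be t.
  apply: (le_trans hg); rewrite ger_pMl// /c2.
  have ac : a * c <= 1 by have := c_le1; have := c_gt0; have := a_gt0; nra.
  lra.
have ob : om (ws t) <= be t by apply: le_trans hK; rewrite ler_peMl// ltW.
have yb := Im_ps_le ht.
have h3 : modulus (gap t) ^+ 2 * (a ^+ 2 * be t ^+ 2 / 4) <= Cr * om (ws t) ^+ 3 * ((D1 + 3) * be t).
  apply: (@le_trans _ _ (modulus (F lam (us t) - F lam (ps t)) ^+ 2)).
    rewrite (_ : _ * _ = (modulus (gap t) * (a * be t / 2)) ^+ 2); last by field.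
    rewrite lerXn2r ?nnegrE ?modulus_ge0//.
    by rewrite mulr_ge0// divr_ge0// mulr_ge0// ltW.
  apply: (le_trans h2); rewrite ler_wpM2l//; first by rewrite mulr_ge0 ?exprn_ge0 ?ltW.
  by rewrite mulrDl; lra.
rewrite /A1 -(ler_pM2r (x := a ^+ 2 * be t / 4)); last by rewrite divr_gt0// mulr_gt0// exprn_gt0.
rewrite (_ : _ * be t * _ = modulus (gap t) ^+ 2 * (a ^+ 2 * be t ^+ 2 / 4)); last by field.
apply: (le_trans h3); rewrite le_eqVlt; apply/orP; left; apply/eqP.
by field; rewrite gt_eqF.
Qed.

(** Since beta increases and omega decreases with height, the stable condition at [t] persists up to
    [T0]. Continuity is run downwards from there, with gap <= c2 beta improving itself to gap <= c2
    beta / 2. *)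
Let stable_phase t : 0 <= t <= T0 -> K * om (ws t) <= be t -> modulus (gap t) <= c2 * be t.
Proof.
move=> ht hK; have /andP[t0 tT] := ht.
pose f r := modulus (gap (t + r)) - c2 * be (t + r).
pose Lip := ((1 + M) * (1 + y0 ^- 2) + 1) + c2 * (2 * y0 ^- 3 + 1).
have iy n : 0 <= y0 ^- n by rewrite invr_ge0 exprn_ge0// ltW.
have Lip0 : 0 < Lip.
  rewrite /Lip ltr_pwDl//; last by rewrite mulr_ge0 ?ltW// ltr_wpDl// mulr_ge0.
  by rewrite ltr_wpDl// mulr_ge0// ?addr_ge0.
have kk : 0 < c2 * be t / 2 by rewrite divr_gt0// mulr_gt0// be_gt0.
suff : f 0 <= 0 by rewrite /f addr0 subr_le0.
apply: (continuity_induction (T0 := T0 - t) Lip0 kk); last by rewrite lexx subr_ge0.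
- rewrite /f (_ : t + (T0 - t) = T0); last ring.
  rewrite subr_le0 (le_trans gap_T0)//.
  apply: (@le_trans _ _ c2); last by rewrite ler_peMr// ltW.
  have T0p : 0 < T0 by have := T0_ge2; lra.
  by rewrite ler_pdivrMr// mulrC -ler_pdivrMr// /T0 !le_max lexx orbT.
- move=> r /andP[r0 rT]; have tr : 0 <= t + r <= T0 by apply/andP; split; lra.
  have tr0 : 0 <= t + r by case/andP: tr.
  have ttr : 0 <= t <= t + r by rewrite t0 lerDl.
  rewrite /f subr_le0 => hg.
  have hKr : K * om (ws (t + r)) <= be (t + r).
    apply: (le_trans _ (be_mono ttr)); apply: (le_trans _ hK).
    rewrite ler_wpM2l//; first by apply: le_trans K_ge1.
    by apply: om_mono; [exact: ws_ge|exact: ws_mono].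
  have h := stable_step tr hKr hg.
  have b0 := be_gt0 tr0; have o0 := om_gt0 (ws_ge tr0).
  have bt := be_mono ttr.
  have hlt : modulus (gap (t + r)) <= c2 * be (t + r) / 2.
    rewrite leNgt; apply/negP => hlt.
    have h1 : (c2 * be (t + r) / 2) ^+ 2 * be (t + r) < modulus (gap (t + r)) ^+ 2 * be (t + r).
      rewrite ltr_pM2r// ltrXn2r// ?nnegrE ?modulus_ge0//.
      by rewrite divr_ge0// mulr_ge0 ?ltW.
    have h2 : A1 * om (ws (t + r)) ^+ 3 <= (c2 * be (t + r) / 2) ^+ 2 * be (t + r).
      have k3 : (K * om (ws (t + r))) ^+ 3 <= be (t + r) ^+ 3.
        rewrite lerXn2r ?nnegrE ?(ltW b0)// mulr_ge0 ?(ltW o0)//.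
        by apply: le_trans K_ge1.
      (* This is what fixes K = 4 A1 / c2^2 + 1; the cube is weakened to K by K >= 1. *)
      have A1K : A1 <= c2 ^+ 2 / 4 * K ^+ 3.
        apply: (@le_trans _ _ (c2 ^+ 2 / 4 * K)).
          rewrite /K /path_K mulrDr mulr1 -[leLHS]addr0 lerD//.
            by rewrite le_eqVlt; apply/orP; left; apply/eqP; field; rewrite gt_eqF.
          by rewrite divr_ge0// sqr_ge0.
        rewrite ler_wpM2l ?divr_ge0 ?sqr_ge0//.
        by rewrite -[leLHS]expr1 ler_weXn2l.
      apply: (@le_trans _ _ (c2 ^+ 2 / 4 * K ^+ 3 * om (ws (t + r)) ^+ 3)).
        by rewrite ler_wpM2r// exprn_ge0// ltW.
      rewrite -mulrA -exprMn (_ : (c2 * be (t + r) / 2) ^+ 2 * be (t + r) = c2 ^+ 2 / 4 * be (t + r) ^+ 3); last by field.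
      by rewrite ler_wpM2l// divr_ge0// sqr_ge0.
    by have := lt_le_trans h1 (le_trans h h2); rewrite ltxx.
  have : c2 * be t <= c2 * be (t + r) by rewrite ler_wpM2l// ltW.
  lra.
- move=> r s /andP[r0 rT] /andP[s0 sT].
  have h1 := gap_lip (addr_ge0 t0 r0) (addr_ge0 t0 s0).
  have h2 := be_lip (addr_ge0 t0 r0) (addr_ge0 t0 s0).
  have e : t + r - (t + s) = r - s by ring.
  rewrite e in h1 h2.
  rewrite /f (_ : _ - _ - (_ - _) = (modulus (gap (t + r)) - modulus (gap (t + s)))
     - c2 * (be (t + r) - be (t + s))); last ring.
  rewrite (le_trans (ler_normB _ _))// /Lip mulrDl lerD// normrM (gtr0_norm c2_gt0).
  by rewrite -mulrA ler_wpM2l// ltW.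
Qed.

Let stable_conclusion t : 0 <= t <= T0 -> K * om (ws t) <= be t ->
  modulus (gap t) <= (A1 + 1) * om (ws t).
Proof.
move=> ht hK; have /andP[t0 tT] := ht.
have h := stable_step ht hK (stable_phase ht hK).
have b0 := be_gt0 t0; have o0 := om_gt0 (ws_ge t0).
have ob : om (ws t) <= be t by apply: le_trans hK; rewrite ler_peMl// ltW.
have h1 : modulus (gap t) ^+ 2 <= A1 * om (ws t) ^+ 2.
  rewrite -(ler_pM2r o0) (le_trans _ (le_trans h _))//.
    by rewrite ler_wpM2l// sqr_ge0.
  by rewrite (_ : A1 * om (ws t) ^+ 2 * om (ws t) = A1 * om (ws t) ^+ 3); last ring.
rewrite -ler_sqr ?nnegrE ?modulus_ge0//; last by rewrite mulr_ge0 ?ltW// ltr_wpDl// ltW.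
apply: (le_trans h1); rewrite exprMn ler_wpM2r ?sqr_ge0//.
by have := A1_gt0; nra.
Qed.

Let om_le t : 0 <= t -> om (ws t) <= path_om0.
Proof.
move=> t0; apply: le_trans om_small; apply: om_mono; first exact: lexx.
exact: ws_ge.
Qed.

Lemma path_C_gt0 : 0 < path_C.
Proof. by rewrite /path_C; have := A1_gt0; have := A2_gt0; have := bc_gt0; lra. Qed.
Let C_gt0 := path_C_gt0.

Lemma path_om0_gt0 : 0 < path_om0.
Proof.
rewrite lt_min !divr_gt0 ?path_C_gt0//; exact: lt_le_trans K_ge1.
Qed.

(** Either the gap is at most a multiple of beta, hence of omega, or at most omega, or the quadratic
    term dominates. In the last case squaring [edge_regime] gives gap^4 <= C omega^3 gap, and a cube
    root is taken. *)
Let edge_conclusion t : 0 <= t <= T0 -> be t < K * om (ws t) -> modulus (gap t) <= c0 ->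
  modulus (gap t) <= path_C * om (ws t).
Proof.
move=> ht hK hg; have /andP[t0 tT] := ht.
have o0 := om_gt0 (ws_ge t0); have b0 := be_gt0 t0.
have K0 : 0 < K by apply: lt_le_trans K_ge1.
have hg2 : modulus (gap t) <= c / 2 by apply: (le_trans hg); rewrite /c0 ge_min lexx.
have hg3 : modulus (gap t) <= b * c ^+ 2 / 4.
  by apply: (le_trans hg); rewrite /c0 ge_min lexx orbT.
have ky : K * om (ws t) <= c / 4.
  have := om_le t0; rewrite /path_om0 le_min => /andP[h _].
  rewrite mulrC -ler_pdivlMr//; apply: (le_trans h).
  by rewrite le_eqVlt; apply/orP; left; apply/eqP; field; rewrite gt_eqF.
have S1 : 0 <= 1 - S2 lam (ps t) by rewrite subr_ge0 S2_le1.
have yt : complex.Im (ps t) <= be t.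
  move: hK; rewrite /be /stab_beta; case: (leP 1 (complex.Im (ps t))) => h; last by lra.
  by have := c_le1; lra.
have yc : complex.Im (ps t) <= c / 2 by have := c_gt0; lra.
have h1 := edge_regime hsupp lam0_gt0 c_gt0 c_le1 B_ge0 hkey hlam (ps_gt0 t0) (S2_le1 t0) _
  (us_gt0 t0) hg2 yc hg3.
rewrite ps_Re in h1; have {}h1 := h1 hRe.
have h2 := F_gap ht hg2.
rewrite -/(gap t) -/b in h1.
have g0 : 0 <= modulus (gap t) by exact: modulus_ge0.
have [hs|hs] := leP (modulus (gap t)) (8 / (b * c) * be t).
  apply: (le_trans hs); apply: (@le_trans _ _ (8 / (b * c) * (K * om (ws t)))).
    by rewrite ler_wpM2l ?ltW// divr_gt0// mulr_gt0.
  rewrite (_ : _ * (K * _) = 8 * K / (b * c) * om (ws t)); last ring.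
  rewrite ler_wpM2r ?ltW// /path_C; have := A1_gt0; have := A2_gt0; lra.
have [ho|ho] := leP (modulus (gap t)) (om (ws t)).
  rewrite (le_trans ho)// ler_peMl ?ltW// /path_C.
  by have := A1_gt0; have := A2_gt0; have := bc_gt0; lra.
have h3 : modulus (gap t) ^+ 2 * (b / 4) <= modulus (F lam (us t) - F lam (ps t)).
  apply: le_trans h1; rewrite expr2 -mulrA ler_wpM2l//.
  have : 2 / c * be t <= modulus (gap t) * (b / 4).
    rewrite (_ : 2 / c * be t = 8 / (b * c) * be t * (b / 4)); last first.
      by field; rewrite !gt_eqF.
    by rewrite ler_wpM2r ?ltW// divr_gt0.
  rewrite -/(be t); lra.
have h4 : modulus (gap t) ^+ 4 * (b ^+ 2 / 16) <= Cr * om (ws t) ^+ 3 * ((K + 2) * modulus (gap t)).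
  apply: (@le_trans _ _ (modulus (F lam (us t) - F lam (ps t)) ^+ 2)).
    rewrite (_ : _ * _ = (modulus (gap t) ^+ 2 * (b / 4)) ^+ 2); last by field.
    rewrite lerXn2r ?nnegrE ?modulus_ge0//.
    by rewrite mulr_ge0 ?sqr_ge0// divr_ge0// ltW.
  apply: (le_trans h2); rewrite ler_wpM2l//; first by rewrite mulr_ge0 ?exprn_ge0 ?ltW.
  have : K * om (ws t) <= K * modulus (gap t) by rewrite ler_wpM2l ?ltW.
  have aux (k' o g' y e : R) : y <= e -> e <= k' * o -> k' * o <= k' * g' -> o <= g' ->
      y + g' + o <= (k' + 2) * g' by move=> *; lra.
  by move=> hKg; apply: (aux _ _ _ _ _ yt (ltW hK) hKg); exact: ltW.
have gp : 0 < modulus (gap t) by apply: lt_trans ho.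
have h5 : modulus (gap t) ^+ 3 <= A2 * om (ws t) ^+ 3.
  rewrite /A2 -(ler_pM2r (x := modulus (gap t) * (b ^+ 2 / 16))); last first.
    by rewrite mulr_gt0// divr_gt0// exprn_gt0.
  rewrite (_ : _ ^+ 3 * (_ * _) = modulus (gap t) ^+ 4 * (b ^+ 2 / 16)); last by field.
  apply: (le_trans h4); rewrite le_eqVlt; apply/orP; left; apply/eqP.
  by field; rewrite gt_eqF.
apply: (@le_trans _ _ ((A2 + 1) * om (ws t))); last first.
  rewrite ler_wpM2r ?ltW// /path_C; have := A1_gt0; have := bc_gt0; lra.
have A21 : 0 <= A2 + 1 by have := A2_gt0; lra.
rewrite leNgt; apply/negP => hlt.
have : ((A2 + 1) * om (ws t)) ^+ 3 < modulus (gap t) ^+ 3.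
  have m0 : 0 <= (A2 + 1) * om (ws t) by apply: mulr_ge0 => //; exact: ltW.
  by rewrite ltrXn2r// ?nnegrE.
rewrite exprMn => h6.
have : A2 * om (ws t) ^+ 3 <= (A2 + 1) ^+ 3 * om (ws t) ^+ 3.
  rewrite ler_wpM2r ?exprn_ge0 ?ltW//; have := A2_gt0.
  have -> : (A2 + 1) ^+ 3 = A2 ^+ 3 + 3 * A2 ^+ 2 + 3 * A2 + 1 by ring.
  by move=> A20; have := exprn_gt0 3 A20; have := exprn_gt0 2 A20; lra.
lra.
Qed.

(** A second continuity argument, now with the fixed radius [c0] and across both regimes: gap <= c0
    implies gap <= path_C omega <= c0 / 2. The claim is its value at t = 0, where the path passes
    through z + mfc. *)
Lemma path_stability : modulus (m z - mfc mu lam z) <= path_C * om z.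
Proof.
have C0 := C_gt0.
have both t : 0 <= t <= T0 -> modulus (gap t) <= c0 -> modulus (gap t) <= path_C * om (ws t).
  move=> ht hg; have /andP[t0 tT] := ht; have o0 := om_gt0 (ws_ge t0).
  have [h|h] := leP (K * om (ws t)) (be t); last exact: edge_conclusion.
  apply: (le_trans (stable_conclusion ht h)); apply: ler_wpM2r; first exact: ltW.
  by rewrite /path_C lerDl; have := A2_gt0; have := bc_gt0; lra.
have T0p : 0 < T0 by have := T0_ge2; lra.
have all t : 0 <= t <= T0 -> modulus (gap t) - c0 <= 0.
  pose Lip := ((1 + M) * (1 + y0 ^- 2) + 1).
  have iy n : 0 <= y0 ^- n by rewrite invr_ge0 exprn_ge0// ltW.
  have Lip0 : 0 < Lip by rewrite ltr_wpDl// mulr_ge0// ?addr_ge0.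
  have kk : 0 < c0 / 2 by rewrite divr_gt0.
  move: t; apply: (continuity_induction Lip0 kk).
  - rewrite subr_le0 (le_trans gap_T0)//.
    by rewrite ler_pdivrMr// mulrC -ler_pdivrMr// /T0 !le_max lexx !orbT.
  - move=> t ht; have /andP[t0 tT] := ht; rewrite subr_le0 => hg.
    have h1 := both t ht hg.
    have h2 : path_C * om (ws t) <= c0 / 2.
      have := om_le t0; rewrite {1}/path_om0 le_min => /andP[_ h].
      by rewrite mulrC -ler_pdivlMr.
    lra.
  - move=> s t /andP[s0 _] /andP[t0 _].
    rewrite (_ : _ - _ - (_ - _) = modulus (gap s) - modulus (gap t)); last ring.
    exact: gap_lip.
have h0 : 0 <= (0 : R) <= T0 by rewrite lexx ltW.
have := both 0 h0; have := all 0 h0; rewrite subr_le0 => h1 /(_ h1).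
rewrite ws0 (_ : gap 0 = m z - mfc mu lam z)//.
rewrite /gap /us ws0 /ps (_ : 0 *i = 0)// addr0 /zs; ring.
Qed.

End OnePath.
End Path.

(** * Strict bounds on the square of the kernel *)

Lemma sqr_sum_ge0 {R : realType} (a b c : R) : 0 <= a ^+ 2 * b ^+ 2 + c ^+ 2.
Proof. by apply: addr_ge0; [apply: mulr_ge0|]; exact: sqr_ge0. Qed.

Lemma sqr_sum_gt0 {R : realType} (a b c : R) : 0 < c -> 0 < a ^+ 2 * b ^+ 2 + c ^+ 2.
Proof.
move=> c0; apply: ltr_wpDl; last exact: exprn_gt0.
by apply: mulr_ge0; exact: sqr_ge0.
Qed.

Section LawDensity.
Context {R : realType} (mu : probability (measurableTypeR R) R).
Implicit Types (e d v k x : R).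
Local Notation leb := (@lebesgue_measure R).
Local Notation Dom := (`]-1, 1[%classic : set (measurableTypeR R)).

Lemma density_supp f : has_density mu f -> (forall v, ~~ (-1 <= v <= 1) -> f v = 0) ->
  mu (~` [set v : R | -1 <= v <= 1]) = 0%E.
Proof.
move=> hf f0; rewrite hf; last by apply: measurableC; exact: (@measurable_support R).
by apply: integral0_eq => v /= /negP h; rewrite f0.
Qed.

Lemma density_point f (x : R) : has_density mu f -> mu [set x] = 0%E.
Proof. by move=> hf; rewrite hf// integral_set1. Qed.

Lemma density_open_supp f : has_density mu f -> (forall v, ~~ (-1 <= v <= 1) -> f v = 0) ->
  mu (~` Dom) = 0%E.
Proof.
move=> hf f0; apply/eqP; rewrite eq_le measure_ge0 andbT.
have mS := measurableC (@measurable_support R).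
have sub : ~` Dom `<=` (~` [set v : R | -1 <= v <= 1] `|` [set -1]) `|` [set 1].
  move=> v /=; rewrite in_itv /= => h.
  have [->|v1] := eqVneq v 1; first by right.
  have [->|v2] := eqVneq v (-1); first by left; right.
  left; left => /andP[h1 h2]; apply: h.
  by rewrite !lt_neqAle h1 h2 v1 eq_sym v2.
have m1 : measurable (~` [set v : R | -1 <= v <= 1] `|` [set -1] : set (measurableTypeR R)).
  exact: measurableU.
have mD : measurable (~` Dom) by apply: measurableC; exact: measurable_itv.
apply: (@le_trans _ _ (mu ((~` [set v : R | -1 <= v <= 1] `|` [set -1]) `|` [set 1]))).
  by apply: le_measure; rewrite ?inE//; exact: measurableU.
apply: (le_trans (measureU2 _ _ _)) => //.
rewrite [X in (_ + X)%E](density_point _ hf) adde0.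
apply: (le_trans (measureU2 _ _ _)) => //.
by rewrite [X in (_ + X)%E](density_point _ hf) adde0 [X in (X <= _)%E](density_supp hf f0).
Qed.

Lemma density_ge f (A : set R) (k : R) : has_density mu f -> measurable A -> 0 <= k ->
  measurable_fun A f -> (forall v, A v -> k <= f v) -> (k%:E * leb A <= mu A)%E.
Proof.
move=> hf mA k0 mf hk; rewrite hf// -integral_cst//.
apply: ge0_le_integral => //.
exact/measurable_EFinP.
Qed.

(* The integral is monotone in the shift, so a strict bound on the singular
   integral survives regularisation. *)
Definition end_kernel (lam0 e d v : R) : R :=
  (lam0 ^+ 2 * (1 - e * v + d) ^+ 2 + d ^+ 2)^-1.

Lemma rbounded_end_kernel lam0 e d : 0 < d ->
  rbounded (end_kernel lam0 e d : measurableTypeR R -> R).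
Proof.
move=> d0; split.
  apply: measurable_inv_fun; apply: measurable_funD => //.
  apply: measurable_funM => //; apply: measurable_funX; apply: measurable_funD => //.
  by apply: measurable_funB => //; exact: measurable_funM.
exists (d ^- 2) => v; rewrite ger0_norm; last by rewrite invr_ge0 sqr_sum_ge0.
rewrite lef_pV2 ?posrE ?exprn_gt0 ?sqr_sum_gt0// lerDr.
by apply: mulr_ge0; exact: sqr_ge0.
Qed.

(** By contradiction along d = 1 / (n + 1): on the open interval the kernels increase to (1 - e
    v)^-2 / lam0^2, and monotone convergence would bound the singular integral by lam0^2. That
    integral may diverge, hence the extended reals; the sign [e] selects the end point. *)
Lemma end_kernel_bound lam0 e : 0 < lam0 -> `|e| = 1 ->
  ((lam0 ^+ 2)%:E < \int[mu]_(v in Dom) ((1 - e * v) ^- 2)%:E)%E ->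
  exists d, 0 < d /\ 1 < \int[mu]_v end_kernel lam0 e d v.
Proof.
move=> l0 e1 hlt.
pose dl n : R := n.+1%:R^-1.
have dl0 n : 0 < dl n by rewrite invr_gt0.
apply: contrapT => /forallNP hno.
have hle n : \int[mu]_v end_kernel lam0 e (dl n) v <= 1.
  by rewrite leNgt; apply/negP => h; apply: (hno (dl n)).
have mD : measurable Dom by exact: measurable_itv.
pose h n (v : measurableTypeR R) : \bar R := (end_kernel lam0 e (dl n) v)%:E.
have h0 n v : (0 <= h n v)%E.
  by rewrite lee_fin invr_ge0 sqr_sum_ge0.
have mh n : measurable_fun Dom (h n).
  apply/measurable_EFinP; apply: (measurable_funS measurableT) => //.
  by have [] := rbounded_end_kernel lam0 e (dl0 n).
have pos v : Dom v -> 0 < 1 - e * v.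
  rewrite /= in_itv/= => hv; rewrite subr_gt0 (le_lt_trans (ler_norm _))// normrM e1 mul1r.
  by rewrite ltr_norml.
have hIle n : (\int[mu]_(v in Dom) h n v <= 1)%E.
  apply: (@le_trans _ _ (\int[mu]_v h n v)%E).
    apply: ge0_subset_integral => //.
    by apply/measurable_EFinP; have [] := rbounded_end_kernel lam0 e (dl0 n).
  rewrite -[X in (X <= _)%E]fineK; last first.
    by apply: integrable_fin_num => //; exact/rbounded_integrable/rbounded_end_kernel.
  by rewrite lee_fin; exact: hle.
have hmono v : Dom v -> {homo h^~ v : n m / (n <= m)%N >-> (n <= m)%E}.
  move=> Dv n m nm; rewrite lee_fin lef_pV2 ?posrE ?sqr_sum_gt0//.
  have hd : dl m <= dl n by rewrite lef_pV2 ?posrE// ler_nat.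
  have p := pos v Dv; have dm := dl0 m.
  have dn := dl0 n; apply: lerD; last by rewrite lerXn2r// nnegrE ltW.
  rewrite ler_wpM2l ?sqr_ge0// lerXn2r ?nnegrE ?lerD2l//; lra.
have := monotone_convergence mu mD mh (fun n v _ => h0 n v) hmono.
set L := (\int[mu]_(x in Dom) _)%E => hL.
have L1 : (L <= 1)%E.
  rewrite hL; apply: lime_le; last by apply: nearW => n; exact: hIle.
  apply: ereal_nondecreasing_is_cvgn => n m nm; apply: ge0_le_integral => //.
  by move=> v Dv; exact: hmono.
have mk : measurable_fun Dom (fun v => ((1 - e * v) ^- 2)%:E).
  apply/measurable_EFinP; apply: (measurable_funS measurableT) => //.
  apply: measurable_inv_fun; apply: measurable_funX.
  by apply: measurable_funB => //; exact: measurable_funM.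
have l20 : 0 <= lam0 ^- 2 by rewrite invr_ge0 sqr_ge0.
have LE : L = ((lam0 ^- 2)%:E * \int[mu]_(v in Dom) ((1 - e * v) ^- 2)%:E)%E.
  rewrite -ge0_integralZl//; last by move=> v _; rewrite lee_fin invr_ge0 sqr_ge0.
  apply: eq_integral => v; rewrite inE => Dv; rewrite -EFinM.
  apply/cvg_lim => //; apply: cvg_EFin; first by apply: nearW.
  have cd : dl @ \oo --> (0 : R) by exact: cvg_harmonic.
  have -> : lam0 ^- 2 * (1 - e * v) ^- 2 =
      (lam0 ^+ 2 * ((1 - e * v + 0) * (1 - e * v + 0)) + 0 * 0)^-1.
    by rewrite mul0r !addr0; exact: esym (invfM _ _).
  rewrite /h /end_kernel; apply: cvgV.
    by rewrite addr0 mul0r addr0 -expr2 mulf_neq0// expf_neq0// gt_eqF// pos.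
  apply: cvgD; last by under eq_fun do rewrite expr2; exact: cvgM.
  apply: cvgMr; under eq_fun do rewrite expr2.
  by apply: cvgM; apply: cvgD => //; exact: cvg_cst.
move: L1; rewrite LE => h1.
have : ((lam0 ^+ 2)%:E * ((lam0 ^- 2)%:E * \int[mu]_(v in Dom) ((1 - e * v) ^- 2)%:E) <= (lam0 ^+ 2)%:E)%E.
  by rewrite -[leRHS]mule1; apply: lee_wpmul2l => //; rewrite lee_fin sqr_ge0.
rewrite muleA -EFinM mulfV ?mul1e; last by rewrite expf_neq0// gt_eqF.
by rewrite leNgt hlt.
Qed.

(** For |x| < 1 one has (1 - x)^-2 >= (1 + x)^2. With x = e v and a centered law the right side
    integrates to 1 plus the variance, and the mass on (1/2, 1) makes the variance positive. *)
Lemma Jensen_end e : `|e| = 1 -> (\int[mu]_v v)%R = 0 -> mu (~` Dom) = 0%E ->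
  (0 < mu `](2^-1)%R, 1%R[%classic)%E ->
  (1 < \int[mu]_(v in Dom) ((1 - e * v) ^- 2)%:E)%E.
Proof.
move=> e1 hc hD hpos.
have mD : measurable Dom by exact: measurable_itv.
(* Truncation makes the identity bounded without changing its integral, the complement of [Dom]
   being null. *)
pose cl v : R := v * \1_Dom v.
have bcl : rbounded (cl : measurableTypeR R -> R).
  split; first by apply: measurable_funM => //; exact: measurable_indic.
  exists 1 => v; rewrite /cl indicE; case: (boolP (v \in _)) => h.
    by rewrite mulr1; move: h; rewrite inE /= in_itv /= ler_norml => /andP[h1 h2]; rewrite !ltW.
  by rewrite mulr0 normr0.
have hcl : \int[mu]_v cl v = 0.
  rewrite -[RHS]hc; congr fine; apply: ae_eq_integral => //.
    by apply/measurable_EFinP; case: bcl.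
  exists (~` Dom); split => //; first exact: measurableC.
  by move=> v /= h Dv; apply: h => _; rewrite /cl indicE mem_set// mulr1.
pose w v : R := (1 + e * cl v) ^+ 2.
have ecl : rbounded (fun v : measurableTypeR R => e * cl v).
  by apply: rboundedM => //; exact: rbounded_cst.
have hw : 1 < \int[mu]_v w v.
  have -> : \int[mu]_v w v = 1 + \int[mu]_v (cl v * cl v).
    have -> : w = (fun v => 1 + (2 * e) * cl v + cl v * cl v).
      apply/funext => v; rewrite /w; have : e ^+ 2 = 1 by rewrite -real_normK ?num_real// e1 expr1n.
      by move=> e2; rewrite sqrrD exprMn e2; ring.
    rewrite RintD; [|apply: rboundedD; [exact: rbounded_cst|] |exact: rboundedM]; last first.
      by apply: rboundedM => //; exact: rbounded_cst.
    rewrite RintD; [|exact: rbounded_cst|by apply: rboundedM => //; exact: rbounded_cst].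
    by rewrite Rint_cst RintZ// hcl mulr0 addr0.
  rewrite ltrDl.
  have mJ : measurable (`]2^-1, 1[%classic : set (measurableTypeR R)) by exact: measurable_itv.
  have bJ : rbounded (\1_`]2^-1, 1[%classic : measurableTypeR R -> R).
    split; first exact: measurable_indic.
    by exists 1 => v; rewrite indicE; case: (_ \in _); rewrite ?normr1 ?normr0.
  apply: (@lt_le_trans _ _ (\int[mu]_v (4^-1 * \1_`]2^-1, 1[%classic v))).
    rewrite RintZ// mulr_gt0// /Rintegral integral_indic// setIT fine_gt0//.
    by rewrite hpos (le_lt_trans (probability_le1 _ _)) ?ltry.
  apply: le_Rint => //; first by apply: rboundedM => //; exact: rbounded_cst.
    exact: rboundedM.
  move=> v; rewrite /cl !indicE; case: (boolP (v \in `]2^-1, 1[%classic)) => h; last first.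
    by rewrite mulr0 -expr2 sqr_ge0.
  move: h; rewrite inE /= in_itv /= => /andP[h1 h2].
  rewrite mem_set; last by rewrite /= in_itv /=; apply/andP; split; lra.
  by rewrite /= !mulr1; nra.
have bw : rbounded (w : measurableTypeR R -> R).
  rewrite /w; under eq_fun do rewrite expr2.
  by apply: rboundedM; apply: rboundedD => //; exact: rbounded_cst.
apply: (@lt_le_trans _ _ (\int[mu]_v w v)%:E); first by rewrite lte_fin.
rewrite fineK; last by apply: integrable_fin_num => //; exact: rbounded_integrable.
rewrite (negligible_integral (measurableC mD))//; last exact: rbounded_integrable.
rewrite setTD setCK; apply: ge0_le_integral => //.
- by move=> v _; rewrite lee_fin sqr_ge0.
- by apply/measurable_EFinP; apply: (measurable_funS measurableT) => //; case: bw.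
- apply/measurable_EFinP; apply: (measurable_funS measurableT) => //.
  apply: measurable_inv_fun; apply: measurable_funX.
  by apply: measurable_funB => //; exact: measurable_funM.
move=> v Dv; rewrite lee_fin /w /cl indicE mem_set// mulr1.
have hv : -1 < e * v < 1.
  by rewrite -ltr_norml normrM e1 mul1r ltr_norml; move: Dv; rewrite /= in_itv.
move: hv; set x := e * v => /andP[x1 x2].
have x3 : 0 < (1 - x) ^+ 2 by rewrite exprn_gt0// subr_gt0.
rewrite -[leRHS]mul1r ler_pdivlMr//.
have : 0 <= (1 + x) * (1 - x) <= 1 by apply/andP; split; nra.
rewrite -exprMn => /andP[h1 h2]; rewrite expr_le1//.
Qed.

End LawDensity.

Section KeyBound.
Context {R : realType} (mu : probability (measurableTypeR R) R).
Implicit Types (a b d e k r s v x y : R).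
Local Notation leb := (@lebesgue_measure R).
Local Notation Dom := (`]-1, 1[%classic : set (measurableTypeR R)).

Definition end_strip e a b : set (measurableTypeR R) := [set v | a < 1 - e * v <= b].

Lemma end_strip_itv e a b : e = 1 \/ e = -1 ->
  exists i : interval R, end_strip e a b = [set` i] /\ (a < b -> leb [set` i] = (b - a)%:E).
Proof.
case=> ->.
  exists `[1 - b, 1 - a[; split.
    by apply/seteqP; split => v /=; rewrite /end_strip /= in_itv/= => /andP[h1 h2]; apply/andP; split; lra.
  move=> ab; rewrite lebesgue_measure_itv /= lte_fin ltrD2l ltrN2 ab -EFinD.
  by congr EFin; ring.
exists `]a - 1, b - 1]; split.
  by apply/seteqP; split => v /=; rewrite /end_strip /= in_itv/= => /andP[h1 h2]; apply/andP; split; lra.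
move=> ab; rewrite lebesgue_measure_itv /= lte_fin ltrD2r ab -EFinD.
by congr EFin; ring.
Qed.

Lemma measurable_end_strip e a b : e = 1 \/ e = -1 -> measurable (end_strip e a b).
Proof. by move=> /(end_strip_itv a b)[i [-> _]]; exact: measurable_itv. Qed.

Lemma measurable_end_sing (A : set (measurableTypeR R)) e :
  measurable_fun A (fun v => ((1 - e * v) ^- 2)%:E).
Proof.
apply/measurable_EFinP; apply: (measurable_funS measurableT) => //.
apply: measurable_inv_fun; apply: measurable_funX.
by apply: measurable_funB => //; exact: measurable_funM.
Qed.

(** On the dyadic strip r / 2 < 1 - e v <= r the integrand is at least r^-2, the density at least k
    r / 2 and the length is r / 2. Each strip thus contributes at least k / 4, independently of r,
    and there are infinitely many disjoint ones. *)
Lemma end_diverges (f : R -> R) e k : has_density mu f -> e = 1 \/ e = -1 -> 0 < k ->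
  measurable_fun Dom f -> (forall v, 0 <= e * v < 1 -> k * (1 - e * v) <= f v) ->
  forall M : R, (M%:E < \int[mu]_(v in Dom) ((1 - e * v) ^- 2)%:E)%E.
Proof.
move=> hf he k0 mf hk M.
have inD a : 0 <= a -> end_strip e a 1 `<=` Dom.
  move=> a0 v /= /andP[h1 h2]; rewrite in_itv /=.
  by move: h1 h2; case: he => -> h1 h2; apply/andP; split; lra.
have pos v : (0 <= ((1 - e * v) ^- 2)%:E)%E by rewrite lee_fin invr_ge0 sqr_ge0.
have strip r : 0 < r <= 1 ->
    ((k / 4)%:E <= \int[mu]_(v in end_strip e (r / 2) r) ((1 - e * v) ^- 2)%:E)%E.
  move=> /andP[r0 r1].
  have mS := measurable_end_strip (r / 2) r he.
  have r2 : r / 2 < r by lra.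
  have lS : leb (end_strip e (r / 2) r) = (r / 2)%:E.
    have [i [-> ->//]] := end_strip_itv (r / 2) r he.
    by congr EFin; field.
  have SD : end_strip e (r / 2) r `<=` Dom.
    apply: subset_trans (inD (r / 2) _); last by lra.
    by move=> v /= /andP[h1 h2]; apply/andP; split => //; lra.
  have h1 : ((k * (r / 2))%:E * leb (end_strip e (r / 2) r) <= mu (end_strip e (r / 2) r))%E.
    apply: (density_ge hf) => //; first by rewrite mulr_ge0// ltW// divr_gt0.
      by apply: (measurable_funS _ SD mf); exact: measurable_itv.
    move=> v /= /andP[v1 v2]; apply: le_trans (hk v _); last by apply/andP; split; lra.
    by rewrite ler_wpM2l ?ltW.
  apply: (@le_trans _ _ (\int[mu]_(v in end_strip e (r / 2) r) cst (r ^- 2)%:E v)%E).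
    rewrite integral_cst//; apply: (@le_trans _ _ ((r ^- 2)%:E * ((k * (r / 2))%:E * (r / 2)%:E))%E).
      by rewrite -!EFinM lee_fin le_eqVlt; apply/orP; left; apply/eqP; field; rewrite gt_eqF.
    by rewrite lS in h1; apply: lee_wpmul2l => //; rewrite lee_fin invr_ge0 sqr_ge0.
  apply: ge0_le_integral => //.
  - by move=> v _; rewrite lee_fin invr_ge0 sqr_ge0.
  - exact: measurable_end_sing.
  move=> v /= /andP[v1 v2]; rewrite lee_fin lef_pV2 ?posrE ?exprn_gt0//; last by lra.
  by rewrite lerXn2r ?nnegrE//; lra.
have h2n n : 0 < (2 ^- n : R) <= 1.
  by rewrite invr_gt0 exprn_gt0//= invf_le1 ?exprn_gt0// exprn_ege1// ler1n.
have union n : ((n%:R * (k / 4))%:E <= \int[mu]_(v in end_strip e (2 ^- n) 1) ((1 - e * v) ^- 2)%:E)%E.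
  elim: n => [|n ih].
    by rewrite mul0r; apply: integral_ge0 => v _.
  have r := h2n n; have /andP[r0 r1] := r.
  have e2 : 2 ^- n.+1 = 2 ^- n / 2 :> R by rewrite exprS invfM mulrC.
  have -> : end_strip e (2 ^- n.+1) 1 = end_strip e (2 ^- n) 1 `|` end_strip e (2 ^- n / 2) (2 ^- n).
    rewrite e2; apply/seteqP; split => v /=.
      move=> /andP[h1 h2]; have [h|h] := ltP (2 ^- n) (1 - e * v); first by left; rewrite /end_strip /= h h2.
      by right; rewrite /end_strip /= h h1.
    by case => /andP[h1 h2]; apply/andP; split => //; lra.
  rewrite ge0_integral_setU//; [|exact: measurable_end_strip|exact: measurable_end_strip|exact: measurable_end_sing|].
    by rewrite -natr1 mulrDl mul1r EFinD; apply: leeD => //; exact: strip.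
  apply/disj_setPS => v /= [/andP[h1 h2] /andP[h3 h4]].
  by have := lt_le_trans h1 h4; rewrite ltxx.
pose n := (Num.truncn (`|M| / (k / 4))).+1.
apply: (@lt_le_trans _ _ (n%:R * (k / 4))%:E).
  rewrite lte_fin (le_lt_trans (ler_norm _))// -ltr_pdivrMr ?divr_gt0//.
  exact: truncnS_gt.
apply: (le_trans (union n)); apply: ge0_subset_integral => //.
- exact: measurable_end_strip.
- exact: measurable_end_sing.
by apply: inD; have /andP[/ltW] := h2n n.
Qed.

Lemma continuous_density_measurable (f : R -> R) :
  (forall v, -1 < v < 1 -> {for v, continuous f}) -> measurable_fun Dom f.
Proof.
move=> cf; apply: open_continuous_measurable_fun; first exact: interval_open.
by move=> v; rewrite inE /= in_itv /=; exact: cf.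
Qed.

(** Near one end point the far factor has base in [1, 2] and exponent above -1, so it is at least
    1/2; the near factor y^s with s <= 1 is at least y; the smooth factor attains a positive
    minimum. The density therefore vanishes at most linearly. *)
Lemma jacobi_end a b e (he : e = 1 \/ e = -1) (M : R) : jacobi_measure mu a b -> a <= 1 -> b <= 1 ->
  (M%:E < \int[mu]_(v in Dom) ((1 - e * v) ^- 2)%:E)%E.
Proof.
move=> [a1 b1 [Z [g [Z0 [cg _] gpos hd]]]] aL bL.
have [c /[!in_itv]/= cin cmin] := @EVT_min R g (-1) 1 (ltW (gtrN ltr01)) cg.
have gc : 0 < g c by exact: gpos.
have pow2 x t : 1 <= x <= 2 -> -1 < t -> 2^-1 <= x `^ t.
  move=> /andP[x1 x2] t1; apply: (@le_trans _ _ (x `^ (-1))).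
    by rewrite powR_inv1 ?lef_pV2 ?posrE//; lra.
  by rewrite ler_powR// ltW.
apply: (end_diverges (k := Z^-1 * 2^-1 * g c) hd he).
- by rewrite !mulr_gt0// invr_gt0.
- have mDom : measurable Dom by exact: measurable_itv.
  have mS : measurable (`[-1, 1]%classic : set (measurableTypeR R)) by exact: measurable_itv.
  apply: (@eq_measurable_fun _ _ _ _ _ (fun v => Z^-1 * (1 + v) `^ a * (1 - v) `^ b * g v)).
    by move=> v; rewrite inE /= in_itv /= => /andP[h1 h2]; rewrite (ltW h1) (ltW h2).
  apply: measurable_funM; last first.
    have mg : measurable_fun (`[-1, 1]%classic : set (measurableTypeR R)) g.
      exact: subspace_continuous_measurable_fun.
    by apply: measurable_funS mg => //; exact: subset_itvW.
  apply: measurable_funM.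
    apply: measurable_funM => //.
    apply: (measurable_funS measurableT) => //.
    apply: (@measurableT_comp _ _ _ _ _ _ (fun x => x `^ a)) => //.
    exact: measurable_funD.
  apply: (measurable_funS measurableT) => //.
  apply: (@measurableT_comp _ _ _ _ _ _ (fun x => x `^ b)) => //.
  exact: measurable_funB.
move=> v hv.
have core x y t s : 1 <= x <= 2 -> 0 < y <= 1 -> -1 < t -> s <= 1 -> g c <= g v ->
    Z^-1 * 2^-1 * g c * y <= Z^-1 * (x `^ t * y `^ s) * g v.
  move=> hx hy ht hs hg.
  have h1 := pow2 x t hx ht; have h2 : y <= y `^ s by exact: ger1_powR.
  have y0 : 0 < y by case/andP: hy.
  rewrite (_ : _ * y = Z^-1 * (2^-1 * y) * g c); last by ring.
  apply: ler_pM => //; [by rewrite !mulr_ge0// ?invr_ge0// ltW|exact: ltW|].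
  apply: ler_wpM2l; first by rewrite invr_ge0 ltW.
  by apply: ler_pM => //; exact: ltW.
case: he hv => -> /andP[v0 v1].
  have hin : -1 <= v <= 1 by apply/andP; split; lra.
  rewrite mul1r in v0 v1 *.
  rewrite hin -[_ * (1 + v) `^ a * _]mulrA; apply: core => //; try by apply/andP; split; lra.
  by apply: cmin; rewrite in_itv.
have hin : -1 <= v <= 1 by apply/andP; split; lra.
rewrite hin -[_ * (1 + v) `^ a * _]mulrA [(1 + v) `^ a * _]mulrC.
have -> : 1 - -1 * v = 1 + v by ring.
apply: core => //; try by apply/andP; split; lra.
by apply: cmin; rewrite in_itv.
Qed.

(** The premise concerns an [Rintegral], whose value is 0 for a divergent integral, and the
    conclusion an extended one; in the divergent case the conclusion holds anyway. *)
Lemma sqrt_end lam0 e : 0 < lam0 -> mu (~` Dom) = 0%E ->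
  lam0 < Num.sqrt (\int[mu]_v (1 - e * v) ^- 2) ->
  ((lam0 ^+ 2)%:E < \int[mu]_(v in Dom) ((1 - e * v) ^- 2)%:E)%E.
Proof.
move=> l0 hD hs.
have I0 : 0 < \int[mu]_v (1 - e * v) ^- 2 by rewrite -sqrtr_gt0 (lt_trans l0).
have : lam0 ^+ 2 < \int[mu]_v (1 - e * v) ^- 2.
  by rewrite -(sqr_sqrtr (ltW I0)) ltrXn2r ?nnegrE ?sqrtr_ge0// ltW.
rewrite /Rintegral => {}hs.
have mD : measurable Dom by exact: measurable_itv.
have -> : (\int[mu]_(v in Dom) ((1 - e * v) ^- 2)%:E = \int[mu]_v ((1 - e * v) ^- 2)%:E)%E.
  rewrite [RHS](ge0_negligible_integral (measurableC mD))//.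
  - by rewrite setTD setCK.
  - exact: measurable_end_sing.
  - by move=> v _; rewrite lee_fin invr_ge0 sqr_ge0.
move: hs; have : (0 <= \int[mu]_v ((1 - e * v) ^- 2)%:E)%E.
  by apply: integral_ge0 => v _; rewrite lee_fin invr_ge0 sqr_ge0.
case: (\int[mu]_v _)%E => [r| |] //= _; rewrite ?lte_fin//.
by move=> _; rewrite ltry.
Qed.

Lemma measure_gt0_supp a b : support_of mu = [set x : R | -1 <= x <= 1] ->
  -1 <= a -> a < b -> b <= 1 -> (0 < mu `]a, b[%classic)%E.
Proof.
move=> hs a1 ab b1.
have : support_of mu ((a + b) / 2) by rewrite hs /=; apply/andP; split; lra.
apply; first exact: interval_open.
by rewrite /= in_itv /=; apply/andP; split; lra.
Qed.

Lemma kernel_sqr_eq lam (z : R[i]) v :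
  modulus (cauchy_kernel lam z v) ^+ 2 =
    ((lam * v - complex.Re z) ^+ 2 + complex.Im z ^+ 2)^-1.
Proof.
by rewrite /cauchy_kernel modulusV exprVn sqr_modulus Re_kernel_den Im_kernel_den sqrrN.
Qed.

(** If the density is at least k around s, the interval [s - c, s + c] has mass at least 2 c k, and
    there |p|^2 >= 1 / ((lam0^2 + 1) c^2). The product is at least 2 once c <= k / (lam0^2 + 1).
    Writing Re z = lam s makes this uniform in lam. *)
Lemma key_interior (f : R -> R) lam0 d : has_density mu f -> 0 < lam0 -> 0 < d <= 1 ->
  (forall v, -1 < v < 1 -> {for v, continuous f}) -> (forall v, -1 < v < 1 -> 0 < f v) ->
  exists c, 0 < c /\ forall lam (z : R[i]) s, 0 < lam <= lam0 -> 0 < complex.Im z <= c ->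
    complex.Re z = lam * s -> `|s| <= 1 - d -> 1 < kernel_sqr mu lam z.
Proof.
move=> hf l0 /andP[d0 d1] cf pf.
have ab : -1 + d / 2 <= 1 - d / 2 by lra.
have [m /[!in_itv]/= mI hm] : exists2 m : R, m \in `[-1 + d / 2, 1 - d / 2] &
    forall t : R, t \in `[-1 + d / 2, 1 - d / 2] -> f m <= f t.
  apply: EVT_min => //; apply: continuous_in_subspaceT => v.
  rewrite inE /= in_itv /= => /andP[h1 h2]; apply: cf; apply/andP; split; lra.
have k0 : 0 < f m by apply: pf; apply/andP; split; lra.
set k := f m in k0 hm; clearbody k.
have D0 : 0 < lam0 ^+ 2 + 1 by rewrite ltr_pwDr// sqr_ge0.
pose c := Num.min (d / 2) (k / (lam0 ^+ 2 + 1)).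
have c0 : 0 < c by rewrite lt_min !divr_gt0.
exists c; split => // lam z s /andP[lam_gt0 lamL] /andP[y0 yc] hx hs.
have [s1 s2] : -1 + d <= s /\ s <= 1 - d by move: hs; rewrite ler_norml => /andP[h1 h2]; split; lra.
have cd : c <= d / 2 by rewrite /c ge_min lexx.
have ck : c <= k / (lam0 ^+ 2 + 1) by rewrite /c ge_min lexx orbT.
clearbody c.
pose J : set (measurableTypeR R) := `[s - c, s + c]%classic.
have mJ : measurable J by exact: measurable_itv.
have JD : J `<=` Dom.
  by move=> v; rewrite /J /= !in_itv /= => /andP[h1 h2]; apply/andP; split; lra.
have lJ : leb J = (2 * c)%:E.
  rewrite /J lebesgue_measure_itv /= lte_fin ifT; last lra.
  by rewrite -EFinD; congr EFin; ring.
have hJ : ((k * (2 * c))%:E <= mu J)%E.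
  rewrite EFinM -lJ; apply: (density_ge hf) => //; first exact: ltW.
    by apply: (measurable_funS _ JD (continuous_density_measurable cf)); exact: measurable_itv.
  move=> v; rewrite /J /= in_itv /= => /andP[h1 h2].
  by apply: hm; rewrite in_itv /=; apply/andP; split; lra.
have fmu : mu J \is a fin_num by rewrite fin_num_measure.
have hJ' : k * (2 * c) <= fine (mu J) by rewrite -lee_fin fineK.
pose K := ((lam0 ^+ 2 + 1) * c ^+ 2)^-1.
have K0 : 0 <= K by rewrite invr_ge0 mulr_ge0 ?sqr_ge0// ltW.
have bJ : rbounded (\1_J : measurableTypeR R -> R).
  split; first exact: measurable_indic.
  by exists 1 => v; rewrite indicE; case: (_ \in _); rewrite ?normr1 ?normr0.
apply: (@lt_le_trans _ _ (\int[mu]_v (K * \1_J v))).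
  rewrite RintZ// /Rintegral integral_indic// setIT.
  apply: (@lt_le_trans _ _ (K * (k * (2 * c)))); last by rewrite ler_wpM2l.
  rewrite /K mulrC ltr_pdivlMr ?mulr_gt0 ?exprn_gt0// mul1r.
  have : (lam0 ^+ 2 + 1) * c <= k by rewrite mulrC -ler_pdivlMr.
  by rewrite expr2 mulrA => h; nra.
apply: le_Rint; [by apply: rboundedM => //; exact: rbounded_cst|exact: rbounded_kernel_sqr|].
move=> v; rewrite indicE; case: (boolP (v \in J)) => h; last first.
  by rewrite mulr0 sqr_ge0.
rewrite mulr1 kernel_sqr_eq /K lef_pV2 ?posrE ?mulr_gt0 ?exprn_gt0//; last first.
  by rewrite ltr_wpDl ?sqr_ge0// exprn_gt0.
rewrite mulrDl mul1r hx -mulrBr exprMn; apply: lerD.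
  apply: ler_pM; rewrite ?sqr_ge0//; first by rewrite lerXn2r ?nnegrE// ltW.
  move: h; rewrite inE /J /= in_itv /= => /andP[h1 h2].
  rewrite -[leLHS]real_normK ?num_real// lerXn2r ?nnegrE//; first exact: ltW.
  by rewrite ler_norml; apply/andP; split; lra.
by rewrite lerXn2r ?nnegrE// ltW.
Qed.

(** [end_kernel] is the worst case of |p|^2 on the support: |v - s| <= 1 - e v + d, lam <= lam0 and
    Im z <= d. *)
Lemma key_end lam0 e d : mu (~` [set v : R | -1 <= v <= 1]) = 0%E -> 0 < lam0 -> `|e| = 1 -> 0 < d ->
  1 < \int[mu]_v end_kernel lam0 e d v ->
  forall lam (z : R[i]) s, 0 < lam <= lam0 -> 0 < complex.Im z <= d ->
    complex.Re z = lam * s -> 1 - d <= e * s <= 1 + d -> 1 < kernel_sqr mu lam z.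
Proof.
move=> hS l0 e1 d0 hI lam z s /andP[lam_gt0 lamL] /andP[y0 yd] hx /andP[hs1 hs2].
apply: (lt_le_trans hI); apply: (le_Rint_supp hS).
- exact: rbounded_end_kernel.
- exact: rbounded_kernel_sqr.
move=> v hv; rewrite kernel_sqr_eq /end_kernel lef_pV2 ?posrE ?sqr_sum_gt0//; last first.
  by rewrite ltr_wpDl ?sqr_ge0// exprn_gt0.
have hev : `|e * v| <= 1 by rewrite normrM e1 mul1r ler_norml.
have e2 : e ^+ 2 = 1 by rewrite -real_normK ?num_real// e1 expr1n.
rewrite hx -mulrBr exprMn; apply: lerD; last by rewrite lerXn2r ?nnegrE// ltW.
apply: ler_pM; rewrite ?sqr_ge0//; first by rewrite lerXn2r ?nnegrE// ltW.
rewrite -[leLHS]mul1r -e2 -exprMn -[leLHS]real_normK ?num_real// lerXn2r ?nnegrE//.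
  by move: hev; rewrite ler_norml => /andP[h1 h2]; lra.
by rewrite mulrBr ler_norml; move: hev; rewrite ler_norml => /andP[h1 h2]; apply/andP; split; lra.
Qed.

Theorem key_bound_exists lam0 : 0 < lam0 -> \int[mu]_v v = 0 ->
  support_of mu = [set x : R | -1 <= x <= 1] ->
  (forall lambda, lambda_domain lam0 lambda -> admissible mu lambda) ->
  mu (~` [set v : R | -1 <= v <= 1]) = 0%E /\
  exists c, [/\ 0 < c, c <= 1 & key_bound mu lam0 c].
Proof.
move=> l0 hc hs hadm.
(* A coupling in the domain that is at most 1, whatever [lam0] is; admissibility there provides the
   density, continuous and positive inside the interval. *)
have hmin : lambda_domain lam0 (Num.min 1 lam0).
  by rewrite /lambda_domain /= lt_min l0 ltr01 ge_min lexx orbT.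
have hm1 : Num.min 1 lam0 <= 1 by rewrite ge_min lexx.
have [/(_ hm1)[f [hf cf pf f0]] _] := hadm _ hmin.
have hS := density_supp hf f0; have hD := density_open_supp hf f0.
split => //.
have pm1 e : e = 1 \/ e = -1 -> `|e| = 1 by case=> ->; rewrite ?normrN normr1.
(* The bound is wanted at the largest coupling. For lam0 <= 1 the variance argument suffices;
   otherwise admissibility at [lam0] itself gives a Jacobi law, with either a divergent integral or
   lam0 below [lambda1] and [lambda2]. *)
have hend e : e = 1 \/ e = -1 -> ((lam0 ^+ 2)%:E < \int[mu]_(v in Dom) ((1 - e * v) ^- 2)%:E)%E.
  move=> he; have [l1|l1] := leP lam0 1.
    apply: (@le_lt_trans _ _ 1%:E).
      by rewrite lee_fin expr_le1// ltW.
    apply: Jensen_end => //; first exact: pm1.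
    by apply: measure_gt0_supp => //; lra.
  have hl : lambda_domain lam0 lam0 by rewrite /lambda_domain /= l0 lexx.
  have [_ /(_ l1)[a [b [hJ]]]] := hadm _ hl.
  move=> [[aL bL]|[_ _ hl1 hl2]]; first exact: (jacobi_end he _ hJ).
  apply: sqrt_end => //; case: he => ->.
    by move: hl2; rewrite /lambda2; under eq_Rintegral do rewrite -[X in 1 - X]mul1r.
  by move: hl1; rewrite /lambda1; under eq_Rintegral do rewrite -[X in 1 + X]opprK -[X in 1 - X]mulN1r.
have [dp [dp0 hp]] := end_kernel_bound l0 (pm1 1 (or_introl erefl)) (hend _ (or_introl erefl)).
have [dm [dm0 hm]] := end_kernel_bound l0 (pm1 _ (or_intror erefl)) (hend _ (or_intror erefl)).
have Kp := key_end hS l0 (pm1 1 (or_introl erefl)) dp0 hp.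
have Km := key_end hS l0 (pm1 _ (or_intror erefl)) dm0 hm.
clear hc hp hm hm1 hmin hend hadm hs.
have [d [d0 d1 dpL dmL]] : exists d, [/\ 0 < d, d <= 1, d <= dp & d <= dm].
  exists (Num.min 1 (Num.min dp dm)); split; rewrite ?ge_min ?lexx ?orbT//.
  by rewrite !lt_min ltr01 dp0.
have [ci [ci0 hi]] := key_interior hf l0 (introT andP (conj d0 d1)) cf pf.
have [c [c0 cd cci]] : exists c, [/\ 0 < c, c <= d / 4 & c <= ci].
  by exists (Num.min (d / 4) ci); split; rewrite ?ge_min ?lexx ?orbT// lt_min ci0 divr_gt0.
exists c; split => //; first by lra.
move=> lam z hlam /andP[y0 yc] hx; have /andP[lam_gt0 lamL] := hlam.
(* For small lam no position has to be known: |lam v - Re z| <= 3/4 and Im z <= 1/4 make |p|^2 at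
   least 16/10. For lam >= 1/4 the choice c <= d / 4 turns |Re z| <= lam + c into |s| <= 1 + d. *)
have [lam4|lam4] := ltP lam 4^-1.
  apply: (@lt_le_trans _ _ (\int[mu]_v (16 / 10))).
    by rewrite Rint_cst; lra.
  apply: (le_Rint_supp hS); [exact: rbounded_cst|exact: rbounded_kernel_sqr|].
  move=> v hv; rewrite kernel_sqr_eq -[leLHS]invrK lef_pV2 ?posrE; last 2 first.
  - by rewrite invr_gt0 divr_gt0.
  - by rewrite ltr_wpDl ?sqr_ge0// exprn_gt0.
  have h1 : `|lam * v - complex.Re z| <= 3 / 4.
    rewrite (le_trans (ler_normB _ _))//.
    have : `|lam * v| <= lam.
      by rewrite normrM (gtr0_norm lam_gt0); apply: ler_piMr; [exact: ltW|rewrite ler_norml].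
    lra.
  have h2 : (lam * v - complex.Re z) ^+ 2 <= (3 / 4) ^+ 2.
    by rewrite -[leLHS]real_normK ?num_real// lerXn2r ?nnegrE.
  have h4 : complex.Im z <= 1 / 4 by lra.
  have h3 : complex.Im z ^+ 2 <= (1 / 4) ^+ 2 by nra.
  by rewrite invf_div; move: h2 h3; rewrite !expr2; lra.
have [s hxs] : exists s, complex.Re z = lam * s.
  by exists (complex.Re z / lam); rewrite mulrCA divff ?mulr1// gt_eqF.
have sL : `|s| <= 1 + d.
  move: hx; rewrite hxs normrM (gtr0_norm lam_gt0) => hx.
  by rewrite -(ler_pM2l lam_gt0) (le_trans hx)// mulrDr mulr1 lerD2l; nra.
move: (sL); rewrite ler_norml => /andP[s1 s2].
have [h|h] := leP (1 - d) s.
  apply: (Kp _ _ _ hlam _ hxs).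
    by rewrite y0 /=; lra.
  by rewrite mul1r; apply/andP; split; lra.
have [h'|h'] := leP s (- (1 - d)).
  apply: (Km _ _ _ hlam _ hxs).
    by rewrite y0 /=; lra.
  by rewrite mulN1r; apply/andP; split; lra.
apply: (hi _ _ _ hlam _ hxs); last by rewrite ler_norml; apply/andP; split; lra.
by rewrite y0 (le_trans yc).
Qed.

End KeyBound.

(** * Resolvent identities *)

Section ResolventAlgebra.
Context {R : realType} (N : nat).
Implicit Types (H : 'M[R[i]]_N) (z : R[i]) (i j k : 'I_N).

Definition hermitian H := forall i j, H i j = conjc (H j i).
Definition green H z : 'M[R[i]]_N := invmx (H - z%:M).

Lemma sum_mul_conjc (f : 'I_N -> R[i]) :
  \sum_j f j * conjc (f j) = (\sum_j modulus (f j) ^+ 2)%:C.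
Proof. by rewrite rmorph_sum /=; apply: eq_bigr => j _; rewrite mul_conjc_modulus. Qed.

Lemma sum_modulus_sqr_eq0 (f : 'I_N -> R[i]) :
  \sum_j modulus (f j) ^+ 2 = 0 -> forall j, f j = 0.
Proof.
move=> /eqP; rewrite psumr_eq0; last by move=> j _; exact: sqr_ge0.
by move=> /allP h j; apply/eqP; rewrite -modulus_eq0 -sqrf_eq0; apply: h; rewrite mem_index_enum.
Qed.

(** A left null vector v would make the real number v H v^* equal to z |v|^2. *)
Lemma hermitian_unit H z : hermitian H -> 0 < complex.Im z -> H - z%:M \in unitmx.
Proof.
move=> hH z0; rewrite unitmxE unitfE; apply/negP => /det0P[v v0 hv].
have hz j : \sum_k v 0 k * H k j = z * v 0 j.
  have /matrixP/(_ 0 j) := hv; rewrite mulmxBr !mxE => /eqP; rewrite subr_eq0 => /eqP ->.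
  rewrite (bigD1 j)//= !mxE eqxx mulr1n big1 ?addr0 1?mulrC// => k kj.
  by rewrite !mxE (negbTE kj) mulr0n mulr0.
pose S := \sum_j (\sum_k v 0 k * H k j) * conjc (v 0 j).
have S1 : S = z * (\sum_j modulus (v 0 j) ^+ 2)%:C.
  rewrite -sum_mul_conjc mulr_sumr; apply: eq_bigr => j _.
  by rewrite hz mulrA.
have S2 : conjc S = S.
  rewrite rmorph_sum /=.
  under eq_bigr do rewrite rmorphM /= conjcK rmorph_sum /= mulr_suml.
  rewrite exchange_big /=; apply: eq_bigr => k _; rewrite mulr_suml; apply: eq_bigr => j _.
  by rewrite rmorphM /= -hH; ring.
have : complex.Im S = 0 by move: (congr1 (@complex.Im R) S2); rewrite Im_conjc; lra.
rewrite S1 ImM /= mulr0 add0r => /eqP; rewrite mulf_eq0 (gt_eqF z0) /= => /eqP h.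
have hv0 := sum_modulus_sqr_eq0 h.
by move/negP: v0; apply; apply/eqP/rowP => j; rewrite hv0 mxE.
Qed.

Section Fixed.
Variables (H : 'M[R[i]]_N) (z : R[i]).
Hypotheses (hH : hermitian H) (z0 : 0 < complex.Im z).
Local Notation G := (green H z).
Local Notation eta := (complex.Im z).

Lemma greenK : G *m (H - z%:M) = 1%:M.
Proof. by rewrite mulVmx// hermitian_unit. Qed.
Lemma greenVK : (H - z%:M) *m G = 1%:M.
Proof. by rewrite mulmxV// hermitian_unit. Qed.

Lemma green_mulr i j : \sum_k G i k * H k j - z * G i j = (i == j)%:R.
Proof.
have /matrixP/(_ i j) := greenK; rewrite mulmxBr mul_mx_scalar !mxE => <-.
by [].
Qed.
Lemma green_mull i j : \sum_k H i k * G k j - z * G i j = (i == j)%:R.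
Proof.
have /matrixP/(_ i j) := greenVK; rewrite mulmxBl mul_scalar_mx !mxE => <-.
by [].
Qed.

(** [D] is the adjoint of [G] and [Mb] its inverse. The resolvent identity between [G] and [D], in
    both orders of the factors, gives Ward's identity for rows and for columns. *)
Let D : 'M[R[i]]_N := map_mx conjc G^T.
Let Mb : 'M[R[i]]_N := H - (conjc z)%:M.

Let MbE : Mb = map_mx conjc (H - z%:M)^T.
Proof.
apply/matrixP => i j; rewrite !mxE rmorphB /= -hH; congr (_ - _).
by rewrite eq_sym rmorphMn.
Qed.

Let DK : D *m Mb = 1%:M.
Proof. by rewrite MbE -map_mxM -trmx_mul greenVK trmx1 map_mx1. Qed.
Let DVK : Mb *m D = 1%:M.
Proof. by rewrite MbE -map_mxM -trmx_mul greenK trmx1 map_mx1. Qed.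

Let zB : z - conjc z = (2 * eta)%:C * 'i%C.
Proof. by apply/eqP; rewrite eq_complex; case: (z) => a b /=; apply/andP; split; apply/eqP; ring. Qed.

Let MbB : Mb - (H - z%:M) = (z - conjc z)%:M.
Proof. by apply/matrixP => i j; rewrite !mxE; case: (i == j); rewrite ?mulr1n ?mulr0n; ring. Qed.

Let GD : G - D = (z - conjc z) *: (G *m D).
Proof.
rewrite -mul_scalar_mx -MbB mulmxA.
have -> : (Mb - (H - z%:M)) *m G *m D = Mb *m G *m D - (H - z%:M) *m G *m D.
  by rewrite mulmxBl mulmxBl.
rewrite greenVK mul1mx.
have comm : (z - conjc z)%:M *m G = G *m (z - conjc z)%:M by rewrite scalar_mxC.
have : Mb *m G *m D = G; last by move=> ->.
have -> : Mb *m G = G *m Mb.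
  have -> : Mb = (H - z%:M) + (z - conjc z)%:M by rewrite -MbB addrC subrK.
  by rewrite mulmxDl mulmxDr comm greenK greenVK.
by rewrite -mulmxA DVK mulmx1.
Qed.

Let DG : G - D = (z - conjc z) *: (D *m G).
Proof.
rewrite -mul_mx_scalar -MbB -mulmxA mulmxBr.
have -> : G *m Mb = Mb *m G.
  have -> : Mb = (H - z%:M) + (z - conjc z)%:M by rewrite -MbB addrC subrK.
  by rewrite mulmxDl mulmxDr scalar_mxC greenK greenVK.
by rewrite greenK mulmxBr mulmxA DK mul1mx mulmx1.
Qed.

Let im_factor (w : R[i]) (s : R) : w - conjc w = (z - conjc z) * s%:C -> complex.Im w = eta * s.
Proof.
rewrite zB => /(congr1 (@complex.Im R)); rewrite ImD ImN Im_conjc opprK !ImM !ReM /=.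
by move=> h; lra.
Qed.

Lemma ward_row i : complex.Im (G i i) = eta * \sum_j modulus (G i j) ^+ 2.
Proof.
apply: im_factor; rewrite -sum_mul_conjc.
have /matrixP/(_ i i) := GD; rewrite !mxE => ->; congr (_ * _).
by apply: eq_bigr => j _; rewrite !mxE.
Qed.

Lemma ward_col i : complex.Im (G i i) = eta * \sum_j modulus (G j i) ^+ 2.
Proof.
apply: im_factor; rewrite -sum_mul_conjc.
have /matrixP/(_ i i) := DG; rewrite !mxE => ->; congr (_ * _).
by apply: eq_bigr => j _; rewrite !mxE mulrC.
Qed.

Lemma green_diag_Im_gt0 i : 0 < complex.Im (G i i).
Proof.
rewrite ward_row mulr_gt0// lt_def sumr_ge0 ?andbT; last by move=> j _; exact: sqr_ge0.
apply/eqP => h; have h0 := sum_modulus_sqr_eq0 h.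
have := green_mulr i i; rewrite eqxx h0 mulr0 subr0 big1 ?mulr1n//.
  by move=> /eqP; rewrite eq_sym oner_eq0.
by move=> k _; rewrite h0 mul0r.
Qed.

Lemma green_diag_neq0 i : G i i != 0.
Proof. by apply: contraTneq (green_diag_Im_gt0 i) => ->; rewrite ltxx. Qed.

Let sum_ge_entry (f : 'I_N -> R[i]) j : modulus (f j) ^+ 2 <= \sum_k modulus (f k) ^+ 2.
Proof. by rewrite (bigD1 j)//= lerDl sumr_ge0// => k _; exact: sqr_ge0. Qed.

(** On the diagonal Ward's identity gives eta |G_ii|^2 <= Im G_ii <= |G_ii|; off the diagonal
    |G_ij|^2 <= Im G_ii / eta. *)
Lemma modulus_green i j : modulus (G i j) <= eta^-1.
Proof.
have hii k : modulus (G k k) <= eta^-1.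
  have h := le_trans (ler_norm _) (Im_le_modulus (G k k)); rewrite ward_row in h.
  have h2 := sum_ge_entry (G k) k.
  have g0 : 0 < modulus (G k k) by rewrite modulus_gt0 green_diag_neq0.
  rewrite -[leRHS]mul1r ler_pdivlMr// -(ler_pM2l g0) mulr1.
  apply: le_trans h; rewrite mulrA mulrC; apply: ler_wpM2l; first exact: ltW.
  by rewrite -expr2.
have h := ward_row i; have h2 := sum_ge_entry (G i) j.
have h3 : complex.Im (G i i) <= eta^-1.
  by rewrite (le_trans (ler_norm _))// (le_trans (Im_le_modulus _)).
rewrite -ler_sqr ?nnegrE ?modulus_ge0 ?invr_ge0 ?(ltW z0)//.
apply: (le_trans h2); rewrite expr2.
rewrite -[leLHS](mulKf (lt0r_neq0 z0)) -h; apply: ler_wpM2l => //.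
by rewrite invr_ge0 ltW.
Qed.

Lemma green_row_sqr i : \sum_j modulus (G i j) ^+ 2 = complex.Im (G i i) / eta.
Proof. by rewrite ward_row mulrC mulKf// lt0r_neq0. Qed.
Lemma green_col_sqr i : \sum_j modulus (G j i) ^+ 2 = complex.Im (G i i) / eta.
Proof. by rewrite ward_col mulrC mulKf// lt0r_neq0. Qed.

End Fixed.

Lemma greenB H H' z z' : hermitian H -> hermitian H' -> 0 < complex.Im z -> 0 < complex.Im z' ->
  green H z - green H' z' = green H z *m ((H' - H) + (z - z')%:M) *m green H' z'.
Proof.
move=> hH hH' z0 z0'.
have -> : H' - H + (z - z')%:M = (H' - z'%:M) - (H - z%:M).
  by apply/matrixP => i j; rewrite !mxE; case: (i == j); rewrite ?mulr1n ?mulr0n; ring.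
rewrite mulmxBr mulmxBl greenK// mul1mx -mulmxA greenVK// mulmx1.
by [].
Qed.

Lemma green_lip H H' z z' d : hermitian H -> hermitian H' -> 0 < complex.Im z -> 0 < complex.Im z' ->
  (forall i j, i != j -> H i j = H' i j) -> (forall i, modulus (H' i i - H i i) <= d) ->
  forall i j, modulus (green H z i j - green H' z' i j) <=
    N%:R * ((complex.Im z)^-1 * (complex.Im z')^-1 * (d + modulus (z - z'))).
Proof.
move=> hH hH' z0 z0' hoff hd i j.
have /matrixP/(_ i j) := greenB hH hH' z0 z0'; rewrite !mxE => ->.
have -> : \sum_k (green H z *m (H' - H + (z - z')%:M)) i k * green H' z' k j =
    \sum_k green H z i k * (H' k k - H k k + (z - z')) * green H' z' k j.
  apply: eq_bigr => k _; rewrite !mxE; congr (_ * _).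
  rewrite (bigD1 k)//= big1 ?addr0; last first.
    by move=> l lk; rewrite !mxE (hoff _ _ lk) subrr add0r (negbTE lk) mulr0n mulr0.
  by rewrite !mxE eqxx mulr1n.
apply: (le_trans (modulus_sum _ _ _)).
rewrite mulr_natl -[X in _ *+ X]card_ord -sumr_const; apply: ler_sum => k _.
rewrite !modulusM mulrAC; apply: ler_pM; rewrite ?mulr_ge0 ?modulus_ge0//.
  by apply: ler_pM; rewrite ?modulus_ge0 ?modulus_green.
by rewrite (le_trans (modulusD _ _))// lerD2r.
Qed.

(* Removing row and column [i] without changing the dimension. *)
Definition zero_out i H : 'M[R[i]]_N :=
  \matrix_(a, b) if (a == i) || (b == i) then 0 else H a b.

Lemma hermitian_zero_out i H : hermitian H -> hermitian (zero_out i H).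
Proof.
by move=> hH a b; rewrite !mxE orbC; case: ifP; rewrite ?conjc0// => _; exact: hH.
Qed.

Section Minor.
Variables (H : 'M[R[i]]_N) (z : R[i]) (i : 'I_N).
Hypotheses (hH : hermitian H) (z0 : 0 < complex.Im z).
Local Notation G := (green H z).
Local Notation G0 := (green (zero_out i H) z).
Local Notation eta := (complex.Im z).

Let hH0 := hermitian_zero_out i hH.

Let z_neq0 : z != 0. Proof. by apply: contraTneq z0 => ->; rewrite ltxx. Qed.

Lemma minor_row j : j != i -> G0 i j = 0.
Proof.
move=> ji; have := green_mull hH0 z0 i j; rewrite eq_sym (negbTE ji) big1; last first.
  by move=> k _; rewrite mxE eqxx mul0r.
by rewrite sub0r => /eqP; rewrite oppr_eq0 mulf_eq0 (negbTE z_neq0) => /eqP.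
Qed.

Lemma minor_col j : j != i -> G0 j i = 0.
Proof.
move=> ji; have := green_mulr hH0 z0 j i; rewrite (negbTE ji) big1; last first.
  by move=> k _; rewrite mxE eqxx orbT mulr0.
by rewrite sub0r => /eqP; rewrite oppr_eq0 mulf_eq0 (negbTE z_neq0) => /eqP.
Qed.

Definition minor_rowsum j := \sum_b H i b * G0 b j.
Definition minor_colsum j := \sum_a G0 j a * H a i.
(** Zeroing out row and column i leaves one spurious entry in the resolvent, -1 / z at (i, i).
    Clearing column i removes it, and row i then vanishes as well, so this is the resolvent of the
    true minor padded by zeros. *)
Definition minor_mx : 'M[R[i]]_N := \matrix_(a, b) if b == i then 0 else G0 a b.
Definition minor_quad := \sum_a \sum_b H i a * minor_mx a b * H b i.

(** In G - G0 = G (H0 - H) G0 the middle factor lives on row and column i, and G0 i j = 0 removes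
    its column part. *)
Lemma schur_row r j : j != i -> G r j = G0 r j - G r i * minor_rowsum j.
Proof.
move=> ji; have /matrixP/(_ r j) := greenB hH hH0 z0 z0; rewrite !mxE subrr => /eqP.
rewrite subr_eq => /eqP ->; rewrite addrC; congr (_ + _).
rewrite /minor_rowsum mulr_sumr -sumrN; apply: eq_bigr => b _.
have [->|bi] := eqVneq b i; first by rewrite minor_row// !mulr0 oppr0.
rewrite mulrA -mulNr; congr (_ * _); rewrite !mxE (bigD1 i)//= !mxE eqxx /= mul0rn addr0 sub0r mulrN.
rewrite big1 ?addr0// => a ai; rewrite !mxE (negbTE ai) (negbTE bi) /= mul0rn addr0 subrr mulr0//.
Qed.

Lemma schur_col j c : j != i -> G j c = G0 j c - minor_colsum j * G i c.
Proof.
move=> ji; have /matrixP/(_ j c) := greenB hH0 hH z0 z0; rewrite !mxE subrr => /eqP.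
rewrite subr_eq => /eqP e; apply/eqP; rewrite eq_sym subr_eq addrC [X in _ == X + _](_ : _ =
  \sum_k (G0 *m (H - zero_out i H + 0%:M)) j k * G k c); last first.
  rewrite [RHS](bigD1 i)//= [X in _ = _ + X]big1 ?addr0; last first.
    move=> k ki; rewrite !mxE big1 ?mul0r// => a _; rewrite !mxE (negbTE ki) orbF mul0rn addr0.
    by have [->|ai] := eqVneq a i; rewrite ?minor_col ?mul0r// subrr mulr0.
  congr (_ * _); rewrite !mxE; apply: eq_bigr => a _.
  by rewrite !mxE eqxx orbT mul0rn addr0 subr0.
by rewrite e.
Qed.

Lemma minor_mxE a b : minor_mx a b = if (a == i) || (b == i) then 0 else G0 a b.
Proof.
rewrite mxE; case: eqVneq => [|bi]; rewrite ?orbT ?orbF//.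
by case: eqVneq => // ->; rewrite minor_row.
Qed.

Lemma schur_diag : G i i * (H i i - z - minor_quad) = 1.
Proof.
have e := green_mulr hH z0 i i; rewrite eqxx in e; rewrite -[RHS]/(true%:R) -e.
rewrite (bigD1 i)//= mulrBr mulrBr -addrA -[RHS]addrA; congr (_ + _).
rewrite [RHS]addrC mulrC; congr (_ + _).
rewrite /minor_quad mulr_sumr -sumrN.
transitivity (\sum_a \sum_b - (G i i * (H i a * minor_mx a b * H b i))).
  by apply: eq_bigr => a _; rewrite mulr_sumr sumrN.
rewrite exchange_big /= (bigD1 i)//= [X in X + _]big1 ?add0r; last first.
  by move=> a _; rewrite mxE eqxx mulr0 mul0r mulr0 oppr0.
apply: eq_bigr => b bi; rewrite (schur_row _ bi) (minor_row bi) sub0r /minor_rowsum.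
rewrite mulr_sumr mulNr mulr_suml -sumrN; apply: eq_bigr => a _.
by rewrite mxE (negbTE bi) !mulrA.
Qed.

Lemma minor_diag j : j != i -> G j j = G0 j j + G j i * G i j / G i i.
Proof.
move=> ji; have gi := green_diag_neq0 hH z0 i.
rewrite [LHS](schur_row _ ji); congr (_ + _).
have := schur_row i ji; rewrite (minor_row ji) sub0r => ->.
by move: gi; set x := G i i; set y := minor_rowsum j; set w := G j i => x0; field.
Qed.

(** The differences of the diagonal entries are G_ki G_ik / G_ii for every k, also for k = i. Their
    sum is bounded by the arithmetic-geometric inequality and both forms of Ward's identity. *)
Lemma trace_minor : modulus (\tr G - \sum_k minor_mx k k) <= eta^-1.
Proof.
have gi := green_diag_neq0 hH z0 i.
have -> : \tr G - \sum_k minor_mx k k = (\sum_k G k i * G i k) / G i i.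
  rewrite /mxtrace -sumrB mulr_suml; apply: eq_bigr => k _.
  have [->|ki] := eqVneq k i; first by rewrite mxE eqxx subr0 mulfK.
  by rewrite mxE (negbTE ki) (minor_diag ki) addrC addKr.
rewrite modulusM modulusV ler_pdivrMr ?modulus_gt0//.
apply: (le_trans (modulus_sum _ _ _)).
apply: (@le_trans _ _ (2^-1 * (\sum_k modulus (G k i) ^+ 2 + \sum_k modulus (G i k) ^+ 2))).
  rewrite -big_split /= mulr_sumr; apply: ler_sum => k _; rewrite modulusM.
  by have := sqr_ge0 (modulus (G k i) - modulus (G i k)); rewrite sqrrB; lra.
rewrite green_col_sqr// green_row_sqr//.
have : complex.Im (G i i) <= modulus (G i i) by rewrite (le_trans (ler_norm _))// Im_le_modulus.
have : 0 < eta^-1 by rewrite invr_gt0.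
set e := eta^-1; set x := complex.Im _; set y := modulus _ => e0 xy; nra.
Qed.

Lemma minor_mx_sqr : \sum_a \sum_b modulus (minor_mx a b) ^+ 2 = complex.Im (\sum_k minor_mx k k) / eta.
Proof.
rewrite exchange_big /= Im_sum mulr_suml; apply: eq_bigr => b _.
rewrite mxE; case: eqVneq => [->|bi] /=.
  by rewrite mul0r big1// => a _; rewrite mxE eqxx modulus0 expr0n.
rewrite -green_col_sqr//; apply: eq_bigr => a _; by rewrite mxE (negbTE bi).
Qed.

End Minor.

Lemma zero_out_ext i H H' : (forall a b, a != i -> b != i -> H a b = H' a b) ->
  zero_out i H = zero_out i H'.
Proof.
move=> h; apply/matrixP => a b; rewrite !mxE; have [|ai] := eqVneq a i => //=.
by have [|bi] := eqVneq b i => //=; exact: h.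
Qed.

(** The entry (i, i) is the one left free, which is why v_i can be resampled without changing the
    quadratic form. *)
Lemma minor_quad_ext z i H H' : (forall a b, a != i -> b != i -> H a b = H' a b) ->
  (forall a, a != i -> H i a = H' i a) -> (forall a, a != i -> H a i = H' a i) ->
  hermitian H -> hermitian H' -> 0 < complex.Im z ->
  minor_quad H z i = minor_quad H' z i.
Proof.
move=> h hr hc hH hH' z0; rewrite /minor_quad /minor_mx (zero_out_ext h).
apply: eq_bigr => a _; apply: eq_bigr => b _; rewrite !mxE.
have [|bi] := eqVneq b i; first by rewrite !mulr0 !mul0r.
have [->|ai] := eqVneq a i; first by rewrite minor_row// !mulr0 !mul0r.
by rewrite hr// hc.
Qed.

End ResolventAlgebra.

(** * Schur's formula for the deformed matrix *)

Section Hamiltonian.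
Context {R : realType} (N : nat).
Implicit Types (lam : R) (v : 'rV[R]_N) (W : 'M[R[i]]_N) (z : R[i]) (i j : 'I_N).

Lemma hamiltonianE lam v W i j :
  hamiltonian lam v W i j = (if i == j then (lam * v 0 i)%:C else 0) + W i j.
Proof.
rewrite !mxE; congr (_ + _); case: eqVneq => [->|_]; last by rewrite mulr0n mulr0.
by rewrite mulr1n -rmorphM.
Qed.

Lemma hermitian_hamiltonian lam v W : hermitian W -> hermitian (hamiltonian lam v W).
Proof.
move=> hW i j; rewrite !hamiltonianE [W i j]hW raddfD /=; congr (_ + _).
by rewrite eq_sym; case: eqVneq => [->|_]; rewrite ?conjc0// conjc_real.
Qed.

Lemma resolventE lam v W z : resolvent lam v W z = green (hamiltonian lam v W) z.
Proof. by []. Qed.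

(* The error term of the self-consistent equation; it does not involve [v 0 i]. *)
Definition schur_error lam v W z i : R[i] :=
  minor_quad (hamiltonian lam v W) z i - mN lam v W z - W i i.

Lemma schur_error_diag lam v W z i : hermitian W -> 0 < complex.Im z ->
  resolvent lam v W z i i * ((lam * v 0 i)%:C - (z + mN lam v W z) - schur_error lam v W z i) = 1.
Proof.
move=> hW z0; rewrite -[RHS](schur_diag i (hermitian_hamiltonian lam v hW) z0).
rewrite resolventE hamiltonianE eqxx /schur_error.
by congr (_ * _); move: (minor_quad _ _ _) (mN _ _ _ _) (_%:C) (W i i) => a b e f; ring.
Qed.

(** The average [mN] of the original [v] may remain, although the matrix is changed, since it
    cancels between z + mN and [schur_error]. *)
Lemma schur_error_set_entry lam v W z i x : hermitian W -> 0 < complex.Im z ->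
  resolvent lam (set_entry v i x) W z i i *
    ((lam * x)%:C - (z + mN lam v W z) - schur_error lam v W z i) = 1.
Proof.
move=> hW z0; have hH' := hermitian_hamiltonian lam (set_entry v i x) hW.
have := schur_diag i hH' z0; rewrite -resolventE hamiltonianE !mxE !eqxx /schur_error.
have -> : minor_quad (hamiltonian lam (set_entry v i x) W) z i = minor_quad (hamiltonian lam v W) z i.
  apply: minor_quad_ext z0.
- by move=> a b ai bi; rewrite !hamiltonianE mxE (negbTE ai).
- by move=> a ai; rewrite !hamiltonianE eq_sym (negbTE ai).
- by move=> a ai; rewrite !hamiltonianE (negbTE ai).
- exact: hH'.
- exact: hermitian_hamiltonian.
move: (resolvent _ _ _ _ _ _) (minor_quad _ _ _) (mN _ _ _ _) (_%:C) (W i i) => g a b e f <-.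
by congr (g * _); ring.
Qed.

Lemma Im_mN lam v W z : 0 < complex.Im z -> (0 < N)%N -> hermitian W ->
  0 < complex.Im (mN lam v W z).
Proof.
move=> z0 N0 hW; rewrite /mN (_ : (N%:R^-1 : R[i]) = (N%:R^-1)%:C); last first.
  by rewrite rmorphV ?unitfE ?pnatr_eq0 -?lt0n//= rmorph_nat.
rewrite ImM /= mul0r addr0 mulr_gt0// ?invr_gt0 ?ltr0n// Im_sum.
have hpos i := green_diag_Im_gt0 (hermitian_hamiltonian lam v hW) z0 i.
rewrite (bigD1 (Ordinal N0))//= ltr_wpDr// sumr_ge0// => i _; exact/ltW.
Qed.

Lemma invC_nat (n : nat) : (n%:R^-1 : R[i]) = (n%:R^-1 : R)%:C.
Proof. by rewrite fmorphV /= rmorph_nat. Qed.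

Lemma modulus_average (f : 'I_N -> R[i]) (b : R) : (0 < N)%N ->
  (forall k, modulus (f k) <= b) -> modulus (N%:R^-1 * \sum_k f k) <= b.
Proof.
move=> N0 h; rewrite modulusM invC_nat modulus_real ger0_norm ?invr_ge0//.
rewrite mulrC ler_pdivrMr ?ltr0n// mulrC.
apply: (le_trans (modulus_sum _ _ _)); apply: (@le_trans _ _ (\sum_(k < N) b)).
  by apply: ler_sum => k _.
by rewrite sumr_const card_ord mulr_natl.
Qed.

Lemma modulus_mN lam v W z : 0 < complex.Im z -> (0 < N)%N -> hermitian W ->
  modulus (mN lam v W z) <= (complex.Im z)^-1.
Proof.
move=> z0 N0 hW; apply: modulus_average => // k.
exact: (modulus_green (hermitian_hamiltonian lam v hW) z0).
Qed.

Lemma mN_lip lam v W y z z' : 0 < y -> y <= complex.Im z -> y <= complex.Im z' -> (0 < N)%N ->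
  hermitian W ->
  modulus (mN lam v W z - mN lam v W z') <= N%:R * y ^- 2 * modulus (z - z').
Proof.
move=> y0 yz yz' N0 hW; have z0 := lt_le_trans y0 yz; have z0' := lt_le_trans y0 yz'.
rewrite /mN -mulrBr /mxtrace -sumrB; apply: modulus_average => // k.
have hH := hermitian_hamiltonian lam v hW.
have := @green_lip _ _ _ _ z z' 0 hH hH z0 z0' (fun _ _ _ => erefl) _ k k.
rewrite add0r => h; apply: le_trans (h _) _ => [i|].
  by rewrite subrr modulus0.
rewrite -[leRHS]mulrA; apply: ler_wpM2l; first exact: ler0n.
apply: ler_wpM2r; first exact: modulus_ge0.
by rewrite -exprVn [leRHS]expr2; apply: ler_pM; rewrite ?lef_pV2// invr_ge0 ltW.
Qed.

End Hamiltonian.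

(** * The local law for a good sample *)

Section SelfConsistent.
Context {R : realType} (mu : probability (measurableTypeR R) R).
Hypothesis hsupp : mu (~` [set v : R | -1 <= v <= 1]) = 0%E.
Variables (N : nat) (c Y1 Phi CH : R).
Hypotheses (N_gt0 : (0 < N)%N) (c_gt0 : 0 < c) (c_le1 : c <= 1).
Hypotheses (Phi_ge1 : 1 <= Phi) (CH_ge0 : 0 <= CH).
Variables (v : 'rV[R]_N) (W : 'M[R[i]]_N) (lam : R) (w : R[i]) (om : R).
Hypotheses (hW : hermitian W) (hv : forall i, -1 <= v 0 i <= 1).
Hypothesis hWdiag : forall i, modulus (W i i) <= Phi / Num.sqrt N%:R.
Hypotheses (w_gt0 : 0 < complex.Im w) (w_le : complex.Im w <= Y1) (Y1_ge1 : 1 <= Y1).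
Hypotheses (om_gt0 : 0 < om) (om_le1 : om <= 1).
Hypothesis om_def : om ^+ 3 = Phi ^+ 2 / (N%:R * complex.Im w).

Local Notation H := (hamiltonian lam v W).
Local Notation m := (mN lam v W w).
Local Notation zeta := (w + m).
Local Notation eta := (complex.Im w).
Local Notation y := (complex.Im zeta).
Local Notation eps := (schur_error lam v W w).
Local Notation G := (resolvent lam v W w).

(** The factor 2 comes from estimating diagonal and off-diagonal parts separately; the summand 1 / N
    is slack for passing from a net to all parameters. *)
Definition quad_concentrated i := modulus (minor_quad H w i - N%:R^-1 * \sum_k minor_mx H w i k k)
  <= 2 * Phi / N%:R * Num.sqrt (\sum_a \sum_b modulus (minor_mx H w i a b) ^+ 2) + N%:R^-1.
Hypothesis hquad : forall i, quad_concentrated i.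
Hypothesis hoff : off_support (c / 2) lam zeta.
Hypothesis om_small1 : 28 * om ^+ 3 <= c / 16.
Hypothesis om_small2 : 28 * om ^+ 4 <= c ^+ 2 / 32.

Let NR0 : (0 : R) < N%:R. Proof. by rewrite ltr0n. Qed.
Let Neta0 : 0 < N%:R * eta. Proof. exact: mulr_gt0. Qed.
Let hH : hermitian H. Proof. exact: hermitian_hamiltonian. Qed.
Let Imm0 : 0 < complex.Im m. Proof. exact: Im_mN. Qed.
Let y_gt0 : 0 < y. Proof. by rewrite raddfD /= addr_gt0. Qed.

Let Phi0 : 0 < Phi. Proof. exact: lt_le_trans Phi_ge1. Qed.
Let Phi2 : 1 <= Phi ^+ 2.
Proof. by rewrite -[1](expr1n _ 2) lerXn2r ?nnegrE ?ler01// ltW. Qed.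
Let o0 : 0 <= om. Proof. exact: ltW. Qed.

Let invN_le : (N%:R^-1 : R) ^+ 2 <= om ^+ 3 * y.
Proof.
apply: (@le_trans _ _ (om ^+ 3 * eta)); last first.
  by apply: ler_wpM2l; rewrite ?exprn_ge0// raddfD /= lerDl ltW.
rewrite (_ : om ^+ 3 * eta = Phi ^+ 2 / N%:R); last by rewrite om_def; field; rewrite !gt_eqF.
rewrite expr2; apply: ler_wpM2r; first by rewrite invr_ge0 ltW.
by apply: le_trans Phi2; rewrite invf_le1// ler1n.
Qed.

(** Four contributions: fluctuation of the quadratic form, net slack, removal of one row from the
    trace, and W_ii. Their squares are at most 4, 1, 1 and 1 times om^3 (y + om), and squaring a sum
    of four costs another 4. The first uses Ward's identity for the minor. *)
Lemma schur_error_sqr i : modulus (eps i) ^+ 2 <= 28 * om ^+ 3 * (y + om).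
Proof.
have hs4 (a b e f : R) : (a + b + e + f) ^+ 2 <= 4 * (a ^+ 2 + b ^+ 2 + e ^+ 2 + f ^+ 2).
  have := sqr_ge0 (a - b); have := sqr_ge0 (a - e); have := sqr_ge0 (a - f).
  have := sqr_ge0 (b - e); have := sqr_ge0 (b - f); have := sqr_ge0 (e - f); nra.
set S : R := \sum_a \sum_b modulus (minor_mx H w i a b) ^+ 2.
have hD : modulus (N%:R^-1 * \sum_k minor_mx H w i k k - m) <= (N%:R * eta)^-1.
  rewrite -mulrBr modulusM invC_nat modulus_real ger0_norm; last by rewrite invr_ge0 ltW.
  rewrite invfM ler_pM2l ?invr_gt0// -modulusN opprB.
  exact: (trace_minor i hH w_gt0).
have S_eq : S = complex.Im (\sum_k minor_mx H w i k k) / eta by apply: minor_mx_sqr.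
have S_le : S <= N%:R / eta * (complex.Im m + (N%:R * eta)^-1).
  have := le_trans (ler_norm _) (le_trans (Im_le_modulus _) hD).
  rewrite ImD ImN invC_nat ImM /= mul0r addr0 lerBlDl => h.
  rewrite S_eq mulrAC ler_pM2r ?invr_gt0// mulrC -ler_pdivrMr//.
  by rewrite mulrC addrC addrC.
have S_ge0 : 0 <= S by apply: sumr_ge0 => a _; apply: sumr_ge0 => b _; exact: sqr_ge0.
have iNe : (N%:R * eta)^-1 <= om ^+ 3 by rewrite om_def ler_peMl// invr_ge0; exact: ltW.
have om3 : om ^+ 3 <= om by rewrite exprS ler_piMr// exprn_ile1.
have mod_eps : modulus (eps i) <= 2 * Phi / N%:R * Num.sqrt S + N%:R^-1 + (N%:R * eta)^-1 + Phi / Num.sqrt N%:R.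
  rewrite /schur_error (_ : _ - _ - _ = (minor_quad H w i - N%:R^-1 * \sum_k minor_mx H w i k k) +
     (N%:R^-1 * \sum_k minor_mx H w i k k - m) - W i i); last first.
    by move: (N%:R^-1 * _) => a; ring.
  apply: (le_trans (modulusB _ _)); apply: lerD; last exact: hWdiag.
  by apply: (le_trans (modulusD _ _)); apply: lerD => //; exact: hquad.
have t1 : (2 * Phi / N%:R * Num.sqrt S) ^+ 2 <= 4 * (om ^+ 3 * (y + om)).
  rewrite exprMn sqr_sqrtr//.
  apply: (@le_trans _ _ ((2 * Phi / N%:R) ^+ 2 * (N%:R / eta * (complex.Im m + (N%:R * eta)^-1)))).
    by apply: ler_wpM2l; first exact: sqr_ge0.
  rewrite (_ : _ * _ = 4 * (om ^+ 3 * (complex.Im m + (N%:R * eta)^-1))); last first.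
    by rewrite om_def; field; rewrite !gt_eqF.
  rewrite ler_pM2l//; apply: ler_wpM2l; first exact: exprn_ge0.
  apply: lerD; last exact: le_trans iNe om3.
  by rewrite raddfD /= lerDr ltW.
have t3 : (N%:R * eta)^-1 ^+ 2 <= om ^+ 3 * om.
  by rewrite [leLHS]expr2; apply: ler_pM; rewrite ?invr_ge0 ?(ltW Neta0)//; exact: le_trans iNe om3.
have t4 : (Phi / Num.sqrt N%:R) ^+ 2 <= om ^+ 3 * y.
  rewrite exprMn exprVn sqr_sqrtr; last exact: ltW.
  rewrite (_ : Phi ^+ 2 / N%:R = om ^+ 3 * eta).
    by apply: ler_wpM2l; rewrite ?exprn_ge0// raddfD /= lerDl ltW.
  by rewrite om_def; field; rewrite !gt_eqF.
apply: (@le_trans _ _ ((2 * Phi / N%:R * Num.sqrt S + N%:R^-1 + (N%:R * eta)^-1 + Phi / Num.sqrt N%:R) ^+ 2)).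
  by rewrite lerXn2r ?nnegrE ?modulus_ge0//; apply: le_trans mod_eps; exact: modulus_ge0.
apply: (le_trans (hs4 _ _ _ _)).
have p1 : 0 <= om ^+ 3 * y by apply: mulr_ge0; [exact: exprn_ge0|exact: ltW].
have p2 : 0 <= om ^+ 3 * om by rewrite mulr_ge0 ?exprn_ge0.
move: t1 t3 t4 invN_le p1 p2; rewrite mulrDr [28 * _ * _]mulrDr.
rewrite -[28 * _ * y]mulrA -[28 * _ * om]mulrA.
move: (om ^+ 3 * y) (om ^+ 3 * om) => A B.
move: ((_ * Num.sqrt S) ^+ 2) ((N%:R^-1) ^+ 2) ((N%:R * eta)^-1 ^+ 2) ((_ / Num.sqrt _) ^+ 2) => a b e f.
lra.
Qed.

(** The distance M from lam x to zeta is at least c / 2 and also at least y = Im zeta. The second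
    bound absorbs the factor y of [schur_error_sqr], so no upper bound on y is involved. *)
Lemma schur_error_small i (x : R) : -1 <= x <= 1 ->
  modulus (eps i) <= modulus ((lam * x)%:C - zeta) / 2.
Proof.
move=> hx; set M := modulus (_ - zeta).
have Mc : c / 2 <= M by exact: hoff.
have My : y <= M by exact: kernel_den_ge.
have c2 : 0 < c / 2 by rewrite divr_gt0.
have M0 : 0 < M by exact: lt_le_trans Mc.
have h := schur_error_sqr i.
rewrite -(@ler_pXn2r _ 2)// ?nnegrE ?modulus_ge0//; last by rewrite divr_ge0// ltW.
apply: (le_trans h); rewrite mulrDr.
have h1 : 28 * om ^+ 3 * y <= M ^+ 2 / 8.
  apply: (@le_trans _ _ (c / 16 * M)).
    by apply: ler_pM => //; [rewrite mulr_ge0// exprn_ge0|exact: ltW].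
  have : c / 2 * M <= M ^+ 2 by rewrite expr2 ler_pM2r.
  lra.
have h2 : 28 * om ^+ 3 * om <= M ^+ 2 / 8.
  rewrite -mulrA -exprSr; apply: (le_trans om_small2).
  have : (c / 2) ^+ 2 <= M ^+ 2 by rewrite lerXn2r// nnegrE ltW.
  rewrite (_ : (c / 2) ^+ 2 = c ^+ 2 / 4); last by field.
  lra.
rewrite (_ : (M / 2) ^+ 2 = M ^+ 2 / 4); last by field.
lra.
Qed.

(* Both the diagonal resolvent entries and their [v_i]-resampled versions are of this form. *)
Lemma perturbed_kernel i (x : R) (g : R[i]) : -1 <= x <= 1 ->
  g * ((lam * x)%:C - zeta - eps i) = 1 ->
  modulus g <= 4 / c /\ modulus (g - cauchy_kernel lam zeta x) <= 8 / c ^+ 2 * modulus (eps i).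
Proof.
move=> hx; set D := (lam * x)%:C - zeta => hg.
have hs := schur_error_small i hx; rewrite -/D in hs.
have Dc : c / 2 <= modulus D by exact: hoff.
have c2 : 0 < c / 2 by rewrite divr_gt0.
have D0 : 0 < modulus D by exact: lt_le_trans Dc.
have g_le : modulus g <= 4 / c.
  have g1 : modulus g * modulus (D - eps i) = 1 by rewrite -modulusM hg modulus1.
  have hd : c / 4 <= modulus (D - eps i) by have := modulus_lerB D (eps i); lra.
  have c4 : 0 < c / 4 by rewrite divr_gt0.
  have d0 := lt_le_trans c4 hd.
  rewrite -(ler_pM2r d0) g1 -[X in X <= _](_ : 4 / c * (c / 4) = 1); last by field; rewrite gt_eqF.
  by rewrite ler_pM2l// divr_gt0.
split=> //; have Dn : D != 0 by rewrite -modulus_gt0.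
rewrite (_ : g - _ = eps i * g * cauchy_kernel lam zeta x); last first.
  rewrite /cauchy_kernel -/D -[X in X - _](mulfK Dn) -[X in _ - X]mul1r -mulrBl; congr (_ * _).
  by rewrite -hg; move: (eps i) => e; clearbody D; ring.
rewrite !modulusM -mulrA [leLHS]mulrC; apply: ler_wpM2r; first exact: modulus_ge0.
rewrite (_ : 8 / c ^+ 2 = 4 / c * (2 / c)); last by field; rewrite gt_eqF.
apply: ler_pM; rewrite ?modulus_ge0//.
by rewrite /cauchy_kernel modulusV -/D -[2 / c]invf_div lef_pV2.
Qed.

Lemma modulus_resolvent_diag i : modulus (G i i) <= 4 / c.
Proof. exact: (perturbed_kernel (hv i) (schur_error_diag lam v i hW w_gt0)).1. Qed.

Lemma modulus_mN_le : modulus m <= 4 / c.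
Proof. by apply: modulus_average => // k; exact: modulus_resolvent_diag. Qed.

Hypothesis hlaw : modulus (N%:R^-1 * \sum_k cauchy_kernel lam zeta (v 0 k) - stieltjes mu lam zeta)
  <= CH * Phi / Num.sqrt N%:R + N%:R^-1.

Definition subord_error_const : R := 256 * 28 / c ^+ 4 + 4 * CH ^+ 2 + 4.

(** F(zeta) - w equals m - g(zeta). It is split at the empirical average of the kernels: the first
    difference consists of Schur errors, the second is the concentration of the v_i. *)
Lemma subord_error : modulus (subord_inv mu lam zeta - w) ^+ 2 <=
  subord_error_const * om ^+ 3 * (y + om).
Proof.
have hs3 (a b e : R) : (a + b + e) ^+ 2 <= 2 * a ^+ 2 + 4 * b ^+ 2 + 4 * e ^+ 2.
  have := sqr_ge0 (a - (b + e)); have := sqr_ge0 (b - e); nra.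
have hyom : 0 <= y + om by rewrite addr_ge0// ltW.
set E := 28 * om ^+ 3 * (y + om).
have E0 : 0 <= E by rewrite !mulr_ge0 ?exprn_ge0.
have h1 : modulus (m - N%:R^-1 * \sum_k cauchy_kernel lam zeta (v 0 k)) <= 8 / c ^+ 2 * Num.sqrt E.
  rewrite /mN -mulrBr /mxtrace -sumrB; apply: modulus_average => // k.
  apply: (le_trans (perturbed_kernel (hv k) (schur_error_diag lam v k hW w_gt0)).2).
  rewrite ler_pM2l ?divr_gt0 ?exprn_gt0//.
  by rewrite -[leLHS]ger0_norm ?modulus_ge0// -sqrtr_sqr ler_wsqrtr// schur_error_sqr.
have h2 : modulus (subord_inv mu lam zeta - w) <=
   8 / c ^+ 2 * Num.sqrt E + CH * Phi / Num.sqrt N%:R + N%:R^-1.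
  rewrite /subord_inv (_ : _ - w = (m - N%:R^-1 * \sum_k cauchy_kernel lam zeta (v 0 k)) +
    (N%:R^-1 * \sum_k cauchy_kernel lam zeta (v 0 k) - stieltjes mu lam zeta)); last first.
    by set a := N%:R^-1 * _; set b := stieltjes _ _ _; clearbody a b; ring.
  by apply: (le_trans (modulusD _ _)); rewrite -addrA lerD.
apply: (@le_trans _ _ ((8 / c ^+ 2 * Num.sqrt E + CH * Phi / Num.sqrt N%:R + N%:R^-1) ^+ 2)).
  by rewrite lerXn2r ?nnegrE ?modulus_ge0//; apply: le_trans h2; exact: modulus_ge0.
apply: (le_trans (hs3 _ _ _)).
have t2 : (CH * Phi / Num.sqrt N%:R) ^+ 2 <= CH ^+ 2 * (om ^+ 3 * y).
  rewrite !exprMn exprVn sqr_sqrtr; last exact: ltW.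
  rewrite -mulrA; apply: ler_wpM2l; first exact: sqr_ge0.
  rewrite (_ : Phi ^+ 2 / N%:R = om ^+ 3 * eta).
    by apply: ler_wpM2l; rewrite ?exprn_ge0// raddfD /= lerDl ltW.
  by rewrite om_def; field; rewrite !gt_eqF.
have t1 : (8 / c ^+ 2 * Num.sqrt E) ^+ 2 = 64 * 28 / c ^+ 4 * (om ^+ 3 * (y + om)).
  by rewrite exprMn sqr_sqrtr// /E; field; rewrite gt_eqF.
rewrite t1 /subord_error_const -[leRHS]mulrA.
have p1 : om ^+ 3 * y <= om ^+ 3 * (y + om) by apply: ler_wpM2l; rewrite ?exprn_ge0// lerDl.
have p2 : 0 <= om ^+ 3 * (y + om) by rewrite mulr_ge0 ?exprn_ge0.
have k0 : 0 <= 28 / c ^+ 4 by rewrite divr_ge0// exprn_ge0// ltW.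
have k1 : 0 <= CH ^+ 2 by exact: sqr_ge0.
have -> : 64 * 28 / c ^+ 4 = 64 * (28 / c ^+ 4) by rewrite mulrA.
have -> : 256 * 28 / c ^+ 4 = 256 * (28 / c ^+ 4) by rewrite mulrA.
have t2' := le_trans t2 (ler_wpM2l k1 p1); have t3' := le_trans invN_le p1.
move: t2' t3' p2 k0 k1; move: (om ^+ 3 * (y + om)) => A.
move: ((N%:R^-1) ^+ 2) ((_ / Num.sqrt _) ^+ 2) (28 / c ^+ 4) (CH ^+ 2) => e f k q fq eA A0 k0 q0.
have := mulr_ge0 k0 A0; have := mulr_ge0 q0 A0.
lra.
Qed.

Lemma partial_expectation_near i :
  modulus (partial_expectation_G mu lam v W w i - stieltjes mu lam zeta) <= 8 / c ^+ 2 * modulus (eps i).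
Proof.
(* Because eps_i does not see v_i, the resampled entry is exactly a Cauchy kernel in x, and its mean
   is a Stieltjes transform. *)
have hx x : resolvent lam (set_entry v i x) W w i i = cauchy_kernel lam (zeta + eps i) x.
  have := schur_error_set_entry lam v i x hW w_gt0; rewrite -addrA -opprD => hg.
  have dn : (lam * x)%:C - (zeta + eps i) != 0.
    by apply/eqP => h0; move: hg; rewrite h0 mulr0 => /eqP; rewrite eq_sym oner_eq0.
  by rewrite /cauchy_kernel -[LHS](mulfK dn) hg mul1r.
(* The sign is read off from Im G_ii > 0 at one resampled value, here 0; the size of eps_i is not
   consulted. *)
have Imp : 0 < complex.Im (zeta + eps i).
  have h' := hermitian_hamiltonian lam (set_entry v i 0) hW.
  have := green_diag_Im_gt0 h' w_gt0 i.
  rewrite -resolventE hx Im_kernel pmulr_lgt0// exprn_gt0// modulus_gt0 -hx.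
  exact: (green_diag_neq0 h' w_gt0).
have c1 := @cbounded_kernel _ lam _ Imp; have c2 := @cbounded_kernel _ lam _ y_gt0.
rewrite /partial_expectation_G (cintegral_ext mu (g := cauchy_kernel lam (zeta + eps i)))//.
rewrite /stieltjes -cintegralB//.
have := @modulus_cintegral_supp _ mu hsupp _ (fun=> 8 / c ^+ 2 * modulus (eps i)) (cboundedB c1 c2) (rbounded_cst _ _).
rewrite Rint_cst; apply => x xx.
by apply: (perturbed_kernel xx _).2; rewrite -hx; exact: schur_error_set_entry.
Qed.

End SelfConsistent.

Lemma min_gt0 (R : realType) (a b : R) : 0 < a -> 0 < b -> 0 < Num.min a b.
Proof. by rewrite lt_min => -> ->. Qed.

Section LocalLaw.
Context {R : realType} (mu : probability (measurableTypeR R) R).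
Hypothesis hsupp : mu (~` [set v : R | -1 <= v <= 1]) = 0%E.
Variables (lam0 c B CH : R).
Hypotheses (lam0_gt0 : 0 < lam0) (c_gt0 : 0 < c) (c_le1 : c <= 1) (B_ge0 : 0 <= B).
Hypothesis hkey : key_bound mu lam0 c.
Hypothesis CH_ge0 : 0 <= CH.

(** The largest height met by the path: 3 in the spectral domain, 1 for |mfc|, and the length of the
    path. [law_radius] adds the bound 4 / c on m, so that it confines w + m. *)
Definition range_height : R := 3 + 1 + path_length lam0 c B.
Definition law_radius : R := B + 1 + range_height + 4 / c.

Section Sample.
Variables (N : nat) (Phi : R) (v : 'rV[R]_N) (W : 'M[R[i]]_N).

Definition resolvent_range (lam : R) (w : R[i]) : Prop :=
  [/\ 0 < lam <= lam0, `|complex.Re w| <= B + 1, complex.Im w <= range_height &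
      Phi ^+ 12 <= N%:R * complex.Im w].

Definition law_range (lam : R) (zeta : R[i]) : Prop :=
  [/\ 0 < lam <= lam0, 0 < complex.Im zeta, `|complex.Re zeta| <= law_radius,
      complex.Im zeta <= law_radius & off_support (c / 2) lam zeta].

Definition colsum_concentrated lam w (i j : 'I_N) : Prop :=
  modulus (minor_colsum (hamiltonian lam v W) w i j) <=
  Phi / Num.sqrt N%:R *
    Num.sqrt (\sum_a modulus (green (zero_out i (hamiltonian lam v W)) w j a) ^+ 2) + N%:R^-1.

Definition law_concentrated lam zeta : Prop :=
  modulus (N%:R^-1 * \sum_k cauchy_kernel lam zeta (v 0 k) - stieltjes mu lam zeta)
    <= CH * Phi / Num.sqrt N%:R + N%:R^-1.

(** The last clause ranges over free points zeta: the point w + m at which it is used depends on v,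
    and a probability bound holds for deterministic points only. *)
Definition good_sample : Prop :=
  [/\ forall i, -1 <= v 0 i <= 1,
      forall i, modulus (W i i) <= Phi / Num.sqrt N%:R,
      forall lam w, resolvent_range lam w -> forall i, quad_concentrated Phi v W lam w i,
      forall lam w, resolvent_range lam w -> forall i j, j != i -> colsum_concentrated lam w i j &
      forall lam zeta, law_range lam zeta -> law_concentrated lam zeta].

Hypotheses (N_gt0 : (0 < N)%N) (Phi_ge1 : 1 <= Phi) (hW : hermitian W) (hgood : good_sample).

Let Cr := subord_error_const c CH.
(** Bounds |1 / G_ii| = |lam v_i - zeta - eps_i|, the factor 3/2 coming from [schur_error_small]. It
    enters the last entry of [omega_threshold], which lets the bound for the diagonal of the minors
    close. *)
Definition inv_diag_const : R := 3 / 2 * (lam0 + 2 * law_radius).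
Definition omega_threshold : R :=
  Num.min (Num.min 1 (c ^+ 2 / 896))
    (Num.min (Num.min (path_om0 lam0 c B 3 Cr) (c / 2 / path_C lam0 c B 3 Cr))
             (c ^+ 2 / (64 * inv_diag_const))).
Hypothesis Phi_large : Phi ^- 3 <= omega_threshold.

Definition omega (w : R[i]) : R := (Phi ^+ 2 / (N%:R * complex.Im w)) `^ 3^-1.

Let NR0 : (0 : R) < N%:R. Proof. by rewrite ltr0n. Qed.
Let Phi0 : 0 < Phi. Proof. exact: lt_le_trans Phi_ge1. Qed.
Let PhiX n : 0 < Phi ^+ n. Proof. exact: exprn_gt0. Qed.

Let height_ge : 6 <= range_height.
Proof.
have h : 2 <= path_length lam0 c B by rewrite /path_length le_max lexx.
rewrite /range_height; lra.
Qed.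

Let c4 : 0 < 4 / c. Proof. exact: divr_gt0. Qed.
Let radius_gt0 : 0 < law_radius.
Proof. by rewrite /law_radius; have := height_ge; have := B_ge0; have := c4; lra. Qed.
Let inv_diag_gt0 : 0 < inv_diag_const.
Proof. by rewrite /inv_diag_const mulr_gt0// addr_gt0// mulr_gt0. Qed.
Let Cr_gt0 : 0 < Cr.
Proof.
rewrite /Cr /subord_error_const; apply: ltr_wpDl; last by rewrite ltr0n.
apply: addr_ge0; last by apply: mulr_ge0; [exact: ler0n|exact: sqr_ge0].
by apply: divr_ge0; [apply: mulr_ge0; exact: ler0n|apply: exprn_ge0; exact: ltW].
Qed.

Lemma cube_powR3V (x : R) : 0 <= x -> (x `^ 3^-1) ^+ 3 = x.
Proof. by move=> x0; rewrite -powR_mulrn ?powR_ge0// -powRrM mulVf// powRr1. Qed.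

Lemma omega_gt0 w : 0 < complex.Im w -> 0 < omega w.
Proof. by move=> w0; rewrite powR_gt0// divr_gt0// mulr_gt0. Qed.

Lemma omega_cube w : 0 < complex.Im w -> omega w ^+ 3 = Phi ^+ 2 / (N%:R * complex.Im w).
Proof. by move=> w0; rewrite cube_powR3V// divr_ge0 ?mulr_ge0 ?ltW. Qed.

Lemma omega_mono w w' : 0 < complex.Im w -> complex.Im w <= complex.Im w' -> omega w' <= omega w.
Proof.
move=> w0 ww'; have w0' := lt_le_trans w0 ww'.
rewrite /omega ge0_ler_powR// ?nnegrE; try by rewrite ltW// divr_gt0// mulr_gt0.
by rewrite ler_pM2l// lef_pV2 ?posrE ?mulr_gt0// ler_pM2l.
Qed.

(** The exponent 12 is used here: omega^3 <= Phi^2 / Phi^12, which is at most Phi^-9. *)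
Lemma omega_le w : Phi ^+ 12 <= N%:R * complex.Im w -> omega w <= Phi ^- 3.
Proof.
move=> h; have Nw : 0 < N%:R * complex.Im w by exact: lt_le_trans h.
have w0 : 0 < complex.Im w by rewrite -(pmulr_rgt0 _ NR0).
rewrite -(@ler_pXn2r _ 3)// ?nnegrE ?powR_ge0//; last by rewrite invr_ge0 ltW.
rewrite omega_cube//.
rewrite ler_pdivrMr//; apply: (@le_trans _ _ ((Phi ^- 3) ^+ 3 * Phi ^+ 12)); last first.
  by rewrite ler_pM2l// exprn_gt0// invr_gt0.
rewrite (_ : (Phi ^- 3) ^+ 3 * Phi ^+ 12 = Phi ^+ 3); last by field; rewrite gt_eqF.
by rewrite [leRHS]exprS ler_peMl// ltW.
Qed.

Let range_pos lam w : resolvent_range lam w -> 0 < complex.Im w.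
Proof.
by move=> [_ _ _ h]; rewrite -(pmulr_rgt0 _ NR0); exact: lt_le_trans h.
Qed.

Section Smallness.
Variable (om : R).
Hypotheses (om_gt0 : 0 < om) (om_le : om <= Phi ^- 3).
Let le_thr := le_trans om_le Phi_large.

Lemma omega_le1 : om <= 1.
Proof. by move: le_thr; rewrite !le_min => /andP[/andP[]]. Qed.
Let om_X n : om ^+ n.+1 <= om.
Proof. by rewrite exprS ler_piMr ?exprn_ile1// ?omega_le1// ltW. Qed.
Let le_sq : om <= c ^+ 2 / 896.
Proof. by move: le_thr; rewrite !le_min => /andP[/andP[]]. Qed.
Lemma omega_small1 : 28 * om ^+ 3 <= c / 16.
Proof.
have := om_X 2; have := le_sq; have := c_gt0.
have : c ^+ 2 <= c by rewrite expr2 ler_piMr// ltW.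
lra.
Qed.
Lemma omega_small2 : 28 * om ^+ 4 <= c ^+ 2 / 32.
Proof. by have := om_X 3; have := le_sq; lra. Qed.
Lemma omega_path : om <= path_om0 lam0 c B 3 Cr /\ path_C lam0 c B 3 Cr * om <= c / 2.
Proof.
move: le_thr; rewrite !le_min => /andP[_ /andP[/andP[h1 h2] _]]; split => //.
by rewrite mulrC -ler_pdivlMr//; exact: path_C_gt0.
Qed.
Lemma omega_inv : inv_diag_const * (32 / c ^+ 2) * om ^+ 3 <= 2^-1.
Proof.
move: le_thr; rewrite !le_min => /andP[_ /andP[_ h]].
have k0 : 0 < inv_diag_const * (32 / c ^+ 2).
  by apply: mulr_gt0 => //; apply: divr_gt0 => //; exact: exprn_gt0.
apply: (@le_trans _ _ (inv_diag_const * (32 / c ^+ 2) * om)).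
  by rewrite ler_pM2l//; exact: om_X 2.
apply: (@le_trans _ _ (inv_diag_const * (32 / c ^+ 2) * (c ^+ 2 / (64 * inv_diag_const)))).
  by rewrite ler_pM2l.
by rewrite le_eqVlt; apply/orP; left; apply/eqP; field; rewrite !gt_eqF.
Qed.
End Smallness.

(** The bound 4 / c on m rests on Schur's formula and the quadratic forms only, so membership is
    known before the concentration of the v_i is invoked at w + m. *)
Lemma zeta_in_law_range lam w : resolvent_range lam w ->
  off_support (c / 2) lam (w + mN lam v W w) -> law_range lam (w + mN lam v W w).
Proof.
move=> hr hoff; have w0 := range_pos hr; have [hlam hRe hIm hN] := hr.
have [hv hWd hq _ _] := hgood; have oc := omega_le hN; have og := omega_gt0 w0.
have hm := modulus_mN_le N_gt0 c_gt0 Phi_ge1 hW hv hWd w0 og (omega_le1 oc) (omega_cube w0)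
  (hq _ _ hr) hoff (omega_small1 og oc) (omega_small2 og oc).
have hR := le_trans (Re_le_modulus (mN lam v W w)) hm.
have hI := le_trans (ler_norm _) (le_trans (Im_le_modulus (mN lam v W w)) hm).
split => //.
- by rewrite ImD addr_gt0// Im_mN.
- rewrite ReD (le_trans (ler_normD _ _))// /law_radius; have := height_ge; lra.
- by rewrite ImD /law_radius; have := B_ge0; lra.
Qed.

Section AtPoint.
Variables (lam : R) (w : R[i]).
Hypotheses (hr : resolvent_range lam w) (hoff : off_support (c / 2) lam (w + mN lam v W w)).
Let om := omega w.
Let w0 := range_pos hr.
Let om_gt0 : 0 < om := omega_gt0 w0.
Let om_le : om <= Phi ^- 3. Proof. by have [_ _ _ h] := hr; exact: omega_le. Qed.
Let m := mN lam v W w.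
Let y := complex.Im (w + m).
Let hlaw : law_range lam (w + m) := zeta_in_law_range hr hoff.
Let hv : forall i, -1 <= v 0 i <= 1. Proof. by have [] := hgood. Qed.
Let hWd : forall i, modulus (W i i) <= Phi / Num.sqrt N%:R. Proof. by have [] := hgood. Qed.
Let hq : forall i, quad_concentrated Phi v W lam w i.
Proof. by have [_ _ h _ _] := hgood; exact: h. Qed.
Let hl : law_concentrated lam (w + m).
Proof. by have [_ _ _ _ h] := hgood; exact: h. Qed.
Let oc1 := omega_le1 om_le.

Lemma subord_error_at : modulus (subord_inv mu lam (w + m) - w) ^+ 2 <= Cr * om ^+ 3 * (y + om).
Proof.
exact: (subord_error N_gt0 c_gt0 Phi_ge1 hW hv hWd w0 om_gt0 oc1 (omega_cube w0) hq hoff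
  (omega_small1 om_gt0 om_le) (omega_small2 om_gt0 om_le) hl).
Qed.

Let yom_le : y + om <= law_radius + 1.
Proof. by have [_ _ _ h _] := hlaw; apply: lerD. Qed.

Let A : R := Phi / (N%:R * complex.Im w) `^ 3^-1.
Let Nw_ge1 : 1 <= N%:R * complex.Im w.
Proof. by have [_ _ _ h] := hr; apply: le_trans h; rewrite exprn_ege1. Qed.
Let t := (N%:R * complex.Im w) `^ 3^-1.
Let t3 : t ^+ 3 = N%:R * complex.Im w.
Proof. by rewrite cube_powR3V// (le_trans _ Nw_ge1). Qed.
Let t_gt0 : 0 < t. Proof. by rewrite powR_gt0// (lt_le_trans _ Nw_ge1). Qed.
Let t_ge1 : 1 <= t.
Proof. by rewrite -(@ler_pXn2r _ 3)// ?nnegrE ?(ltW t_gt0)// expr1n t3. Qed.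
Let om3_le : om ^+ 3 <= A ^+ 2.
Proof.
rewrite omega_cube// -t3 /A -/t expr_div_n ler_pM2l// lef_pV2 ?posrE ?exprn_gt0//.
by rewrite [leRHS]exprS ler_peMl// exprn_ge0// ltW.
Qed.
Let A_gt0 : 0 < A. Proof. by rewrite divr_gt0. Qed.

(** Away from the question of stability a cruder scale suffices: om^3 <= A^2, and y + om is merely
    bounded. *)
Let sqrt_bound (x K : R) : 0 <= K -> 0 <= x -> x ^+ 2 <= K * om ^+ 3 * (y + om) ->
  x <= (K * (law_radius + 1) + 1) * A.
Proof.
move=> K0 x0 hx; have K1 : 0 <= K * (law_radius + 1) by apply: mulr_ge0 => //; apply: addr_ge0 => //; exact: ltW.
have L0 : 0 <= K * (law_radius + 1) + 1 by exact: addr_ge0.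
have LA := mulr_ge0 L0 (ltW A_gt0).
rewrite -(@ler_pXn2r _ 2)// ?nnegrE//.
apply: (le_trans hx); rewrite exprMn.
apply: (@le_trans _ _ (K * (law_radius + 1) * A ^+ 2)).
  rewrite -[leLHS]mulrA -[leRHS]mulrA; apply: ler_wpM2l => //; rewrite mulrC; apply: ler_pM => //.
    by apply: addr_ge0; last exact: ltW; apply: ltW; rewrite /y ImD addr_gt0// Im_mN.
  by apply: exprn_ge0; exact: ltW.
apply: ler_wpM2r; first exact: sqr_ge0.
by have := sqr_ge0 (K * (law_radius + 1)); nra.
Qed.

Definition diag_const : R := 8 / c ^+ 2 * (28 * (law_radius + 1) + 1) + (Cr * (law_radius + 1) + 1).

Lemma partial_expectation_mN i : modulus (partial_expectation_G mu lam v W w i - m) <= diag_const * A.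
Proof.
have h1 := partial_expectation_near hsupp N_gt0 c_gt0 Phi_ge1 hW hWd w0 om_gt0 oc1 (omega_cube w0) hq hoff
  (omega_small1 om_gt0 om_le) (omega_small2 om_gt0 om_le) i.
have h2 := schur_error_sqr N_gt0 Phi_ge1 hW hWd w0 om_gt0 oc1 (omega_cube w0) hq i.
have {}h2 := sqrt_bound (ler0n _ _) (modulus_ge0 _) h2.
have h3 := sqrt_bound (ltW Cr_gt0) (modulus_ge0 _) subord_error_at.
(* Uses that the error F(w + m) - w of the self-consistent equation is m - g(w + m). *)
rewrite (_ : _ - m = (partial_expectation_G mu lam v W w i - stieltjes mu lam (w + m)) -
   (subord_inv mu lam (w + m) - w)); last by rewrite /subord_inv; ring.
apply: (le_trans (modulusB _ _)); rewrite /diag_const mulrDl; apply: lerD => //.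
apply: (le_trans h1); rewrite -[leRHS]mulrA; apply: ler_wpM2l => //.
by apply: divr_ge0 => //; apply: exprn_ge0; exact: ltW.
Qed.

Let H := hamiltonian lam v W.
Let hH : hermitian H. Proof. exact: hermitian_hamiltonian. Qed.
Let G := green H w.
Let Gd i : modulus (G i i) <= 4 / c.
Proof.
exact: (modulus_resolvent_diag N_gt0 c_gt0 Phi_ge1 hW hv hWd w0 om_gt0 oc1 (omega_cube w0) hq hoff
  (omega_small1 om_gt0 om_le) (omega_small2 om_gt0 om_le) i).
Qed.

Let Ginv i : modulus (G i i)^-1 <= inv_diag_const.
Proof.
have h := schur_error_diag lam v i hW w0.
have Gn : G i i != 0 by exact: green_diag_neq0.
have -> : (G i i)^-1 = (lam * v 0 i)%:C - (w + m) - schur_error lam v W w i.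
  by rewrite -[LHS]mulr1 -h mulKf.
have hs := schur_error_small N_gt0 c_gt0 Phi_ge1 hW hWd w0 om_gt0 oc1 (omega_cube w0) hq hoff
  (omega_small1 om_gt0 om_le) (omega_small2 om_gt0 om_le) i (hv i).
apply: (le_trans (modulusB _ _)).
have [hlam hi hRe hIm _] := hlaw.
have : modulus ((lam * v 0 i)%:C - (w + m)) <= lam0 + 2 * law_radius.
  apply: (le_trans (modulusB _ _)); apply: lerD.
    rewrite modulus_real normrM; have /andP[l0 l1] := hlam; rewrite gtr0_norm//.
    rewrite -[leRHS]mulr1; apply: ler_pM => //; first exact: ltW.
    by rewrite ler_norml.
  apply: (le_trans (modulus_le_ReIm _)); rewrite (gtr0_norm hi); lra.
rewrite /inv_diag_const; move: hs; rewrite -/m; lra.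
Qed.

Let G0 i j := green (zero_out i H) w j j.
(** By [schur_col], G_ji is -G_ii times a linear form in column i. Its concentration and Ward's
    identity leave the square root of a diagonal entry of the minor, which is still to be
    bounded. *)
Let offdiag_rec i j : i != j -> modulus (G j i) <=
  4 / c * (Phi / Num.sqrt (N%:R * complex.Im w) * Num.sqrt (modulus (G0 i j)) + N%:R^-1).
Proof.
move=> ij; have ji : j != i by rewrite eq_sym.
have -> : G j i = - (minor_colsum H w i j * G i i).
  by rewrite /G (schur_col hH w0 i ji) (minor_col hH w0 ji) sub0r.
rewrite modulusN modulusM mulrC; apply: ler_pM; rewrite ?modulus_ge0//.
have [_ _ _ h _] := hgood; apply: (le_trans (h _ _ hr _ _ ji)); rewrite lerD2r.
rewrite green_row_sqr//; last exact: hermitian_zero_out.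
have I0 := green_diag_Im_gt0 (hermitian_zero_out i hH) w0 j.
rewrite (sqrtrM _ (ltW I0)) (sqrtrV (ltW w0)) (sqrtrM _ (ltW NR0)).
rewrite [X in _ <= _ / X * _]mulrC invfM.
rewrite mulrCA [leRHS](_ : _ = Phi / Num.sqrt N%:R * (Num.sqrt (modulus (G0 i j)) / Num.sqrt (complex.Im w))).
  rewrite mulrCA; apply: ler_wpM2l; first by rewrite divr_ge0 ?sqrtr_ge0// ltW.
  apply: ler_wpM2r; first by rewrite invr_ge0 sqrtr_ge0.
  apply: ler_wsqrtr; exact: le_trans (ler_norm _) (Im_le_modulus _).
by rewrite -!mulrA; congr (_ * _); rewrite mulrC -mulrA; congr (_ * _); rewrite mulrC.
Qed.

Definition minor_diag_const : R := 2 * (4 / c + inv_diag_const * (32 / c ^+ 2)).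

(** Let F be the largest diagonal entry over all minors. Since G0 differs from G by G_ba G_ab /
    G_aa, the recursion for the off-diagonal entries gives F <= 4 / c + k om^3 F + k. [omega_inv]
    makes k om^3 at most 1/2, and F is absorbed. *)
Let minor_diag_le i j : i != j -> modulus (G0 i j) <= minor_diag_const.
Proof.
move=> ij; pose F (p : 'I_N * 'I_N) := modulus (G0 p.1 p.2).
case: (@arg_maxP _ _ _ (i, j) (fun p : 'I_N * 'I_N => p.1 != p.2) F ij) => -[a b] /= ab hmax.
suff h : F (a, b) <= minor_diag_const by apply: le_trans h; exact: (hmax (i, j) ij).
have ba : b != a by rewrite eq_sym.
have hr1 := offdiag_rec ab; have hr2 := offdiag_rec ba.
have hba : modulus (G0 b a) <= F (a, b) by exact: (hmax (b, a) ba).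
set Q := Phi / Num.sqrt (N%:R * complex.Im w) * Num.sqrt (F (a, b)) + N%:R^-1.
have Q0 : 0 <= Q by rewrite addr_ge0 ?invr_ge0// mulr_ge0 ?sqrtr_ge0// divr_ge0 ?sqrtr_ge0// ltW.
have h1 : modulus (G b a) <= 4 / c * Q by exact: hr1.
have h2 : modulus (G a b) <= 4 / c * Q.
  apply: (le_trans hr2); rewrite ler_pM2l// lerD2r; apply: ler_wpM2l.
    by rewrite divr_ge0 ?sqrtr_ge0// ltW.
  exact: ler_wsqrtr.
have e : G0 a b = G b b - G b a * G a b / G a a.
  by rewrite /G (minor_diag hH w0 ba) addrK.
have h3 : F (a, b) <= 4 / c + (4 / c * Q) ^+ 2 * inv_diag_const.
  rewrite /F /= e; apply: (le_trans (modulusB _ _)); apply: lerD => //.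
  rewrite !modulusM expr2; apply: ler_pM; rewrite ?mulr_ge0 ?modulus_ge0//.
  by apply: ler_pM; rewrite ?modulus_ge0.
have Q2 : Q ^+ 2 <= 2 * (om ^+ 3 * F (a, b) + 1).
  have hs (x z : R) : (x + z) ^+ 2 <= 2 * (x ^+ 2 + z ^+ 2) by have := sqr_ge0 (x - z); nra.
  apply: (le_trans (hs _ _)); rewrite ler_pM2l//; apply: lerD.
    rewrite exprMn sqr_sqrtr ?modulus_ge0// expr_div_n sqr_sqrtr; last by rewrite (le_trans _ Nw_ge1).
    by rewrite omega_cube.
  by rewrite expr_le1// ?invr_ge0// invf_le1// ler1n.
have h4 : (4 / c * Q) ^+ 2 * inv_diag_const <=
    inv_diag_const * (32 / c ^+ 2) * om ^+ 3 * F (a, b) + inv_diag_const * (32 / c ^+ 2).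
  rewrite exprMn (_ : _ + _ = (4 / c) ^+ 2 * (2 * (om ^+ 3 * F (a, b) + 1)) * inv_diag_const); last first.
    by move: (F _) => x; field; rewrite gt_eqF.
  by rewrite ler_pM2r// ler_wpM2l// sqr_ge0.
have F0 : 0 <= F (a, b) by exact: modulus_ge0.
have := ler_wpM2r F0 (omega_inv om_gt0 om_le).
rewrite /minor_diag_const; move: h3 h4.
move: (inv_diag_const * (32 / c ^+ 2)) (F (a, b)) => k x; lra.
Qed.

(** The square root of [minor_diag_const] is at most that constant plus 1; [range_height] accounts
    for the net slack, 1 / N being Im w / (N Im w). *)
Definition offdiag_const : R := 4 / c * (minor_diag_const + 1 + range_height).

Lemma offdiag_at i j : i != j ->
  modulus (G i j) <= offdiag_const * (Phi / Num.sqrt (N%:R * complex.Im w)).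
Proof.
move=> ij; have ji : j != i by rewrite eq_sym.
apply: (le_trans (offdiag_rec ji)); rewrite /offdiag_const -[leRHS]mulrA ler_pM2l// mulrDl.
have sN : 0 < Num.sqrt (N%:R * complex.Im w) by rewrite sqrtr_gt0 (lt_le_trans _ Nw_ge1).
apply: lerD.
  rewrite mulrC; apply: ler_wpM2r; first by rewrite divr_ge0//; exact: ltW.
  have h := minor_diag_le ji; apply: (le_trans (ler_wsqrtr h)).
  have k0 : 0 <= minor_diag_const by exact: le_trans (modulus_ge0 _) h.
  rewrite -(@ler_pXn2r _ 2)// ?nnegrE ?sqrtr_ge0 ?addr_ge0// sqr_sqrtr//; nra.
rewrite (_ : N%:R^-1 = complex.Im w / (N%:R * complex.Im w)); last by field; rewrite !gt_eqF.
have [_ _ hh _] := hr; apply: ler_pM; rewrite ?invr_ge0 ?(ltW w0) ?(le_trans _ Nw_ge1)//.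
apply: (@le_trans _ _ (Num.sqrt (N%:R * complex.Im w))^-1); last by rewrite ler_peMl// invr_ge0 ltW.
rewrite lef_pV2 ?posrE// ?(lt_le_trans _ Nw_ge1)//.
rewrite -[leRHS]sqr_sqrtr; last by rewrite (le_trans _ Nw_ge1).
rewrite expr2 ler_peMl// ?(ltW sN)//.
by rewrite -[leLHS]sqrtr1 ler_wsqrtr.
Qed.

End AtPoint.

Definition spectral_range (lam : R) (z : R[i]) : Prop :=
  [/\ 0 < lam <= lam0, `|complex.Re z| <= B - 1, complex.Im z <= 3 & Phi ^+ 12 <= N%:R * complex.Im z].

Let spectral_resolvent lam z : spectral_range lam z -> resolvent_range lam z.
Proof. by move=> [h1 h2 h3 h4]; split => //; have := height_ge; lra. Qed.

(** [B] exceeds the range of Re z by 1, which |mfc| does not exceed, so z + mfc stays within [B].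
    The domain of [subord_error_at] contains the whole path, as N Im w only grows along it. *)
Lemma mN_mfc lam z : spectral_range lam z ->
  modulus (mN lam v W z - mfc mu lam z) <= path_C lam0 c B 3 Cr * omega z.
Proof.
move=> hs; have hr := spectral_resolvent hs; have z0 := range_pos hr.
have [hlam hRe hIm hN] := hs; have oc := omega_le hN; have og := omega_gt0 z0.
have pos w : complex.Im z <= complex.Im w -> 0 < complex.Im w by exact: lt_le_trans.
apply: (path_stability hsupp lam0_gt0 c_gt0 c_le1 B_ge0 (Y := 3) _ hkey hlam z0 hIm _
   (M := N%:R * complex.Im z ^- 2)) => //.
- rewrite ReD (le_trans (ler_normD _ _))//.
  by have := le_trans (Re_le_modulus _) (modulus_mfc_le1 hsupp lam z0); lra.
- by move=> w w' h h'; exact: mN_lip.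
- by move=> w h; apply/ltW/Im_mN => //; exact: pos.
- by move=> w h; apply: modulus_mN => //; exact: pos.
- by move=> w h; apply: omega_gt0; exact: pos.
- by move=> w w' h h'; apply: omega_mono => //; exact: pos.
- by rewrite mulr_ge0// invr_ge0 sqr_ge0.
- move=> w hw hB hT hoff; apply: subord_error_at => //; split => //.
  by apply: (le_trans hN); rewrite ler_pM2l.
- exact: (omega_path oc).1.
Qed.

Lemma zeta_off_support lam z : spectral_range lam z -> off_support (c / 2) lam (z + mN lam v W z).
Proof.
move=> hs; have hr := spectral_resolvent hs; have z0 := range_pos hr.
have [hlam hRe hIm hN] := hs; have oc := omega_le hN; have og := omega_gt0 z0.
have Imp : 0 < complex.Im (z + mfc mu lam z) by rewrite ImD addr_gt0//; have [] := mfcP hsupp lam z0.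
apply: (off_support_near hkey hlam Imp).
  have h := kernel_sqr_mfc hsupp lam z0; rewrite -subr_ge0 -(pmulr_rge0 _ Imp) h; exact: ltW.
rewrite opprD addrACA subrr add0r.
exact: le_trans (mN_mfc hs) (omega_path oc).2.
Qed.

Lemma diag_const_gt0 : 0 < diag_const.
Proof.
have h1 : 0 <= Cr * (law_radius + 1) by apply: mulr_ge0; [exact: ltW|apply: addr_ge0 => //; exact: ltW].
have h2 : 0 <= 8 / c ^+ 2 * (28 * (law_radius + 1) + 1).
  apply: mulr_ge0; first by apply: divr_ge0 => //; exact: sqr_ge0.
  by have := radius_gt0; lra.
by rewrite /diag_const; lra.
Qed.

Lemma offdiag_const_gt0 : 0 < offdiag_const.
Proof.
rewrite /offdiag_const; apply: mulr_gt0 => //.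
have : 0 < inv_diag_const * (32 / c ^+ 2).
  by apply: mulr_gt0 => //; apply: divr_gt0 => //; exact: exprn_gt0.
by rewrite /minor_diag_const; have := height_ge; have := c4; lra.
Qed.

Definition local_law_const : R := path_C lam0 c B 3 Cr + (diag_const + offdiag_const).

Lemma local_law_const_gt0 : 0 < local_law_const.
Proof.
have := diag_const_gt0; have := offdiag_const_gt0.
have := path_C_gt0 lam0_gt0 c_gt0 B_ge0 (ler0n _ 3) Cr_gt0.
by rewrite /local_law_const; lra.
Qed.

Lemma omega_threshold_gt0 : 0 < omega_threshold.
Proof.
have c2 : 0 < c ^+ 2 by exact: exprn_gt0.
apply: min_gt0; last apply: min_gt0; try apply: min_gt0; first exact: ltr01.
- by apply: divr_gt0; [exact: c2|rewrite ltr0n].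
- exact: path_om0_gt0.
- by apply: divr_gt0; [exact: divr_gt0|exact: path_C_gt0].
- by apply: divr_gt0; [exact: c2|apply: mulr_gt0; [rewrite ltr0n|exact: inv_diag_gt0]].
Qed.

Lemma local_law lam z : spectral_range lam z ->
  [/\ forall i j, i != j -> modulus (resolvent lam v W z i j) <=
        local_law_const * (Phi / Num.sqrt (N%:R * complex.Im z)),
      forall i, modulus (partial_expectation_G mu lam v W z i - mN lam v W z) <=
        local_law_const * Phi * (lam / Num.sqrt N%:R + ((N%:R * complex.Im z) `^ 3^-1)^-1) &
      modulus (mN lam v W z - mfc mu lam z) <=
        local_law_const * (Phi / (N%:R * complex.Im z) `^ 3^-1)].
Proof.
move=> hs; have hr := spectral_resolvent hs; have z0 := range_pos hr.
have hoff := zeta_off_support hs.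
have Nz : 0 < N%:R * complex.Im z by exact: mulr_gt0.
have t0 : 0 < (N%:R * complex.Im z) `^ 3^-1 by rewrite powR_gt0.
have a0 : 0 <= Phi / (N%:R * complex.Im z) `^ 3^-1 by rewrite ltW// divr_gt0.
have b0 : 0 <= Phi / Num.sqrt (N%:R * complex.Im z) by rewrite divr_ge0 ?sqrtr_ge0// ltW.
have pC := path_C_gt0 lam0_gt0 c_gt0 B_ge0 (ler0n _ 3) Cr_gt0.
have dC := diag_const_gt0; have oC := offdiag_const_gt0.
split.
- move=> i j ij; apply: (le_trans (offdiag_at hr hoff ij)); apply: ler_wpM2r => //.
  by rewrite /local_law_const; lra.
- move=> i; apply: (le_trans (partial_expectation_mN hr hoff i)).
  apply: (@le_trans _ _ (local_law_const * (Phi / (N%:R * complex.Im z) `^ 3^-1))).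
    by apply: ler_wpM2r => //; rewrite /local_law_const; lra.
  have l0 : 0 <= local_law_const by rewrite /local_law_const; lra.
  rewrite -[leRHS]mulrA; apply: ler_wpM2l => //; apply: ler_wpM2l; first exact: ltW.
  rewrite lerDr divr_ge0 ?sqrtr_ge0//; have [/andP[/ltW]] := hs; by [].
- apply: (le_trans (mN_mfc hs)).
  have om_le : omega z <= Phi / (N%:R * complex.Im z) `^ 3^-1.
    rewrite -(@ler_pXn2r _ 3)// ?nnegrE ?powR_ge0// omega_cube// expr_div_n cube_powR3V; last exact: ltW.
    by rewrite ler_pM2r ?invr_gt0// [leRHS]exprS ler_peMl// ltW.
  apply: (@le_trans _ _ (path_C lam0 c B 3 Cr * (Phi / (N%:R * complex.Im z) `^ 3^-1))).
    by rewrite ler_pM2l.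
  by apply: ler_wpM2r => //; rewrite /local_law_const; lra.
Qed.

End Sample.

End LocalLaw.

(** * Independence *)

Section Joint.
Context {R : realType} d (T : measurableType d) (P : probability T R).
Context d1 d2 (T1 : measurableType d1) (T2 : measurableType d2).
Variables (X : T -> T1) (Y : T -> T2).
Hypotheses (mX : measurable_fun setT X) (mY : measurable_fun setT Y).
Hypothesis hXY : forall A B, measurable A -> measurable B ->
  P (X @^-1` A `&` Y @^-1` B) = (P (X @^-1` A) * P (Y @^-1` B))%E.

Let X' : {mfun T >-> T1} := HB.pack X (isMeasurableFun.Build _ _ _ _ X mX).
Let Y' : {mfun T >-> T2} := HB.pack Y (isMeasurableFun.Build _ _ _ _ Y mY).
Let mZ : measurable_fun setT (fun t => (X t, Y t)). Proof. exact: measurable_fun_pair. Qed.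
Let Z : {mfun T >-> (T1 * T2)%type} := HB.pack (fun t => (X t, Y t)) (isMeasurableFun.Build _ _ _ _ _ mZ).

Lemma measurable_integral_section (F : T1 * T2 -> \bar R) : measurable_fun setT F ->
  (forall x, (0 <= F x)%E) -> measurable_fun setT (fun s => \int[P]_t F (s, Y t))%E.
Proof.
move=> mF F0; rewrite (_ : (fun s => _) = fubini_F (distribution P Y') F); last first.
  apply/funext => s; rewrite /fubini_F /=.
  by rewrite (@ge0_integral_distribution _ _ _ _ _ P Y' (fun y => F (s, y)))//=; exact: measurableT_comp.
exact: measurable_fun_fubini_tonelli_F.
Qed.

(** The joint law agrees with the product of the marginals on rectangles, hence everywhere; the rest
    is Tonelli's theorem. *)
Lemma integral_independent (F : T1 * T2 -> \bar R) : measurable_fun setT F ->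
  (forall x, (0 <= F x)%E) ->
  (\int[P]_t F (X t, Y t) = \int[P]_s \int[P]_t F (X s, Y t))%E.
Proof.
move=> mF F0.
have e1 := @ge0_integral_distribution _ _ _ _ _ P Z F mF F0.
transitivity (\int[distribution P Z]_z F z)%E; first by rewrite e1.
transitivity (\int[distribution P X' \x distribution P Y']_z F z)%E.
  apply: eq_measure_integral => A mA _; apply/esym.
  by apply: product_measure_unique => // A1 A2 mA1 mA2; rewrite /distribution /pushforward -hXY.
rewrite fubini_tonelli1//.
rewrite (@ge0_integral_distribution _ _ _ _ _ P X' (fubini_F (distribution P Y') F))//=; last 2 first.
- exact: measurable_fun_fubini_tonelli_F.
- by move=> y; apply: integral_ge0.
apply: eq_integral => s _; rewrite /fubini_F /=.
by rewrite (@ge0_integral_distribution _ _ _ _ _ P Y' (fun y => F (X s, y)))//=; exact: measurableT_comp.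
Qed.

(** Takes the place of conditional probability: a bound valid for every frozen value of X survives
    when X is random and independent of Y. *)
Lemma section_bound (E : set (T1 * T2)) (p : \bar R) : measurable E ->
  (forall x, P [set t | E (x, Y t)] <= p)%E -> (P [set t | E (X t, Y t)] <= p)%E.
Proof.
move=> mE hp; have e (g : T -> T1 * T2) : measurable_fun setT g ->
    (\int[P]_t (\1_E (g t) : R)%:E)%E = P [set t | E (g t)].
  move=> mg; have mg' : measurable [set t | E (g t)].
    by rewrite -[X in measurable X]setTI; exact: mg.
  by have := integral_indic P measurableT mg'; rewrite setIT => <-.
have mI : measurable_fun setT (fun z => (\1_E z : R)%:E).
  by apply/measurable_EFinP; exact: measurable_indic.
rewrite -e// (integral_independent mI); last by move=> x; rewrite lee_fin.
apply: (@le_trans _ _ (\int[P]_s p)%E).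
  apply: ge0_le_integral => //.
  - by move=> s _; apply: integral_ge0 => t _; rewrite lee_fin.
  - by apply: (measurableT_comp (measurable_integral_section mI _) mX) => z; rewrite lee_fin.
  - by move=> s _; rewrite e//; exact: measurable_fun_pair.
rewrite integral_cst//.
by rewrite [X in (_ * X)%E](probability_setT P) mule1.
Qed.

End Joint.

Section Generated.
Context {R : realType} d (T : measurableType d) (P : probability T R).

Lemma sub_generated (G : set (set T)) : G `<=` measurable -> <<s G >> `<=` (measurable : set (set T)).
Proof. by move=> h; apply: smallest_sub => //; exact: sigma_algebra_measurable. Qed.

Lemma independent_setC (A B : set T) : measurable A -> measurable B ->
  P (A `&` B) = (P A * P B)%E -> P (~` A `&` B) = (P (~` A) * P B)%E.
Proof.
move=> mA mB e; rewrite setIC -setDE measureD//; last by rewrite (le_lt_trans (probability_le1 _ _)) ?ltry.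
transitivity (P B - P A * P B)%E; first by congr (_ - _)%E; rewrite setIC; exact: e.
rewrite probability_setC//.
have fB := fin_num_measure P B mB; have fA := fin_num_measure P A mA.
by rewrite muleBl ?mul1e// fin_num_adde_defr.
Qed.

Lemma independent_bigcup (F : (set T)^nat) (B : set T) : (forall n, measurable (F n)) ->
  measurable B -> trivIset setT F -> (forall n, P (F n `&` B) = (P (F n) * P B)%E) ->
  P ((\bigcup_k F k) `&` B) = (P (\bigcup_k F k) * P B)%E.
Proof.
move=> mF mB tF e; rewrite setI_bigcupl !measure_semi_bigcup//.
- have bf : P B \is a fin_num by exact: fin_num_measure.
  transitivity (\sum_(i <oo) ((fine (P B))%:E * P (F i)))%E.
    by apply: eq_eseriesr => n _; rewrite fineK// muleC; exact: e.
  by rewrite nneseriesZl; [rewrite fineK// muleC|move=> n _; exact: measure_ge0].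
- exact: bigcupT_measurable.
- by move=> n; exact: measurableI.
- by apply: trivIset_setIr.
- by apply: bigcupT_measurable => n; exact: measurableI.
Qed.

(** Dynkin's argument: for fixed B the sets A satisfying the product rule are stable under
    complements and disjoint countable unions. *)
Lemma independent_generatedl (G1 G2 : set (set T)) : setI_closed G1 ->
  G1 `<=` measurable -> G2 `<=` measurable -> independent P G1 G2 -> independent P <<s G1 >> G2.
Proof.
move=> GI m1 m2 h A B GA GB; have mB := m2 _ GB; have sub := sub_generated m1.
move: A GA; apply: (@dynkin_induction _ (g_sigma_algebraType G1) G1 (fun A => P (A `&` B) = (P A * P B)%E)) => //.
- by rewrite setTI probability_setT mul1e.
- by move=> A GA; exact: h.
- by move=> A mA; apply: independent_setC => //; exact: sub.
- by move=> F mF tF e; apply: independent_bigcup => // n; apply: sub; exact: mF.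
Qed.

Lemma independent_sym (S1 S2 : set (set T)) : independent P S1 S2 -> independent P S2 S1.
Proof. by move=> h A B hA hB; rewrite setIC h// muleC. Qed.

Lemma independent_generated (G1 G2 : set (set T)) : setI_closed G1 -> setI_closed G2 ->
  G1 `<=` measurable -> G2 `<=` measurable -> independent P G1 G2 ->
  independent P <<s G1 >> <<s G2 >>.
Proof.
move=> c1 c2 m1 m2 h; apply: independent_generatedl => //; first exact: sub_generated.
apply: independent_sym; apply: independent_generatedl => //; exact: independent_sym.
Qed.

End Generated.

Section Groups.
Context {R : realType} d (T : measurableType d) (P : probability T R).
Variables (I : finType) (D : {set I}) (S : I -> set (set T)) (S0 : set (set T)).
Hypotheses (mS : forall i, S i `<=` measurable) (cS : forall i, setI_closed (S i)).
Hypothesis ST : forall i, S i setT.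
Hypotheses (mS0 : S0 `<=` measurable) (cS0 : setI_closed S0) (S0T : S0 setT).
Hypothesis indepS : mutually_independent P D S.
Hypothesis indepS0 : forall B A, S0 B -> (forall i, i \in D -> S i (A i)) ->
  P (B `&` \bigcap_(i in [set` D]) A i) = (P B * P (\bigcap_(i in [set` D]) A i))%E.

(** Cylinders form an intersection-stable generating class of the sigma-algebra of a block; [cyl0]
    adjoins one factor from [S0], which later carries the potential. *)
Let cyl (E : {set I}) : set (set T) :=
  [set C | exists A, (forall i, S i (A i)) /\ C = \bigcap_(i in [set` E]) A i].
Let cyl0 (E : {set I}) : set (set T) :=
  [set C | exists B C', [/\ S0 B, cyl E C' & C = B `&` C']].

Let cyl_measurable E : cyl E `<=` measurable.
Proof.
move=> _ [A [SA ->]]; apply: fin_bigcap_measurable; first exact: finite_finset.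
by move=> i _; exact: mS (SA i).
Qed.
Let cyl0_measurable E : cyl0 E `<=` measurable.
Proof.
by move=> _ [B [C [SB CE ->]]]; apply: measurableI; [exact: mS0|exact: cyl_measurable CE].
Qed.
Let cylI E : setI_closed (cyl E).
Proof.
move=> _ _ [A [SA ->]] [B [SB ->]]; exists (fun i => A i `&` B i); split; first by move=> i; exact: cS.
by rewrite bigcapI.
Qed.
Let cyl0I E : setI_closed (cyl0 E).
Proof.
move=> _ _ [A [C [SA CE ->]]] [A' [C' [SA' CE' ->]]]; exists (A `&` A'), (C `&` C').
by split; [exact: cS0|exact: cylI|rewrite setIACA].
Qed.
Let cylT E : cyl E setT.
Proof. by exists (fun=> setT); split => //; rewrite bigcapT. Qed.
Let sub_cyl (E : {set I}) : \bigcup_(i in [set` E]) S i `<=` cyl E.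
Proof.
move=> A [i iE SA]; exists (fun j => if j == i then A else setT); split.
  by move=> j; case: eqVneq => [->|].
apply/seteqP; split => [x Ax j _|x h]; first by case: eqP.
by have := h i iE; rewrite eqxx.
Qed.

Let bigcap_split (D1 D2 : {set I}) (A B : I -> set T) : (forall i, i \in D1 -> i \notin D2) ->
  \bigcap_(i in [set` D1 :|: D2]) (if i \in D1 then A i else B i) =
  (\bigcap_(i in [set` D1]) A i) `&` (\bigcap_(i in [set` D2]) B i).
Proof.
move=> dis; have dis' i : i \in D2 -> i \notin D1 by apply: contraL; exact: dis.
apply/seteqP; split => [x h|x [h1 h2] i /=].
  split => i /= iD.
    by have := h i; rewrite /= inE iD => /(_ isT).
  by have := h i; rewrite /= inE iD orbT (negbTE (dis' _ iD)) => /(_ isT).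
by rewrite inE; case: ifPn => [iD _|_ /= iD]; [exact: h1|exact: h2].
Qed.

Let cyl_indep (D1 D2 : {set I}) : (forall i, i \in D1 -> i \notin D2) -> D1 \subset D -> D2 \subset D ->
  independent P (cyl D1) (cyl0 D2).
Proof.
move=> dis s1 s2; have dis' i : i \in D2 -> i \notin D1 by apply: contraL; exact: dis.
move=> _ _ [A [SA ->]] [B [_ [SB [A' [SA' ->]] ->]]].
(* A cylinder over fewer coordinates is one over all of [D], with [setT] in the missing places. *)
have ind0 (E : {set I}) (F : I -> set T) : E \subset D -> (forall i, S i (F i)) ->
    P (B `&` \bigcap_(i in [set` E]) F i) = (P B * P (\bigcap_(i in [set` E]) F i))%E.
  move=> sE SF; have -> : \bigcap_(i in [set` E]) F i =
      \bigcap_(i in [set` D]) (if i \in E then F i else setT).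
    apply/seteqP; split => [x h i _|x h i /= iE]; first by case: ifP => // iE; exact: h.
    by have := h i (fintype.subsetP sE _ iE); rewrite iE.
  by apply: indepS0 => // i _; case: ifP.
rewrite setICA -bigcap_split// ind0; last 2 first.
- by rewrite finset.subUset s1.
- by move=> i; case: ifP.
rewrite ind0// !indepS//; last 2 first.
- by rewrite finset.subUset s1.
- by move=> i _; case: ifP.
rewrite muleCA; congr (_ * _)%E.
rewrite (eq_bigl [predU D1 & D2]); last by move=> i; rewrite !inE.
rewrite bigU/=; last by rewrite disjoint_subset; apply/fintype.subsetP => i; exact: dis.
congr (_ * _)%E; apply: eq_bigr => i iD; first by rewrite iD.
by rewrite (negbTE (dis' _ iD)).
Qed.

Lemma independent_groups (D1 D2 : {set I}) : (forall i, i \in D1 -> i \notin D2) -> D1 \subset D -> D2 \subset D ->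
  independent P <<s \bigcup_(i in [set` D1]) S i >> <<s S0 `|` \bigcup_(i in [set` D2]) S i >>.
Proof.
move=> dis s1 s2 A B hA hB.
apply: (independent_generated (@cylI D1) (@cyl0I D2) _ _ (cyl_indep dis s1 s2)) => //.
  by apply: sub_sigma_algebra2 hA; exact: sub_cyl.
apply: sub_sigma_algebra2 hB => C [SC|/sub_cyl SC].
  by exists C, setT; split => //; rewrite setIT.
by exists setT, C; split => //; rewrite setTI.
Qed.

End Groups.

Section SigmaOf.
Context {R : realType} d (T : measurableType d).
Implicit Types F : set (T -> R).

Lemma sigma_of_measurable F : (forall f, F f -> measurable_fun setT f) -> sigma_of F `<=` measurable.
Proof.
move=> mF; apply: sub_generated => _ [f Ff [B mB <-]]; exact: mF.
Qed.

Lemma sigma_ofT F : sigma_of F setT.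
Proof. exact: (@measurableT _ (g_sigma_algebraType (\bigcup_(f in F) preimage_set_system setT f measurable))). Qed.

Lemma sigma_ofI F : setI_closed (sigma_of F).
Proof. exact: (@measurableI _ (g_sigma_algebraType (\bigcup_(f in F) preimage_set_system setT f measurable))). Qed.

(** The same carrier with a smaller sigma-algebra. The identity into it acts as the random variable
    formed by all functions of [F], so independence of sigma-algebras can be used through
    [section_bound]. *)
Definition sigma_type F := g_sigma_algebraType (\bigcup_(f in F) preimage_set_system setT f measurable).

Lemma measurable_sigma_type F f : F f -> measurable_fun setT (f : sigma_type F -> R).
Proof.
move=> Ff _ B mB; rewrite setTI; apply: sub_sigma_algebra; exists f => //.
by exists B => //; rewrite setTI.
Qed.

Lemma sub_sigma_of F F' : (forall f, F f -> measurable_fun setT (f : sigma_type F' -> R)) ->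
  sigma_of F `<=` sigma_of F'.
Proof.
move=> h; apply: smallest_sub; first exact: smallest_sigma_algebra.
by move=> _ [f Ff [B mB <-]]; exact: h.
Qed.

End SigmaOf.

(** * Large deviations for random coefficients *)

Section Reindex.
Context {R : realType} d (T : measurableType d) (P : probability T R).

Lemma mutually_independent_reindex (I J : finType) (D : {set J}) (S : J -> set (set T))
    (f : I -> J) (S' : I -> set (set T)) : injective f -> (forall i, f i \in D) ->
  (forall i, S' i `<=` S (f i)) -> mutually_independent P D S ->
  mutually_independent P [set: I] S'.
Proof.
move=> finj fD sub indep K A _ hA.
pose A' j := if [pick i | (f i == j) && (i \in K)] is Some i then A i else setT.
have A'E i : i \in K -> A' (f i) = A i.
  move=> iK; rewrite /A'; case: pickP => [i' /andP[/eqP/finj -> _]//|/(_ i)].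
  by rewrite eqxx iK.
have := indep (f @: K)%SET A' _ _.
have -> : \bigcap_(j in [set` (f @: K)%SET]) A' j = \bigcap_(i in [set` K]) A i.
  apply/seteqP; split => x h.
    by move=> i /= iK; rewrite -A'E//; apply: h; apply: imset_f.
  by move=> _ /= /imsetP[i iK ->]; rewrite A'E//; exact: h.
rewrite big_imset/=; last by move=> i j _ _; exact: finj.
rewrite (eq_bigr (fun i => P (A i))); last by move=> i iK; rewrite A'E.
apply; first by apply/fintype.subsetP => _ /imsetP[i _ ->]; exact: fD.
by move=> _ /imsetP[i iK ->]; rewrite A'E//; apply: sub; exact: hA.
Qed.

Lemma measurable_ltr_set (f g : T -> R) : measurable_fun setT f -> measurable_fun setT g ->
  measurable [set w | (f w < g w)%R].
Proof.
move=> mf mg; have := measurable_fun_ltr mf mg.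
by move=> /(_ measurableT [set true] I); rewrite setTI; congr (measurable _).
Qed.

Lemma measurable_ler_set (f g : T -> R) : measurable_fun setT f -> measurable_fun setT g ->
  measurable [set w | (f w <= g w)%R].
Proof.
move=> mf mg; have := measurable_fun_ler mf mg.
by move=> /(_ measurableT [set true] I); rewrite setTI; congr (measurable _).
Qed.

(** At threshold 0 the deviation estimate says nothing, but then all coefficients vanish, X = 0, and
    the strict event is empty. *)
Lemma strict_deviation (X : T -> R[i]) (t p : R) : cmeasurable X -> 0 <= p -> 0 <= t ->
  (t = 0 -> forall w, X w = 0) -> deviation_le P X t p ->
  (P [set w | (t < modulus (X w))%R] <= p%:E)%E.
Proof.
move=> mX p0; rewrite le_eqVlt => /orP[/eqP <-|t0] h0 hd.
  rewrite (_ : [set w | _] = set0) ?measure0 ?lee_fin//.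
  by apply/seteqP; split => // w /=; rewrite h0// modulus0 ltxx.
apply: le_trans (hd t0); apply: le_measure; rewrite ?inE.
- by apply: measurable_ltr_set; [exact: measurable_cst|exact: measurable_modulus].
- by apply: measurable_ler_set; [exact: measurable_cst|exact: measurable_modulus].
- by move=> w /=; exact: ltW.
Qed.


End Reindex.

Section WignerColumn.
Context {R : realType} d (T : measurableType d) (P : probability T R).
Variables (theta C0 : R) (N : nat) (W : T -> 'M[R[i]]_N).
Hypotheses (theta_gt1 : 1 < theta) (C0_gt0 : 0 < C0) (N_ge3 : (3 <= N)%N).
Hypothesis hW : wigner P theta C0 W.

Let NR0 : (0 : R) < N%:R. Proof. by rewrite ltr0n; exact: leq_trans N_ge3. Qed.
Local Notation sigma := (Num.sqrt N%:R)^-1.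
Let sigma_gt0 : (0 : R) < sigma. Proof. by rewrite invr_gt0 sqrtr_gt0. Qed.
Let sigma2 : (sigma : R) ^+ 2 = N%:R^-1.
Proof. by rewrite exprVn sqr_sqrtr// ltW. Qed.

Let W_measurable i j : cmeasurable (fun w => W w i j). Proof. by have [h _ _ _ _] := hW. Qed.
Let W_hermitian w : hermitian (W w). Proof. by have [_ h _ _ _] := hW; move=> i j; exact: h. Qed.

(* The model bounds [P (X > x)] and the estimates assume a bound on [P (X >= x)]; the gap is
   closed by continuity of the bound in [x]. *)
Lemma wigner_ld_variable i j : ld_variable P theta C0 sigma (fun w => W w i j).
Proof.
have [_ _ _ [h0 _ h2 _] ht] := hW; split => //.
  by rewrite h2 invC_nat sigma2.
move=> x x0; have th : 0 < theta^-1 by rewrite invr_gt0 (lt_trans _ theta_gt1).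
set p := P _.
have le_y y : 0 < y < x -> (p <= (C0 * expR (- (y `^ theta^-1)))%:E)%E.
  move=> /andP[y0 yx]; apply: le_trans (ht i j y y0).
  apply: le_measure; rewrite ?inE.
  - by apply: measurable_ler_set; [exact: measurable_cst|exact/measurable_modulus/W_measurable].
  - apply: measurable_ltr_set; first exact: measurable_cst.
    apply: measurable_funM; first exact: measurable_cst.
    exact/measurable_modulus/W_measurable.
  - move=> w /=; rewrite ler_pdivrMr ?sqrtr_gt0// mulrC => h; exact: lt_le_trans h.
have pfin : p \is a fin_num.
  apply: fin_num_measure.
  by apply: measurable_ler_set; [exact: measurable_cst|exact/measurable_modulus/W_measurable].
rewrite -(fineK pfin) lee_fin; set M := C0 * _.
have M0 : 0 < M by rewrite mulr_gt0// expR_gt0.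
have u0 : 0 < x `^ theta^-1 by rewrite powR_gt0.
rewrite leNgt; apply/negP => hM.
have r0 : 0 < fine p by exact: lt_trans hM.
have L0 : 0 < ln (fine p / M) by rewrite ln_gt0// ltr_pdivlMr// mul1r.
pose e := Num.min (x `^ theta^-1 / 2) (ln (fine p / M) / 2).
have e0 : 0 < e by rewrite lt_min !divr_gt0.
have eu : e <= x `^ theta^-1 / 2 by rewrite ge_min lexx.
have eL : e <= ln (fine p / M) / 2 by rewrite ge_min lexx orbT.
pose y := (x `^ theta^-1 - e) `^ theta.
have t0 : theta != 0 by rewrite gt_eqF// (lt_trans _ theta_gt1).
have ue0 : 0 < x `^ theta^-1 - e by lra.
have yE : y `^ theta^-1 = x `^ theta^-1 - e by rewrite /y -powRrM mulfV// powRr1// ltW.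
have yx : 0 < y < x.
  rewrite powR_gt0//=; rewrite -[ltRHS](powRr1 (ltW x0)) -(mulVf t0) powRrM.
  by apply: gt0_ltr_powR; rewrite ?nnegrE ?(ltW ue0) ?(ltW u0)//; [exact: lt_trans theta_gt1|lra].
have := le_y _ yx; rewrite -(fineK pfin) lee_fin yE opprB expRD mulrCA mulrC -/M => h.
have : fine p < fine p.
  apply: (le_lt_trans h); rewrite -ltr_pdivlMl// mulrC -[ltRHS](@lnK _ (fine p / M)).
    rewrite ltr_expR; lra.
  by rewrite posrE divr_gt0.
by rewrite ltxx.
Qed.

(** Independence is stated for entries on or above the diagonal; every entry is one of these or the
    conjugate of one, with the same generated sigma-algebra. *)
Definition upper (i j : 'I_N) : 'I_N * 'I_N := if (i <= j)%N then (i, j) else (j, i).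

Lemma upper_le i j : ((upper i j).1 <= (upper i j).2)%N.
Proof. by rewrite /upper; case: ifP => //= /negbT; rewrite -ltnNge => /ltnW. Qed.

Lemma upper_eq i j : upper i j = (i, j) \/ upper i j = (j, i).
Proof. by rewrite /upper; case: ifP => _; [left|right]. Qed.

Lemma sigma_conjc (X Y : T -> R[i]) : cmeasurable Y -> (forall w, X w = conjc (Y w)) ->
  sigma_of (coords X) `<=` sigma_of (coords Y).
Proof.
move=> mY e; apply: sub_sigma_of => _ [->|->].
  rewrite (_ : (fun t => _) = (fun t => complex.Re (Y t))).
    by apply: measurable_sigma_type; left.
  by apply/funext => t; rewrite e Re_conjc.
rewrite (_ : (fun t => _) = (fun t => - complex.Im (Y t))).
  by apply: measurable_funN; apply: measurable_sigma_type; right.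
by apply/funext => t; rewrite e Im_conjc.
Qed.

Lemma sigma_upper i j : sigma_of (coords (fun w => W w i j)) `<=`
  sigma_of (coords (fun w => W w (upper i j).1 (upper i j).2)).
Proof.
case: (upper_eq i j) => ->//=; apply: sigma_conjc => // w; exact: W_hermitian.
Qed.

Lemma other_pair (i : 'I_N) : exists p q : 'I_N, [/\ (p < q)%N, p != i & q != i].
Proof.
have h0 : (0 < N)%N by exact: leq_trans N_ge3.
have h1 : (1 < N)%N by exact: leq_trans N_ge3.
pose o0 := Ordinal h0; pose o1 := Ordinal h1; pose o2 := Ordinal N_ge3.
have [i0|i0] := eqVneq (i : nat) 0%N; first by exists o1, o2; rewrite -!val_eqE /= i0.
have [i1|i1] := eqVneq (i : nat) 1%N; first by exists o0, o2; rewrite -!val_eqE /= i1.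
by exists o0, o1; rewrite -!val_eqE /= ![_ == (i : nat)]eq_sym i0 i1.
Qed.

(* The second family of the large deviation estimates plays no role here, but it has to be
   independent of column [i]: take the other diagonal entries and one off-diagonal entry. *)
Lemma column_family i : exists b, ld_family P theta C0 sigma (fun k w => W w k i) b.
Proof.
have [p [q [pq pi qi]]] := other_pair i.
pose f (k : 'I_N + 'I_N) : 'I_N * 'I_N :=
  match k with inl k => upper k i | inr k => if k == i then (p, q) else (k, k) end.
exists (fun k w => W w (f (inr k)).1 (f (inr k)).2); split.
- by move=> k; exact: wigner_ld_variable.
- by move=> k; exact: wigner_ld_variable.
have hi k : (f (inl k)).1 = i \/ (f (inl k)).2 = i.
  by case: (upper_eq k i) => /= ->; [right|left].
have hni k : (f (inr k)).1 != i /\ (f (inr k)).2 != i by rewrite /f; case: ifP => //= ->.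
have npq : p != q by rewrite -val_eqE /= neq_ltn pq.
have finj : injective f.
  move=> [k|k] [l|l].
  - rewrite /=; case: (upper_eq k i) => ->; case: (upper_eq l i) => -> e; congr inl; congruence.
  - move=> e; have [h1 h2] := hni l; have := hi k; rewrite e.
    by case=> h; move: h1 h2; rewrite h eqxx.
  - move=> e; have [h1 h2] := hni k; have := hi l; rewrite -e.
    by case=> h; move: h1 h2; rewrite h eqxx.
  - rewrite /=; case: eqP => [->|_]; case: eqP => [->|_] //.
    + by move=> [<- e]; move: npq; rewrite e eqxx.
    + by move=> [-> e]; move: npq; rewrite e eqxx.
    + by move=> [->].
apply: (mutually_independent_reindex finj (D := [set p : 'I_N * 'I_N | (p.1 <= p.2)%N]%SET)
  (S := fun p => sigma_of (coords (fun w => W w p.1 p.2)))).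
- move=> [k|k]; rewrite inE; first exact: upper_le.
  by rewrite /=; case: ifP => //= _; exact: ltnW.
- by move=> [k|k] //; exact: sigma_upper.
- by have [_ _ h _ _] := hW.
Qed.

Variables (Phi p : R).
Hypotheses (Phi_gt0 : 0 < Phi) (p_ge0 : 0 <= p).
Hypothesis hld : forall a b A B, ld_family P theta C0 sigma a b -> ld_bounds P sigma Phi p (N := N) a b A B.

Lemma linear_deviation i (A : 'I_N -> R[i]) :
  (P [set w | (Phi / Num.sqrt N%:R * Num.sqrt (\sum_k modulus (A k) ^+ 2) <
     modulus (\sum_k A k * W w k i))%R] <= p%:E)%E.
Proof.
have [b hb] := column_family i; have [h1 _ _ _] := hld A 0 hb.
apply: strict_deviation h1 => //.
- by apply: cmeasurable_sum => k _; apply: cmeasurableM => //; exact: cmeasurable_cst.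
- by rewrite !mulr_ge0 ?sqrtr_ge0// ltW.
move=> /eqP; rewrite mulf_eq0 (gt_eqF (mulr_gt0 Phi_gt0 sigma_gt0))/= sqrtr_eq0 => h w.
rewrite big1// => k _; rewrite (sum_modulus_sqr_eq0 _ k) ?mul0r//.
by apply/eqP; rewrite eq_le h sumr_ge0// => j _; exact: sqr_ge0.
Qed.

Lemma entry_deviation i k : (P [set w | (Phi / Num.sqrt N%:R < modulus (W w k i))%R] <= p%:E)%E.
Proof.
have := linear_deviation i (fun j => (j == k)%:R).
rewrite (bigD1 k)//= eqxx modulus1 expr1n big1 ?addr0 ?sqrtr1 ?mulr1; last first.
  by move=> j /negbTE ->; rewrite modulus0 expr0n.
congr (P _ <= _)%E; apply/seteqP; split => w /=.
all: rewrite (bigD1 k)//= eqxx mul1r big1 ?addr0// => j /negbTE ->; exact: mul0r.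
Qed.

(** The estimates treat diagonal and off-diagonal parts separately. Each square root is at most that
    of the full sum, whence the factor 2 in the threshold, and the two events are united, whence 2
    p. *)
Lemma quadratic_deviation i (B : 'M[R[i]]_N) :
  (P [set w | (2 * Phi / N%:R * Num.sqrt (\sum_a \sum_b modulus (B a b) ^+ 2) <
     modulus (\sum_a \sum_b conjc (W w a i) * B a b * W w b i - N%:R^-1 * \sum_k B k k))%R]
   <= (2 * p)%:E)%E.
Proof.
have [b hb] := column_family i; have [_ h2 h3 _] := hld (fun=> 0) B hb.
set S := \sum_a \sum_b modulus (B a b) ^+ 2.
set X2 := (X in deviation_le _ X _ _) in h2; set X3 := (X in deviation_le _ X _ _) in h3.
set S2 := \sum_a modulus (B a a) ^+ 2 in h2.
set S3 := \sum_a \sum_(b | a != b) modulus (B a b) ^+ 2 in h3.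
have SE : S = S2 + S3.
  rewrite /S /S2 /S3 -big_split; apply: eq_bigr => a _.
  by rewrite (bigD1 a)//=; congr (_ + _); apply: eq_bigl => k; rewrite eq_sym.
have S2_ge0 : 0 <= S2 by apply: sumr_ge0 => a _; exact: sqr_ge0.
have S3_ge0 : 0 <= S3 by apply: sumr_ge0 => a _; apply: sumr_ge0 => k _; exact: sqr_ge0.
have mX2 : cmeasurable X2.
  apply: cmeasurableB; last exact: cmeasurable_cst.
  apply: cmeasurable_sum => k _; apply: cmeasurableM => //; apply: cmeasurableM; last exact: cmeasurable_cst.
  exact: cmeasurable_conjc.
have mX3 : cmeasurable X3.
  apply: cmeasurable_sum => k _; apply: cmeasurable_sum => l _.
  apply: cmeasurableM => //; apply: cmeasurableM; last exact: cmeasurable_cst.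
  exact: cmeasurable_conjc.
have k0 : 0 < Phi * sigma ^+ 2 by rewrite mulr_gt0// exprn_gt0.
have t2 : 0 <= Phi * sigma ^+ 2 * Num.sqrt S2 by rewrite mulr_ge0 ?sqrtr_ge0// ltW.
have t3 : 0 <= Phi * sigma ^+ 2 * Num.sqrt S3 by rewrite mulr_ge0 ?sqrtr_ge0// ltW.
have z2 : Phi * sigma ^+ 2 * Num.sqrt S2 = 0 -> forall w, X2 w = 0.
  move=> /eqP; rewrite mulf_eq0 (gt_eqF k0)/= sqrtr_eq0 => h w.
  have hB : S2 = 0 by apply/eqP; rewrite eq_le h.
  have {}hB a : B a a = 0 := sum_modulus_sqr_eq0 (f := fun a => B a a) hB a.
  by rewrite /X2 !big1 ?subr0// => a _; rewrite hB ?mulr0 ?mul0r.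
have z3 : Phi * sigma ^+ 2 * Num.sqrt S3 = 0 -> forall w, X3 w = 0.
  move=> /eqP; rewrite mulf_eq0 (gt_eqF k0)/= sqrtr_eq0 => h w.
  have hB : S3 = 0 by apply/eqP; rewrite eq_le h.
  rewrite /X3 big1// => a _; rewrite big1// => b' ab.
  suff -> : B a b' = 0 by rewrite mulr0 mul0r.
  apply/eqP; rewrite -modulus_eq0 -sqrf_eq0 eq_le sqr_ge0 andbT -hB.
  rewrite /S3 (bigD1 a)//= (bigD1 b')//= -addrA lerDl addr_ge0// sumr_ge0// => *; rewrite ?sqr_ge0//.
  by rewrite sumr_ge0// => *; exact: sqr_ge0.
have e2 := strict_deviation mX2 p_ge0 t2 z2 h2.
have e3 := strict_deviation mX3 p_ge0 t3 z3 h3.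
have m2 : measurable [set w | (Phi * sigma ^+ 2 * Num.sqrt S2 < modulus (X2 w))%R].
  by apply: measurable_ltr_set; [exact: measurable_cst|exact: measurable_modulus].
have m3 : measurable [set w | (Phi * sigma ^+ 2 * Num.sqrt S3 < modulus (X3 w))%R].
  by apply: measurable_ltr_set; [exact: measurable_cst|exact: measurable_modulus].
have e w : \sum_a \sum_b conjc (W w a i) * B a b * W w b i - N%:R^-1 * \sum_k B k k = X2 w + X3 w.
  rewrite /X2 /X3 addrAC -big_split /=; congr (_ - _).
    apply: eq_bigr => a _; rewrite (bigD1 a)//=; congr (_ + _); apply: eq_bigl => k; by rewrite eq_sym.
  by rewrite mulr_sumr; apply: eq_bigr => k _; rewrite invC_nat sigma2.
apply: (@le_trans _ _ (P ([set w | (Phi * sigma ^+ 2 * Num.sqrt S2 < modulus (X2 w))%R] `|`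
                          [set w | (Phi * sigma ^+ 2 * Num.sqrt S3 < modulus (X3 w))%R]))%E).
  apply: le_measure; rewrite ?inE.
  - apply: measurable_ltr_set; first exact: measurable_cst.
    by under eq_fun do rewrite e; apply: measurable_modulus; exact: cmeasurableD.
  - exact: measurableU.
  move=> w /=; rewrite e => hlt.
  have [h|h] := leP (modulus (X2 w)) (Phi * sigma ^+ 2 * Num.sqrt S2); last by left.
  right; rewrite /= ltNge; apply/negP => h'.
  have := lt_le_trans hlt (le_trans (modulusD _ _) (lerD h h')).
  rewrite -mulrDr sigma2 -mulrA -mulrA (_ : 2 * (Phi * _) = Phi * N%:R^-1 * (Num.sqrt S + Num.sqrt S)); last first.
    by rewrite -mulr2n -mulr_natl; move: (Num.sqrt S) => x; ring.
  rewrite ltr_pM2l ?mulr_gt0 ?invr_gt0// => /(lt_le_trans) h4.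
  have : Num.sqrt S + Num.sqrt S < Num.sqrt S + Num.sqrt S.
    by apply: h4; apply: lerD; apply: ler_wsqrtr; rewrite SE ?lerDl ?lerDr.
  by rewrite ltxx.
apply: (le_trans (measureU2 _ m2 m3)).
by rewrite mulr_natl mulr2n EFinD; apply: leeD; [exact: e2|exact: e3].
Qed.

End WignerColumn.

Lemma measurable_sqrtr {R : realType} : measurable_fun setT (@Num.sqrt R).
Proof. by apply: continuous_measurable_fun; exact: sqrt_continuous. Qed.

Lemma eq_cmeasurable {R : realType} d (T : measurableType d) (f g : T -> R[i]) :
  (forall t, f t = g t) -> cmeasurable g -> cmeasurable f.
Proof. by move=> /funext ->. Qed.

Section RandomCoefficients.
Context {R : realType} d (T : measurableType d) (P : probability T R).
Variables (theta C0 : R) (N : nat) (W : T -> 'M[R[i]]_N) (v : T -> 'rV[R]_N).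
Hypotheses (theta_gt1 : 1 < theta) (C0_gt0 : 0 < C0) (N_ge3 : (3 <= N)%N).
Hypothesis hW : wigner P theta C0 W.
Hypothesis v_measurable : forall i, measurable_fun setT (fun w => v w 0 i).
Hypothesis v_indep : independent P (sigma_of [set (fun w => v w 0 i) | i in [set: 'I_N]])
  (sigma_of (\bigcup_(p in [set: 'I_N * 'I_N]) coords (fun w => W w p.1 p.2))).

Let W_measurable i j : cmeasurable (fun w => W w i j). Proof. by have [h _ _ _ _] := hW. Qed.
Let W_hermitian w : hermitian (W w). Proof. by have [_ h _ _ _] := hW; move=> i j; exact: h. Qed.

Definition upper_pairs : {set 'I_N * 'I_N} := [set p : 'I_N * 'I_N | (p.1 <= p.2)%N]%SET.
Definition column_pairs (i : 'I_N) : {set 'I_N * 'I_N} :=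
  [set p in upper_pairs | (p.1 == i) || (p.2 == i)]%SET.
Definition rest_pairs (i : 'I_N) : {set 'I_N * 'I_N} :=
  [set p in upper_pairs | (p.1 != i) && (p.2 != i)]%SET.
Definition column_funs i : set (T -> R) :=
  \bigcup_(p in [set` column_pairs i]) coords (fun w => W w p.1 p.2).
Definition rest_funs i : set (T -> R) :=
  [set (fun w => v w 0 j) | j in [set: 'I_N]] `|`
  \bigcup_(p in [set` rest_pairs i]) coords (fun w => W w p.1 p.2).

Let coords_measurable i j f : coords (fun w => W w i j) f -> measurable_fun setT f.
Proof. by have [m1 m2] := W_measurable i j; case=> ->. Qed.

Lemma rest_column_independent i : independent P (sigma_of (rest_funs i)) (sigma_of (column_funs i)).
Proof.
apply: independent_sym.
pose S (p : 'I_N * 'I_N) := sigma_of (coords (fun w => W w p.1 p.2)).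
pose S0 := sigma_of [set (fun w => v w 0 i) | i in [set: 'I_N]].
have mS p : S p `<=` measurable by apply: sigma_of_measurable => f; exact: coords_measurable.
have mS0 : S0 `<=` measurable by apply: sigma_of_measurable => _ [j _ <-].
have hS0 (B : set T) (A : 'I_N * 'I_N -> set T) : S0 B -> (forall p, p \in upper_pairs -> S p (A p)) ->
    P (B `&` \bigcap_(p in [set` upper_pairs]) A p) = (P B * P (\bigcap_(p in [set` upper_pairs]) A p))%E.
  move=> SB SA; apply: v_indep => //.
  set F := \bigcup_(p in _) _.
  suff h : @measurable _ (sigma_type F) (\bigcap_(p in [set` upper_pairs]) A p) by exact: h.
  apply: fin_bigcap_measurable; first exact: finite_finset.
  move=> p /= hp; have := SA p hp; apply: sub_sigma_of => f hf.
  by apply: measurable_sigma_type; exists p.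
have := independent_groups mS (fun p => @sigma_ofI _ _ _ _) (fun p => @sigma_ofT _ _ _ _) mS0
  (@sigma_ofI _ _ _ _) (@sigma_ofT _ _ _ _) _ hS0 (D1 := column_pairs i) (D2 := rest_pairs i).
move=> h A B hA hB; apply: h.
- by have [_ _ h _ _] := hW.
- by move=> p; rewrite !inE => /andP[-> h] /=; rewrite -negb_or h.
- by apply/fintype.subsetP => p; rewrite !inE => /andP[].
- by apply/fintype.subsetP => p; rewrite !inE => /andP[].
- apply: (smallest_sub _ _ hA); first exact: smallest_sigma_algebra.
  move=> C [f [p hp fp] hC]; apply: sub_sigma_algebra; exists p => //.
  by apply: sub_sigma_algebra; exists f.
- apply: (smallest_sub _ _ hB); first exact: smallest_sigma_algebra.
  move=> C [f [hf|[p hp fp]] hC]; apply: sub_sigma_algebra; [left|right; exists p => //].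
    by apply: sub_sigma_algebra; exists f.
  by apply: sub_sigma_algebra; exists f.
Qed.

Let rest_sub i : sigma_of (rest_funs i) `<=` measurable.
Proof. by apply: sigma_of_measurable => f [[j _ <-]//|[p _]]; exact: coords_measurable. Qed.
Let column_sub i : sigma_of (column_funs i) `<=` measurable.
Proof. by apply: sigma_of_measurable => f [p _]; exact: coords_measurable. Qed.

(** The diagonal event E(t, t) separates the two roles of a sample: coefficients read it through the
    rest, the linear or quadratic form through column i. *)
Lemma column_conditioning i (E : set (sigma_type (rest_funs i) * sigma_type (column_funs i)))
    (p : \bar R) : measurable E ->
  (forall x, P [set t | E (x, t)] <= p)%E -> (P [set t | E (t, t)] <= p)%E.
Proof.
have mX : measurable_fun setT (id : T -> sigma_type (rest_funs i)).
  by move=> _ B mB; rewrite setTI; have h : measurable (B : set T) := rest_sub mB; exact: h.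
have mY : measurable_fun setT (id : T -> sigma_type (column_funs i)).
  by move=> _ B mB; rewrite setTI; have h : measurable (B : set T) := column_sub mB; exact: h.
apply: (section_bound mX mY) => A B mA mB; exact: (@rest_column_independent i A B mA mB).
Qed.

Let cmeasurable_sigma (F : set (T -> R)) (X : T -> R[i]) : coords X `<=` F ->
  cmeasurable (X : sigma_type F -> R[i]).
Proof. by move=> h; split; apply: measurable_sigma_type; apply: h; [left|right]. Qed.

Lemma cmeasurable_column i k : cmeasurable ((fun w => W w k i) : sigma_type (column_funs i) -> R[i]).
Proof.
have hu : upper k i \in column_pairs i.
  by rewrite !inE upper_le/=; case: (upper_eq k i) => -> /=; rewrite eqxx ?orbT.
have h : cmeasurable ((fun w => W w (upper k i).1 (upper k i).2) : sigma_type (column_funs i) -> R[i]).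
  by apply: cmeasurable_sigma => f hf; exists (upper k i).
case: (upper_eq k i) => e; rewrite e in h => //=.
by apply: (@eq_cmeasurable _ _ (sigma_type (column_funs i)) _ (fun w => conjc (W w i k)) (fun w => W_hermitian w k i)); exact: cmeasurable_conjc.
Qed.

Lemma cmeasurable_rest i k l : k != i -> l != i ->
  cmeasurable ((fun w => W w k l) : sigma_type (rest_funs i) -> R[i]).
Proof.
move=> ki li; have hu : upper k l \in rest_pairs i.
  by rewrite !inE upper_le/=; case: (upper_eq k l) => -> /=; rewrite ki li.
have h : cmeasurable ((fun w => W w (upper k l).1 (upper k l).2) : sigma_type (rest_funs i) -> R[i]).
  by apply: cmeasurable_sigma => f hf; right; exists (upper k l).
case: (upper_eq k l) => e; rewrite e in h => //=.
by apply: (@eq_cmeasurable _ _ (sigma_type (rest_funs i)) _ (fun w => conjc (W w l k)) (fun w => W_hermitian w k l)); exact: cmeasurable_conjc.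
Qed.

Variables (Phi p : R).
Hypotheses (Phi_gt0 : 0 < Phi) (p_ge0 : 0 <= p).
Hypothesis hld : forall a b A B, ld_family P theta C0 (Num.sqrt N%:R)^-1 a b ->
  ld_bounds P (Num.sqrt N%:R)^-1 Phi p (N := N) a b A B.

Lemma random_linear_deviation i (A : T -> 'I_N -> R[i]) :
  (forall k, cmeasurable ((fun w => A w k) : sigma_type (rest_funs i) -> R[i])) ->
  (P [set w | (Phi / Num.sqrt N%:R * Num.sqrt (\sum_k modulus (A w k) ^+ 2) <
     modulus (\sum_k A w k * W w k i))%R] <= p%:E)%E.
Proof.
move=> mA.
pose E : set (sigma_type (rest_funs i) * sigma_type (column_funs i)) :=
  [set z | (Phi / Num.sqrt N%:R * Num.sqrt (\sum_k modulus (A z.1 k) ^+ 2) <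
     modulus (\sum_k A z.1 k * W z.2 k i))%R].
apply: (@column_conditioning i E); last by move=> x; exact: (linear_deviation theta_gt1 C0_gt0 N_ge3 hW Phi_gt0 p_ge0 hld i (A x)).
have mA1 k : cmeasurable (fun z : sigma_type (rest_funs i) * sigma_type (column_funs i) => A z.1 k).
  by apply: (cmeasurable_comp _ (mA k)); exact: measurable_fst.
have mW2 k : cmeasurable (fun z : sigma_type (rest_funs i) * sigma_type (column_funs i) => W z.2 k i).
  by apply: (cmeasurable_comp _ (cmeasurable_column i k)); exact: measurable_snd.
apply: measurable_ltr_set.
  apply: measurable_funM; first exact: measurable_cst.
  apply: measurableT_comp; first exact: measurable_sqrtr.
  by apply: measurable_sum => k; exact: measurable_modulus_sqr.
by apply: measurable_modulus; apply: cmeasurable_sum => k _; exact: cmeasurableM.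
Qed.

Lemma random_quadratic_deviation i (B : T -> 'M[R[i]]_N) :
  (forall a b, cmeasurable ((fun w => B w a b) : sigma_type (rest_funs i) -> R[i])) ->
  (P [set w | (2 * Phi / N%:R * Num.sqrt (\sum_a \sum_b modulus (B w a b) ^+ 2) <
     modulus (\sum_a \sum_b conjc (W w a i) * B w a b * W w b i - N%:R^-1 * \sum_k B w k k))%R]
   <= (2 * p)%:E)%E.
Proof.
move=> mB.
pose E : set (sigma_type (rest_funs i) * sigma_type (column_funs i)) :=
  [set z | (2 * Phi / N%:R * Num.sqrt (\sum_a \sum_b modulus (B z.1 a b) ^+ 2) <
     modulus (\sum_a \sum_b conjc (W z.2 a i) * B z.1 a b * W z.2 b i - N%:R^-1 * \sum_k B z.1 k k))%R].
apply: (@column_conditioning i E); last by move=> x; exact: (quadratic_deviation theta_gt1 C0_gt0 N_ge3 hW Phi_gt0 p_ge0 hld i (B x)).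
have mB1 a b : cmeasurable (fun z : sigma_type (rest_funs i) * sigma_type (column_funs i) => B z.1 a b).
  by apply: (cmeasurable_comp _ (mB a b)); exact: measurable_fst.
have mW2 k : cmeasurable (fun z : sigma_type (rest_funs i) * sigma_type (column_funs i) => W z.2 k i).
  by apply: (cmeasurable_comp _ (cmeasurable_column i k)); exact: measurable_snd.
apply: measurable_ltr_set.
  apply: measurable_funM; first exact: measurable_cst.
  apply: measurableT_comp; first exact: measurable_sqrtr.
  by apply: measurable_sum => a; apply: measurable_sum => b; exact: measurable_modulus_sqr.
apply: measurable_modulus; apply: cmeasurableB.
  apply: cmeasurable_sum => a _; apply: cmeasurable_sum => b _; apply: cmeasurableM => //.
  by apply: cmeasurableM => //; exact: cmeasurable_conjc.
by apply: cmeasurableM; [exact: cmeasurable_cst|exact: cmeasurable_sum].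
Qed.

Section Resolvent.
Variables (lam : R) (z : R[i]) (i : 'I_N).
Hypothesis z_gt0 : 0 < complex.Im z.
Local Notation H w := (hamiltonian lam (v w) (W w)).

(** The point is the smaller sigma-algebra: the minor does not see column i, so its resolvent
    entries may be frozen as coefficients. *)
Lemma cmeasurable_minor a b :
  cmeasurable ((fun w => green (zero_out i (H w)) z a b) : sigma_type (rest_funs i) -> R[i]).
Proof.
apply: cmeasurable_invmx; last first.
  by move=> w; apply: hermitian_unit => //; apply/hermitian_zero_out/hermitian_hamiltonian.
move=> k l.
apply: (@eq_cmeasurable _ _ (sigma_type (rest_funs i)) _ (fun w => (if (k == i) || (l == i) then 0 else
    (if k == l then (lam * v w 0 k)%:C else 0) + W w k l) - z%:M k l)).
  by move=> w; rewrite !mxE; case: ifP => //; rewrite -hamiltonianE !mxE.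
apply: cmeasurableB; last exact: cmeasurable_cst.
have [ki|ki] := eqVneq k i; first by rewrite /=; exact: cmeasurable_cst.
have [li|li] := eqVneq l i; first by rewrite /=; exact: cmeasurable_cst.
rewrite /=; apply: cmeasurableD; last exact: cmeasurable_rest.
case: eqP => _; last exact: cmeasurable_cst.
apply: cmeasurable_real; apply: measurable_funM; first exact: measurable_cst.
by apply: measurable_sigma_type; left; exists k.
Qed.

Lemma cmeasurable_minor_mx a b :
  cmeasurable ((fun w => minor_mx (H w) z i a b) : sigma_type (rest_funs i) -> R[i]).
Proof.
apply: (@eq_cmeasurable _ _ (sigma_type (rest_funs i)) _ (fun w => if b == i then 0 else green (zero_out i (H w)) z a b)).
  by move=> w; rewrite mxE.
by case: eqP => _; [exact: cmeasurable_cst|exact: cmeasurable_minor].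
Qed.

Lemma minor_quad_column w : minor_quad (H w) z i =
  \sum_a \sum_b conjc (W w a i) * minor_mx (H w) z i a b * W w b i.
Proof.
have hH := hermitian_hamiltonian lam (v w) (W_hermitian w).
apply: eq_bigr => a _; apply: eq_bigr => b _; rewrite (minor_mxE i hH z_gt0).
have [->|ai] := eqVneq a i; first by rewrite /= !(mulr0, mul0r).
have [->|bi] := eqVneq b i; first by rewrite /= !(mulr0, mul0r).
rewrite !hamiltonianE eq_sym (negbTE ai) (negbTE bi) !add0r.
by rewrite -(W_hermitian w i a).
Qed.

Lemma minor_colsum_column w j : j != i -> minor_colsum (H w) z i j =
  \sum_a green (zero_out i (H w)) z j a * W w a i.
Proof.
move=> ji; have hH := hermitian_hamiltonian lam (v w) (W_hermitian w).
apply: eq_bigr => a _; have [->|ai] := eqVneq a i; first by rewrite (minor_col hH z_gt0 ji) !mul0r.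
by rewrite hamiltonianE (negbTE ai) add0r.
Qed.

Lemma minor_quad_deviation :
  (P [set w | (2 * Phi / N%:R * Num.sqrt (\sum_a \sum_b modulus (minor_mx (H w) z i a b) ^+ 2) <
     modulus (minor_quad (H w) z i - N%:R^-1 * \sum_k minor_mx (H w) z i k k))%R] <= (2 * p)%:E)%E.
Proof.
have := random_quadratic_deviation cmeasurable_minor_mx.
by congr (P _ <= _)%E; apply/seteqP; split => w /=; rewrite minor_quad_column.
Qed.

Lemma minor_colsum_deviation j : j != i ->
  (P [set w | (Phi / Num.sqrt N%:R * Num.sqrt (\sum_a modulus (green (zero_out i (H w)) z j a) ^+ 2) <
     modulus (minor_colsum (H w) z i j))%R] <= p%:E)%E.
Proof.
move=> ji; have := random_linear_deviation (cmeasurable_minor j).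
by congr (P _ <= _)%E; apply/seteqP; split => w /=; rewrite minor_colsum_column.
Qed.

End Resolvent.
End RandomCoefficients.

(** * Exponential moments and concentration of averages over the potential *)

Lemma measurable_bigprod {R : realType} d (T : measurableType d) (I : Type) (s : seq I)
    (Q : pred I) (f : I -> T -> R) : (forall i, Q i -> measurable_fun setT (f i)) ->
  measurable_fun setT (fun t => \prod_(i <- s | Q i) f i t).
Proof.
move=> mf; elim: s => [|i s ih].
  by under eq_fun do rewrite big_nil; exact: measurable_cst.
have [Qi|Qi] := boolP (Q i); last first.
  by rewrite (_ : (fun t => _) = fun t => \prod_(i <- s | Q i) f i t)//; apply/funext => t; rewrite big_cons (negbTE Qi).
rewrite (_ : (fun t => _) = fun t => f i t * \prod_(i <- s | Q i) f i t); last first.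
  by apply/funext => t; rewrite big_cons Qi.
by apply: measurable_funM => //; exact: mf.
Qed.

Section ProductIntegral.
Context {R : realType} d (T : measurableType d) (P : probability T R).
Context d1 d2 (T1 : measurableType d1) (T2 : measurableType d2).
Variables (X : T -> T1) (Y : T -> T2).
Hypotheses (mX : measurable_fun setT X) (mY : measurable_fun setT Y).
Hypothesis hXY : forall A B, measurable A -> measurable B ->
  P (X @^-1` A `&` Y @^-1` B) = (P (X @^-1` A) * P (Y @^-1` B))%E.

Lemma integral_independent_mul (f : T1 -> R) (g : T2 -> R) :
  measurable_fun setT f -> measurable_fun setT g -> (forall x, 0 <= f x) -> (forall y, 0 <= g y) ->
  (\int[P]_t (f (X t) * g (Y t))%:E = (\int[P]_t (f (X t))%:E) * \int[P]_t (g (Y t))%:E)%E.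
Proof.
move=> mf mg f0 g0.
have mF : measurable_fun setT (fun z : T1 * T2 => (f z.1 * g z.2)%:E).
  by apply/measurable_EFinP; apply: measurable_funM; apply: measurableT_comp.
rewrite (integral_independent mX mY hXY mF); last by move=> z; rewrite lee_fin mulr_ge0.
have mfX : measurable_fun setT (fun t => (f (X t))%:E).
  by apply/measurable_EFinP; apply: measurableT_comp mf mX.
have mgY : measurable_fun setT (fun t => (g (Y t))%:E).
  by apply/measurable_EFinP; apply: measurableT_comp mg mY.
rewrite -ge0_integralZr//; last 2 first.
- by move=> t _; rewrite lee_fin.
- by apply: integral_ge0 => t _; rewrite lee_fin.
apply: eq_integral => s _ /=; under eq_integral do rewrite EFinM.
by rewrite ge0_integralZl//; [move=> t _; rewrite lee_fin|rewrite lee_fin].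
Qed.

End ProductIntegral.

(** From exp(-x) >= 1 - x, and (1 - x)(1 + x + 2 x^2) = 1 + x^2 (1 - 2 x). *)
Lemma expR_le_quadratic {R : realType} (x : R) : x <= 2^-1 -> expR x <= 1 + x + 2 * x ^+ 2.
Proof.
move=> x2; have h : 0 < 1 - x by lra.
have := expR_ge1Dx (- x); rewrite expRN => h1.
rewrite -[expR x]invrK; apply: (@le_trans _ _ (1 - x)^-1).
  by rewrite lef_pV2 ?posrE ?invr_gt0 ?expR_gt0.
rewrite -[leLHS]mul1r ler_pdivrMr//.
have : 0 <= x ^+ 2 * (1 - 2 * x) by rewrite mulr_ge0 ?sqr_ge0//; lra.
nra.
Qed.

Section Chernoff.
Context {R : realType} d (T : measurableType d) (P : probability T R).
Variables (mu : probability (measurableTypeR R) R) (N : nat) (v : T -> 'rV[R]_N).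
Hypothesis hv : iid_with_law P mu v.
Hypothesis N_gt0 : (0 < N)%N.

Let mv i : measurable_fun setT ((fun w => v w 0%R i) : T -> measurableTypeR R).
Proof. by have [h _ _] := hv; exact: h. Qed.

Lemma iid_law_integral (g : measurableTypeR R -> \bar R) i : measurable_fun setT g -> (forall x, (0 <= g x)%E) ->
  (\int[P]_w g (v w 0%R i) = \int[mu]_x g x)%E.
Proof.
move=> mg g0; rewrite -(@ge0_integral_pushforward _ _ _ _ _ _ (mv i) P setT g)//.
apply: eq_measure_integral => A mA _; rewrite /pushforward.
by have [_ h _] := hv; exact: h.
Qed.

Let funs n : set (T -> R) := [set (fun w => v w 0%R k) | k in [set k : 'I_N | (k < n)%N]].

(** An instance of [independent_groups] with trivial extra family, separating the first n
    coordinates from the next one; it feeds the induction of [iid_product_integral]. *)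
Let prefix_independent n (i : 'I_N) (A : set (sigma_type (funs n))) (B : set (measurableTypeR R)) :
  i = n :> nat -> measurable A -> measurable B ->
  P ((id : T -> sigma_type (funs n)) @^-1` A `&` (fun w => v w 0%R i) @^-1` B) =
  (P ((id : T -> sigma_type (funs n)) @^-1` A) * P ((fun w => v w 0%R i) @^-1` B))%E.
Proof.
move=> ni mA mB.
pose S (k : 'I_N) := sigma_of [set (fun w => v w 0%R k)].
have mS k : S k `<=` measurable by apply: sigma_of_measurable => _ ->; exact: mv.
have := @independent_groups _ _ _ P _ [set: 'I_N]%SET S [set setT] mS (fun p => @sigma_ofI _ _ _ _)
  (fun p => @sigma_ofT _ _ _ _) _ _ _ _ _ [set k : 'I_N | (k < n)%N]%SET [set i]%SET.
apply.
- by move=> _ ->.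
- by move=> _ _ -> ->; rewrite setTI.
- by [].
- by have [_ _ h] := hv.
- by move=> C D -> _; rewrite setTI probability_setT mul1e.
- move=> k; rewrite !inE; apply: contraTneq => ->; by rewrite ni ltnn.
- exact: finset.subsetT.
- exact: finset.subsetT.
- apply: (smallest_sub _ _ mA); first exact: smallest_sigma_algebra.
  move=> C [_ [k hk <-] hC]; apply: sub_sigma_algebra; exists k; first by rewrite /= inE.
  by apply: sub_sigma_algebra; exists (fun w => v w 0%R k).
- apply: sub_sigma_algebra; right; exists i; first by rewrite /= inE.
  apply: sub_sigma_algebra; exists (fun w => v w 0%R i) => //.
  by exists B => //; rewrite setTI.
Qed.

Lemma iid_product_integral (g : measurableTypeR R -> R) (K : R) n : measurable_fun setT g ->
  (forall x, 0 <= g x) -> (\int[mu]_x (g x)%:E <= K%:E)%E -> (n <= N)%N ->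
  (\int[P]_w (\prod_(k < N | (k < n)%N) g (v w 0%R k))%:E <= (K ^+ n)%:E)%E.
Proof.
move=> mg g0 hK; have K0 : 0 <= K.
  by rewrite -lee_fin; apply: le_trans hK; apply: integral_ge0 => x _; rewrite lee_fin.
elim: n => [_|n ih nN].
  under eq_integral do rewrite big_pred0//.
  by rewrite integral_cst// mul1e [X in (X <= _)%E](probability_setT P) expr0.
pose i : 'I_N := Ordinal nN.
have mf : measurable_fun setT ((fun w => \prod_(k < N | (k < n)%N) g (v w 0%R k)) : sigma_type (funs n) -> R).
  apply: measurable_bigprod => k kn; apply: measurableT_comp => //.
  by apply: measurable_sigma_type; exists k.
have mX : measurable_fun setT (id : T -> sigma_type (funs n)).
  move=> _ B mB; rewrite setTI; have h : measurable (B : set T); last exact: h.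
  by apply: (sigma_of_measurable _ mB) => _ [k _ <-]; exact: mv.
have e : (\int[P]_w (\prod_(k < N | (k < n.+1)%N) g (v w 0%R k))%:E =
   (\int[P]_w (\prod_(k < N | (k < n)%N) g (v w 0%R k))%:E) * \int[P]_w (g (v w 0%R i))%:E)%E.
  rewrite -(integral_independent_mul mX (mv i) _ mf mg)//.
  - apply: eq_integral => w _; rewrite (bigD1 i)//= mulrC; congr (_ * _)%:E.
    apply: eq_bigl => k; rewrite ltnS leq_eqVlt -val_eqE /=.
    by case: (ltngtP k n).
  - by move=> A B; exact: prefix_independent.
  - by move=> w; apply: prodr_ge0.
rewrite e exprSr EFinM; apply: lee_pmul.
- by apply: integral_ge0 => w _; rewrite lee_fin prodr_ge0.
- by apply: integral_ge0 => w _; rewrite lee_fin.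
- exact/ih/ltnW.
- by rewrite (@iid_law_integral (fun x => (g x)%:E))//; apply/measurable_EFinP.
Qed.

Variables (Phi : R).
Hypotheses (Phi_gt0 : 0 < Phi) (Phi_le : Phi <= Num.sqrt N%:R).
Let sN : (0 : R) < Num.sqrt N%:R. Proof. by rewrite sqrtr_gt0 ltr0n. Qed.

Lemma chernoff (f : measurableTypeR R -> R) (b : R) : measurable_fun setT f -> 0 < b ->
  (forall x, `|f x| <= b) -> \int[mu]_x f x = 0 ->
  (P [set w | (3 * b * Phi * Num.sqrt N%:R < \sum_k f (v w 0%R k))%R] <= (expR (- Phi ^+ 2))%:E)%E.
Proof.
move=> mf b0 hb f0.
(* The hypothesis Phi <= sqrt N gives t b <= 1/2. At the threshold the exponent is 3/2 Phi^2, the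
   moment bound costs 2 N (t b)^2 = Phi^2 / 2, and Phi^2 remains. *)
pose t := Phi / (2 * b * Num.sqrt N%:R).
have t0 : 0 < t by rewrite divr_gt0// !mulr_gt0.
have tb : t * b <= 2^-1.
  rewrite /t (_ : _ * b = Phi / Num.sqrt N%:R / 2); last by field; rewrite !gt_eqF.
  by rewrite -[leRHS]mul1r ler_pM2r// ler_pdivrMr// mul1r.
have rf : rbounded f by split => //; exists b.
pose g x := expR (t * f x).
have mg : measurable_fun setT g.
  by apply: measurableT_comp => //; apply: measurable_funM => //; exact: measurable_cst.
have tfb x : `|t * f x| <= t * b by rewrite normrM gtr0_norm// ler_pM2l.
have rg : rbounded g.
  split => //; exists (expR (t * b)) => x; rewrite ger0_norm ?expR_ge0// ler_expR.
  exact: le_trans (ler_norm _) (tfb x).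
have hK : (\int[mu]_x (g x)%:E <= (expR (2 * (t * b) ^+ 2))%:E)%E.
  have h := le_Rint mu rg (rboundedD (rboundedD (rbounded_cst _ 1) (rboundedM (rbounded_cst _ t) rf))
     (rbounded_cst _ (2 * (t * b) ^+ 2))).
  rewrite -[X in (X <= _)%E](@fineK _ _); last by apply: integrable_fin_num => //; exact: rbounded_integrable.
  rewrite lee_fin; apply: le_trans (h _) _.
    move=> x; apply: (le_trans (expR_le_quadratic _)).
      exact: le_trans (le_trans (ler_norm _) (tfb x)) tb.
    rewrite lerD2l ler_pM2l// -[leLHS]real_normK ?num_real//.
    by rewrite lerXn2r// nnegrE; exact: le_trans (tfb x).
  rewrite RintD; [|exact: rboundedD (rbounded_cst _ _) (rboundedM (rbounded_cst _ _) rf)|exact: rbounded_cst].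
  rewrite RintD; [|exact: rbounded_cst|exact: rboundedM (rbounded_cst _ _) rf].
  by rewrite RintZ// f0 mulr0 addr0 !Rint_cst; exact: expR_ge1Dx.
have := iid_product_integral mg (fun x => expR_ge0 _) hK (leqnn N).
have eprod w : \prod_(k < N | (k < N)%N) g (v w 0%R k) = expR (t * \sum_k f (v w 0%R k)).
  rewrite mulr_sumr expR_sum; apply: eq_bigl => k; by rewrite ltn_ord.
under eq_integral do rewrite eprod.
rewrite -expRM_natl => hM.
set s := 3 * b * Phi * Num.sqrt N%:R.
have mS : measurable_fun setT (fun w => \sum_k f (v w 0%R k)).
  by apply: measurable_sum => k; exact: measurableT_comp mf (mv k).
have mA : measurable [set w | (s < \sum_k f (v w 0%R k))%R].
  by apply: measurable_ltr_set => //; exact: measurable_cst.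
have h : ((expR (t * s))%:E * P [set w | (s < \sum_k f (v w 0%R k))%R] <=
    \int[P]_w (expR (t * \sum_k f (v w 0%R k)))%:E)%E.
  have := integral_indic P measurableT mA; rewrite setIT => <-.
  have mI : measurable_fun setT (fun w => (\1_[set w | (s < \sum_k f (v w 0%R k))%R] w)%:E : \bar R).
    by apply/measurable_EFinP; exact: measurable_indic.
  rewrite -ge0_integralZl//; try (by rewrite lee_fin expR_ge0); try (by move=> w _; rewrite lee_fin).
  apply: ge0_le_integral => //.
  - by apply/measurable_EFinP; apply: measurable_funM; [exact: measurable_cst|exact: measurable_indic].
  - apply/measurable_EFinP; apply: measurableT_comp => //.
    by apply: measurable_funM => //; exact: measurable_cst.
  - move=> w _; rewrite -EFinM lee_fin indicE; have [ws|_] := boolP (w \in _).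
    by rewrite mulr1 ler_expR ler_pM2l//; move: ws; rewrite inE => /ltW.
    by rewrite mulr0 expR_ge0.
have {}hM := le_trans h hM.
have e0 : (0 < expR (t * s))%R by exact: expR_gt0.
have -> : (expR (- Phi ^+ 2))%:E = ((expR (- (t * s)))%:E * (expR (2 * (t * b) ^+ 2 *+ N))%:E)%E.
  rewrite -EFinM -expRD; congr (expR _)%:E.
  have sN2 : Num.sqrt N%:R ^+ 2 = N%:R :> R by rewrite sqr_sqrtr.
  have -> : t * s = 3 / 2 * Phi ^+ 2 by rewrite /t /s; field; rewrite !gt_eqF.
  have -> : (t * b) ^+ 2 = Phi ^+ 2 / (4 * N%:R).
    by rewrite -sN2 /t; field; rewrite !gt_eqF.
  by rewrite -mulr_natr; field; rewrite gt_eqF// ltr0n.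
rewrite expRN; move: hM.
have : P [set w | (s < \sum_k f (v w 0%R k))%R] \is a fin_num by exact: fin_num_measure.
move=> /fineK <-; rewrite -!EFinM !lee_fin => hM.
by rewrite -mulr_natl mulrC ler_pdivlMr// mulrC.
Qed.

Lemma chernoff_abs (f : measurableTypeR R -> R) (b : R) : measurable_fun setT f -> 0 < b ->
  (forall x, `|f x| <= b) -> \int[mu]_x f x = 0 ->
  (P [set w | (3 * b * Phi * Num.sqrt N%:R < `|\sum_k f (v w 0%R k)|)%R] <= (2 * expR (- Phi ^+ 2))%:E)%E.
Proof.
move=> mf b0 hb f0; set s := 3 * b * Phi * Num.sqrt N%:R.
have rf : rbounded f by split => //; exists b.
have h1 := chernoff mf b0 hb f0.
have h2 : (P [set w | (s < \sum_k - f (v w 0%R k))%R] <= (expR (- Phi ^+ 2))%:E)%E.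
  apply: (@chernoff (fun x => - f x)) => //; first exact: measurable_funN.
    by move=> x; rewrite normrN.
  by rewrite RintN// f0 oppr0.
have mS : measurable_fun setT (fun w => \sum_k f (v w 0%R k)).
  by apply: measurable_sum => k; exact: measurableT_comp mf (mv k).
have mS' : measurable_fun setT (fun w => \sum_k - f (v w 0%R k)).
  by apply: measurable_sum => k; apply: measurable_funN; exact: measurableT_comp mf (mv k).
have m1 : measurable [set w | (s < \sum_k f (v w 0%R k))%R] by exact: measurable_ltr_set.
have m2 : measurable [set w | (s < \sum_k - f (v w 0%R k))%R] by exact: measurable_ltr_set.
apply: (@le_trans _ _ (P ([set w | (s < \sum_k f (v w 0%R k))%R] `|` [set w | (s < \sum_k - f (v w 0%R k))%R]))).
  apply: le_measure; rewrite ?inE; [|exact: measurableU|].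
    by apply: measurable_ltr_set => //; exact: measurableT_comp.
  move=> w /=; rewrite sumrN; case: (ger0P (\sum_k f (v w 0%R k))) => _ h; by [left|right].
apply: (le_trans (measureU2 _ m1 m2)).
by rewrite mulr_natl mulr2n EFinD; apply: leeD.
Qed.

(** Centering doubles the bound b, and the thresholds of the real and imaginary parts add up: 2 * 3
    * 2 b = 12 b. *)
Lemma chernoff_complex (f : measurableTypeR R -> R[i]) (b : R) : cmeasurable f -> 0 < b ->
  (forall x, modulus (f x) <= b) ->
  (P [set w | (12 * b * Phi / Num.sqrt N%:R < modulus (N%:R^-1 * \sum_k f (v w 0%R k) - cintegral mu f))%R]
    <= (4 * expR (- Phi ^+ 2))%:E)%E.
Proof.
move=> mf b0 hb; have cf : cbounded f by split => //; exists b.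
have NR0 : (0 : R) < N%:R by rewrite ltr0n.
set F := cintegral mu f.
have hF : modulus F <= b.
  apply: (le_trans (modulus_cintegral mu cf)); rewrite -[leRHS](Rint_cst mu).
  by apply: le_Rint => //; [exact: cbounded_modulus|exact: rbounded_cst].
pose fr (x : measurableTypeR R) := complex.Re (f x) - complex.Re F.
pose fi (x : measurableTypeR R) := complex.Im (f x) - complex.Im F.
have b2 : 0 < 2 * b by exact: mulr_gt0.
have mr : measurable_fun setT fr by apply: measurable_funB => //; case: mf.
have mi : measurable_fun setT fi by apply: measurable_funB => //; case: mf.
have br x : `|fr x| <= 2 * b.
  rewrite /fr (le_trans (ler_normB _ _))// mulr_natl mulr2n lerD//.
    exact: le_trans (Re_le_modulus _) (hb x).
  exact: le_trans (Re_le_modulus _) hF.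
have bi x : `|fi x| <= 2 * b.
  rewrite /fi (le_trans (ler_normB _ _))// mulr_natl mulr2n lerD//.
    exact: le_trans (Im_le_modulus _) (hb x).
  exact: le_trans (Im_le_modulus _) hF.
have r0 : \int[mu]_x fr x = 0.
  by rewrite RintB ?Rint_cst ?Re_cintegral ?subrr//; [exact: cbounded_Re|exact: rbounded_cst].
have i0 : \int[mu]_x fi x = 0.
  by rewrite RintB ?Rint_cst ?Im_cintegral ?subrr//; [exact: cbounded_Im|exact: rbounded_cst].
have h1 := chernoff_abs mr b2 br r0; have h2 := chernoff_abs mi b2 bi i0.
set s := 3 * (2 * b) * Phi * Num.sqrt N%:R in h1 h2.
have mS g : measurable_fun setT (g : measurableTypeR R -> R) -> measurable_fun setT (fun w => `|\sum_k g (v w 0%R k)|).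
  move=> mg; apply: measurableT_comp => //.
  by apply: measurable_sum => k; exact: measurableT_comp mg (mv k).
have m1 : measurable [set w | (s < `|\sum_k fr (v w 0%R k)|)%R] by apply: measurable_ltr_set => //; exact: mS.
have m2 : measurable [set w | (s < `|\sum_k fi (v w 0%R k)|)%R] by apply: measurable_ltr_set => //; exact: mS.
apply: (@le_trans _ _ (P ([set w | (s < `|\sum_k fr (v w 0%R k)|)%R] `|` [set w | (s < `|\sum_k fi (v w 0%R k)|)%R]))).
  apply: le_measure; rewrite ?inE; [|exact: measurableU|].
    apply: measurable_ltr_set => //; apply: measurable_modulus; apply: cmeasurableB; last exact: cmeasurable_cst.
    apply: cmeasurableM; first exact: cmeasurable_cst.
    by apply: cmeasurable_sum => k _; exact: cmeasurable_comp (mv k) mf.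
  move=> w /=; set S := N%:R^-1 * _ - F => hlt.
  have eR : complex.Re S = N%:R^-1 * \sum_k fr (v w 0%R k).
    rewrite /S ReD ReN invC_nat ReM /= mul0r subr0 Re_sum /fr sumrB sumr_const card_ord mulrBr.
    by rewrite -[complex.Re F *+ N]mulr_natl mulKf// gt_eqF.
  have eI : complex.Im S = N%:R^-1 * \sum_k fi (v w 0%R k).
    rewrite /S ImD ImN invC_nat ImM /= mul0r addr0 Im_sum /fi sumrB sumr_const card_ord mulrBr.
    by rewrite -[complex.Im F *+ N]mulr_natl mulKf// gt_eqF.
  have [h|h] := leP `|\sum_k fr (v w 0%R k)| s; last by left.
  right; rewrite /= ltNge; apply/negP => h'.
  have := lt_le_trans hlt (modulus_le_ReIm S); rewrite eR eI !normrM gtr0_norm ?invr_gt0// -mulrDr.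
  have /(ler_wpM2l (ltW _)) : `|\sum_k fr (v w 0%R k)| + `|\sum_k fi (v w 0%R k)| <= s + s by exact: lerD.
  move=> /(_ (N%:R^-1)); rewrite invr_gt0 => /(_ NR0) h3 h4.
  have := lt_le_trans h4 h3; rewrite (_ : N%:R^-1 * (s + s) = 12 * b * Phi / Num.sqrt N%:R) ?ltxx//.
  have sN2 : N%:R = Num.sqrt N%:R ^+ 2 :> R by rewrite sqr_sqrtr// ltW.
  by rewrite /s {1}sN2; field; rewrite gt_eqF.
apply: (le_trans (measureU2 _ m1 m2)).
rewrite (_ : 4 * _ = 2 * expR (- Phi ^+ 2) + 2 * expR (- Phi ^+ 2)); last by lra.
by rewrite EFinD; apply: leeD.
Qed.

End Chernoff.

(** * Union bound over a net *)

Section NetLemmas.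
Context {R : realType}.

Lemma grid_cell (r : R) (M : nat) : (0 < M)%N -> 0 <= r -> exists (K : nat) (cell : R -> 'I_K.+1),
  K%:R <= 2 * r * M%:R /\
  forall x y, `|x| <= r -> `|y| <= r -> cell x = cell y -> `|x - y| <= M%:R^-1.
Proof.
move=> M0 r0; have MR : (0 : R) < M%:R by rewrite ltr0n.
pose t x := Num.truncn ((x + r) * M%:R).
have pos x : `|x| <= r -> 0 <= (x + r) * M%:R.
  by rewrite ler_norml => /andP[h _]; rewrite mulr_ge0// -lerBlDr sub0r.
exists (t r), (fun x => inord (t x)); split.
  have /andP[h _] : (t r)%:R <= (r + r) * M%:R < (t r).+1%:R.
    by apply: truncn_itv; apply: pos; rewrite ger0_norm.
  by apply: (le_trans h); rewrite -mulr2n -[r *+ 2]mulr_natl.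
have tle x : `|x| <= r -> (t x < (t r).+1)%N.
  move=> hx; rewrite ltnS; apply: le_truncn; rewrite ler_pM2r// lerD2r.
  exact: le_trans (ler_norm _) hx.
move=> x y hx hy /(congr1 (@nat_of_ord _)); rewrite !inordK ?tle// => e.
have /andP[x1 x2] := truncn_itv (pos _ hx); have /andP[y1 y2] := truncn_itv (pos _ hy).
rewrite -/(t x) in x1 x2; rewrite -/(t y) -e in y1 y2.
rewrite -(ler_pM2r MR) mulVf ?gt_eqF// -[M%:R in leLHS]ger0_norm ?ler0n// -normrM.
rewrite -natr1 in x2 y2.
rewrite (_ : (x - y) * M%:R = (x + r) * M%:R - (y + r) * M%:R); last ring.
rewrite ler_norml; lra.
Qed.

(** Termwise |g|^2 <= |f|^2 + 2 K D: for |g| >= D compare |f| with |g| - D, and otherwise |g|^2 <= K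
    D. Subadditivity of the square root finishes. *)
Lemma sqrt_sum_perturb (J : finType) (f g : J -> R[i]) (D K : R) : 0 <= D -> 0 <= K ->
  (forall j, modulus (f j - g j) <= D) -> (forall j, modulus (g j) <= K) ->
  Num.sqrt (\sum_j modulus (g j) ^+ 2) <= Num.sqrt (\sum_j modulus (f j) ^+ 2) +
    Num.sqrt (#|J|%:R * (2 * K * D)).
Proof.
move=> D0 K0 hfg hg.
have hsq (x y : R) : 0 <= x -> 0 <= y -> Num.sqrt (x + y) <= Num.sqrt x + Num.sqrt y.
  move=> x0 y0; have s0 : 0 <= Num.sqrt x + Num.sqrt y by rewrite addr_ge0 ?sqrtr_ge0.
  rewrite -[leRHS](ger0_norm s0) -sqrtr_sqr ler_wsqrtr// sqrrD !sqr_sqrtr//.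
  by rewrite addrAC lerDl mulrn_wge0// mulr_ge0 ?sqrtr_ge0.
have S0 : 0 <= \sum_j modulus (f j) ^+ 2 by apply: sumr_ge0 => j _; exact: sqr_ge0.
have KD : 0 <= 2 * K * D by rewrite !mulr_ge0.
have J0 : 0 <= #|J|%:R * (2 * K * D) by rewrite mulr_ge0.
apply: le_trans (hsq _ _ S0 J0); apply: ler_wsqrtr.
have -> : #|J|%:R * (2 * K * D) = \sum_(j : J) (2 * K * D) by rewrite sumr_const mulr_natl.
rewrite -big_split; apply: ler_sum => j _ /=.
have h1 := hfg j; have h2 := hg j.
have h3 := modulus_lerB (g j) (g j - f j); rewrite subKr in h3.
rewrite -modulusN opprB in h1.
have f0 := modulus_ge0 (f j); have g0 := modulus_ge0 (g j).
have [gD|gD] := leP D (modulus (g j)).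
  have : (modulus (g j) - D) ^+ 2 <= modulus (f j) ^+ 2.
    by rewrite lerXn2r ?nnegrE//; [rewrite subr_ge0|lra].
  have : modulus (g j) * D <= K * D by exact: ler_wpM2r.
  move: (modulus (g j)) (modulus (f j)) D0 => a b D0; have := sqr_ge0 D; nra.
have : modulus (g j) * modulus (g j) <= K * D by apply: ler_pM => //; exact: ltW.
have := sqr_ge0 (modulus (f j)); rewrite [modulus (g j) ^+ 2]expr2; lra.
Qed.

End NetLemmas.

Section FiniteUnion.
Context {R : realType} d (T : measurableType d) (P : probability T R).

Lemma finite_union_bound (I : finType) (B : I -> set T) (eps : R) :
  (forall i, measurable (B i)) -> (forall i, P (B i) <= eps%:E)%E ->
  exists A, [/\ measurable A, (P A <= (#|I|%:R * eps)%:E)%E & forall i, B i `<=` A].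
Proof.
move=> mB hB.
suff [A [mA hA hs]] : exists A, [/\ measurable A, (P A <= ((size (enum I))%:R * eps)%:E)%E &
    forall i, i \in enum I -> B i `<=` A].
  by exists A; split => //; [rewrite cardE|move=> i; apply: hs; rewrite mem_enum].
elim: (enum I) => [|i s [A [mA hA hs]]].
  by exists set0; split => //; rewrite measure0 mul0r.
exists (B i `|` A); split; first exact: measurableU.
  apply: (le_trans (measureU2 _ (mB i) mA)).
  by rewrite /= -nat1r mulrDl mul1r EFinD; exact: leeD.
move=> j; rewrite inE => /predU1P[->|js]; first exact: subsetUl.
by apply: subset_trans (hs j js) _; exact: subsetUr.
Qed.

(* The net point of a cell is chosen among the admissible parameters lying in the cell. *)
Lemma net_union (U : Type) (F : finType) (cell : U -> F) (S : set U) (bad : U -> set T) (eps : R) :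
  0 <= eps -> (forall u, S u -> measurable (bad u)) -> (forall u, S u -> P (bad u) <= eps%:E)%E ->
  exists A, [/\ measurable A, (P A <= (#|F|%:R * eps)%:E)%E &
    forall w, ~ A w -> forall u, S u -> exists u', [/\ S u', cell u' = cell u & ~ bad u' w]].
Proof.
move=> eps0 mb hb.
pose B f := if pselect (exists u, S u /\ cell u = f) is left h then bad (projT1 (cid h)) else set0.
have [A [mA hA hs]] : exists A, [/\ measurable A, (P A <= (#|F|%:R * eps)%:E)%E & forall f, B f `<=` A].
  apply: finite_union_bound => f; rewrite /B; case: pselect => [h|_].
  - by case: (cid h) => u [Su _] /=; exact: mb.
  - exact: measurable0.
  - by case: (cid h) => u [Su _] /=; exact: hb.
  - by rewrite measure0 lee_fin.
exists A; split => // w Aw u Su.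
have := @hs (cell u) w; rewrite /B; case: pselect => [h|h]; last by exfalso; apply: h; exists u.
by case: (cid h) => u' [Su' e] /= h'; exists u'; split => // /h'.
Qed.

End FiniteUnion.

Section PowerIdentities.
Context {R : realType} (x y : R).
Hypothesis xy : x * y = 1.
Let pw (k : R) p q : k * y ^+ q * (x * y) ^+ p = k * y ^+ q. Proof. by rewrite xy expr1n mulr1. Qed.
Lemma mul3_inv_pow10 : x * (x * x * (y ^+ 10 + 2 * y ^+ 10)) = 3 * y ^+ 7.
Proof. by transitivity (3 * y ^+ 7 * (x * y) ^+ 3); [ring|exact: pw]. Qed.
Lemma mul_inv_pow7 : x * (3 * y ^+ 7) = 3 * y ^+ 6.
Proof. by transitivity (3 * y ^+ 6 * (x * y) ^+ 1); [ring|exact: pw]. Qed.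
Lemma mul2_inv_pow7 : x * (x * (3 * y ^+ 7)) = 3 * y ^+ 5.
Proof. by transitivity (3 * y ^+ 5 * (x * y) ^+ 2); [ring|exact: pw]. Qed.
End PowerIdentities.

(** * From the net to all parameters *)

Section PerturbationEntries.
Context {R : realType} (N : nat).
Implicit Types (lam : R) (v : 'rV[R]_N) (W H : 'M[R[i]]_N) (i a b : 'I_N).

Lemma zero_outE i H a b : zero_out i H a b = if (a == i) || (b == i) then 0 else H a b.
Proof. by rewrite mxE. Qed.

Lemma zero_out_offdiag lam lam' v W i a b : a != b ->
  zero_out i (hamiltonian lam v W) a b = zero_out i (hamiltonian lam' v W) a b.
Proof.
move=> /negbTE ab; have := hamiltonianE lam v W a b; have := hamiltonianE lam' v W a b.
rewrite ab; move: (hamiltonian lam v W) (hamiltonian lam' v W) => H H' e e'.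
by rewrite (zero_outE i H) (zero_outE i H') e e'.
Qed.

Lemma zero_out_diag_near lam lam' v W i a (d : R) : `|lam' - lam| <= d -> -1 <= v 0 a <= 1 ->
  modulus (zero_out i (hamiltonian lam' v W) a a - zero_out i (hamiltonian lam v W) a a) <= d.
Proof.
move=> hlam hv; have := hamiltonianE lam v W a a; have := hamiltonianE lam' v W a a.
move: (hamiltonian lam v W) (hamiltonian lam' v W) => H H' e e'.
rewrite (zero_outE i H) (zero_outE i H') e e'; case: ifP => _.
  by rewrite subr0 modulus0; exact: le_trans hlam.
rewrite eqxx opprD addrACA subrr addr0 -rmorphB -mulrBl modulus_real normrM.
by rewrite -[leRHS]mulr1; apply: ler_pM => //; rewrite ler_norml.
Qed.

Lemma minor_term_near H H' W i a b (m m' : R[i]) (D : R) :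
  (forall k l, modulus (W k l) <= 1) -> modulus (m - m') <= D ->
  H i a = W i a -> H' i a = W i a -> H b i = W b i -> H' b i = W b i ->
  modulus (H i a * m * H b i - H' i a * m' * H' b i) <= D.
Proof.
move=> hW1 h -> -> -> ->.
rewrite -mulrBl -mulrBr !modulusM -[leRHS]mulr1; apply: ler_pM; rewrite ?mulr_ge0 ?modulus_ge0//.
by rewrite -[leRHS]mul1r; apply: ler_pM; rewrite ?modulus_ge0.
Qed.

Lemma hamiltonian_off lam v W a b : a != b -> hamiltonian lam v W a b = W a b.
Proof. by move=> /negbTE ab; rewrite hamiltonianE ab add0r. Qed.

Lemma zero_term (x y m m' x' y' : R[i]) (D : R) : 0 <= D -> m = 0 -> m' = 0 ->
  modulus (x * m * y - x' * m' * y') <= D.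
Proof. by move=> D0 -> ->; rewrite !mulr0 !mul0r subr0 modulus0. Qed.

Lemma near_term (x m m' x' w : R[i]) (D : R) : 0 <= D -> modulus w <= 1 -> x = w -> x' = w ->
  modulus (m - m') <= D -> modulus (m * x - m' * x') <= D.
Proof.
move=> D0 hw -> -> h; rewrite -mulrBl modulusM -[leRHS]mulr1.
by apply: ler_pM; rewrite ?modulus_ge0.
Qed.

Lemma perturb_linear1 (n n2 n6 a b e q q' qq : R) : n6 <= n2 * 12^-1 -> n2 <= n * 12^-1 -> 0 < n ->
  q' <= b -> qq <= 3 * n6 -> b <= a + e -> e <= 3 * n2 -> q - q' <= qq -> q <= a + n.
Proof. lra. Qed.

Lemma perturb_linear2 (n n2 n5 n7 a b e q q' qq : R) : n5 <= n2 * 12^-1 -> n7 <= n2 * 12^-1 ->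
  n2 <= n * 12^-1 -> 0 < n -> q' <= b -> b <= a + e -> e <= 2 * (3 * n2) ->
  qq <= 3 * n5 + 3 * n7 -> q - q' <= qq -> q <= a + n.
Proof. lra. Qed.

End PerturbationEntries.

Section Perturbation.
Context {R : realType} (N : nat) (c : R).
Variables (Phi : R) (v : 'rV[R]_N) (W : 'M[R[i]]_N).
Hypotheses (N_ge : (12 <= N)%N) (Phi_gt0 : 0 < Phi) (Phi_sqr : Phi ^+ 2 <= N%:R).
Hypotheses (hW : hermitian W) (hv : forall i, -1 <= v 0 i <= 1) (hW1 : forall i j, modulus (W i j) <= 1).
Let NR0 : (0 : R) < N%:R. Proof. by rewrite ltr0n; exact: leq_trans N_ge. Qed.
Let N12 : (12 : R) <= N%:R. Proof. by rewrite ler_nat. Qed.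
Let n := (N%:R : R)^-1.
Let n0 : 0 < n. Proof. by rewrite invr_gt0. Qed.
Let n1 : n <= 12^-1. Proof. by rewrite lef_pV2 ?posrE. Qed.

Let n_sqr : n ^+ 2 <= n * 12^-1. Proof. by rewrite expr2; apply: ler_wpM2l => //; exact: ltW. Qed.
Let Phi_le_sqrt : Phi / Num.sqrt N%:R <= 1.
Proof.
rewrite ler_pdivrMr ?sqrtr_gt0// mul1r -[leLHS](ger0_norm (ltW Phi_gt0)) -sqrtr_sqr.
by rewrite ler_wsqrtr.
Qed.
Let Phi_sqr_le : Phi <= N%:R.
Proof.
have : Phi * Phi <= N%:R * N%:R.
  by rewrite -expr2 (le_trans Phi_sqr)// ler_peMl ?ltW//; have := N12; lra.
by rewrite -!expr2 ler_pXn2r// nnegrE ltW.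
Qed.

Section Pair.
Variables (lam lam' : R) (z z' : R[i]).
Hypotheses (hz : 1 <= N%:R * complex.Im z) (hz' : 1 <= N%:R * complex.Im z').
Hypotheses (hlam : `|lam' - lam| <= n ^+ 10) (hRe : `|complex.Re z' - complex.Re z| <= n ^+ 10)
  (hIm : `|complex.Im z' - complex.Im z| <= n ^+ 10).
Local Notation H := (hamiltonian lam v W).
Local Notation H' := (hamiltonian lam' v W).

Let z0 : 0 < complex.Im z. Proof. by rewrite -(pmulr_rgt0 _ NR0); exact: lt_le_trans hz. Qed.
Let z0' : 0 < complex.Im z'. Proof. by rewrite -(pmulr_rgt0 _ NR0); exact: lt_le_trans hz'. Qed.
Let inv_le (w : R[i]) : 1 <= N%:R * complex.Im w -> (complex.Im w)^-1 <= N%:R.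
Proof.
move=> h; have w0 : 0 < complex.Im w by rewrite -(pmulr_rgt0 _ NR0); exact: lt_le_trans h.
by rewrite -[leLHS]mul1r ler_pdivrMr.
Qed.

Let zz : modulus (z' - z) <= 2 * n ^+ 10.
Proof.
apply: (le_trans (modulus_le_ReIm _)); rewrite ReD ImD ReN ImN mulr_natl mulr2n.
exact: lerD.
Qed.

(** Parameters n^10 apart move each resolvent entry by at most N * N^2 * 3 n^10. A linear form then
    moves by 3 n^6 and a quadratic form by 3 n^5, well below the slack n; this explains the power
    10. *)
Let D := 3 * n ^+ 7.
Let D0 : 0 <= D. Proof. by rewrite mulr_ge0// exprn_ge0// ltW. Qed.

Let NnE : N%:R * n = 1. Proof. by rewrite /n mulfV// gt_eqF. Qed.

Let entry_near i j k : modulus (green (zero_out i H) z j k - green (zero_out i H') z' j k) <= D.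
Proof.
have hH := hermitian_zero_out i (hermitian_hamiltonian lam v hW).
have hH' := hermitian_zero_out i (hermitian_hamiltonian lam' v hW).
apply: (le_trans (green_lip (d := n ^+ 10) hH hH' z0 z0' _ _ j k)).
- by move=> a b; exact: zero_out_offdiag.
- by move=> a; exact: zero_out_diag_near.
apply: (@le_trans _ _ (N%:R * (N%:R * N%:R * (n ^+ 10 + 2 * n ^+ 10)))).
  apply: ler_wpM2l; first exact: ltW.
  apply: ler_pM.
  - by rewrite mulr_ge0 ?invr_ge0 ?ltW.
  - by rewrite addr_ge0 ?modulus_ge0// exprn_ge0// ltW.
  - by apply: ler_pM; rewrite ?invr_ge0 ?(ltW z0) ?(ltW z0')// inv_le.
  - by rewrite lerD2l -modulusN opprB.
by rewrite (mul3_inv_pow10 NnE).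
Qed.

Let entry_bound i j k : modulus (green (zero_out i H) z j k) <= N%:R.
Proof.
have hH := hermitian_zero_out i (hermitian_hamiltonian lam v hW).
exact: le_trans (modulus_green hH z0 j k) (inv_le hz).
Qed.
Let entry_bound' i j k : modulus (green (zero_out i H') z' j k) <= N%:R.
Proof.
have hH := hermitian_zero_out i (hermitian_hamiltonian lam' v hW).
exact: le_trans (modulus_green hH z0' j k) (inv_le hz').
Qed.

Let sqrt_err (K : nat) : (K <= N * N)%N -> Num.sqrt (K%:R * (2 * N%:R * D)) <= 3 * n ^+ 2.
Proof.
move=> hK; have p0 : 0 <= 3 * n ^+ 2 by rewrite mulr_ge0// exprn_ge0// ltW.
rewrite -[leRHS](ger0_norm p0) -sqrtr_sqr ler_wsqrtr//.
apply: (@le_trans _ _ ((N * N)%:R * (2 * N%:R * D))).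
  by apply: ler_wpM2r; [exact: mulr_ge0 (mulr_ge0 (ler0n _ 2) (ltW NR0)) D0|rewrite ler_nat].
rewrite natrM /D (_ : _ * _ = 6 * n ^+ 4 * (N%:R * n) ^+ 3); last by ring.
rewrite NnE expr1n mulr1 exprMn -exprM; have : 0 <= n ^+ 4 by rewrite exprn_ge0// ltW.
by move: (n ^+ 4) => x; lra.
Qed.

Let n_pow (k : nat) : n ^+ k.+3 <= n ^+ 2 * 12^-1.
Proof.
have n00 := ltW n0; have n01 : n <= 1 by have := n1; lra.
rewrite -addn3 exprD [n ^+ 3]exprSr mulrA [_ * n ^+ 2]mulrC -mulrA; apply: ler_wpM2l; first exact: exprn_ge0.
by rewrite -[leRHS]mul1r; apply: ler_pM; rewrite ?exprn_ge0// exprn_ile1.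
Qed.

Lemma colsum_perturb i j : j != i ->
  modulus (minor_colsum H' z' i j) <= Phi / Num.sqrt N%:R *
    Num.sqrt (\sum_a modulus (green (zero_out i H') z' j a) ^+ 2) ->
  modulus (minor_colsum H z i j) <= Phi / Num.sqrt N%:R *
    Num.sqrt (\sum_a modulus (green (zero_out i H) z j a) ^+ 2) + n.
Proof.
move=> ji h.
have hH := hermitian_hamiltonian lam v hW; have hH' := hermitian_hamiltonian lam' v hW.
have h1 : modulus (minor_colsum H z i j - minor_colsum H' z' i j) <= N%:R * D.
  rewrite /minor_colsum -sumrB; apply: (le_trans (modulus_sum _ _ _)).
  rewrite mulr_natl -[X in _ *+ X](card_ord N) -sumr_const; apply: ler_sum => a _.
  have [ai|ai] := eqVneq a i; last first.
    exact: (near_term D0 (hW1 a i) (hamiltonian_off _ _ _ ai) (hamiltonian_off _ _ _ ai)).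
  have := zero_term 1 (H a i) 1 (H' a i) D0 (minor_col hH z0 ji) (minor_col hH' z0' ji).
  by rewrite !mul1r -ai.
have h2 := sqrt_sum_perturb D0 (ltW NR0) (entry_near i j) (entry_bound' i j).
have h3 : (#|'I_N| <= N * N)%N by rewrite card_ord leq_pmulr// (leq_trans _ N_ge).
have {}h2 := le_trans h2 (lerD (lexx _) (sqrt_err h3)).
have t0 : 0 <= Phi / Num.sqrt N%:R by rewrite divr_ge0 ?sqrtr_ge0// ltW.
have := ler_wpM2l t0 h2; rewrite mulrDr => h4.
have h5 : Phi / Num.sqrt N%:R * (3 * n ^+ 2) <= 3 * n ^+ 2.
  by apply: ler_piMl => //; apply: mulr_ge0 => //; apply: exprn_ge0; exact: ltW.
have h6 := modulus_lerB (minor_colsum H z i j) (minor_colsum H' z' i j).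
have h7 : N%:R * D = 3 * n ^+ 6 by exact: mul_inv_pow7 NnE.
have h8 := n_pow 3; have h9 := n_sqr.
rewrite h7 in h1; exact: perturb_linear1 h8 h9 n0 h h1 h4 h5 h6.
Qed.

Lemma quad_perturb i :
  modulus (minor_quad H' z' i - N%:R^-1 * \sum_k minor_mx H' z' i k k) <=
    2 * Phi / N%:R * Num.sqrt (\sum_a \sum_b modulus (minor_mx H' z' i a b) ^+ 2) ->
  quad_concentrated Phi v W lam z i.
Proof.
move=> h; rewrite /quad_concentrated.
have hH := hermitian_hamiltonian lam v hW; have hH' := hermitian_hamiltonian lam' v hW.
have Bnear a b : modulus (minor_mx H z i a b - minor_mx H' z' i a b) <= D.
  by rewrite !mxE; case: ifP => _; rewrite ?subrr ?modulus0.
have Bbound a b : modulus (minor_mx H' z' i a b) <= N%:R.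
  by rewrite mxE; case: ifP => _; rewrite ?modulus0// ltW.
have h1 : modulus (minor_quad H z i - minor_quad H' z' i) <= N%:R * (N%:R * D).
  rewrite /minor_quad -sumrB; apply: (le_trans (modulus_sum _ _ _)).
  rewrite mulr_natl -[X in _ *+ X](card_ord N) -sumr_const; apply: ler_sum => a _.
  rewrite -sumrB; apply: (le_trans (modulus_sum _ _ _)).
  rewrite mulr_natl -[X in _ *+ X](card_ord N) -sumr_const; apply: ler_sum => b _.
  have [hab|] := boolP ((a == i) || (b == i)); last first.
    rewrite negb_or => /andP[ai bi]; have ia : i != a by rewrite eq_sym.
    exact: (minor_term_near hW1 (Bnear a b) (hamiltonian_off _ _ _ ia) (hamiltonian_off _ _ _ ia)
      (hamiltonian_off _ _ _ bi) (hamiltonian_off _ _ _ bi)).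
  apply: zero_term => //; first by rewrite (minor_mxE i hH z0) hab.
  by rewrite (minor_mxE i hH' z0') hab.
have h2 : modulus (N%:R^-1 * \sum_k minor_mx H z i k k - N%:R^-1 * \sum_k minor_mx H' z' i k k) <= D.
  rewrite -mulrBr -sumrB; apply: modulus_average => //.
  by apply: leq_trans N_ge.
have h3 := sqrt_sum_perturb (f := fun p : 'I_N * 'I_N => minor_mx H z i p.1 p.2)
  (g := fun p : 'I_N * 'I_N => minor_mx H' z' i p.1 p.2) D0 (ltW NR0) (fun p => Bnear _ _) (fun p => Bbound _ _).
rewrite -(pair_bigA _ (fun a b => modulus (minor_mx H z i a b) ^+ 2))/= in h3.
rewrite -(pair_bigA _ (fun a b => modulus (minor_mx H' z' i a b) ^+ 2))/= in h3.
have hc : (#|{: 'I_N * 'I_N}| <= N * N)%N by rewrite card_prod card_ord.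
have {}h3 := le_trans h3 (lerD (lexx _) (sqrt_err hc)).
have t0 : 0 <= 2 * Phi / N%:R by rewrite divr_ge0// mulr_ge0// ltW.
have t2 : 2 * Phi / N%:R <= 2.
  rewrite ler_pdivrMr// ler_pM2l//; apply: (le_trans _ Phi_sqr_le); exact: lexx.
have := ler_wpM2l t0 h3; rewrite mulrDr => h4.
have h5 : 2 * Phi / N%:R * (3 * n ^+ 2) <= 2 * (3 * n ^+ 2).
  by apply: ler_wpM2r => //; apply: mulr_ge0 => //; apply: exprn_ge0; exact: ltW.
set Q := minor_quad H z i - _; set Q' := minor_quad H' z' i - _ in h *.
have h6 : modulus (Q - Q') <= N%:R * (N%:R * D) + D.
  rewrite /Q /Q' opprD addrACA -opprD; apply: (le_trans (modulusB _ _)); exact: lerD.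
have h6' := modulus_lerB Q Q'.
have h7 : N%:R * (N%:R * D) = 3 * n ^+ 5.
  exact: mul2_inv_pow7 NnE.
have h8 := n_pow 2; have h8' := n_pow 4; have h9 := n_sqr.
rewrite h7 in h6; exact: perturb_linear2 h8 h8' h9 n0 h h4 h5 h6 h6'.
Qed.

End Pair.
End Perturbation.

Section LawPerturbation.
Context {R : realType} (mu : probability (measurableTypeR R) R).
Hypothesis hsupp : mu (~` [set v : R | -1 <= v <= 1]) = 0%E.
Variables (N : nat) (c : R) (v : 'rV[R]_N).
Hypotheses (N_ge : (12 <= N)%N) (c_gt0 : 0 < c) (c_large : 24 / c ^+ 2 <= N%:R).
Hypothesis hv : forall i, -1 <= v 0 i <= 1.
Let n : R := N%:R^-1.
Let NR0 : (0 : R) < N%:R. Proof. by rewrite ltr0n; exact: leq_trans N_ge. Qed.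
Let n0 : 0 < n. Proof. by rewrite invr_gt0. Qed.
Let n1 : n <= 1. Proof. by rewrite invf_le1// ler1n; exact: leq_trans N_ge. Qed.

(** Both points being off the support, the kernels are bounded by 2 / c on it, and the empirical
    mean and the integral each move by at most 12 n^10 / c^2. [c_large] fits twice this into n. *)
Lemma law_perturb (lam lam' : R) (z z' : R[i]) (X : R) : 0 < complex.Im z -> 0 < complex.Im z' ->
  off_support (c / 2) lam z -> off_support (c / 2) lam' z' ->
  `|lam' - lam| <= n ^+ 10 -> `|complex.Re z' - complex.Re z| <= n ^+ 10 ->
  `|complex.Im z' - complex.Im z| <= n ^+ 10 ->
  modulus (N%:R^-1 * \sum_k cauchy_kernel lam' z' (v 0 k) - stieltjes mu lam' z') <= X ->
  modulus (N%:R^-1 * \sum_k cauchy_kernel lam z (v 0 k) - stieltjes mu lam z) <= X + n.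
Proof.
move=> z0 z0' hz hz' hlam hRe hIm hX.
have c2 : 0 < c / 2 by rewrite divr_gt0.
have d0 : 0 <= n ^+ 10 by rewrite exprn_ge0// ltW.
have kb l u x : off_support (c / 2) l u -> -1 <= x <= 1 -> modulus (cauchy_kernel l u x) <= 2 / c.
  move=> hu hx; have h := hu x hx; have h0 := lt_le_trans c2 h.
  by rewrite /cauchy_kernel modulusV -[2 / c]invf_div lef_pV2.
pose e := 3 * n ^+ 10 * (4 / c ^+ 2).
have pt x : -1 <= x <= 1 -> modulus (cauchy_kernel lam z x - cauchy_kernel lam' z' x) <= e.
  move=> hx; rewrite kernelB ?gt_eqF// !modulusM /e.
  apply: ler_pM; rewrite ?mulr_ge0 ?modulus_ge0//.
    apply: (le_trans (modulusD _ _)); rewrite (_ : 3 * n ^+ 10 = n ^+ 10 + n ^+ 10 + n ^+ 10); last by ring.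
    apply: lerD.
      by rewrite -modulusN opprB; apply: (le_trans (modulus_le_ReIm _)); rewrite ReD ImD ReN ImN lerD.
    by rewrite modulus_real normrM -[leRHS]mulr1 ler_pM// ler_norml.
  rewrite (_ : 4 / c ^+ 2 = 2 / c * (2 / c)); last by field; rewrite gt_eqF.
  by apply: ler_pM; rewrite ?modulus_ge0// kb.
have cz := @cbounded_kernel _ lam _ z0; have cz' := @cbounded_kernel _ lam' _ z0'.
have h1 : modulus (stieltjes mu lam z - stieltjes mu lam' z') <= e.
  rewrite /stieltjes -cintegralB// -[leRHS](Rint_cst mu).
  by apply: (modulus_cintegral_supp hsupp (h := fun=> e) (cboundedB cz cz') (rbounded_cst _ _)).
have h2 : modulus (N%:R^-1 * \sum_k cauchy_kernel lam z (v 0 k) - N%:R^-1 * \sum_k cauchy_kernel lam' z' (v 0 k)) <= e.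
  rewrite -mulrBr -sumrB; apply: modulus_average; first exact: leq_trans N_ge.
  by move=> k; exact: pt.
have he : 2 * e <= n.
  have -> : 2 * e = 24 / c ^+ 2 * n ^+ 10 by rewrite /e; move: (n ^+ 10) => x; field; rewrite gt_eqF.
  apply: (le_trans (ler_wpM2r d0 c_large)); rewrite exprS mulrA /n mulfV ?gt_eqF// mul1r -/n.
  by rewrite -[leRHS]expr1 ler_wiXn2l// ltW.
move: hX h1 h2; set S := N%:R^-1 * _; set S' := N%:R^-1 * _; set t := stieltjes _ _ _; set t' := stieltjes _ _ _.
move=> hX h1 h2; rewrite (_ : S' - t' = (S - t) + ((S' - S) - (t' - t))).
  apply: (le_trans (modulusD _ _)); apply: lerD => //; apply: (le_trans (modulusB _ _)).
  by apply: le_trans (lerD h2 h1) _; rewrite -mulr2n -mulr_natl.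
by clearbody S S' t t'; ring.
Qed.

End LawPerturbation.

(** * Probability of a good sample *)

Section GoodEvent.
Context {R : realType} (mu : probability (measurableTypeR R) R).
Hypothesis hsupp : mu (~` [set v : R | -1 <= v <= 1]) = 0%E.
Variables (lam0 c B : R).
Hypotheses (lam0_gt0 : 0 < lam0) (c_gt0 : 0 < c) (B_ge0 : 0 <= B).
Context d (T : measurableType d) (P : probability T R).
Variables (theta C0 : R) (N : nat) (W : T -> 'M[R[i]]_N) (v : T -> 'rV[R]_N) (Phi p : R).
Hypotheses (theta_gt1 : 1 < theta) (C0_gt0 : 0 < C0).
Hypothesis hmodel : deformed_model P theta C0 mu W v.
Hypothesis hld : forall a b A B, ld_family P theta C0 (Num.sqrt N%:R)^-1 a b ->
  ld_bounds P (Num.sqrt N%:R)^-1 Phi p (N := N) a b A B.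
Hypotheses (N_ge : (12 <= N)%N) (Phi_ge1 : 1 <= Phi) (Phi_sqr : Phi ^+ 2 <= N%:R).
Hypotheses (c_large : 24 / c ^+ 2 <= N%:R).
Let r := lam0 + law_radius lam0 c B.
Hypotheses (r_large : 2 * r + 1 <= N%:R).
Hypotheses (p_ge0 : 0 <= p) (Phi_p : expR (- Phi ^+ 2) <= p).

Let hW : wigner P theta C0 W. Proof. by have [] := hmodel. Qed.
Let hiid : iid_with_law P mu v. Proof. by have [] := hmodel. Qed.
Let hind := let: And3 _ _ h := hmodel in h.
Let W_measurable i j : cmeasurable (fun w => W w i j). Proof. by have [h _ _ _ _] := hW. Qed.
Let W_hermitian w : hermitian (W w). Proof. by have [_ h _ _ _] := hW; move=> i j; exact: h. Qed.
Let v_measurable i : measurable_fun setT (fun w => v w 0 i). Proof. by have [h _ _] := hiid. Qed.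
Let NR0 : (0 : R) < N%:R. Proof. by rewrite ltr0n; exact: leq_trans N_ge. Qed.
Let N3 : (3 <= N)%N. Proof. exact: leq_trans N_ge. Qed.
Let N1 : (1 : R) <= N%:R. Proof. by rewrite ler1n; exact: leq_trans N_ge. Qed.
Let Phi0 : 0 < Phi. Proof. exact: lt_le_trans Phi_ge1. Qed.
Let Phi_le : Phi <= Num.sqrt N%:R.
Proof. by rewrite -[leLHS](ger0_norm (ltW Phi0)) -sqrtr_sqr ler_wsqrtr. Qed.
Local Notation H lam w := (hamiltonian lam (v w) (W w)).

Lemma cmeasurable_hamiltonian lam i j : cmeasurable (fun w => H lam w i j).
Proof.
apply: (eq_cmeasurable (g := fun w => (if i == j then (lam * v w 0 i)%:C else 0) + W w i j)).
  by move=> w; rewrite hamiltonianE.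
apply: cmeasurableD => //; case: eqP => _; last exact: cmeasurable_cst.
by apply: cmeasurable_real; apply: measurable_funM; [exact: measurable_cst|exact: v_measurable].
Qed.

Lemma cmeasurable_green (A : T -> 'M[R[i]]_N) z : (forall w, hermitian (A w)) -> 0 < complex.Im z ->
  (forall i j, cmeasurable (fun w => A w i j)) -> forall i j, cmeasurable (fun w => green (A w) z i j).
Proof.
move=> hA z0 mA i j; apply: cmeasurable_invmx; last by move=> w; exact: hermitian_unit.
move=> k l; apply: (eq_cmeasurable (g := fun w => A w k l - z%:M k l)).
  by move=> w; rewrite !mxE.
by apply: cmeasurableB => //; exact: cmeasurable_cst.
Qed.

Let m_minor lam z i j k : 0 < complex.Im z -> cmeasurable (fun w => green (zero_out i (H lam w)) z j k).
Proof.
move=> z0; apply: cmeasurable_green => //.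
  by move=> w; apply: hermitian_zero_out; exact: hermitian_hamiltonian.
move=> a b; apply: (eq_cmeasurable (g := fun w => if (a == i) || (b == i) then 0 else H lam w a b)).
  by move=> w; exact: zero_outE.
by case: (_ || _); [exact: cmeasurable_cst|exact: cmeasurable_hamiltonian].
Qed.
Let m_minor_mx lam z i j k : 0 < complex.Im z -> cmeasurable (fun w => minor_mx (H lam w) z i j k).
Proof.
move=> z0; apply: (eq_cmeasurable (g := fun w => if k == i then 0 else green (zero_out i (H lam w)) z j k)).
  by move=> w; rewrite mxE.
by case: (k == i); [exact: cmeasurable_cst|exact: m_minor].
Qed.

Definition param : Type := ('I_N * 'I_N) * (R * R * R).
Definition param_z (u : param) : R[i] := u.2.1.2 +i* u.2.2.
Definition param_lam (u : param) : R := u.2.1.1.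

Definition bad_quad (u : param) : set T := [set w |
  (2 * Phi / N%:R * Num.sqrt (\sum_a \sum_b modulus (minor_mx (H (param_lam u) w) (param_z u) u.1.1 a b) ^+ 2) <
   modulus (minor_quad (H (param_lam u) w) (param_z u) u.1.1 -
     N%:R^-1 * \sum_k minor_mx (H (param_lam u) w) (param_z u) u.1.1 k k))%R].

Definition bad_colsum (u : param) : set T := [set w |
  (Phi / Num.sqrt N%:R * Num.sqrt (\sum_a modulus (green (zero_out u.1.1 (H (param_lam u) w)) (param_z u) u.1.2 a) ^+ 2) <
   modulus (minor_colsum (H (param_lam u) w) (param_z u) u.1.1 u.1.2))%R].

Let b := 2 / c.
(** [off_support] bounds the kernel only for x in [-1, 1]; cutting off outside makes it bounded by
    [b] everywhere. Neither the integral nor the values at samples in [-1, 1] change. *)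
Let f (u : param) (x : measurableTypeR R) : R[i] :=
  (\1_[set x : R | -1 <= x <= 1] x)%:C * cauchy_kernel (param_lam u) (param_z u) x.

Definition bad_law (u : param) : set T := [set w |
  (12 * b * Phi / Num.sqrt N%:R < modulus (N%:R^-1 * \sum_k f u (v w 0%R k) - cintegral mu (f u)))%R].

Let measurable_quad u : 0 < complex.Im (param_z u) -> measurable (bad_quad u).
Proof.
move=> z0; apply: measurable_ltr_set.
  apply: measurable_funM; first exact: measurable_cst.
  apply: measurableT_comp; first exact: measurable_sqrtr.
  by apply: measurable_sum => i; apply: measurable_sum => j; apply: measurable_modulus_sqr; exact: m_minor_mx.
apply: measurable_modulus; apply: cmeasurableB.
  apply: cmeasurable_sum => i _; apply: cmeasurable_sum => j _; apply: cmeasurableM; last exact: cmeasurable_hamiltonian.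
  by apply: cmeasurableM; [exact: cmeasurable_hamiltonian|exact: m_minor_mx].
by apply: cmeasurableM; [exact: cmeasurable_cst|apply: cmeasurable_sum => k _; exact: m_minor_mx].
Qed.

Let measurable_colsum u : 0 < complex.Im (param_z u) -> measurable (bad_colsum u).
Proof.
move=> z0; apply: measurable_ltr_set.
  apply: measurable_funM; first exact: measurable_cst.
  apply: measurableT_comp; first exact: measurable_sqrtr.
  by apply: measurable_sum => i; apply: measurable_modulus_sqr; exact: m_minor.
apply: measurable_modulus; apply: cmeasurable_sum => i _.
by apply: cmeasurableM; [exact: m_minor|exact: cmeasurable_hamiltonian].
Qed.

Let f_measurable u : 0 < complex.Im (param_z u) -> cmeasurable (f u).
Proof.
move=> z0; apply: cmeasurableM; last by have [] := @cbounded_kernel _ (param_lam u) _ z0.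
by apply: cmeasurable_real; apply: measurable_indic; exact: measurable_support.
Qed.

Let measurable_law u : 0 < complex.Im (param_z u) -> measurable (bad_law u).
Proof.
move=> z0; apply: measurable_ltr_set; first exact: measurable_cst.
apply: measurable_modulus; apply: cmeasurableB; last exact: cmeasurable_cst.
apply: cmeasurableM; first exact: cmeasurable_cst.
apply: cmeasurable_sum => k _; exact: (cmeasurable_comp (v_measurable k) (f_measurable z0)).
Qed.

Let P_quad u : 0 < complex.Im (param_z u) -> (P (bad_quad u) <= (2 * p)%:E)%E.
Proof.
move=> z0; exact: (minor_quad_deviation theta_gt1 C0_gt0 N3 hW v_measurable hind Phi0 p_ge0 hld).
Qed.

Let P_colsum u : 0 < complex.Im (param_z u) -> u.1.2 != u.1.1 -> (P (bad_colsum u) <= p%:E)%E.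
Proof.
move=> z0 ij; exact: (minor_colsum_deviation theta_gt1 C0_gt0 N3 hW v_measurable hind Phi0 p_ge0 hld).
Qed.

Let c2 : 0 < c / 2. Proof. exact: divr_gt0. Qed.
Let b0 : 0 < b. Proof. exact: divr_gt0. Qed.

Let P_law u : 0 < complex.Im (param_z u) -> off_support (c / 2) (param_lam u) (param_z u) ->
  (P (bad_law u) <= (4 * p)%:E)%E.
Proof.
move=> z0 hz; apply: (@le_trans _ _ (4 * expR (- Phi ^+ 2))%:E); last by rewrite lee_fin ler_pM2l.
apply: (chernoff_complex hiid _ Phi0 Phi_le (f_measurable z0) b0); first exact: leq_trans N_ge.
move=> x; rewrite /f indicE; have [hx|_] := boolP (x \in _); last by rewrite mul0r modulus0 ltW.
rewrite mul1r; move: hx; rewrite inE => hx; have h := hz x hx; have h0 := lt_le_trans c2 h.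
by rewrite /cauchy_kernel modulusV /b -[2 / c]invf_div lef_pV2.
Qed.

Let cintegral_f u : 0 < complex.Im (param_z u) -> cintegral mu (f u) = stieltjes mu (param_lam u) (param_z u).
Proof.
move=> z0; have cz := @cbounded_kernel _ (param_lam u) _ z0.
have cf : cbounded (f u).
  apply: cboundedM => //; apply: cbounded_real; split; first exact: measurable_indic measurable_support.
  by exists 1 => x; rewrite indicE; case: (_ \in _); rewrite ?normr1 ?normr0.
apply/eqP; rewrite -subr_eq0 -modulus_eq0 eq_le modulus_ge0 andbT /stieltjes -cintegralB//.
rewrite -[leRHS](Rint_cst mu).
apply: (modulus_cintegral_supp hsupp (h := fun=> 0) (cboundedB cf cz) (rbounded_cst _ _)) => x hx.
by rewrite /f indicE mem_set// mul1r subrr modulus0.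
Qed.

Let height_gt0 : 0 < range_height lam0 c B.
Proof.
have h : 2 <= path_length lam0 c B by rewrite /path_length le_max lexx.
rewrite /range_height; lra.
Qed.
Let c4 : 0 < 4 / c. Proof. exact: divr_gt0. Qed.
Let r_ge0 : 0 <= r.
Proof. by rewrite /r /law_radius; have := height_gt0; have := lam0_gt0; have := B_ge0; have := c4; lra. Qed.

Let bad_entry (q : 'I_N * 'I_N) : set T := [set w | (Phi / Num.sqrt N%:R < modulus (W w q.1 q.2))%R].
Let bad_diag (i : 'I_N) : set T := [set w | (~` [set x : R | -1 <= x <= 1]) (v w 0%R i)].

Let bad_entry_union : exists A, [/\ measurable A, (P A <= ((N * N)%:R * p)%:E)%E &
  forall w, ~ A w -> forall i j, modulus (W w i j) <= Phi / Num.sqrt N%:R].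
Proof.
have [q|q|A [mA hA hs]] := @finite_union_bound _ _ _ P _ bad_entry p.
- by apply: measurable_ltr_set; [exact: measurable_cst|exact: measurable_modulus].
- exact: (entry_deviation theta_gt1 C0_gt0 N3 hW Phi0 p_ge0 hld).
exists A; split => //; first by move: hA; rewrite card_prod card_ord.
by move=> w Aw i j; rewrite leNgt; apply/negP => h; apply: Aw; exact: (hs (i, j)).
Qed.

Let bad_diag_union : exists A, [/\ measurable A, (P A <= 0%:E)%E &
  forall w, ~ A w -> forall i, -1 <= v w 0 i <= 1].
Proof.
have [_ hlaw _] := hiid; have mC := measurableC (@measurable_support R).
have [i|i|A [mA hA hs]] := @finite_union_bound _ _ _ P _ bad_diag 0.
- by have := v_measurable i; move=> /(_ measurableT _ mC); rewrite setTI.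
- by rewrite /bad_diag (hlaw i _ mC) hsupp.
exists A; split => //; first by move: hA; rewrite mulr0.
by move=> w Aw i; apply/negPn/negP => h; apply: Aw; apply: (hs i); move/negP: h.
Qed.

Let n : R := N%:R^-1.

Let range_box lam z : resolvent_range lam0 c B N Phi lam z ->
  [/\ `|lam| <= r, `|complex.Re z| <= r, `|complex.Im z| <= r & 1 <= N%:R * complex.Im z].
Proof.
move=> [/andP[l0 l1] hRe hIm hN].
have h1 : 1 <= N%:R * complex.Im z by apply: le_trans hN; rewrite exprn_ege1.
have z0 : 0 < complex.Im z by rewrite -(pmulr_rgt0 _ NR0); exact: lt_le_trans h1.
have := height_gt0; have := lam0_gt0; have := B_ge0; have := c4.
split => //; rewrite /r /law_radius; last by rewrite gtr0_norm//; lra.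
  by rewrite gtr0_norm//; lra.
lra.
Qed.

Let law_box lam z : law_range lam0 c B lam z ->
  [/\ `|lam| <= r, `|complex.Re z| <= r & `|complex.Im z| <= r].
Proof.
move=> [/andP[l0 l1] z0 hRe hIm _].
have h0 := le_trans (normr_ge0 _) hRe; have := lam0_gt0; rewrite /r (gtr0_norm l0) (gtr0_norm z0).
by split; lra.
Qed.

(** Two indices give N^2; each of the three real parameters needs at most (2 r + 1) N^10 <= N^11
    cells of width N^-10. *)
Let grid : exists (F : finType) (cell : param -> F), #|F|%:R <= N%:R ^+ 35 :> R /\
  forall u u' : param, `|param_lam u| <= r -> `|complex.Re (param_z u)| <= r ->
    `|complex.Im (param_z u)| <= r -> `|param_lam u'| <= r -> `|complex.Re (param_z u')| <= r ->
    `|complex.Im (param_z u')| <= r -> cell u' = cell u ->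
    [/\ u'.1 = u.1, `|param_lam u' - param_lam u| <= n ^+ 10,
      `|complex.Re (param_z u') - complex.Re (param_z u)| <= n ^+ 10 &
      `|complex.Im (param_z u') - complex.Im (param_z u)| <= n ^+ 10].
Proof.
have M0 : (0 < N ^ 10)%N by rewrite expn_gt0 (leq_trans _ N_ge).
have [K [cell [hK hcell]]] := grid_cell M0 r_ge0.
have nE : (N ^ 10)%:R^-1 = n ^+ 10 :> R by rewrite natrX /n exprVn.
exists (('I_N * 'I_N) * ('I_K.+1 * 'I_K.+1 * 'I_K.+1))%type.
exists (fun u => (u.1, (cell (param_lam u), cell (complex.Re (param_z u)), cell (complex.Im (param_z u))))).
split; last first.
  move=> u u' h1 h2 h3 h1' h2' h3' [e1 e2 e3 e4]; rewrite -nE; split => //; exact: hcell.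
rewrite !card_prod !card_ord !natrM.
have hK1 : K.+1%:R <= N%:R ^+ 11 :> R.
  rewrite -natr1; apply: (@le_trans _ _ ((2 * r + 1) * N%:R ^+ 10)).
    rewrite mulrDl mul1r; apply: lerD; first by rewrite natrX in hK.
    by rewrite exprn_ege1.
  by rewrite exprS; apply: ler_wpM2r => //; rewrite exprn_ge0.
rewrite (_ : N%:R ^+ 35 = N%:R * N%:R * (N%:R ^+ 11 * N%:R ^+ 11 * N%:R ^+ 11) :> R); last by rewrite -!exprD -mulrA -!exprS.
apply: ler_wpM2l; first by rewrite mulr_ge0 ?ltW.
by apply: ler_pM => //; apply: ler_pM.
Qed.

Lemma good_event : exists A : set T, [/\ measurable A, (P A <= (N%:R ^+ 36 * p)%:E)%E &
  forall w, ~ A w -> good_sample mu lam0 c B (24 / c) Phi (v w) (W w)].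
Proof.
have [Av [mAv PAv hAv]] := bad_diag_union.
have [Aw [mAw PAw hAw]] := bad_entry_union.
have [F [cell [cardF hcell]]] := grid.
pose Sq := [set u | resolvent_range lam0 c B N Phi (param_lam u) (param_z u)].
pose Sl := [set u | law_range lam0 c B (param_lam u) (param_z u)].
have Sq0 u : Sq u -> 0 < complex.Im (param_z u).
  by move=> /range_box[_ _ _ h]; rewrite -(pmulr_rgt0 _ NR0); exact: lt_le_trans h.
have Sl0 u : Sl u -> 0 < complex.Im (param_z u) by case.
have p20 : 0 <= 2 * p by exact: mulr_ge0.
have p40 : 0 <= 4 * p by exact: mulr_ge0.
have [Aq [mAq PAq hAq]] := @net_union _ _ _ P _ _ cell Sq bad_quad (2 * p) p20
  (fun u hu => measurable_quad (Sq0 u hu)) (fun u hu => P_quad (Sq0 u hu)).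
have [Ac [mAc PAc hAc]] := @net_union _ _ _ P _ _ cell (Sq `&` [set u | u.1.2 != u.1.1]) bad_colsum p p_ge0
  (fun u hu => measurable_colsum (Sq0 u hu.1)) (fun u hu => P_colsum (Sq0 u hu.1) hu.2).
have hl u : Sl u -> off_support (c / 2) (param_lam u) (param_z u) by case.
have [Al [mAl PAl hAl]] := @net_union _ _ _ P _ _ cell Sl bad_law (4 * p) p40
  (fun u hu => measurable_law (Sl0 u hu)) (fun u hu => P_law (Sl0 u hu) (hl u hu)).
exists (Av `|` (Aw `|` (Aq `|` (Ac `|` Al)))); split.
- by repeat apply: measurableU.
- have u2 A A' x y : measurable A -> measurable A' -> (P A <= x%:E)%E -> (P A' <= y%:E)%E ->
      (P (A `|` A') <= (x + y)%:E)%E.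
    by move=> mA mA' h h'; apply: (le_trans (measureU2 _ mA mA')); rewrite EFinD; exact: leeD.
  have m4 : measurable (Ac `|` Al) by exact: measurableU.
  have m3 : measurable (Aq `|` (Ac `|` Al)) by exact: measurableU.
  have m2 : measurable (Aw `|` (Aq `|` (Ac `|` Al))) by exact: measurableU.
  apply: le_trans (u2 _ _ _ _ mAv m2 PAv (u2 _ _ _ _ mAw m3 PAw (u2 _ _ _ _ mAq m4 PAq (u2 _ _ _ _ mAc mAl PAc PAl)))) _.
  rewrite lee_fin add0r natrM.
  have hF : #|F|%:R * p <= N%:R ^+ 35 * p by exact: ler_wpM2r.
  have hN2 : N%:R * N%:R * p <= N%:R ^+ 35 * p.
    by apply: ler_wpM2r => //; rewrite -expr2; apply: ler_weXn2l.
  (* The four nontrivial exceptional sets cost at most 1 + 2 + 1 + 4 = 8 times N^35 p, which fits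
     since N >= 12. *)
  have hN : 12 * (N%:R ^+ 35 * p) <= N%:R ^+ 36 * p.
    rewrite [N%:R ^+ 36]exprS -[leRHS]mulrA; apply: ler_wpM2r; last by rewrite ler_nat.
    by rewrite mulr_ge0// exprn_ge0.
  have hp : 0 <= N%:R ^+ 35 * p by rewrite mulr_ge0// exprn_ge0.
  rewrite !(mulrCA #|F|%:R); move: hF hN2 hN hp; move: (#|F|%:R * p) (N%:R * N%:R * p) (N%:R ^+ 35 * p) (N%:R ^+ 36 * p) => x y z t; lra.
move=> w /not_orP[/hAv hv /not_orP[/hAw hw /not_orP[/hAq hq /not_orP[/hAc hc /hAl hL]]]].
have hw1 i j : modulus (W w i j) <= 1.
  by apply: (le_trans (hw i j)); rewrite ler_pdivrMr ?sqrtr_gt0// mul1r.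
have near u u' : Sq u -> Sq u' -> cell u' = cell u -> [/\ u'.1 = u.1, `|param_lam u' - param_lam u| <= n ^+ 10,
      `|complex.Re (param_z u') - complex.Re (param_z u)| <= n ^+ 10 &
      `|complex.Im (param_z u') - complex.Im (param_z u)| <= n ^+ 10].
  by move=> /range_box[a1 a2 a3 _] /range_box[b1 b2 b3 _]; exact: hcell.
split => //.
- move=> lam z hz i; pose u : param := ((i, i), (lam, complex.Re z, complex.Im z)).
  have zE : param_z u = z by rewrite /param_z /=; case: (z).
  have Su : Sq u by rewrite /Sq /= zE.
  have [u' [Su' e /negP hu']] := hq u Su.
  have [_ _ _ N1z] := range_box hz; have [_ _ _ N1z'] := range_box Su'.
  have [e1 d1 d2 d3] := near u u' Su Su' e.
  rewrite zE in d2 d3; rewrite -leNgt e1 /= in hu'.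
  exact: (quad_perturb N_ge Phi0 Phi_sqr (W_hermitian w) hv hw1 N1z N1z' d1 d2 d3 hu').
- move=> lam z hz i j ji; pose u : param := ((i, j), (lam, complex.Re z, complex.Im z)).
  have zE : param_z u = z by rewrite /param_z /=; case: (z).
  have Su : Sq u by rewrite /Sq /= zE.
  have [u' [[Su' _] e /negP hu']] := hc u (conj Su ji).
  have [_ _ _ N1z] := range_box hz; have [_ _ _ N1z'] := range_box Su'.
  have [e1 d1 d2 d3] := near u u' Su Su' e.
  rewrite zE in d2 d3; rewrite -leNgt e1 /= in hu'.
  exact: (colsum_perturb N_ge Phi0 Phi_sqr (W_hermitian w) hv hw1 N1z N1z' d1 d2 d3 ji hu').
- move=> lam z hz; have N0 : (0 < N)%N by exact: leq_trans N_ge.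
  pose i0 := Ordinal N0; pose u : param := ((i0, i0), (lam, complex.Re z, complex.Im z)).
  have zE : param_z u = z by rewrite /param_z /=; case: (z).
  have Su : Sl u by rewrite /Sl /= zE.
  have [u' [Su' e /negP hu']] := hL u Su.
  have [a1 a2 a3] := law_box Su; have [b1 b2 b3] := law_box Su'.
  have [_ d1 d2 d3] := hcell u u' a1 a2 a3 b1 b2 b3 e.
  rewrite zE in d2 d3; rewrite -leNgt (cintegral_f (Sl0 _ Su')) in hu'.
  have [_ z0 _ _ hoff] := hz; have [_ z0' _ _ hoff'] := Su'.
  rewrite /law_concentrated; apply: (law_perturb hsupp N_ge c_gt0 c_large hv z0 z0' hoff hoff' d1 d2 d3).
  rewrite (_ : 24 / c * Phi = 12 * b * Phi); last by rewrite /b mulrA -natrM.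
  apply: le_trans hu'; rewrite le_eqVlt; apply/orP; left; apply/eqP; congr (modulus (_ * _ - _)).
  by apply: eq_bigr => k _; rewrite /f indicE mem_set ?mul1r//; exact: hv.
Qed.

End GoodEvent.

(** * Measurability of the events *)

Lemma contraction_absorb {R : realDomainType} (a b k : R) : a <= (a + b) * (1 - k) -> 0 <= k * b -> a * k <= b.
Proof. by rewrite mulrBr mulr1 mulrDl [k * b]mulrC; lra. Qed.

Lemma mul_le_half_sum_sqr {R : realFieldType} (a b : R) : a * b <= 2^-1 * (a ^+ 2 + b ^+ 2).
Proof. by have := sqr_ge0 (a - b); rewrite sqrrB; lra. Qed.

Section MfcLipschitz.
Context {R : realType} (mu : probability (measurableTypeR R) R).
Hypothesis hsupp : mu (~` [set v : R | -1 <= v <= 1]) = 0%E.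

(** By [kernel_sqr_mfc], 1 - S2 = Im z / Im (z + mfc) >= y / (Y + 1) at both solutions. The
    difference of the equations is therefore a contraction with a factor below 1, plus the change of
    the parameters. *)
Lemma mfc_lip (y Y lam lam' : R) (z z' : R[i]) : 0 < y -> y <= complex.Im z <= Y ->
  y <= complex.Im z' <= Y ->
  modulus (mfc mu lam z - mfc mu lam' z') <= (Y + 1) / y * (`|lam - lam'| + modulus (z - z')).
Proof.
move=> y0 /andP[yz zY] /andP[yz' zY'].
have z0 := lt_le_trans y0 yz; have z0' := lt_le_trans y0 yz'.
have [m0 e] := mfcP hsupp lam z0; have [m0' e'] := mfcP hsupp lam' z0'.
have Y0 : 0 < Y + 1 by apply: ltr_wpDl => //; apply: le_trans zY; exact: ltW.
have kap l u : 0 < complex.Im u -> y <= complex.Im u -> complex.Im u <= Y ->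
    kernel_sqr mu l (u + mfc mu l u) <= 1 - y / (Y + 1).
  move=> u0 yu uY; have h := kernel_sqr_mfc hsupp l u0.
  have [mu0 _] := mfcP hsupp l u0.
  have Im0 : 0 < complex.Im (u + mfc mu l u) by rewrite ImD addr_gt0.
  have ImY : complex.Im (u + mfc mu l u) <= Y + 1.
    rewrite ImD lerD//; apply: le_trans (modulus_mfc_le1 hsupp l u0).
    exact: le_trans (ler_norm _) (Im_le_modulus _).
  rewrite lerBrDr addrC -lerBrDr.
  rewrite ler_pdivrMr//; apply: (le_trans yu); rewrite -{1}h mulrC.
  by apply: ler_wpM2l => //; rewrite -(pmulr_rge0 _ Im0) h ltW.
have S := kap lam z z0 yz zY; have S' := kap lam' z' z0' yz' zY'.
move: e e' S S'; set m := mfc mu lam z; set m' := mfc mu lam' z'.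
set u := z + m; set u' := z' + m' => e e' S S'.
have u0 : 0 < complex.Im u by rewrite ImD addr_gt0.
have u0' : 0 < complex.Im u' by rewrite ImD addr_gt0.
pose K := modulus (m - m') + (`|lam - lam'| + modulus (z - z')).
have K0 : 0 <= K by rewrite !addr_ge0 ?modulus_ge0.
have cz := @cbounded_kernel _ lam _ u0; have cz' := @cbounded_kernel _ lam' _ u0'.
have b1 := rbounded_kernel_sqr lam u0; have b2 := rbounded_kernel_sqr lam' u0'.
have hb : rbounded (fun v : measurableTypeR R => K / 2 *
    (modulus (cauchy_kernel lam u v) ^+ 2 + modulus (cauchy_kernel lam' u' v) ^+ 2)).
  by apply: rboundedM; [exact: rbounded_cst|exact: rboundedD].
have h : modulus (m - m') <= K / 2 * (kernel_sqr mu lam u + kernel_sqr mu lam' u').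
  rewrite {1}e {1}e' /stieltjes -cintegralB//.
  apply: (le_trans (modulus_cintegral_supp hsupp (cboundedB cz cz') hb _)).
    move=> x hx; rewrite kernelB ?gt_eqF// modulusM.
    rewrite -mulrA; apply: ler_pM; rewrite ?modulus_ge0//.
      apply: (le_trans (modulusD _ _)); rewrite (_ : u - u' = (m - m') + (z - z')); last by rewrite /u /u'; ring.
      apply: (le_trans (lerD (modulusD _ _) (lexx _))); rewrite /K -!addrA lerD2l addrC lerD2r.
      rewrite modulus_real normrM distrC -[leRHS]mulr1; apply: ler_pM => //.
      by rewrite ler_norml.
    rewrite modulusM; set a := modulus _; set b := modulus _.
    exact: mul_le_half_sum_sqr.
  by rewrite RintZ ?RintD//; exact: rboundedD.
have k0 : 0 < y / (Y + 1) by rewrite divr_gt0.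
have h2 : modulus (m - m') <= K * (1 - y / (Y + 1)).
  apply: (le_trans h); rewrite -mulrA; apply: ler_wpM2l => //.
  by rewrite mulrC ler_pdivrMr// mulr_natr mulr2n; exact: lerD.
have : modulus (m - m') * (y / (Y + 1)) <= `|lam - lam'| + modulus (z - z').
  have d0 : 0 <= `|lam - lam'| + modulus (z - z') by rewrite addr_ge0 ?modulus_ge0.
  exact: contraction_absorb h2 (mulr_ge0 (ltW k0) d0).
by rewrite mulrC -ler_pdivlMl// invf_div.
Qed.

End MfcLipschitz.

Section CountableReduction.
Context {R : realType}.

(** Continuity relative to the range [I]: the resolvent estimates hold only inside it, with Im z
    bounded away from 0, and the ranges contain end points. *)
Definition continuous_within (I : R -> Prop) (h : R -> R) := forall x, I x -> forall e, 0 < e ->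
  exists2 d, 0 < d & forall y, I y -> `|x - y| < d -> `|h x - h y| < e.

Lemma continuous_withinB I f g : continuous_within I f -> continuous_within I g ->
  continuous_within I (fun x => f x - g x).
Proof.
move=> hf hg x Ix e e0; have e2 : 0 < e / 2 by rewrite divr_gt0.
have [d1 d10 h1] := hf x Ix _ e2; have [d2 d20 h2] := hg x Ix _ e2.
exists (Num.min d1 d2); first by rewrite lt_min d10.
move=> y Iy; rewrite lt_min => /andP[/(h1 y Iy) k1 /(h2 y Iy) k2].
rewrite (_ : _ - _ = (f x - f y) - (g x - g y)); last ring.
by rewrite (le_lt_trans (ler_normB _ _))//; lra.
Qed.

Lemma lipschitz_continuous_within I h M : 0 <= M ->
  (forall x y, I x -> I y -> `|h x - h y| <= M * `|x - y|) -> continuous_within I h.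
Proof.
move=> M0 hh x Ix e e0; have M1 : 0 < M + 1 by rewrite ltr_wpDl.
exists (e / (M + 1)); first exact: divr_gt0.
move=> y Iy; rewrite ltr_pdivlMr// => hy; apply: le_lt_trans (hh x y Ix Iy) _.
apply: le_lt_trans hy; rewrite mulrC; apply: ler_wpM2l => //; lra.
Qed.

Lemma continuous_at_within (I : R -> Prop) (h : R -> R) : (forall x, I x -> {for x, continuous h}) ->
  continuous_within I h.
Proof.
move=> hc x Ix e e0; have /cvgrPdist_lt/(_ e e0) := hc x Ix.
by rewrite near_simpl => -[d /= d0 hd]; exists d => // y _ hy; exact: hd.
Qed.

(* Through [a + (b - a) * q] degenerate ranges [a = b] are covered as well. *)
Definition rat_point (a b : R) (n : nat) : R := a + (b - a) * ratr (odflt 0 (unpickle n : option rat)).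

Lemma rat_point_dense (I : R -> Prop) (a b : R) : (forall x, I x -> a <= x <= b) ->
  (forall x, a < x < b -> I x) -> forall x d, I x -> 0 < d ->
  exists2 n, I (rat_point a b n) & `|x - rat_point a b n| < d.
Proof.
move=> hI hI' x d Ix d0; have /andP[ax xb] := hI x Ix.
have pickleE (q : rat) : rat_point a b (pickle q) = a + (b - a) * ratr q by rewrite /rat_point pickleK.
have [ab|ba] := ltP a b; last first.
  have [xa ba'] : x = a /\ b = a by split; apply/eqP; rewrite eq_le; apply/andP; split; lra.
  by exists (pickle (0 : rat)); rewrite pickleE ba' subrr mul0r addr0 -xa// subrr normr0.
have ba0 : 0 < b - a by rewrite subr_gt0.
pose l := Num.max a (x - d / 2); pose r := Num.min b (x + d / 2).
have lr : l < r by rewrite gt_max !lt_min; apply/andP; split; apply/andP; split; lra.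
have [q] : exists q : rat, ratr q \in `](l - a) / (b - a), (r - a) / (b - a)[.
  by apply: rat_in_itvoo; rewrite ltr_pM2r ?invr_gt0// ltrD2r.
rewrite in_itv /= ltr_pdivrMr// ltr_pdivlMr// => /andP[q1 q2].
have hl : a <= l /\ x - d / 2 <= l by rewrite !le_max !lexx orbT.
have hr : r <= b /\ r <= x + d / 2 by rewrite !ge_min !lexx orbT.
exists (pickle q); rewrite pickleE mulrC.
  by apply: hI'; case: hl hr => ? ? [? ?]; apply/andP; split; lra.
by rewrite ltr_norml; case: hl hr => ? ? [? ?]; apply/andP; split; lra.
Qed.

Lemma le0_of_rat_points (I : R -> Prop) (a b : R) (h : R -> R) : (forall x, I x -> a <= x <= b) ->
  (forall x, a < x < b -> I x) -> continuous_within I h ->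
  (forall n, I (rat_point a b n) -> h (rat_point a b n) <= 0) -> forall x, I x -> h x <= 0.
Proof.
move=> hI hI' hc hn x Ix; rewrite leNgt; apply/negP => hx.
have [d d0 hd] := hc x Ix _ hx.
have [n In hxn] := rat_point_dense hI hI' Ix d0.
have := hd _ In hxn; have := hn n In; rewrite ltr_norml; lra.
Qed.

End CountableReduction.

Section ParametricEvent.
Context {R : realType} d (T : measurableType d).
Variables (E0 eta0 lam0 : R).

Definition energy_range (x : R) : Prop := - E0 <= x <= E0.
Definition scale_range (x : R) : Prop := eta0 <= x <= 3.
Definition coupling_range (x : R) : Prop := 0 < x <= lam0.

(** A nonstrict inequality passes to limits, so countably many parameters suffice. They are extended
    one variable at a time, which asks only for separate continuity. *)
Lemma measurable_parametric (h : R -> R -> R -> T -> R) :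
  (forall x y l, energy_range x -> scale_range y -> coupling_range l -> measurable_fun setT (h x y l)) ->
  (forall w x y, energy_range x -> scale_range y -> continuous_within coupling_range (fun l => h x y l w)) ->
  (forall w x l, energy_range x -> coupling_range l -> continuous_within scale_range (fun y => h x y l w)) ->
  (forall w y l, scale_range y -> coupling_range l -> continuous_within energy_range (fun x => h x y l w)) ->
  measurable [set w | forall x y l, energy_range x -> scale_range y -> coupling_range l -> h x y l w <= 0].
Proof.
move=> mh cl cy cx.
pose X := rat_point (- E0) E0; pose Y := rat_point eta0 3; pose L := rat_point 0 lam0.
pose F i j k := [set w | energy_range (X i) -> scale_range (Y j) -> coupling_range (L k) -> h (X i) (Y j) (L k) w <= 0].
have -> : [set w | forall x y l, energy_range x -> scale_range y -> coupling_range l -> h x y l w <= 0] =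
    \bigcap_i \bigcap_j \bigcap_k F i j k.
  apply/seteqP; split => [w hw i _ j _ k _ hx hy hl|w hw]; first exact: hw.
  have h1 i j l : energy_range (X i) -> scale_range (Y j) -> coupling_range l -> h (X i) (Y j) l w <= 0.
    move=> hx hy; apply: (le0_of_rat_points (I := coupling_range) (a := 0) (b := lam0)
      (h := fun l => h (X i) (Y j) l w)).
    - by move=> u /andP[/ltW -> ->].
    - by move=> u /andP[u0 u1]; rewrite /coupling_range u0 ltW.
    - exact: cl.
    - by move=> k hk; exact: (hw i I j I k I).
  have h2 i y l : energy_range (X i) -> scale_range y -> coupling_range l -> h (X i) y l w <= 0.
    move=> hx + hl; apply: (le0_of_rat_points (I := scale_range) (a := eta0) (b := 3)
      (h := fun y => h (X i) y l w)) => //.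
    - by move=> u /andP[u0 u1]; rewrite /scale_range !ltW.
    - exact: cy.
    - by move=> j hj; exact: h1.
  move=> x y l + hy hl; apply: (le0_of_rat_points (I := energy_range) (a := - E0) (b := E0)
    (h := fun x => h x y l w)) => //.
  - by move=> u /andP[u0 u1]; rewrite /energy_range !ltW.
  - exact: cx.
  - by move=> i hi; exact: h2.
apply: bigcapT_measurable => i; apply: bigcapT_measurable => j; apply: bigcapT_measurable => k.
have [hx|hx] := pselect (energy_range (X i)); last first.
  by rewrite (_ : F i j k = setT)//; apply/seteqP; split => // w _ /hx.
have [hy|hy] := pselect (scale_range (Y j)); last first.
  by rewrite (_ : F i j k = setT)//; apply/seteqP; split => // w _ _ /hy.
have [hl|hl] := pselect (coupling_range (L k)); last first.
  by rewrite (_ : F i j k = setT)//; apply/seteqP; split => // w _ _ _ /hl.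
rewrite (_ : F i j k = [set w | (h (X i) (Y j) (L k) w <= 0)%R]).
  by apply: measurable_ler_set; [exact: mh|exact: measurable_cst].
by apply/seteqP; split => w /=; [apply|move=> ? _ _ _].
Qed.

End ParametricEvent.

Section MeasurableSection.
Context {R : realType} (mu : probability (measurableTypeR R) R) d (T : measurableType d).

(** Adding [K] makes the integrand nonnegative, so that Tonelli's measurability statement applies;
    the constant is subtracted again. *)
Lemma measurable_Rint_section (f : T * measurableTypeR R -> R) (K : R) : measurable_fun setT f ->
  (forall t, `|f t| <= K) -> measurable_fun setT (fun w => \int[mu]_x f (w, x)).
Proof.
move=> mf hf.
have bs w : rbounded (fun x => f (w, x)).
  by split; [exact: measurable_fun_pair2|exists K => x].
have fK t : 0 <= f t + K by have := hf t; rewrite ler_norml; lra.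
have e w : \int[mu]_x f (w, x) = fine (fubini_F mu (fun t => (f t + K)%:E) w) - K.
  have <- : \int[mu]_x (f (w, x) + K) = fine (fubini_F mu (fun t => (f t + K)%:E) w) by [].
  by rewrite RintD ?Rint_cst ?addrK//; exact: rbounded_cst.
apply: (eq_measurable_fun (fun w => fine (fubini_F mu (fun t => (f t + K)%:E) w) - K)) => [w _|].
  by rewrite e.
apply: (@measurable_funB _ _ _ _ _ (fun=> K)); last exact: measurable_cst.
apply: (measurableT_comp (fine_measurable measurableT)).
apply: measurable_fun_fubini_tonelli_F; last by move=> t; rewrite lee_fin.
by apply/measurable_EFinP; apply: measurable_funD => //; exact: measurable_cst.
Qed.

Lemma cmeasurable_cintegral_section (f : T * measurableTypeR R -> R[i]) (K : R) : cmeasurable f ->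
  (forall t, modulus (f t) <= K) -> cmeasurable (fun w => cintegral mu (fun x => f (w, x))).
Proof.
move=> [mRe mIm] hf; split => /=.
  by apply: (measurable_Rint_section mRe) => t; apply: le_trans (Re_le_modulus _) (hf t).
by apply: (measurable_Rint_section mIm) => t; apply: le_trans (Im_le_modulus _) (hf t).
Qed.

End MeasurableSection.

Section ParametricModulus.
Context {R : realType} d (T : measurableType d) (E0 eta0 lam0 : R).

Definition parameter_range (l : R) (z : R[i]) : Prop :=
  [/\ `|complex.Re z| <= E0, eta0 <= complex.Im z <= 3 & 0 < l <= lam0].

Lemma measurable_parametric_modulus (X : R -> R[i] -> T -> R[i]) (b : R -> R -> R) :
  (forall l z, parameter_range l z -> cmeasurable (X l z)) ->
  (forall w, exists2 M, 0 <= M & forall l z l' z', parameter_range l z -> parameter_range l' z' ->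
     modulus (X l z w - X l' z' w) <= M * (`|l - l'| + modulus (z - z'))) ->
  (forall y, scale_range eta0 y -> continuous_within (coupling_range lam0) (b y)) ->
  (forall l, coupling_range lam0 l -> continuous_within (scale_range eta0) (b^~ l)) ->
  measurable [set w | forall l z, parameter_range l z -> modulus (X l z w) <= b (complex.Im z) l].
Proof.
move=> mX lX bl by_.
pose h x y l w := modulus (X l (x +i* y) w) - b y l.
have pr x y l : energy_range E0 x -> scale_range eta0 y -> coupling_range lam0 l -> parameter_range l (x +i* y).
  by move=> hx hy hl; split => //=; rewrite ler_norml.
rewrite (_ : mkset _ = [set w | forall x y l, energy_range E0 x -> scale_range eta0 y -> coupling_range lam0 l ->
    h x y l w <= 0]); last first.
  apply/seteqP; split => w /= hw.
    by move=> x y l hx hy hl; rewrite subr_le0; exact: (hw l (x +i* y) (pr _ _ _ hx hy hl)).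
  move=> l z [hx hy hl]; rewrite -subr_le0; have := hw (complex.Re z) (complex.Im z) l.
  by rewrite /h /energy_range -ler_norml; case: (z) hx hy => /= x y hx hy; apply.
have lip w : exists2 M, 0 <= M & forall x y l x' y' l',
    energy_range E0 x -> scale_range eta0 y -> coupling_range lam0 l ->
    energy_range E0 x' -> scale_range eta0 y' -> coupling_range lam0 l' ->
    `|modulus (X l (x +i* y) w) - modulus (X l' (x' +i* y') w)| <= M * (`|l - l'| + (`|x - x'| + `|y - y'|)).
  have [M M0 hM] := lX w; exists M => // x y l x' y' l' hx hy hl hx' hy' hl'.
  apply: le_trans (_ : modulus (X l (x +i* y) w - X l' (x' +i* y') w) <= _).
    rewrite ler_norml; have := modulus_lerB (X l (x +i* y) w) (X l' (x' +i* y') w).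
    have := modulus_lerB (X l' (x' +i* y') w) (X l (x +i* y) w); rewrite [modulus (_ - X l _ w)]modulusC.
    by move=> h1 h2; apply/andP; split; lra.
  apply: le_trans (hM _ _ _ _ (pr _ _ _ hx hy hl) (pr _ _ _ hx' hy' hl')) _.
  by apply: ler_wpM2l => //; rewrite lerD2l; exact: modulus_le_ReIm.
apply: measurable_parametric.
- move=> x y l hx hy hl; apply: measurable_funB; last exact: measurable_cst.
  by apply: measurable_modulus; apply: mX; exact: pr.
- move=> w x y hx hy; apply: continuous_withinB; last exact: bl.
  have [M M0 hM] := lip w; apply: (lipschitz_continuous_within M0) => l l' hl hl'.
  by have := hM x y l x y l' hx hy hl hx hy hl'; rewrite !subrr normr0 !addr0.
- move=> w x l hx hl; apply: continuous_withinB; last exact: by_.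
  have [M M0 hM] := lip w; apply: (lipschitz_continuous_within M0) => y y' hy hy'.
  by have := hM x y l x y' l hx hy hl hx hy' hl; rewrite !subrr normr0 !add0r.
- move=> w y l hy hl; apply: continuous_withinB; last first.
    by apply: (@lipschitz_continuous_within _ _ _ 0) => // x x' _ _; rewrite subrr normr0 mul0r.
  have [M M0 hM] := lip w; apply: (lipschitz_continuous_within M0) => x x' hx hx'.
  by have := hM x y l x' y l hx hy hl hx' hy hl; rewrite !subrr normr0 add0r addr0.
Qed.

End ParametricModulus.

Section Thresholds.
Context {R : realType}.

Lemma continuous_withinZ (I : R -> Prop) (c : R) g : continuous_within I g ->
  continuous_within I (fun x => c * g x).
Proof.
move=> hg x Ix e e0; have c1 : 0 < `|c| + 1 by rewrite ltr_wpDl.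
have [d d0 hd] := hg x Ix _ (divr_gt0 e0 c1); exists d => // y Iy /(hd y Iy) h.
rewrite -mulrBr normrM; apply: le_lt_trans (_ : (`|c| + 1) * `|g x - g y| < _).
  by apply: ler_wpM2r => //; lra.
by rewrite mulrC -ltr_pdivlMr.
Qed.

Lemma continuous_withinDl (I : R -> Prop) (c : R) g : continuous_within I g ->
  continuous_within I (fun x => c + g x).
Proof.
move=> hg x Ix e e0; have [d d0 hd] := hg x Ix _ e0; exists d => // y Iy /(hd y Iy) h.
by rewrite opprD addrACA subrr add0r.
Qed.

Lemma continuous_inv_sqrt (n y : R) : 0 < n -> 0 < y ->
  {for y, continuous (fun y => (Num.sqrt (n * y))^-1)}.
Proof.
move=> n0 y0; apply: cvgV; first by rewrite gt_eqF// sqrtr_gt0 mulr_gt0.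
apply: (@continuous_comp _ _ _ (fun y : R => n * y) (@Num.sqrt R)).
  by apply: cvgM; [exact: cvg_cst|exact: cvg_id].
exact: sqrt_continuous.
Qed.

Lemma continuous_inv_powR (n y a : R) : 0 < n -> 0 < y ->
  {for y, continuous (fun y => ((n * y) `^ a)^-1)}.
Proof.
move=> n0 y0; have ny : 0 < n * y by exact: mulr_gt0.
apply: cvgV; first by rewrite gt_eqF// powR_gt0.
apply: (@continuous_comp _ _ _ (fun y : R => n * y) (fun x => x `^ a)).
  by apply: cvgM; [exact: cvg_cst|exact: cvg_id].
apply: differentiable_continuous; apply/derivable1_diffP.
by apply: derivable_powR; rewrite in_itv /= ny.
Qed.

End Thresholds.

Section HamiltonianPerturbation.
Context {R : realType} (N : nat) (W : 'M[R[i]]_N).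
Hypothesis hW : hermitian W.

Lemma resolvent_lip (v : 'rV[R]_N) (V y lam lam' : R) (z z' : R[i]) i j : (forall k, `|v 0 k| <= V) ->
  0 < y -> y <= complex.Im z -> y <= complex.Im z' ->
  modulus (resolvent lam v W z i j - resolvent lam' v W z' i j) <=
    N%:R * (y^-1 / y) * (V + 1) * (`|lam - lam'| + modulus (z - z')).
Proof.
move=> hV y0 hz hz'; rewrite !resolventE.
have V0 : 0 <= V by apply: le_trans (hV i).
have z0 := lt_le_trans y0 hz; have z0' := lt_le_trans y0 hz'.
have h := @green_lip _ _ _ _ _ _ (V * `|lam - lam'|) (hermitian_hamiltonian lam v hW)
  (hermitian_hamiltonian lam' v hW) z0 z0'.
apply: le_trans (h _ _ i j) _.
- by move=> a b ab; rewrite !hamiltonian_off.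
- move=> a; have e l : hamiltonian l v W a a = (l * v 0 a)%:C + W a a by rewrite hamiltonianE eqxx.
  rewrite (e lam') (e lam).
  rewrite opprD addrACA subrr addr0 (_ : _ - _ = (lam' * v 0 a - lam * v 0 a)%:C); last first.
    by apply/eqP; rewrite eq_complex /= subrr !eqxx.
  rewrite modulus_real -mulrBl normrM mulrC distrC.
  exact: ler_wpM2r.
rewrite -!mulrA; apply: ler_wpM2l => //.
have yi : 0 <= y^-1 by rewrite invr_ge0 ltW.
rewrite !mulrA -[leRHS]mulrA.
apply: ler_pM.
- by apply: mulr_ge0; rewrite invr_ge0 ltW.
- by rewrite addr_ge0 ?modulus_ge0// mulr_ge0.
- by apply: ler_pM; rewrite ?invr_ge0 ?(ltW z0) ?(ltW z0')// lef_pV2.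
have := mulr_ge0 V0 (modulus_ge0 (z - z')); have := modulus_ge0 (z - z'); have := normr_ge0 (lam - lam').
by rewrite mulrDr mulrDl; lra.
Qed.

Lemma modulus_resolvent lam (v : 'rV[R]_N) z i j : 0 < complex.Im z ->
  modulus (resolvent lam v W z i j) <= (complex.Im z)^-1.
Proof. by move=> z0; rewrite resolventE; apply: modulus_green => //; exact: hermitian_hamiltonian. Qed.

Lemma mN_joint_lip (v : 'rV[R]_N) (V y lam lam' : R) (z z' : R[i]) : (0 < N)%N -> (forall k, `|v 0 k| <= V) ->
  0 < y -> y <= complex.Im z -> y <= complex.Im z' ->
  modulus (mN lam v W z - mN lam' v W z') <=
    N%:R * (y^-1 / y) * (V + 1) * (`|lam - lam'| + modulus (z - z')).
Proof.
move=> N0 hV y0 hz hz'; rewrite /mN -mulrBr /mxtrace -sumrB; apply: modulus_average => // k.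
exact: resolvent_lip.
Qed.

End HamiltonianPerturbation.

Section PartialExpectationLipschitz.
Context {R : realType} (mu : probability (measurableTypeR R) R).
Hypothesis hsupp : mu (~` [set v : R | -1 <= v <= 1]) = 0%E.
Variables (N : nat) (W : 'M[R[i]]_N).
Hypothesis hW : hermitian W.

Lemma set_entry_measurable d (T : measurableType d) (u : T -> 'rV[R]_N) (f : T -> R) i :
  (forall k, measurable_fun setT (fun t => u t 0 k)) -> measurable_fun setT f ->
  forall k, measurable_fun setT (fun t => set_entry (u t) i (f t) 0 k).
Proof.
move=> hu hf k; have [->|ki] := eqVneq k i.
  by apply: (eq_measurable_fun f) => [t _|//]; rewrite !mxE eqxx.
by apply: (eq_measurable_fun (fun t => u t 0 k)) => [t _|//]; rewrite !mxE (negbTE ki).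
Qed.

Lemma cmeasurable_resolvent d (T : measurableType d) (A : T -> 'M[R[i]]_N) (u : T -> 'rV[R]_N) l z :
  (forall t, hermitian (A t)) -> (forall i j, cmeasurable (fun t => A t i j)) ->
  (forall k, measurable_fun setT (fun t => u t 0 k)) ->
  0 < complex.Im z -> forall i j, cmeasurable (fun t => resolvent l (u t) (A t) z i j).
Proof.
move=> hA mA hu z0 i j; apply: (eq_cmeasurable (g := fun t => green (hamiltonian l (u t) (A t)) z i j)).
  by move=> t; rewrite resolventE.
apply: cmeasurable_green => // [t|a b]; first exact: hermitian_hamiltonian.
apply: (eq_cmeasurable (g := fun t => (if a == b then (l * u t 0 a)%:C else 0) + A t a b)).
  by move=> t; rewrite hamiltonianE.
apply: cmeasurableD => //; case: eqP => _; last exact: cmeasurable_cst.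
by apply: cmeasurable_real; apply: measurable_funM => //; exact: measurable_cst.
Qed.

Lemma partial_expectation_lip (v : 'rV[R]_N) (V y lam lam' : R) (z z' : R[i]) i : (forall k, `|v 0 k| <= V) ->
  0 < y -> y <= complex.Im z -> y <= complex.Im z' ->
  modulus (partial_expectation_G mu lam v W z i - partial_expectation_G mu lam' v W z' i) <=
    N%:R * (y^-1 / y) * (V + 2) * (`|lam - lam'| + modulus (z - z')).
Proof.
move=> hV y0 hz hz'; have z0 := lt_le_trans y0 hz; have z0' := lt_le_trans y0 hz'.
have cb l u : 0 < complex.Im u -> cbounded (fun x : measurableTypeR R => resolvent l (set_entry v i x) W u i i).
  move=> u0; split; last by exists (complex.Im u)^-1 => x; exact: modulus_resolvent.
  apply: (cmeasurable_resolvent _ (A := fun=> W)) => // k.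
  by apply: (set_entry_measurable (u := fun=> v)) => // k'; exact: measurable_cst.
rewrite /partial_expectation_G -cintegralB; [|exact: cb|exact: cb].
set K := _ * _ * _ * _; rewrite -[leRHS](Rint_cst mu).
apply: (modulus_cintegral_supp hsupp (h := fun=> K) _ (rbounded_cst _ K)).
  by apply: cboundedB; exact: cb.
move=> x hx; rewrite /K (_ : V + 2 = (V + 1) + 1); last by ring.
apply: resolvent_lip => // k; rewrite mxE; case: eqP => _.
  by have := le_trans (normr_ge0 _) (hV k); have := hx; rewrite -ler_norml; lra.
by have := hV k; lra.
Qed.

End PartialExpectationLipschitz.

Section EventMeasurability.
Context {R : realType} (mu : probability (measurableTypeR R) R).
Hypothesis hsupp : mu (~` [set v : R | -1 <= v <= 1]) = 0%E.
Context d (T : measurableType d) (N : nat) (W : T -> 'M[R[i]]_N) (v : T -> 'rV[R]_N).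
Hypotheses (W_measurable : forall i j, cmeasurable (fun w => W w i j)).
Hypotheses (W_hermitian : forall w, hermitian (W w)).
Hypotheses (v_measurable : forall i, measurable_fun setT (fun w => v w 0 i)).
Hypothesis N_gt0 : (0 < N)%N.
Variables (Cphi E0 lam0 C xi L : R).
Hypothesis phi_gt0 : 0 < phi Cphi N `^ L.
Let Phi : R := phi Cphi N `^ xi.
Let NR0 : (0 : R) < N%:R. Proof. by rewrite ltr0n. Qed.
Let eta0 : R := phi Cphi N `^ L / N%:R.
Let eta0_gt0 : 0 < eta0. Proof. exact: divr_gt0. Qed.
Local Notation prange := (parameter_range E0 eta0 lam0).

Let prange_ge l z : prange l z -> eta0 <= complex.Im z. Proof. by case=> _ /andP[]. Qed.
Let prange_gt0 l z : prange l z -> 0 < complex.Im z.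
Proof. by move=> /prange_ge; exact: lt_le_trans. Qed.

Lemma parameter_rangeP (F : R -> R[i] -> set T) :
  \bigcap_(z in spectral_domain Cphi E0 N L) \bigcap_(lam in lambda_domain lam0) F lam z =
  [set w | forall l z, prange l z -> F l z w].
Proof.
have e (z : R[i]) : (phi Cphi N `^ L <= N%:R * complex.Im z <= 3 * N%:R) = (eta0 <= complex.Im z <= 3).
  by rewrite /eta0 ler_pdivrMr// [3 * _]mulrC ler_pM2l// [N%:R * _]mulrC.
apply/seteqP; split => w /= hw.
  by move=> l z [h1 h2 h3]; apply: (hw z) => //; split; rewrite ?e.
by move=> z [h1 h2] l h3; apply: hw; split => //; rewrite -e.
Qed.

(** Measurability concerns every sample, also those with some |v_i| > 1, so the Lipschitz constants
    are allowed to depend on w through this sum. *)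
Let bound w := \sum_i `|v w 0 i|.
Let boundP w k : `|v w 0 k| <= bound w.
Proof. by rewrite /bound (bigD1 k)//= lerDl sumr_ge0. Qed.

Let cm_mN l z : 0 < complex.Im z -> cmeasurable (fun w => mN l (v w) (W w) z).
Proof.
move=> z0; apply: cmeasurableM; first exact: cmeasurable_cst.
by apply: cmeasurable_sum => k _; exact: cmeasurable_resolvent.
Qed.

Lemma measurable_offdiagonal_event : measurable (offdiagonal_event W v Cphi E0 lam0 C xi L).
Proof.
rewrite /offdiagonal_event parameter_rangeP.
pose F (p : 'I_N * 'I_N) := [set w | forall l z, prange l z ->
  modulus ((if p.1 != p.2 then resolvent l (v w) (W w) z p.1 p.2 else 0)) <=
  C * (Phi / Num.sqrt (N%:R * complex.Im z))].
pose F' (p : 'I_N * 'I_N) := if p.1 != p.2 then F p else setT.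
rewrite (_ : mkset _ = \bigcap_(p in [set: 'I_N * 'I_N]) F' p); last first.
  apply/seteqP; split => w /= hw.
    move=> [i j] _; rewrite /F' /F /=; have [//|ij] := eqVneq i j.
    by move=> l z hz; exact: hw.
  by move=> l z hz i j ij; have := hw (i, j) I; rewrite /F' /F /= ij; apply.
apply: fin_bigcap_measurable => // -[i j] _; rewrite /F' /F /=.
case: (i != j); last exact: measurableT.
apply: (measurable_parametric_modulus (X := fun l z w => resolvent l (v w) (W w) z i j)
  (b := fun y l => C * (Phi / Num.sqrt (N%:R * y)))).
- by move=> l z /prange_gt0 z0; exact: cmeasurable_resolvent.
- move=> w; exists (N%:R * (eta0^-1 / eta0) * (bound w + 1)).
    have b0 : 0 <= bound w by exact: sumr_ge0.
    have e0 : 0 <= eta0^-1 by rewrite invr_ge0 ltW.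
    by apply: mulr_ge0; [apply: mulr_ge0 => //; exact: mulr_ge0|exact: addr_ge0].
  by move=> l z l' z' /prange_ge h /prange_ge h'; apply: resolvent_lip.
- move=> y _; apply: (@lipschitz_continuous_within _ _ _ 0) => // l l' _ _; by rewrite subrr normr0 mul0r.
- move=> l _; apply: continuous_withinZ; apply: continuous_withinZ; apply: continuous_at_within => y /andP[hy _].
  by apply: continuous_inv_sqrt => //; exact: lt_le_trans hy.
Qed.

Lemma measurable_weak_local_law_event : measurable (weak_local_law_event W v mu Cphi E0 lam0 C xi L).
Proof.
rewrite /weak_local_law_event parameter_rangeP /=.
apply: (measurable_parametric_modulus (X := fun l z w => mN l (v w) (W w) z - mfc mu l z)
  (b := fun y l => C * (Phi / (N%:R * y) `^ (3^-1)))).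
- by move=> l z /prange_gt0 z0; apply: cmeasurableB; [exact: cm_mN|exact: cmeasurable_cst].
- move=> w; pose M1 := N%:R * (eta0^-1 / eta0) * (bound w + 1); pose M2 := (3 + 1) / eta0.
  have M10 : 0 <= M1.
    have b0 : 0 <= bound w by exact: sumr_ge0.
    have e0 : 0 <= eta0^-1 by rewrite invr_ge0 ltW.
    by apply: mulr_ge0; [apply: mulr_ge0 => //; exact: mulr_ge0|exact: addr_ge0].
  have M20 : 0 <= M2 by apply: divr_ge0 => //; exact: ltW.
  exists (M1 + M2) => [|l z l' z' hz hz']; first exact: addr_ge0.
  rewrite mulrDl opprD addrACA -opprD.
  apply: (le_trans (modulusB _ _)); apply: lerD.
    by apply: mN_joint_lip => //; [exact: prange_ge hz|exact: prange_ge hz'].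
  by case: hz hz' => _ h _ [_ h' _]; exact: mfc_lip.
- move=> y _; apply: (@lipschitz_continuous_within _ _ _ 0) => // l l' _ _; by rewrite subrr normr0 mul0r.
- move=> l _; apply: continuous_withinZ; apply: continuous_withinZ; apply: continuous_at_within => y /andP[hy _].
  by apply: continuous_inv_powR => //; exact: lt_le_trans hy.
Qed.

Lemma measurable_diagonal_event : measurable (diagonal_event W v mu Cphi E0 lam0 C xi L).
Proof.
rewrite /diagonal_event parameter_rangeP.
pose F i := [set w | forall l z, prange l z ->
  modulus (partial_expectation_G mu l (v w) (W w) z i - mN l (v w) (W w) z) <=
  C * Phi * (l / Num.sqrt N%:R + ((N%:R * complex.Im z) `^ (3^-1))^-1)].
rewrite (_ : mkset _ = \bigcap_(i in [set: 'I_N]) F i); last first.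
  apply/seteqP; split => w /= hw; first by move=> i _ l z hz; exact: hw.
  by move=> l z hz i; exact: (hw i I).
apply: fin_bigcap_measurable => // i _; rewrite /F.
apply: (measurable_parametric_modulus
  (X := fun l z w => partial_expectation_G mu l (v w) (W w) z i - mN l (v w) (W w) z)
  (b := fun y l => C * Phi * (l / Num.sqrt N%:R + ((N%:R * y) `^ (3^-1))^-1))).
- move=> l z /prange_gt0 z0; apply: cmeasurableB; last exact: cm_mN.
  apply: (cmeasurable_cintegral_section mu
    (f := fun t : T * measurableTypeR R => resolvent l (set_entry (v t.1) i t.2) (W t.1) z i i)
    (K := (complex.Im z)^-1)); last by move=> t; exact: modulus_resolvent.
  apply: (cmeasurable_resolvent _ (A := fun t : T * measurableTypeR R => W t.1)) => // [a b|k].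
    exact: (cmeasurable_comp measurable_fst (W_measurable a b)).
  apply: (set_entry_measurable (u := fun t : T * measurableTypeR R => v t.1)); last exact: measurable_snd.
  by move=> k'; apply: (measurableT_comp (v_measurable k')); exact: measurable_fst.
- move=> w; pose K := N%:R * (eta0^-1 / eta0); pose M1 := K * (bound w + 1); pose M2 := K * (bound w + 2).
  have b0 : 0 <= bound w by exact: sumr_ge0.
  have K0 : 0 <= K.
    have e0 : 0 <= eta0^-1 by rewrite invr_ge0 ltW.
    by apply: mulr_ge0 => //; exact: mulr_ge0.
  exists (M2 + M1) => [|l z l' z' hz hz'].
    by apply: addr_ge0; apply: mulr_ge0 => //; exact: addr_ge0.
  rewrite mulrDl opprD addrACA -opprD.
  have h := prange_ge hz; have h' := prange_ge hz'.
  apply: (le_trans (modulusB _ _)); apply: lerD; first exact: partial_expectation_lip.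
  exact: mN_joint_lip.
- move=> y _; apply: continuous_withinZ; apply: (@lipschitz_continuous_within _ _ _ (Num.sqrt N%:R)^-1) => [|l l' _ _].
    by rewrite invr_ge0 sqrtr_ge0.
  rewrite opprD addrACA subrr addr0 -mulrBl normrM mulrC ger0_norm ?invr_ge0 ?sqrtr_ge0//.
- move=> l _; apply: continuous_withinZ; apply: continuous_withinDl; apply: continuous_at_within => y /andP[hy _].
  by apply: continuous_inv_powR => //; exact: lt_le_trans hy.
Qed.

End EventMeasurability.

(** * High probability *)

Section FixedSize.
Context {R : realType} (mu : probability (measurableTypeR R) R).
Hypothesis hsupp : mu (~` [set v : R | -1 <= v <= 1]) = 0%E.
Variables (lam0 c E0 theta C0 Cphi : R).
Hypotheses (lam0_gt0 : 0 < lam0) (c_gt0 : 0 < c) (c_le1 : c <= 1) (E0_ge0 : 0 <= E0).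
Hypotheses (hkey : key_bound mu lam0 c) (theta_gt1 : 1 < theta) (C0_gt0 : 0 < C0) (Cphi_ge1 : 1 <= Cphi).
(** The extra 1 is the margin B - 1 >= |Re z| of [spectral_range]. [CH] is 12 b with b = 2 / c, the
    constant of [bad_law]. *)
Let B := E0 + 1.
Let CH := 24 / c.
Let B_ge0 : 0 <= B. Proof. exact: addr_ge0. Qed.

Definition size_threshold : R :=
  Num.max (24 / c ^+ 2) (2 * (lam0 + law_radius lam0 c (E0 + 1)) + 1).
(** With l = ln N >= 72 and xi >= 2 one has l^xi >= l^2 >= 72 l, twice the exponent of N^36. The
    second entry makes Phi^-3 small enough, as Phi >= l. *)
Definition log_threshold : R := Num.max 72 (omega_threshold lam0 c (E0 + 1) (24 / c))^-1.

Context d (T : measurableType d) (P : probability T R).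
Variables (N : nat) (W : T -> 'M[R[i]]_N) (v : T -> 'rV[R]_N) (xi L : R).
Hypothesis hmodel : deformed_model P theta C0 mu W v.
Let l : R := ln N%:R.
Let Phi : R := phi Cphi N `^ xi.
Hypotheses (N_large : size_threshold <= N%:R) (l_large : log_threshold <= l) (N_ge : (12 <= N)%N).
Hypotheses (xi_ge2 : 2 <= xi) (xi_L : 12 * xi <= L).
Hypothesis hld : forall a b A B, ld_family P theta C0 (Num.sqrt N%:R)^-1 a b ->
  ld_bounds P (Num.sqrt N%:R)^-1 Phi (expR (- (l `^ xi))) (N := N) a b A B.

Let NR0 : (0 : R) < N%:R. Proof. by rewrite ltr0n; exact: leq_trans N_ge. Qed.
Let l72 : 72 <= l. Proof. by apply: le_trans l_large; rewrite le_max lexx. Qed.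
Let l1 : 1 <= l. Proof. by apply: le_trans l72; lra. Qed.
Let l0 : 0 <= l. Proof. exact: le_trans l1. Qed.
Let phi_ge : l <= phi Cphi N.
Proof. by rewrite /phi -/l -{1}[l]powRr1//; apply: ler_powR. Qed.
Let phi1 : 1 <= phi Cphi N. Proof. exact: le_trans phi_ge. Qed.
Let phi0 : 0 <= phi Cphi N. Proof. exact: le_trans phi1. Qed.
Let lxi : l * l <= l `^ xi.
Proof. by rewrite -expr2 -powR_mulrn//; apply: ler_powR. Qed.
Let xi0 : 0 <= xi. Proof. exact: le_trans xi_ge2. Qed.
Let Phi_lxi : l `^ xi <= Phi.
Proof. by apply: ge0_ler_powR. Qed.
Let l_lxi : 72 * l <= l `^ xi.
Proof. by apply: le_trans lxi; exact: ler_wpM2r. Qed.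
Let Phi_l : l <= Phi.
Proof. by apply: le_trans Phi_lxi; apply: le_trans l_lxi; rewrite ler_peMl//; lra. Qed.
Let Phi1 : 1 <= Phi. Proof. exact: le_trans Phi_l. Qed.
Let Phi0 : 0 < Phi. Proof. exact: lt_le_trans Phi1. Qed.

Let Phi_p : expR (- Phi ^+ 2) <= expR (- (l `^ xi)).
Proof. by rewrite ler_expR lerN2; apply: le_trans Phi_lxi _; rewrite expr2 ler_peMl// ltW. Qed.

Let Phi_omega : Phi ^- 3 <= omega_threshold lam0 c B CH.
Proof.
have t0 : 0 < omega_threshold lam0 c B CH by exact: omega_threshold_gt0.
rewrite -[leRHS]invrK lef_pV2 ?posrE ?invr_gt0// ?exprn_gt0//.
apply: (@le_trans _ _ l); first by apply: le_trans l_large; rewrite le_max lexx orbT.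
by apply: le_trans Phi_l _; rewrite -{1}[Phi]expr1 ler_weXn2l.
Qed.

Let Phi12 : Phi ^+ 12 <= phi Cphi N `^ L.
Proof.
have <- : Phi `^ 12%:R = Phi ^+ 12 by exact: (powR_mulrn 12 (ltW Phi0)).
have -> : Phi `^ 12%:R = phi Cphi N `^ (xi * 12%:R) by rewrite powRrM.
by apply: (ler_powR phi1); rewrite mulrC.
Qed.

(** Half of the exponent l^xi pays for the union bound. *)
Let union_probability : N%:R ^+ 36 * expR (- (l `^ xi)) <= expR (- (2^-1 * l `^ xi)).
Proof.
rewrite -{1}(lnK (x := N%:R : R)) ?posrE// -/l -expRM_natl -expRD ler_expR.
by have := l_lxi; lra.
Qed.

(* When the spectral domain is empty the claim is void; otherwise [Phi ^+ 12 <= 3 * N]. *)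
Lemma simultaneous_event : exists A : set T, [/\ measurable A,
  (P A <= (expR (- (2^-1 * l `^ xi)))%:E)%E &
  forall w, ~ A w -> forall z lam, spectral_domain Cphi E0 N L z -> lambda_domain lam0 lam ->
   let C := local_law_const lam0 c B CH in
   [/\ forall i j, i != j -> modulus (resolvent lam (v w) (W w) z i j) <= C * (Phi / Num.sqrt (N%:R * complex.Im z)),
     forall i, modulus (partial_expectation_G mu lam (v w) (W w) z i - mN lam (v w) (W w) z) <=
       C * Phi * (lam / Num.sqrt N%:R + ((N%:R * complex.Im z) `^ (3^-1))^-1) &
     modulus (mN lam (v w) (W w) z - mfc mu lam z) <= C * (Phi / (N%:R * complex.Im z) `^ (3^-1))]].
Proof.
have [[z0 hz0]|nz] := pselect (exists z, spectral_domain Cphi E0 N L z); last first.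
  exists set0; split; [exact: measurable0|by rewrite measure0 lee_fin expR_ge0|].
  by move=> w _ z lam hz; case: nz; exists z.
have Phi_sqr : Phi ^+ 2 <= N%:R.
  have [_ /andP[h1 h2]] := hz0; have h := le_trans Phi12 (le_trans h1 h2).
  have P3 : 3 <= Phi by apply: le_trans Phi_l; apply: le_trans l72; lra.
  have : 3 * Phi ^+ 2 <= Phi ^+ 12.
    rewrite (_ : Phi ^+ 12 = Phi ^+ 9 * Phi * Phi ^+ 2); last by rewrite -exprSr -exprD.
    apply: ler_wpM2r; first exact: exprn_ge0 (ltW Phi0).
    by apply: le_trans P3 _; rewrite ler_peMl ?exprn_ege1// ltW.
  by move=> h3; have := le_trans h3 h; rewrite ler_pM2l.
have hc : 24 / c ^+ 2 <= N%:R by apply: le_trans N_large; rewrite le_max lexx.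
have hr : 2 * (lam0 + law_radius lam0 c B) + 1 <= N%:R.
  by apply: le_trans N_large; rewrite le_max lexx orbT.
have [A [mA PA hA]] := good_event hsupp lam0_gt0 c_gt0 B_ge0 theta_gt1 C0_gt0 hmodel hld N_ge Phi1
  Phi_sqr hc hr (expR_ge0 _) Phi_p.
exists A; split => //; first by apply: le_trans PA _; rewrite lee_fin.
move=> w /hA hw z lam [hRe /andP[hIm hIm3]] hlam C.
have hW : hermitian (W w) by have [[_ h _ _ _] _ _] := hmodel; move=> i j; exact: h.
have N0 : (0 < N)%N by exact: leq_trans N_ge.
apply: (local_law hsupp lam0_gt0 c_gt0 c_le1 B_ge0 hkey N0 Phi1 hW hw Phi_omega).
split => //; first by rewrite /B addrK.
  by rewrite -(ler_pM2l NR0) [leRHS]mulrC.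
exact: le_trans Phi12 hIm.
Qed.

End FixedSize.

Lemma near_ln_ge {R : realType} (x : R) : \forall N \near \oo, x <= ln N%:R.
Proof.
near=> N; have h : expR x <= N%:R by near: N; exact: nbhs_infty_ger.
by rewrite -[x]expRK ler_ln ?posrE ?expR_gt0// (lt_le_trans (expR_gt0 _) h).
Unshelve. all: by end_near. Qed.

Lemma high_probabilityS {R : realType} d (T : measurableType d) (P : probability T R) (A Omega : set T) (q : R) :
  measurable Omega -> measurable A -> (P A <= q%:E)%E -> (forall w, ~ A w -> Omega w) ->
  (P (~` Omega) <= q%:E)%E.
Proof.
move=> mO mA hA h; apply: le_trans hA; apply: le_measure; rewrite ?inE//; first exact: measurableC.
by move=> w hw; apply: contrapT => /h.
Qed.

Unset Implicit Arguments.
Local Close Scope complex_scope.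

Theorem theorem3p1 (R : realType) (theta C0 lambda0 E0 a0 A0 Cphi : R)
    (mu : probability (measurableTypeR R) R)
    (hC0 : 0 < C0) (htheta : 1 < theta)
    (hlambda0 : 0 < lambda0) (hE0 : 3 + lambda0 <= E0)
    (ha0 : 2 < a0) (hA0 : 10 <= A0) (hCphi : 1 <= Cphi)
    (hld : large_deviation_estimates theta C0 a0 A0 Cphi)
    (hcentered : \int[mu]_v v = 0)
    (hsupport : support_of mu = [set x : R | -1 <= x <= 1])
    (hadmissible : forall lambda, lambda_domain lambda0 lambda ->
                     admissible mu lambda) :
  exists C nu : R, 0 < C /\ 0 < nu /\
    forall (d : nat -> measure_display) (T : forall N, measurableType (d N))
      (P : forall N, probability (T N) R)
      (W : forall N, T N -> 'M[R[i]%C]_N) (v : forall N, T N -> 'rV[R]_N),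
    (forall N, (0 < N)%N -> deformed_model (P N) theta C0 mu (W N) (v N)) ->
    forall xi L : nat -> R,
    (\forall N \near \oo, xi_range a0 A0 N (xi N) /\ 12 * xi N <= L N) ->
    [/\ high_probability P xi nu (fun N =>
          offdiagonal_event (W N) (v N) Cphi E0 lambda0 C (xi N) (L N)),
        high_probability P xi nu (fun N =>
          diagonal_event (W N) (v N) mu Cphi E0 lambda0 C (xi N) (L N)) &
        high_probability P xi nu (fun N =>
          weak_local_law_event (W N) (v N) mu Cphi E0 lambda0 C (xi N) (L N))].
Proof.
have [hsupp [c [c0 c1 hkey]]] := key_bound_exists hlambda0 hcentered hsupport hadmissible.
have E00 : 0 <= E0 by apply: le_trans hE0; rewrite addr_ge0 ?ltW.
(* Both constants are fixed before the probability spaces, [xi] and [L]; nu = 1/2 is the half of the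
   exponent left after the union bound. *)
exists (local_law_const lambda0 c (E0 + 1) (24 / c)), 2^-1; split.
  by apply: local_law_const_gt0 => //; exact: addr_ge0.
split=> [|d T P W v hmodel xi L hxi]; first by rewrite invr_gt0.
(* All requirements on the size of N at once; the deviation estimates are specialised to the
   standard deviation N^(-1/2) of the entries. *)
have large : \forall N \near \oo, [/\ (12 <= N)%N, size_threshold lambda0 c E0 <= N%:R,
    log_threshold lambda0 c E0 <= ln N%:R, 2 <= xi N & 12 * xi N <= L N] /\
    forall a b A B, ld_family (P N) theta C0 (Num.sqrt N%:R)^-1 a b ->
      ld_bounds (P N) (Num.sqrt N%:R)^-1 (phi Cphi N `^ xi N) (expR (- (ln N%:R `^ xi N))) (N := N) a b A B.
  have base : \forall N \near \oo, [/\ (12 <= N)%N, size_threshold lambda0 c E0 <= N%:R,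
      log_threshold lambda0 c E0 <= ln N%:R & xi_range a0 A0 N (xi N) /\ 12 * xi N <= L N].
    near=> N; split; near: N; [exact: nbhs_infty_ge|exact: nbhs_infty_ger|exact: near_ln_ge|exact: hxi].
  apply: filterS2 hld base => N h [N12 hN hl [hr hL]]; split.
    by split => //; case/andP: hr => hr _; apply: le_trans hr; exact: ltW.
  move=> a b A B; apply: h => //; rewrite invr_gt0 sqrtr_gt0 ltr0n; exact: leq_trans N12.
have events : \forall N \near \oo, [/\ measurable (offdiagonal_event (W N) (v N) Cphi E0 lambda0
      (local_law_const lambda0 c (E0 + 1) (24 / c)) (xi N) (L N)),
    measurable (diagonal_event (W N) (v N) mu Cphi E0 lambda0
      (local_law_const lambda0 c (E0 + 1) (24 / c)) (xi N) (L N)),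
    measurable (weak_local_law_event (W N) (v N) mu Cphi E0 lambda0
      (local_law_const lambda0 c (E0 + 1) (24 / c)) (xi N) (L N)) &
    exists A : set (T N), [/\ measurable A,
      (P N A <= (expR (- (2^-1 * ln N%:R `^ xi N)))%:E)%E &
      forall w, ~ A w -> [/\ offdiagonal_event (W N) (v N) Cphi E0 lambda0
        (local_law_const lambda0 c (E0 + 1) (24 / c)) (xi N) (L N) w,
      diagonal_event (W N) (v N) mu Cphi E0 lambda0
        (local_law_const lambda0 c (E0 + 1) (24 / c)) (xi N) (L N) w &
      weak_local_law_event (W N) (v N) mu Cphi E0 lambda0
        (local_law_const lambda0 c (E0 + 1) (24 / c)) (xi N) (L N) w]]].
  apply: filterS large => N [[N12 hN hl hxi2 hL] hldN].
  have N0 : (0 < N)%N by exact: leq_trans N12.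
  have hm := hmodel N N0; have [[mW hW _ _ _] [mv _ _] _] := hm.
  have phi0 : 0 < phi Cphi N `^ L N.
    rewrite powR_gt0// /phi powR_gt0//; apply: lt_le_trans hl.
    by rewrite /log_threshold lt_max ltr0n.
  split.
  - exact: measurable_offdiagonal_event.
  - exact: measurable_diagonal_event.
  - exact: measurable_weak_local_law_event.
  have [A [mA PA hA]] := simultaneous_event hsupp hlambda0 c0 c1 E00 hkey htheta hC0 hCphi hm hN hl N12 hxi2 hL hldN.
  exists A; split => // w /hA hw; split => z hz lam hlam; have [h1 h2 h3] := hw z lam hz hlam.
  - exact: h1.
  - exact: h2.
  - exact: h3.
by split; apply: filterS events => N [m1 m2 m3 [A [mA PA hA]]]; split => //;
  apply: (high_probabilityS _ mA PA) => // w /hA[].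
Unshelve. all: by end_near. Qed.
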